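(* Let $1<p\le\infty$, let $\{\rho_\varepsilon\}_{\varepsilon>0}\subset L^1(\mathbb R^n)$ be a family of non-negative radial functions with $\|\rho_\varepsilon\|_{L^1(\mathbb R^n)}=1$ and $\lim_{\varepsilon\to0^+}\|\rho_\varepsilon\|_{L^1(\mathbb R^n\setminus B_\delta)}=0$ for all $\delta>0$, and let $T\in\mathscr D'(\mathbb R^n;V)$ be a strongly admissible distribution (or else let $T\in\mathscr D'(\mathbb R^n;V)$ be arbitrary and assume that the family $\{\rho_\varepsilon\}$ is uniformly compactly supported). Then $\mathcal AT\in L^p(\mathbb R^n;W)$ if and only if $$\liminf_{\varepsilon\to0^+}\|\mathfrak A_{\rho_\varepsilon}T\|_p<\infty.$$ If either of these conditions holds and $1<p<\infty$, then also $\mathfrak A_{\rho_\varepsilon}T\to\mathcal AT$ strongly in $L^p$ as $\varepsilon\to0^+$.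
   Context: $V,W$ are finite-dimensional inner product spaces (identified with their duals), $A_1,\dots,A_n\in\mathrm{Hom}(V,W)$, and $\mathcal A=\sum_{i=1}^nA_i\partial_i:\mathscr D'(\mathbb R^n;V)\to\mathscr D'(\mathbb R^n;W)$. Its symbol is $\mathbb A(\xi)=\sum_iA_i\xi_i$, and $\Omega_{\mathbb A}(\xi)=\mathbb A(\xi/|\xi|)$. The formal adjoint is $\mathcal A^*=-\sum_iA_i^t\partial_i$. $\mathscr D=C^\infty_c$ and $\mathscr D'$ is its dual; $\mathcal M_b$ is the space of finite vector-valued Borel measures. Functions and measures are identified with distributions. Radial operator: for a nonnegative integrable radial Borel function $\rho(x)=\hat\rho(|x|)$ and $u\in\mathscr D(\mathbb R^n;V)$, $$\mathfrak A_\rho u(x)=\lim_{\delta\to0^+}n\int_{\mathbb R^n\setminus B_\delta}\Omega_{\mathbb A}(\xi)\left[\frac{u(x+\xi)-u(x)}{|\xi|}\right]\rho(\xi)\,d\xi,$$ and $\mathfrak A_\rho^*$ denotes the radial operator defined in the same way from $\mathcal A^*$. With $\mu_\rho(x)=\int_0^\infty n\hat\rho(r)1_{B_r}(x)\frac{dr}{r}$ one has $\mathfrak A_\rho^*\psi=\mathcal A^*(\mu_\rho\star\psi)$ for $\psi\in\mathscr D(\mathbb R^n;W)$. $T\in\mathscr D'(\mathbb R^n;V)$ is strongly admissible if at least one of the following holds: (a) $T$ has compact support; (b) $T\in L^p(\mathbb R^n;V)$ for some $1\le p\le\infty$ or $T\in\mathcal M_b(\mathbb R^n;V)$; (c) $\mathcal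 AT\in L^p(\mathbb R^n;W)$ for some $1\le p\le\infty$ or $\mathcal AT\in\mathcal M_b(\mathbb R^n;W)$ (the exponents in (b), (c) are unrelated to the exponent $p$ in the claim). For $T$ strongly admissible, or for any $T$ if $\rho$ is compactly supported, $\mathfrak A_\rho T\in\mathscr D'(\mathbb R^n;W)$ is defined by $\mathfrak A_\rho T(\psi)=T(\mathfrak A_\rho^*\psi)=T(\mathcal A^*(\mu_\rho\star\psi))$; in case (a) $T$ is paired with a $C^\infty$ function, in case (b) the pairing is integration, and in case (c) it is understood as $(\mathcal AT)(\mu_\rho\star\psi)$ by integration. ''Uniformly compactly supported'' means that all $\rho_\varepsilon$ vanish outside one common compact set. Extended norm: for an $X$-valued distribution $T$ and $1\le p\le\infty$ with Hölder conjugate $q$, $\|T\|_p=\sup\{T[\varphi]:\varphi\in\mathscr D(\mathbb R^n;X),\ \|\varphi\|_{L^q}\le1\}\in[0,\infty]$. *)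

(* Defs.v *)
From HB Require Import structures.
From mathcomp Require Import all_boot all_order all_algebra.
From mathcomp Require Import all_classical all_reals all_analysis.
From mathcomp Require Import measurable_realfun.

Set Implicit Arguments.
Unset Strict Implicit.
Unset Printing Implicit Defensive.

Import Order.TTheory GRing.Theory Num.Theory.
Import numFieldNormedType.Exports.
Local Open Scope classical_set_scope.
Local Open Scope ring_scope.

HB.mixin Record NormedVector_isInner (R : realType) V
    of NormedModule R V & Vector R V := {
  inner : V -> V -> R ;
  innerC : forall u v, inner u v = inner v u ;
  inner_linearl : forall a u v w,
    inner (a *: u + v) w = a * inner u w + inner v w ;
  norm_inner : forall v, `|v| ^+ 2 = inner v v
}.

#[short(type="innerVectType")]
HB.structure Definition InnerVector (R : realType) :=
  {V of NormedModule R V & Vector R V & NormedVector_isInner R V}.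

Section inner_theory.
Context {R : realType} {X : innerVectType R}.

Lemma inner0l (v : X) : inner 0 v = 0.
Proof.
have := inner_linearl 1 0 0 v; rewrite scaler0 addr0 mul1r => /eqP.
by rewrite -subr_eq0 opprD addrA subrr sub0r oppr_eq0 => /eqP.
Qed.

Lemma inner_suml (I : Type) (r : seq I) (c : I -> R) (f : I -> X) v :
  inner (\sum_(i <- r) c i *: f i) v = \sum_(i <- r) c i * inner (f i) v.
Proof.
elim: r => [|i r IH]; first by rewrite !big_nil inner0l.
by rewrite !big_cons inner_linearl IH.
Qed.

Definition inner_row d (b : 'I_d -> X) (v : X) : 'rV[R]_d :=
  \row_k inner (b k) v.

Lemma inner_row_is_linear d (b : 'I_d -> X) : linear (inner_row b).
Proof.
move=> a u v; apply/rowP => k; rewrite !mxE.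
by rewrite innerC inner_linearl !(innerC _ (b k)).
Qed.

HB.instance Definition _ d (b : 'I_d -> X) :=
  GRing.isLinear.Build R X 'rV[R]_d _ (inner_row b) (inner_row_is_linear b).

End inner_theory.

(* The sigma-algebra generated by the coordinate functions, as the library does
   for tuples; measurable_rVE below identifies it with the Borel one. *)
Definition measure_rV_display : measure_display. Proof. exact. Qed.

Section measurable_rV.
Context {R : realType} {n : nat}.

Definition measurable_rV : set (set 'rV[R]_n) :=
  g_sigma_preimage (fun (i : 'I_n) (x : 'rV[R]_n) => x ord0 i).

Let rV_set0 : measurable_rV set0.
Proof. exact: sigma_algebra0. Qed.

Let rV_setC A : measurable_rV A -> measurable_rV (~` A).
Proof. exact: sigma_algebraC. Qed.

Let rV_bigcup (F : _^nat) : (forall i, measurable_rV (F i)) ->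
  measurable_rV (\bigcup_i (F i)).
Proof. exact: sigma_algebra_bigcup. Qed.

HB.instance Definition _ := @isMeasurable.Build measure_rV_display
  'rV[R]_n measurable_rV rV_set0 rV_setC rV_bigcup.

Lemma measurable_rV_coord (i : 'I_n) :
  measurable_fun [set: 'rV[R]_n] (fun x : 'rV[R]_n => x ord0 i).
Proof.
move=> _ Y mY; rewrite setTI; apply: sub_sigma_algebra => /=.
rewrite -bigcup_seq/=; exists i => /=; first by rewrite mem_index_enum.
by exists Y => //; rewrite setTI.
Qed.

Lemma measurable_box (A : 'I_n -> set R) : (forall i, measurable (A i)) ->
  measurable [set x : 'rV[R]_n | forall i, A i (x ord0 i)].
Proof.
move=> mA.
rewrite (_ : mkset _ = \bigcap_(i in [set: 'I_n])
    ((fun x : 'rV[R]_n => x ord0 i) @^-1` A i)).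
  apply: fin_bigcap_measurable => // i _.
  by rewrite -[X in measurable X]setTI; exact: measurable_rV_coord.
by apply/seteqP; split => x /= h i; [move=> _|]; apply: h.
Qed.

Lemma measurable_fun_rV d (T : measurableType d) (f : T -> 'rV[R]_n) :
  (forall i, measurable_fun [set: T] (fun t => f t ord0 i)) ->
  measurable_fun [set: T] f.
Proof.
move=> mf _ A mA; rewrite setTI.
have : measurable_rV `<=` [set B | measurable (f @^-1` B)].
  apply: smallest_sub.
    split => /=.
    - by rewrite preimage_set0.
    - by move=> B mB; rewrite setTD preimage_setC; exact: measurableC.
    - by move=> F mF; rewrite preimage_bigcup; exact: bigcup_measurable.
  rewrite -bigcup_seq/=; apply: bigcup_sub => i _ _ [B mB <-] /=.
  by rewrite setTI -comp_preimage -[X in measurable X]setTI; exact: mf.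
exact.
Qed.

Lemma open_measurable_rV (U : set 'rV[R]_n) : open U -> measurable U.
Proof.
move=> oU.
pose c (q : 'rV[rat]_n) : 'rV[R]_n := map_mx ratr q.
pose F (z : 'rV[rat]_n * nat) : set 'rV[R]_n :=
  [set x | (forall i, `|c z.1 ord0 i - x ord0 i| < z.2.+1%:R^-1)].
have mF z : measurable (F z).
  have -> : F z = \bigcap_(i in [set: 'I_n])
     ((fun x : 'rV[R]_n => x ord0 i) @^-1`
        [set y | `|c z.1 ord0 i - y| < z.2.+1%:R^-1]).
    by apply/seteqP; split => x /= h i; [move=> _|]; apply: h.
  apply: fin_bigcap_measurable => // i _.
  rewrite -[X in measurable X]setTI; apply: measurable_rV_coord => //.
  apply: open_measurable.
  have -> : [set y | `|c z.1 ord0 i - y| < z.2.+1%:R^-1] =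
    ball (c z.1 ord0 i) (z.2.+1%:R^-1) by [].
  exact: ball_open.
have -> : U = \bigcup_(z in [set z | F z `<=` U]) F z.
  apply/seteqP; split; last by move=> x [z /= zU] /zU.
  move=> x Ux.
  have /nbhs_ballP [e /= e0 eU] : nbhs x U by exact: open_nbhs_nbhs.
  have [k kU] : exists k : nat, k.+1%:R^-1 < e / 2.
    have e20 : 0 < e / 2 by rewrite divr_gt0.
    exists (Num.truncn (e / 2)^-1).
    rewrite -[X in _ < X]invrK ltf_pV2 ?posrE ?invr_gt0//.
    exact: truncnS_gt.
  have k0 : 0 < k.+1%:R^-1 :> R by rewrite invr_gt0.
  have qx (i : 'I_n) : exists r : rat, `|ratr r - x ord0 i| < k.+1%:R^-1.
    have := @rat_in_itvoo R (x ord0 i - k.+1%:R^-1) (x ord0 i + k.+1%:R^-1).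
    case; first by rewrite ltrD2l gtrN.
    by move=> r; rewrite in_itv/= => h; exists r; rewrite ltr_distl.
  have [q hq] := choice qx.
  exists (\row_i q i, k) => /=; last by move=> i /=; rewrite !mxE.
  move=> y /= hy; apply: eU; split => // i j.
  rewrite (ord1 i).
  have h1 := hq j.
  have h2 := hy j; rewrite /= !mxE in h2.
  rewrite /ball/=.
  rewrite (_ : _ - _ = (ratr (q j) - y ord0 j) - (ratr (q j) - x ord0 j)); last first.
    by rewrite opprB [RHS]addrC addrA subrK.
  apply: le_lt_trans (ler_normB _ _) _.
  rewrite (splitr e); apply: ltrD; [exact: lt_trans h2 kU|exact: lt_trans h1 kU].
rewrite bigcup_mkcond; apply: countable_bigcupT_measurable => [|z].
  exact: countableP.
by case: ifP.
Qed.

Lemma measurable_rVE : @measurable _ 'rV[R]_n = <<s @open 'rV[R]_n >>.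
Proof.
apply/seteqP; split; last first.
  apply: smallest_sub; first exact: sigma_algebra_measurable.
  exact: open_measurable_rV.
apply: smallest_sub; first exact: smallest_sigma_algebra.
rewrite -bigcup_seq/=; apply: bigcup_sub => i _ _ [B mB <-] /=.
rewrite setTI.
suff : @measurable _ R `<=`
    [set B | <<s @open 'rV[R]_n >> ((fun x : 'rV[R]_n => x ord0 i) @^-1` B)].
  exact.
have -> : @measurable _ R = (@RGenOpens.G R).-sigma.-measurable.
  exact: RGenOpens.measurableE.
apply: smallest_sub.
  split => /=.
  - by rewrite preimage_set0; exact: sigma_algebra0.
  - by move=> A sA; rewrite setTD preimage_setC; exact: sigma_algebraC.
  - by move=> F sF; rewrite preimage_bigcup; exact: sigma_algebra_bigcup.
move=> _ [a [b ->]] /=; apply: sub_sigma_algebra.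
by apply: open_comp => [x _|]; [exact: coord_continuous|exact: interval_open].
Qed.

End measurable_rV.

Section lebesgue_rV.
Context {R : realType}.
Local Open Scope ereal_scope.

Definition cons_rV n (z : measurableTypeR R * 'rV[R]_n) : 'rV[R]_n.+1 :=
  \row_i if unlift ord0 i is Some j then z.2 ord0 j else z.1.

Lemma cons_rV0 n (z : measurableTypeR R * 'rV[R]_n) : cons_rV z ord0 ord0 = z.1.
Proof. by rewrite mxE unlift_none. Qed.

Lemma cons_rVS n (z : measurableTypeR R * 'rV[R]_n) i : cons_rV z ord0 (lift ord0 i) = z.2 ord0 i.
Proof. by rewrite mxE liftK. Qed.

Lemma measurable_cons_rV n :
  measurable_fun [set: measurableTypeR R * 'rV[R]_n] (@cons_rV n).
Proof.
apply: measurable_fun_rV => i; case: (unliftP ord0 i) => [j|] ->.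
  under eq_fun do rewrite cons_rVS.
  exact: (measurableT_comp (@measurable_rV_coord R n j)).
by under eq_fun do rewrite cons_rV0; exact: measurable_fst.
Qed.

Section step.
Variables (n : nat) (m : {sigma_finite_measure set 'rV[R]_n -> \bar R}).

Definition lebesgue_rV_step : set 'rV[R]_n.+1 -> \bar R :=
  pushforward (lebesgue_measure \x m) (@cons_rV n).

Let measurable_pre A : measurable A -> measurable (@cons_rV n @^-1` A).
Proof.
by move=> mA; rewrite -[X in measurable X]setTI; exact: measurable_cons_rV.
Qed.

Let step0 : lebesgue_rV_step set0 = 0.
Proof. by rewrite /lebesgue_rV_step /pushforward preimage_set0 measure0. Qed.

Let step_ge0 A : 0 <= lebesgue_rV_step A.
Proof. by rewrite /lebesgue_rV_step /pushforward measure_ge0. Qed.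

Let step_sigma_additive : semi_sigma_additive lebesgue_rV_step.
Proof.
move=> F mF tF mUF; rewrite /lebesgue_rV_step /pushforward preimage_bigcup.
apply: measure_semi_sigma_additive.
- by move=> k; exact: measurable_pre.
- apply/trivIsetP => i j _ _ ij; rewrite -preimage_setI.
  by move/trivIsetP : tF => /(_ _ _ _ _ ij) ->//; rewrite preimage_set0.
- by rewrite -preimage_bigcup; exact: measurable_pre.
Qed.

HB.instance Definition _ := isMeasure.Build _ _ _ lebesgue_rV_step
  step0 step_ge0 step_sigma_additive.

Let tail_rV (x : 'rV[R]_n.+1) : measurableTypeR R * 'rV[R]_n :=
  (x ord0 ord0, \row_i x ord0 (lift ord0 i)).

Let measurable_tail_rV : measurable_fun [set: 'rV[R]_n.+1] tail_rV.
Proof.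
apply/measurable_fun_pairP; split; first exact: measurable_rV_coord.
apply: measurable_fun_rV => i.
by under eq_fun do rewrite mxE; exact: measurable_rV_coord.
Qed.

Let step_sigma_finite : sigma_finite setT lebesgue_rV_step.
Proof.
have /sigma_finiteP[F [TF ndF Foo]] := sigma_finiteT (@lebesgue_measure R).
have /sigma_finiteP[G [TG ndG Goo]] := sigma_finiteT m.
exists (fun k => tail_rV @^-1` (F k `*` G k)).
  rewrite -preimage_bigcup [X in _ @^-1` X](_ : _ = setT) ?preimage_setT//.
  rewrite -setXTT TF TG predeqE => -[x y]; split.
    by move=> [k _ []/= ? ?]; split; exists k.
  move=> [/= [k _ Fkx] [l _ Gly]]; exists (maxn k l) => //; split.
  - by move: x Fkx; exact/subsetPset/ndF/leq_maxl.
  - by move: y Gly; exact/subsetPset/ndG/leq_maxr.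
move=> k; have [mF Fk] := Foo k; have [mG Gk] := Goo k; split.
  rewrite -[X in measurable X]setTI; apply: measurable_tail_rV => //.
  exact: measurableX.
rewrite /lebesgue_rV_step /pushforward -comp_preimage.
rewrite (_ : tail_rV \o @cons_rV n = id); last first.
  apply/funext => -[t v]; rewrite /tail_rV/= cons_rV0/=; congr pair.
  by apply/rowP => i; rewrite mxE cons_rVS.
by rewrite preimage_id product_measure1E// lte_mul_pinfty// ge0_fin_numE.
Qed.

HB.instance Definition _ := Measure_isSigmaFinite.Build _ _ _ lebesgue_rV_step
  step_sigma_finite.

End step.

Fixpoint lebesgue_rV n : {sigma_finite_measure set 'rV[R]_n -> \bar R} :=
  if n is k.+1 then lebesgue_rV_step (lebesgue_rV k) else \d_(0%R : 'rV[R]_0).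

Lemma lebesgue_rV_box n (A : 'I_n -> set R) : (forall i, measurable (A i)) ->
  lebesgue_rV n [set x | forall i, A i (x ord0 i)] =
  \prod_(i < n) lebesgue_measure (A i).
Proof.
elim: n A => [A _|n IH A mA] /=.
  by rewrite big_ord0 diracE mem_set// => -[].
rewrite big_ord_recl /lebesgue_rV_step /pushforward.
rewrite (_ : _ @^-1` _ =
  A ord0 `*` [set x : 'rV[R]_n | forall i, A (lift ord0 i) (x ord0 i)]).
  rewrite product_measure1E; last 2 first.
  - exact: mA.
  - exact: (@measurable_box R n (fun i => A (lift ord0 i)) (fun i => mA _)).
  by congr (_ * _); apply: (IH (fun i => A (lift ord0 i))) => i; exact: mA.
apply/seteqP; split => -[t v] /=.
  move=> h; split; first by have := h ord0; rewrite cons_rV0.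
  by move=> i; have := h (lift ord0 i); rewrite cons_rVS.
move=> [h1 h2] i; case: (unliftP ord0 i) => [j|] ->; first by rewrite cons_rVS.
by rewrite cons_rV0.
Qed.

End lebesgue_rV.

Section euclidean.
Context {R : realType} {n : nat}.

(* The library norm of 'rV[R]_n is the sup norm; it gives the right topology
   but not the right balls. *)
Definition enorm (x : 'rV[R]_n) : R := Num.sqrt (\sum_i x ord0 i ^+ 2).

Definition eball (r : R) : set 'rV[R]_n := [set x | enorm x < r].

Definition vanishes_off (X : zmodType) (K : set 'rV[R]_n) (f : 'rV[R]_n -> X) :=
  forall x, ~ K x -> f x = 0.

Definition tsupport (X : zmodType) (f : 'rV[R]_n -> X) : set 'rV[R]_n :=
  closure [set x | f x != 0].

End euclidean.

Section smooth.
Context {R : realType} {n : nat} {X : normedModType R}.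

Definition partial (i : 'I_n) (u : 'rV[R]_n -> X) : 'rV[R]_n -> X :=
  fun x => 'D_(delta_mx 0 i) u x.

Definition iter_partial (s : seq 'I_n) (u : 'rV[R]_n -> X) : 'rV[R]_n -> X :=
  foldr partial u s.

Definition smooth (u : 'rV[R]_n -> X) : Prop := forall s : seq 'I_n,
  continuous (iter_partial s u) /\
  forall i x, derivable (iter_partial s u) x (delta_mx 0 i).

Definition test_function (u : 'rV[R]_n -> X) : Prop :=
  smooth u /\ compact (tsupport u).

End smooth.

Section distributions.
Context {R : realType} {n : nat} {X : normedModType R}.

(* Linear functionals are represented on all functions; only their values on
   test functions are meaningful. *)
Definition is_distribution (T : ('rV[R]_n -> X) -> R) : Prop :=
  (forall (a : R) u v, test_function u -> test_function v ->
    T (fun x => a *: u x + v x) = a * T u + T v) /\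
  (forall K : set 'rV[R]_n, compact K -> exists (C : R) (N : nat),
    forall (u : 'rV[R]_n -> X) (M : R), test_function u -> tsupport u `<=` K ->
    (forall s x, (size s <= N)%N -> `|iter_partial s u x| <= M) ->
    `|T u| <= C * M).

Definition eq_dist (T S : ('rV[R]_n -> X) -> R) : Prop :=
  forall u, test_function u -> T u = S u.

Definition dist_support_in (T : ('rV[R]_n -> X) -> R) (K : set 'rV[R]_n) :=
  forall u, test_function u -> tsupport u `&` K = set0 -> T u = 0.

Definition compactly_supported (T : ('rV[R]_n -> X) -> R) : Prop :=
  exists2 K, compact K & dist_support_in T K.

(* T' is the extension to all smooth functions of T, compactly supported, by
   means of a cutoff equal to 1 near the support of T. *)
Definition cutoff_extension (T T' : ('rV[R]_n -> X) -> R) : Prop :=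
  exists K U (chi : 'rV[R]_n -> R^o),
    [/\ compact K, dist_support_in T K,
        [/\ open U, K `<=` U, test_function chi & forall x, U x -> chi x = 1] &
        T' = fun f => T (fun x => chi x *: f x)].

End distributions.

Section Lebesgue_spaces.
Context {R : realType} {n : nat} {X : innerVectType R}.
Local Notation leb := (@lebesgue_rV R n).

Definition vector_integral (D : set 'rV[R]_n) (f : 'rV[R]_n -> X) : X :=
  \sum_k (\int[leb]_(x in D) coord (vbasis {:X}) k (f x)) *: (vbasis {:X})`_k.

Definition Lpnorm (p : \bar R) (f : 'rV[R]_n -> X) : \bar R :=
  Lnorm leb p (fun x => `|f x|%:E).

Definition Lp (p : \bar R) (f : 'rV[R]_n -> X) : Prop :=
  (forall v, measurable_fun [set: 'rV[R]_n] (fun x => inner v (f x))) /\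
  (Lpnorm p f < +oo)%E.

Definition fun_dist (f u : 'rV[R]_n -> X) : R :=
  \int[leb]_x inner (f x) (u x).

Definition charge_integral (nu : {charge set 'rV[R]_n -> \bar R})
    (f : 'rV[R]_n -> R) : R :=
  let P := projT1 (cid (Hahn_decomposition nu)) in
  let N := projT1 (cid (projT2 (cid (Hahn_decomposition nu)))) in
  let nuPN : hahn_decomposition nu P N :=
    projT2 (cid (projT2 (cid (Hahn_decomposition nu)))) in
  \int[jordan_pos nuPN]_x f x - \int[jordan_neg nuPN]_x f x.

(* An X-valued finite Borel measure is given by its coordinates in the basis
   vbasis {:X}, which are finite signed measures. *)
Definition measure_dist
    (nu : 'I_(\dim {:X}) -> {charge set 'rV[R]_n -> \bar R})
    (u : 'rV[R]_n -> X) : R :=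
  \sum_k charge_integral (nu k) (fun x => inner (vbasis {:X})`_k (u x)).

Definition integral_functional (I : ('rV[R]_n -> X) -> R) : Prop :=
  (exists (p : \bar R) f, [/\ (1 <= p)%E, Lp p f & I = fun_dist f]) \/
  (exists nu, I = measure_dist nu).

Definition in_Lp (p : \bar R) (T : ('rV[R]_n -> X) -> R) : Prop :=
  exists2 f, Lp p f & eq_dist T (fun_dist f).

Definition dual_norm (p : \bar R) (T : ('rV[R]_n -> X) -> R) : \bar R :=
  ereal_sup [set (T u)%:E | u in
    [set u | test_function u /\ (Lpnorm (hoelder_conjugate p) u <= 1)%E]].

End Lebesgue_spaces.

Section operators.
Context {R : realType} {n : nat}.

Section on_functions.
Context {X Y : innerVectType R}.
Implicit Types B : 'I_n -> 'Hom(X, Y).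

Definition adjoint (B : 'Hom(X, Y)) : 'Hom(Y, X) :=
  xget (0 : 'Hom(Y, X))
    [set C : 'Hom(Y, X) | forall x y, inner (B x) y = inner x (C y)].

Lemma adjointP (B : 'Hom(X, Y)) x y : inner (B x) y = inner x (adjoint B y).
Proof.
suff ex : exists C : 'Hom(Y, X), forall x y, inner (B x) y = inner x (C y).
  by have := @xgetPex _ (0 : 'Hom(Y, X)) _ ex; apply.
pose b (k : 'I_(\dim {:X})) := (vbasis {:X})`_k.
pose G := linfun (inner_row b).
have Xb (z : X) : z = \sum_k coord (vbasis {:X}) k z *: b k.
  exact: coord_vbasis (memvf z).
have G0 : lker G == 0%VS.
  apply/lker0P => u v Guv; apply/eqP; rewrite -subr_eq0 -normr_eq0.
  rewrite -sqrf_eq0 norm_inner [X in inner X _]Xb inner_suml.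
  apply/eqP/big1 => k _.
  have : (G (u - v)) ord0 k = 0 by rewrite linearB/= Guv subrr mxE.
  by rewrite lfunE/= mxE => ->; rewrite mulr0.
have Gfull : limg G = fullv.
  apply/eqP; rewrite eqEdim subvf/= limg_dim_eq ?(eqP G0) ?capv0//.
  by rewrite !dimvf/= /dim/= mul1n.
exists (G^-1 \o linfun (inner_row (fun k => B (b k))))%VF => {}x {}y.
rewrite comp_lfunE lfunE/=.
set z := inner_row _ _.
have Gz : G ((G^-1)%VF z) = z by rewrite limg_lfunVK// Gfull memvf.
rewrite {1}(Xb x) linear_sum/= [in RHS](Xb x) inner_suml.
rewrite (eq_bigr (fun k => coord (vbasis {:X}) k x *: B (b k))); last first.
  by move=> k _; rewrite linearZ.
rewrite inner_suml; apply: eq_bigr => k _; congr (_ * _).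
have := congr1 (fun t : 'rV[R]__ => t ord0 k) Gz.
by rewrite lfunE/= !mxE.
Qed.

Definition formal_adjoint B (i : 'I_n) : 'Hom(Y, X) := - adjoint (B i).

Definition diff_op B (u : 'rV[R]_n -> X) : 'rV[R]_n -> Y :=
  fun x => \sum_i B i (partial i u x).

Definition symbol B (xi : 'rV[R]_n) : 'Hom(X, Y) :=
  \sum_i xi ord0 i *: B i.

Definition Omega B (xi : 'rV[R]_n) : 'Hom(X, Y) :=
  symbol B ((enorm xi)^-1 *: xi).

Definition radial_op B (rho : 'rV[R]_n -> R) (u : 'rV[R]_n -> X) :
    'rV[R]_n -> Y := fun x =>
  lim (n%:R *: vector_integral (~` eball d) (fun xi =>
        rho xi *: Omega B xi ((enorm xi)^-1 *: (u (x + xi) - u x)))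
       @[d --> (0 : R)^'+]).

(* For x = 0 the integral may be infinite, and its value is then 0. *)
Definition mu_kernel (rhoh : R -> R) (x : 'rV[R]_n) : R :=
  \int[lebesgue_measure]_(r in `]0, +oo[) (n%:R * rhoh r * \1_(eball r) x / r).

Definition convolution (k : 'rV[R]_n -> R) (u : 'rV[R]_n -> X) :
    'rV[R]_n -> X :=
  fun x => vector_integral setT (fun y => k y *: u (x - y)).

End on_functions.

Section on_distributions.
Context {V W : innerVectType R} (A : 'I_n -> 'Hom(V, W)).
Implicit Types T : ('rV[R]_n -> V) -> R.

Definition dist_op T : ('rV[R]_n -> W) -> R :=
  fun psi => T (diff_op (formal_adjoint A) psi).

Definition strongly_admissible T : Prop :=
  [\/ compactly_supported T,
      exists2 I, integral_functional I & eq_dist T I |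
      exists2 I, integral_functional I & eq_dist (dist_op T) I].

(* S is the radial operator applied to T, where rho x = rhoh (enorm x). The
   first case is that of a compactly supported kernel, the next ones are those
   of strong admissibility. The cases overlap; S may be given by any of those
   that apply. *)
Definition is_radial_dist (rho : 'rV[R]_n -> R) (rhoh : R -> R) T
    (S : ('rV[R]_n -> W) -> R) : Prop :=
  [\/ (exists2 K, compact K & vanishes_off K rho) /\
        eq_dist S (fun psi => T (radial_op (formal_adjoint A) rho psi)),
      exists2 T', cutoff_extension T T' &
        eq_dist S (fun psi => T' (radial_op (formal_adjoint A) rho psi)),
      exists2 I, integral_functional I /\ eq_dist T I &
        eq_dist S (fun psi => I (radial_op (formal_adjoint A) rho psi)) |
      exists2 I, integral_functional I /\ eq_dist (dist_op T) I &
        eq_dist S (fun psi => I (convolution (mu_kernel rhoh) psi))].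

End on_distributions.
End operators.

(* Main.v *)
Require Import Defs.
From HB Require Import structures.
From mathcomp Require Import all_boot all_order all_algebra.
From mathcomp Require Import all_classical all_reals all_analysis.
From mathcomp Require Import measurable_realfun ess_sup_inf ring lra.

Set Implicit Arguments.
Unset Strict Implicit.
Unset Printing Implicit Defensive.

Import Order.TTheory GRing.Theory Num.Theory.
Import numFieldNormedType.Exports.
Local Open Scope classical_set_scope.
Local Open Scope ring_scope.

(** Let [radial_kernel rho] be the superposition of the uniform probability
    densities on the centred balls, in which the ball of radius [enorm z] has
    weight [rho z]. This kernel is even, it has the total mass of [rho], and
    outside every centred ball it has at most the mass that [rho] has there.
    The flux of a function through a sphere is the integral of its derivative
    over the ball, so averaging difference quotients over spheres amounts to
    averaging derivatives over balls: on test functions the radial operator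
    with density [rho] is the differential operator followed by convolution
    with the kernel ([radial_integral_by_parts], [radial_opE]). Convolution
    commutes with differentiation, hence the radial operator of a distribution
    [T] should be the distribution [dist_op A T] mollified by the kernel, and
    for the given families the kernels form an approximate identity.

    The kernels need not have compact support, which is why a distribution
    must be read in one of several ways. Each reading is an additive and
    bounded function of the kernel, so its value is the limit of the values
    for densities truncated to balls, and those only involve test functions
    ([radial_dist_limit]). Consequently all the readings agree, the result is
    linear, and it converges to [dist_op A T] on every test function
    ([radial_dist_cvg]); the latter needs the admissibility of [T], or the
    common support of the kernels, through the notion [tame].

    If [dist_op A T] is a function [g] of class Lp, the inequality of Young
    bounds the radial distributions in the dual norm, uniformly in the
    parameter. Conversely, a bound along a sequence of parameters passes to
    the limit [dist_op A T], and a functional on test functions that is bounded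
    for the conjugate exponent [q], which is finite, comes from a function of
    class Lp by the Riesz representation theorem ([riesz_vector]). To obtain
    that theorem, the functional is extended to all power integrable functions
    with the help of the density of test functions; multiplied by a fixed
    integrable weight, indicators then define a charge, and its
    Radon-Nikodym derivative divided by the weight is the representing
    function.

    For the strong convergence the same theorem is applied to the difference of
    the radial distribution and [dist_op A T]. On a test function [psi] it is
    the integral of [g] against the error of mollifying [psi]. Replacing [g]
    by a test function costs little in the mean, and for a test function the
    even kernel may be moved to it; its own mollification error is small
    uniformly in [psi] ([mollified_pairing], [radial_dist_uniform_cvg]). *)

(** * Lebesgue measure in coordinates *)

Definition image_measure d d' (T1 : measurableType d) (T2 : measurableType d')
  (R : realType) (m : {measure set T1 -> \bar R}) (f : T1 -> T2)
  (mf : measurable_fun [set: T1] f) : {measure set T2 -> \bar R} :=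
  measure_function_pushforward__canonical__measure_function_Measure m mf.

Section image_integral.
Local Open Scope ereal_scope.
Context d1 d2 (T1 : measurableType d1) (T2 : measurableType d2) (R : realType).
Variables (m1 : {measure set T1 -> \bar R}) (m2 : {measure set T2 -> \bar R}).
Variable phi : T1 -> T2.
Hypothesis mphi : measurable_fun [set: T1] phi.
Hypothesis m12 : forall E, measurable E -> m1 (phi @^-1` E) = m2 E.

Lemma ge0_integral_image (f : T2 -> \bar R) : measurable_fun setT f ->
  (forall x, 0 <= f x) -> \int[m1]_x f (phi x) = \int[m2]_x f x.
Proof.
move=> mf f0.
have := @ge0_integral_pushforward _ _ _ _ _ phi mphi m1 setT f measurableT mf.
rewrite preimage_setT /= => <-//.
by apply: eq_measure_integral => A mA _; exact: m12.
Qed.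

Lemma integral_image (f : T2 -> \bar R) : measurable_fun setT f ->
  \int[m1]_x f (phi x) = \int[m2]_x f x.
Proof.
move=> mf; rewrite integralE [RHS]integralE; congr (_ - _).
  have h := ge0_integral_image (measurable_funepos mf) (fun x => funepos_ge0 _ x).
  by rewrite -[RHS]h; apply: eq_integral => x _; rewrite !funeposE.
have h := ge0_integral_image (measurable_funeneg mf) (fun x => funeneg_ge0 _ x).
by rewrite -[RHS]h; apply: eq_integral => x _; rewrite !funenegE.
Qed.

Lemma integrable_image (f : T2 -> \bar R) :
  m2.-integrable setT f -> m1.-integrable setT (f \o phi).
Proof.
move=> /integrableP[mf foo]; apply/integrableP; split.
  exact: measurableT_comp.
have mf' : measurable_fun setT (abse \o f) by exact: measurableT_comp.
have h := ge0_integral_image mf' (fun x => abse_ge0 _).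
by rewrite [X in X < _]h.
Qed.

End image_integral.

Section lebesgue_rV_invariance.
Context {R : realType} {n : nat}.
Local Notation leb := (@lebesgue_rV R n).
Local Open Scope ereal_scope.

Definition box (A : 'I_n -> set R) : set 'rV[R]_n :=
  [set x | forall i, A i (x ord0 i)].

Lemma boxI (A B : 'I_n -> set R) :
  box A `&` box B = box (fun i => A i `&` B i).
Proof.
apply/seteqP; split => x /=; first by move=> [h1 h2] i; split; [apply: h1|apply: h2].
by move=> h; split => i; have [] := h i.
Qed.

Lemma measurable_rV_boxE : @measurable _ 'rV[R]_n =
  <<s [set box A | A in [set A | forall i, measurable (A i)]] >>.
Proof.
apply/seteqP; split; last first.
  apply: smallest_sub; first exact: sigma_algebra_measurable.
  by move=> _ [A mA <-]; exact: measurable_box.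
apply: smallest_sub; first exact: smallest_sigma_algebra.
rewrite -bigcup_seq/=; apply: bigcup_sub => i _ _ [B mB <-] /=.
apply: sub_sigma_algebra.
exists (fun j => if j == i then B else setT).
  by move=> j /=; case: ifP => // _; exact: measurableT.
rewrite setTI; apply/seteqP; split => x /=; first by move/(_ i); rewrite eqxx.
by move=> Bx j; case: eqP => // ->.
Qed.

(** The intersection of two boxes is a box, and powers of the members of an
    exhaustion of the line exhaust the space. *)
Lemma lebesgue_rV_unique (m : {measure set 'rV[R]_n -> \bar R}) :
  (forall A : 'I_n -> set R, (forall i, measurable (A i)) ->
     m (box A) = \prod_(i < n) lebesgue_measure (A i)) ->
  forall E, measurable E -> leb E = m E.
Proof.
move=> mbox E mE.
have /sigma_finiteP[F [TF ndF Foo]] := sigma_finiteT (@lebesgue_measure R).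
apply: (measure_unique [set box A | A in [set A | forall i, measurable (A i)]]
  (fun k => box (fun=> F k))) => //.
- exact: measurable_rV_boxE.
- move=> _ _ [A mA <-] [B mB <-]; rewrite boxI.
  by exists (fun i => A i `&` B i) => // i; exact: measurableI.
- by move=> k; exists (fun=> F k) => // i; have [] := Foo k.
- apply/seteqP; split => // x _.
  have Fx (i : 'I_n) : exists k, F k (x ord0 i).
    have : setT (x ord0 i) by [].
    by rewrite TF => -[k _ Fk]; exists k.
  have [k hk] := choice Fx.
  exists (\max_(i < n) k i)%N => // i.
  by have /subsetPset := ndF (k i) _ (leq_bigmax i); apply.
- by move=> _ [A mA <-]; rewrite mbox//; exact: lebesgue_rV_box.
- move=> k; rewrite [X in X < _](lebesgue_rV_box (A := fun=> F k)); last first.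
    by move=> i; have [] := Foo k.
  suff : 0 <= \prod_(i < n) lebesgue_measure (F k) < +oo by case/andP.
  elim/big_rec : _ => [|i x _ /andP[x0 xoo]]; first by rewrite lee01 ltry.
  have [_ Fk] := Foo k.
  by rewrite mule_ge0//= lte_mul_pinfty// ge0_fin_numE.
Qed.

(** One-dimensional changes of variables transfer coordinatewise, because the
    preimage of a box is a box. *)
Lemma lebesgue_rV_preimage_coord (s : 'I_n -> R -> R) (c : R) (S : 'rV[R]_n -> 'rV[R]_n) :
  (0 < c)%R -> (forall i x, S x ord0 i = s i (x ord0 i)) ->
  (forall i, measurable_fun setT (s i)) ->
  (forall i B, measurable B ->
     lebesgue_measure (s i @^-1` B : set (measurableTypeR R)) = c%:E * lebesgue_measure B) ->
  measurable_fun [set: 'rV[R]_n] S /\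
  forall E, measurable E -> leb (S @^-1` E) = (c ^+ n)%:E * leb E.
Proof.
move=> c0 Ss ms sc.
have mS : measurable_fun [set: 'rV[R]_n] S.
  apply: measurable_fun_rV => i; under eq_fun do rewrite Ss.
  by apply: measurableT_comp => //; exact: measurable_rV_coord.
split=> // E mE.
have c0' : (0 <= (c ^+ n)^-1)%R by rewrite invr_ge0 exprn_ge0// ltW.
pose p := image_measure leb mS.
have -> : leb E = mscale (NngNum c0') p E.
  apply: lebesgue_rV_unique => // A mA.
  transitivity ((c ^- n)%:E * leb (S @^-1` box A)); first by [].
  rewrite (_ : S @^-1` _ = box (fun i => s i @^-1` A i)); last first.
    by apply/seteqP; split => x /= h i; have := h i; rewrite /= Ss.
  rewrite lebesgue_rV_box; last first.
    by move=> i; rewrite -[X in measurable X]setTI; exact: ms.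
  rewrite (eq_bigr (fun i => c%:E * lebesgue_measure (A i))); last first.
    by move=> i _; exact: sc.
  rewrite big_split/= prodEFin prodr_const card_ord muleA -EFinM mulVf ?mul1e//.
  by rewrite gt_eqF// exprn_gt0.
by rewrite /mscale/= muleA -EFinM divff ?mul1e// gt_eqF// exprn_gt0.
Qed.

Lemma lebesgue_measure_affine (c a : R) (B : set R) : (0 < c)%R -> measurable B ->
  lebesgue_measure ((fun t => c * t + a)%R @^-1` B : set (measurableTypeR R)) =
  (c^-1)%:E * lebesgue_measure B.
Proof.
move=> c0 mB.
have ms : measurable_fun [set: measurableTypeR R]
    ((fun t => c * t + a)%R : measurableTypeR R -> measurableTypeR R).
  by apply: measurable_funD => //; exact: measurable_funM.
pose p := mscale (NngNum (ltW c0)) (image_measure lebesgue_measure ms).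
have pE X : ocitv X -> lebesgue_measure X = p X.
  move=> [[u v] _ <-].
  transitivity (c%:E * lebesgue_measure ((fun t => c * t + a)%R @^-1`
     `]u, v]%classic : set (measurableTypeR R))); last by [].
  rewrite (_ : _ @^-1` _ = `]((u - a) / c)%R, ((v - a) / c)%R]%classic); last first.
    apply/seteqP; split => x /=; rewrite !in_itv/= ltr_pdivrMr// ler_pdivlMr//;
    by rewrite ltrBlDr lerBrDr mulrC.
  rewrite !lebesgue_measure_itv/= !lte_fin ltr_pM2r ?invr_gt0// ltrD2r.
  case: ifPn; rewrite ?mule0// => _; rewrite -!EFinD -EFinM; congr EFin.
  by field; rewrite gt_eqF.
rewrite [X in _ = _ * X](lebesgue_measure_unique pE)//.
transitivity (c^-1%:E * (c%:E * lebesgue_measure ((fun t => c * t + a)%R @^-1`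
     B : set (measurableTypeR R)))); last by [].
by rewrite muleA -EFinM mulVf ?gt_eqF// mul1e.
Qed.

Lemma measurable_addrV (a : 'rV[R]_n) : measurable_fun setT (fun x : 'rV[R]_n => x + a)%R.
Proof.
apply: measurable_fun_rV => i; under eq_fun do rewrite mxE.
by apply: measurable_funD => //; exact: measurable_rV_coord.
Qed.

Lemma lebesgue_rV_translate (a : 'rV[R]_n) E : measurable E ->
  leb ((fun x : 'rV[R]_n => x + a)%R @^-1` E) = leb E.
Proof.
move=> mE.
have [] := @lebesgue_rV_preimage_coord (fun i t => 1 * t + a ord0 i)%R 1%R
  (fun x => x + a)%R ltr01.
- by move=> i x; rewrite mxE mul1r.
- by move=> i; apply: measurable_funD => //; exact: measurable_funM.
- by move=> i B mB; rewrite lebesgue_measure_affine// invr1.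
- by move=> _ ->//; rewrite expr1n mul1e.
Qed.

Lemma measurable_opprV : measurable_fun setT (fun x : 'rV[R]_n => - x)%R.
Proof.
apply: measurable_fun_rV => i; under eq_fun do rewrite mxE.
by apply: measurableT_comp => //; exact: measurable_rV_coord.
Qed.

Lemma lebesgue_rV_opp E : measurable E -> leb ((fun x : 'rV[R]_n => - x)%R @^-1` E) = leb E.
Proof.
move=> mE.
have [] := @lebesgue_rV_preimage_coord (fun i t => - t)%R 1%R (fun x => - x)%R ltr01.
- by move=> i x; rewrite mxE.
- by move=> i; exact: measurableT_comp.
- by move=> i B mB; rewrite mul1e; exact: lebesgue_measureN.
- by move=> _ ->//; rewrite expr1n mul1e.
Qed.

Lemma lebesgue_rV_scale (c : R) E : (0 < c)%R -> measurable E ->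
  leb ((fun x : 'rV[R]_n => c *: x)%R @^-1` E) = (c ^- n)%:E * leb E.
Proof.
move=> c0 mE.
have [] := @lebesgue_rV_preimage_coord (fun i t => c * t + 0)%R c^-1%R
  (fun x => c *: x)%R.
- by rewrite invr_gt0.
- by move=> i x; rewrite mxE addr0.
- by move=> i; apply: measurable_funD => //; exact: measurable_funM.
- by move=> i B mB; rewrite lebesgue_measure_affine.
- by move=> _ ->//; rewrite exprVn.
Qed.

Lemma integral_translate (f : 'rV[R]_n -> \bar R) a : measurable_fun setT f ->
  \int[leb]_x f (x + a)%R = \int[leb]_x f x.
Proof.
by move=> mf; rewrite -(integral_image (measurable_addrV a) (lebesgue_rV_translate a) mf).
Qed.

Lemma integral_reflect (f : 'rV[R]_n -> \bar R) : measurable_fun setT f ->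
  \int[leb]_x f (- x)%R = \int[leb]_x f x.
Proof.
by move=> mf; rewrite -(integral_image measurable_opprV lebesgue_rV_opp mf).
Qed.

End lebesgue_rV_invariance.

Section insert_coordinate.
Context {R : realType} {n : nat}.
Local Open Scope ereal_scope.
Variable i : 'I_n.+1.

(** The point with coordinate [i] equal to [z.1] and the others given by
    [z.2]: Lebesgue measure is defined by splitting off the first coordinate,
    whereas integration by parts requires an arbitrary one. *)
Definition insert_rV (z : measurableTypeR R * 'rV[R]_n) : 'rV[R]_n.+1 :=
  \row_j if unlift i j is Some k then z.2 ord0 k else z.1.

Lemma insert_rV_eq z : insert_rV z ord0 i = z.1.
Proof. by rewrite mxE unlift_none. Qed.

Lemma insert_rV_lift z k : insert_rV z ord0 (lift i k) = z.2 ord0 k.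
Proof. by rewrite mxE liftK. Qed.

Lemma measurable_insert_rV : measurable_fun setT insert_rV.
Proof.
apply: measurable_fun_rV => j; case: (unliftP i j) => [k|] ->.
  under eq_fun do rewrite insert_rV_lift.
  exact: (measurableT_comp (@measurable_rV_coord R n k)).
by under eq_fun do rewrite insert_rV_eq; exact: measurable_fst.
Qed.

Lemma lebesgue_rV_insert E : measurable E ->
  (lebesgue_measure \x lebesgue_rV n) (insert_rV @^-1` E) = lebesgue_rV n.+1 E.
Proof.
move=> mE; rewrite (@lebesgue_rV_unique R n.+1 (image_measure
  (lebesgue_measure \x lebesgue_rV n)%E measurable_insert_rV))// => A mA.
transitivity ((lebesgue_measure \x lebesgue_rV n)%E (insert_rV @^-1` (box A))) => //.
rewrite (_ : insert_rV @^-1` _ = A i `*` box (fun k => A (lift i k))).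
  rewrite product_measure1E; last 2 first.
  - exact: mA.
  - exact: (measurable_box (fun k => mA _)).
  by rewrite (bigD1_ord i)//= lebesgue_rV_box.
apply/seteqP; split => -[t v] /=.
  move=> h; split; first by have := h i; rewrite insert_rV_eq.
  by move=> k; have := h (lift i k); rewrite insert_rV_lift.
move=> [h1 h2] j; case: (unliftP i j) => [k|] ->; first by rewrite insert_rV_lift.
by rewrite insert_rV_eq.
Qed.

Lemma integral_insert_rV (f : 'rV[R]_n.+1 -> \bar R) :
  (lebesgue_rV n.+1).-integrable setT f ->
  \int[lebesgue_rV n.+1]_x f x =
  \int[lebesgue_rV n]_v \int[lebesgue_measure]_t f (insert_rV (t, v)).
Proof.
move=> intf; have [mf _] := integrableP _ _ _ intf.
rewrite -(integral_image measurable_insert_rV lebesgue_rV_insert mf).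
have h := integral21_prod_meas1
  (integrable_image measurable_insert_rV lebesgue_rV_insert intf).
by rewrite -[LHS]h.
Qed.

End insert_coordinate.

(** * Euclidean balls and polar coordinates *)

Section density_measure.
Local Open Scope ereal_scope.
Context d (T : measurableType d) (R : realType).
Variables (m : {measure set T -> \bar R}) (w : T -> R).
Hypotheses (mw : measurable_fun [set: T] w) (w0 : forall x, (0 <= w x)%R).

Definition density (E : set T) : \bar R := \int[m]_(x in E) (w x)%:E.

Let density0 : density set0 = 0.
Proof. by rewrite /density integral_set0. Qed.

Let density_ge0 E : 0 <= density E.
Proof. by apply: integral_ge0 => x _; rewrite lee_fin. Qed.

Let density_sigma_additive : semi_sigma_additive density.
Proof.
move=> /= A mA tA mUA; rewrite /density ge0_integral_bigcup//=.
- by apply: is_cvg_ereal_nneg_natsum_cond => k _ _; exact: density_ge0.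
- by apply: measurable_funTS; exact/measurable_EFinP.
- by move=> x _; rewrite lee_fin.
Qed.

HB.instance Definition _ := isMeasure.Build _ _ _
  density density0 density_ge0 density_sigma_additive.

Definition density_measure : {measure set T -> \bar R} :=
  [the measure _ _ of density].

Import HBNNSimple.

Lemma ge0_integral_density (f : T -> \bar R) : measurable_fun setT f ->
  (forall x, 0 <= f x) -> \int[density_measure]_x f x = \int[m]_x (f x * (w x)%:E).
Proof.
move=> mf f0; pose h := nnsfun_approx measurableT mf.
have fE x : f x = limn (fun k => (h k x)%:E).
  by apply/esym/cvg_lim => //; exact: cvg_nnsfun_approx.
have hnd x a b : (a <= b)%N -> ((h a x)%:E <= (h b x)%:E)%E.
  by move=> ab; rewrite lee_fin; exact/lefP/nd_nnsfun_approx.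
have -> : \int[density_measure]_x f x =
    limn (fun k => \int[density_measure]_x (h k x)%:E).
  under eq_integral do rewrite fE.
  apply: monotone_convergence => //.
  - by move=> k; apply/measurable_EFinP; exact/measurable_funP.
  - by move=> k x _; rewrite lee_fin.
  - by move=> x _ a b ab; exact: hnd.
have -> : \int[m]_x (f x * (w x)%:E) =
    limn (fun k => \int[m]_x ((h k x)%:E * (w x)%:E)).
  have fwE x : f x * (w x)%:E = limn (fun k => (h k x)%:E * (w x)%:E).
    by apply/esym/cvg_lim => //; apply: cvgeZr => //; exact: cvg_nnsfun_approx.
  under eq_integral do rewrite fwE.
  apply: monotone_convergence => //.
  - move=> k; apply: emeasurable_funM; apply/measurable_EFinP => //.
  - by move=> k x _; rewrite mule_ge0// lee_fin.
  - by move=> x _ a b ab; rewrite lee_wpmul2r ?lee_fin ?w0//; exact: hnd.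
congr (limn _); apply/funext => k.
transitivity (\int[density_measure]_x
   (\sum_(y \in range (h k)) (y * \1_(h k @^-1` [set y]) x)%:E)).
  by apply: eq_integral => t _; rewrite /= fimfunE -fsumEFin.
have mi y : measurable_fun setT (fun x => (y * \1_(h k @^-1` [set y]) x)%:E).
  by apply/measurable_EFinP; exact: measurable_funM.
rewrite ge0_integral_fsum//; last by move=> y x _; exact: nnfun_muleindic_ge0.
transitivity (\int[m]_x (\sum_(y \in range (h k))
    (y * \1_(h k @^-1` [set y]) x)%:E * (w x)%:E)); last first.
  apply: eq_integral => x _; rewrite -ge0_mule_fsuml => [|y].
    by rewrite fsumEFin // -fimfunE.
  exact: nnfun_muleindic_ge0.
rewrite ge0_integral_fsum//; last 2 first.
- by move=> y; apply: emeasurable_funM => //; exact/measurable_EFinP.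
- by move=> y x _; rewrite mule_ge0 ?lee_fin// -lee_fin nnfun_muleindic_ge0.
apply: eq_fsbigr => y /set_mem yh.
have y0 : (0 <= y)%R by case: yh => t _ <-.
under eq_integral do rewrite EFinM.
rewrite ge0_integralZl//=; last exact/measurable_EFinP.
rewrite integral_indic//= setIT.
under [RHS]eq_integral do rewrite EFinM -muleA.
rewrite ge0_integralZl//=; last 2 first.
- by apply: emeasurable_funM; apply/measurable_EFinP.
- by move=> x _; rewrite mule_ge0 ?lee_fin.
congr (_ * _); rewrite /density [LHS]integral_mkcond.
by apply: eq_integral => x _; rewrite epatch_indic/= muleC.
Qed.

End density_measure.

Section euclidean_norm.
Context {R : realType} {n : nat}.
Implicit Types (x y : 'rV[R]_n) (r : R).
Local Notation leb := (@lebesgue_rV R n).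

Lemma enorm_ge0 x : 0 <= enorm x.
Proof. exact: sqrtr_ge0. Qed.

Lemma sqr_enorm x : enorm x ^+ 2 = \sum_i x ord0 i ^+ 2.
Proof. by rewrite sqr_sqrtr// sumr_ge0// => i _; exact: sqr_ge0. Qed.

Lemma enormZ r x : enorm (r *: x) = `|r| * enorm x.
Proof.
rewrite /enorm -sqrtr_sqr -sqrtrM ?sqr_ge0//; congr Num.sqrt.
by rewrite mulr_sumr; apply: eq_bigr => i _; rewrite mxE exprMn.
Qed.

Lemma enormN x : enorm (- x) = enorm x.
Proof. by rewrite -scaleN1r enormZ normrN1 mul1r. Qed.

Lemma enorm0 : enorm (0 : 'rV[R]_n) = 0.
Proof. by rewrite -(scale0r 0) enormZ normr0 mul0r. Qed.

Lemma le_coord_enorm x i : `|x ord0 i| <= enorm x.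
Proof.
rewrite -ler_sqr ?nnegrE ?enorm_ge0// sqr_enorm real_normK ?num_real//.
by rewrite (bigD1 i)//= lerDl sumr_ge0// => j _; exact: sqr_ge0.
Qed.

Lemma enorm_eq0 x : (enorm x == 0) = (x == 0).
Proof.
apply/eqP/eqP => [x0|->]; last exact: enorm0.
apply/rowP => i; rewrite mxE; apply/eqP; rewrite -normr_le0 -x0.
exact: le_coord_enorm.
Qed.

Lemma enorm_gt0 x : (0 < enorm x) = (x != 0).
Proof. by rewrite lt_def enorm_eq0 enorm_ge0 andbT. Qed.

Lemma le_norm_enorm x : `|x| <= enorm x.
Proof.
rewrite -[`|x|]/(mx_norm x).
have [->|/mx_norm_neq0[[i j] /= ->]] := eqVneq (mx_norm x) 0; first exact: enorm_ge0.
by rewrite (ord1 i); exact: le_coord_enorm.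
Qed.

Lemma le_enorm_norm x : enorm x <= n%:R * `|x|.
Proof.
have x0 : 0 <= n%:R * `|x| by rewrite mulr_ge0.
rewrite -ler_sqr ?nnegrE ?enorm_ge0// sqr_enorm.
apply: (@le_trans _ _ (\sum_(i < n) `|x| ^+ 2)).
  apply: ler_sum => i _; rewrite -[X in X <= _]real_normK ?num_real//.
  rewrite ler_sqr ?nnegrE//.
  rewrite -[`|x|]/(mx_norm x) mx_normrE.
  exact: (le_bigmax _ (fun i : 'I_1 * 'I_n => `|x i.1 i.2|) (ord0, i)).
rewrite sumr_const card_ord -[leLHS]mulr_natl exprMn ler_wpM2r ?sqr_ge0//.
by case: n {x x0} => [|k]; rewrite ?expr0n// -natrX ler_nat leq_pmull.
Qed.

Lemma measurable_enorm : measurable_fun setT (@enorm R n).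
Proof.
apply: (measurableT_comp (f := @Num.sqrt R)).
  by apply: continuous_measurable_fun; exact: sqrt_continuous.
apply: measurable_sum => i; apply: (@measurable_funX _ _ _ _ (fun x : 'rV[R]_n => x ord0 i)).
exact: measurable_rV_coord.
Qed.

Lemma measurable_eball r : measurable (@eball R n r).
Proof.
rewrite (_ : eball r = @enorm R n @^-1` `]-oo, r[); last first.
  by apply/seteqP; split => x /=; rewrite in_itv.
by rewrite -[X in measurable X]setTI; exact: measurable_enorm.
Qed.

Lemma eball_le0 r : r <= 0 -> @eball R n r = set0.
Proof.
move=> r0; apply/seteqP; split => // x; rewrite /eball/= => h.
by have := enorm_ge0 x; rewrite leNgt (lt_le_trans h).
Qed.

Definition unit_ball_volume : R := fine (leb (eball 1)).

Lemma lebesgue_rV_cube (r : R) : 0 <= r ->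
  leb (box (fun=> `]-r, r[%classic)) = ((2 * r) ^+ n)%:E.
Proof.
move=> r0; rewrite lebesgue_rV_box => [|i]; last exact: measurable_itv.
under eq_bigr do rewrite lebesgue_measure_itv/= lte_fin.
rewrite (eq_bigr (fun=> (2 * r)%:E)) => [|i _].
  by rewrite prodEFin prodr_const card_ord.
case: ltP => [h|h]; first by rewrite -EFinD; congr EFin; ring.
by have -> : r = 0; [lra|rewrite mulr0].
Qed.

Lemma eball_volume_fin r : (leb (eball r) < +oo)%E.
Proof.
have [r0|r0] := leP r 0; first by rewrite eball_le0// measure0.
apply: (@le_lt_trans _ _ (leb (box (fun=> `]-r, r[%classic)))).
  apply: le_measure; rewrite ?inE; [exact: measurable_eball| |].
    by apply: measurable_box => i; exact: measurable_itv.
  move=> x xr i /=; rewrite in_itv/= -ltr_norml.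
  exact: le_lt_trans (le_coord_enorm _ _) xr.
by rewrite lebesgue_rV_cube ?ltry// ltW.
Qed.

Lemma unit_ball_volumeE : leb (eball 1) = unit_ball_volume%:E.
Proof. by rewrite fineK// ge0_fin_numE// eball_volume_fin. Qed.

Lemma unit_ball_volume_gt0 : 0 < unit_ball_volume.
Proof.
rewrite -lte_fin -unit_ball_volumeE.
pose r : R := (n.+1)%:R^-1.
have r0 : 0 < r by rewrite invr_gt0.
apply: (@lt_le_trans _ _ (leb (box (fun=> `]-r, r[%classic)))).
  by rewrite lebesgue_rV_cube ?ltW// lte_fin exprn_gt0// mulr_gt0.
apply: le_measure; rewrite ?inE; [|exact: measurable_eball|].
  by apply: measurable_box => i; exact: measurable_itv.
move=> x xr; rewrite /eball/=.
rewrite -(ltr_pXn2r (n := 2))// ?nnegrE ?enorm_ge0// sqr_enorm expr1n.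
apply: (@le_lt_trans _ _ (\sum_(i < n) r ^+ 2)).
  apply: ler_sum => i _; rewrite -[X in X <= _]real_normK ?num_real//.
  rewrite ler_sqr ?nnegrE ?(ltW r0)//; apply/ltW; rewrite ltr_norml.
  by have := xr i; rewrite /= in_itv.
rewrite sumr_const card_ord -[ltLHS]mulr_natl expr2 mulrA.
have r1 : r < 1 \/ n = 0%N.
  case: (n) @r {r0 x xr} => [|k] r; [by right|left].
  by rewrite invf_lt1// ltr1n.
have nr : n%:R * r < 1 by rewrite /r ltr_pdivrMr// mul1r ltr_nat.
have [r1'|r1'] := leP r 1; last by have : r <= 1 by [rewrite invf_le1// ler1n]; lra.
by apply: le_lt_trans nr; rewrite ler_piMr// mulr_ge0// ltW.
Qed.

Lemma eball_scale r : 0 < r -> eball r = (fun x => r^-1 *: x) @^-1` @eball R n 1.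
Proof.
move=> r0; apply/seteqP; split => x; rewrite /eball/= enormZ gtr0_norm ?invr_gt0//;
by rewrite mulrC ltr_pdivrMr// mul1r.
Qed.

Lemma eball_volume r : 0 < r -> leb (eball r) = (r ^+ n * unit_ball_volume)%:E.
Proof.
move=> r0; rewrite eball_scale// lebesgue_rV_scale ?invr_gt0//; last exact: measurable_eball.
by rewrite unit_ball_volumeE exprVn invrK.
Qed.

End euclidean_norm.

Lemma FTC2_derive {R : realType} (F f : R -> R) (a b : R) : a < b ->
  (forall x : R, is_derive x 1 F (f x)) -> continuous f ->
  (\int[lebesgue_measure]_(x in `[a, b]) (f x)%:E = (F b - F a)%:E)%E.
Proof.
move=> ab dF cf.
have cF : continuous F.
  by move=> x; apply/differentiable_continuous/derivable1_diffP; exact: ex_derive.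
rewrite (@continuous_FTC2 _ f F a b ab)//; first exact: continuous_subspaceT.
- split => [x _| |]; first exact: ex_derive.
  + exact/cvg_at_right_filter/cF.
  + exact/cvg_at_left_filter/cF.
- by move=> x _; rewrite derive1E derive_val.
Qed.

Section polar_coordinates.
Context {R : realType} {n : nat}.
Local Notation leb := (@lebesgue_rV R n.+1).
Local Notation omega := (@unit_ball_volume R n.+1).
Local Open Scope ereal_scope.

(** The derivative of the volume of the ball of radius [r]. *)
Definition radial_weight (r : R) : R := (n.+1%:R * omega * r ^+ n * \1_(`]0, +oo[) r)%R.

Lemma radial_weight_ge0 r : (0 <= radial_weight r)%R.
Proof.
rewrite /radial_weight indicE; case: (boolP (r \in _)); rewrite ?mulr0//.
rewrite mem_setE in_itv/= andbT => r0.
rewrite mulr1; apply: mulr_ge0; last by rewrite exprn_ge0// ltW.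
by apply: mulr_ge0 => //; apply: ltW; exact: unit_ball_volume_gt0.
Qed.

Lemma measurable_radial_weight : measurable_fun setT radial_weight.
Proof.
apply: measurable_funM; last exact: measurable_indic.
by apply: measurable_funM => //; exact: exprn_measurable.
Qed.

Lemma integral_radial_weight b : (0 < b)%R ->
  \int[lebesgue_measure]_(r in `]-oo, b[) (radial_weight r)%:E = (b ^+ n.+1 * omega)%:E.
Proof.
move=> b0.
pose w r : R := (n.+1%:R * omega * r ^+ n)%R.
have -> : \int[lebesgue_measure]_(r in `]-oo, b[) (radial_weight r)%:E =
   \int[lebesgue_measure]_(r in `]0%R, b[) (w r)%:E.
  rewrite integral_mkcond [RHS]integral_mkcond; apply: eq_integral => r _.
  rewrite !patchE /radial_weight indicE !mem_setE/= !in_itv/= andbT.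
  by case: ltP => r0; case: ltP => rb //=; rewrite ?mulr1 ?mulr0.
rewrite -(@integral_itv_bndoo _ _ _ _ true false); last first.
  by apply/measurable_EFinP/measurable_funTS/measurable_funM => //; exact: exprn_measurable.
have dF (x : R) : is_derive x 1%R (fun r => r ^+ n.+1 * omega)%R (w x).
  rewrite (_ : (fun r => _) = omega \*: ((@id R) ^+ n.+1)%R); last first.
    by apply/funext => r; rewrite /= exprfctE mulrC.
  have h := is_deriveZ omega (is_deriveX n.+1 (is_derive_id x (1%R : R))).
  apply: is_derive_eq h _; rewrite /w /= -![_ *: _]/(_ * _)%R; ring.
have cw : continuous w.
  by move=> r; apply: cvgMl_tmp; exact: exprn_continuous.
by rewrite (FTC2_derive b0 dF cw) expr0n/= mul0r subr0.
Qed.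

(** Radial functions see Lebesgue measure only through the volume growth of
    balls: the image of Lebesgue measure under the Euclidean norm and the
    measure with the radial density give the same mass to every half-line. *)
Lemma lebesgue_rV_enorm (E : set R) : measurable E ->
  leb (@enorm R n.+1 @^-1` E) =
  \int[lebesgue_measure]_(r in E) (radial_weight r)%:E.
Proof.
move=> mE.
have me : measurable_fun [set: 'rV[R]_n.+1]
  ((@enorm R n.+1) : 'rV[R]_n.+1 -> measurableTypeR R) by exact: measurable_enorm.
pose m1 := image_measure leb me.
pose m2 := density_measure lebesgue_measure measurable_radial_weight radial_weight_ge0.
have Q b : m1 `]-oo, b[%classic = m2 `]-oo, b[%classic.
  transitivity (leb (eball b)); first by congr (leb _); apply/seteqP; split => x /=; rewrite in_itv.
  transitivity (\int[lebesgue_measure]_(r in `]-oo, b[) (radial_weight r)%:E); last by [].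
  have [b0|b0] := ltP 0%R b; first by rewrite eball_volume// integral_radial_weight.
  rewrite eball_le0// measure0 integral0_eq// => r /=; rewrite in_itv/= => rb.
  rewrite /radial_weight indicE memNset ?mulr0//= in_itv/= andbT.
  by apply/negP; rewrite -leNgt (le_trans (ltW rb)).
suff : m1 E = m2 E by [].
refine (@measure_unique _ R (measurableTypeR R) (@RGenInftyO.G R)
  (fun k => `]-oo, k%:R[%classic) _ _ _ _ m1 m2 _ _ E mE).
- exact: RGenInftyO.measurableE.
- move=> _ _ [x ->] [y ->]; exists (Num.min x y).
  by apply/seteqP; split => z /=; rewrite !in_itv/= lt_min; [move=> [-> ->]|move=> /andP[]].
- by move=> k; exists k%:R.
- apply/seteqP; split => // x _; exists (Num.truncn x).+1 => //=.
  by rewrite in_itv/= truncnS_gt.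
- by move=> _ [x ->]; exact: Q.
- move=> k; rewrite [X in X < _](_ : _ = leb (eball k%:R)) ?eball_volume_fin//.
Qed.

Lemma ge0_integral_radial (f : R -> \bar R) : measurable_fun setT f ->
  (forall r, 0 <= f r) ->
  \int[leb]_z f (enorm z) = \int[lebesgue_measure]_r (f r * (radial_weight r)%:E).
Proof.
move=> mf f0.
rewrite -(ge0_integral_density lebesgue_measure measurable_radial_weight
  radial_weight_ge0 mf f0).
have me : measurable_fun [set: 'rV[R]_n.+1]
  ((@enorm R n.+1) : 'rV[R]_n.+1 -> measurableTypeR R) by exact: measurable_enorm.
exact: (@ge0_integral_image _ _ _ (measurableTypeR R) R leb
  (density_measure lebesgue_measure measurable_radial_weight radial_weight_ge0)
  (@enorm R n.+1) me (fun E mE => lebesgue_rV_enorm mE) f mf f0).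
Qed.

End polar_coordinates.

(** * Smooth functions *)

Section derivative_complements.
Context {R : realType} {V X : normedModType R}.
Implicit Types (u : V -> X) (x v : V).

Lemma is_derive_cvg u x v du : is_derive x v u du ->
  h^-1 *: (u (h *: v + x) - u x) @[h --> (0:R)^'] --> du.
Proof. by move=> [ex <-]; exact: ex. Qed.

Lemma cvg_is_derive u x v du :
  h^-1 *: (u (h *: v + x) - u x) @[h --> (0:R)^'] --> du -> is_derive x v u du.
Proof.
move=> h; apply: DeriveDef; first by apply/cvg_ex; exists du.
by apply: cvg_lim h; exact: norm_hausdorff.
Qed.

End derivative_complements.

Section derivative_rules.
Context {R : realType} {V X Y : normedModType R}.
Implicit Types (u : V -> X) (x v : V).

Lemma is_derive_line u x v (t : R) du : is_derive (x + t *: v) v u du ->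
  is_derive t (1 : R) (fun s : R => u (x + s *: v)) du.
Proof.
move=> /is_derive_cvg h; apply: DeriveDef.
  apply/cvg_ex; exists du; apply: cvg_trans h; apply: near_eq_cvg; apply: nearW => s /=.
  by congr (_ *: (u _ - _)); rewrite -[_ *: 1]/(_ * _) mulr1 scalerDl addrCA addrC.
apply: cvg_lim; first exact: norm_hausdorff.
apply: cvg_trans h; apply: near_eq_cvg; apply: nearW => s /=.
by congr (_ *: (u _ - _)); rewrite -[_ *: 1]/(_ * _) mulr1 scalerDl addrCA addrC.
Qed.

Lemma is_derive_of_line u x v du :
  is_derive (0 : R) (1 : R) (fun s : R => u (x + s *: v)) du -> is_derive x v u du.
Proof.
move=> /is_derive_cvg h; apply: cvg_is_derive.
apply: cvg_trans h; apply: near_eq_cvg; apply: nearW => s /=.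
by rewrite scale0r !addr0 -[s *: 1]/(s * 1) mulr1 [x + _]addrC.
Qed.

Lemma is_derive_linear (L : {linear X -> Y}) u x v du : continuous L ->
  is_derive x v u du -> is_derive x v (L \o u) (L du).
Proof.
move=> cL /is_derive_cvg h; apply: cvg_is_derive.
have := cvg_comp _ _ h (cL du); apply: cvg_trans; apply: near_eq_cvg.
by apply: nearW => s /=; rewrite linearZ linearB.
Qed.

Lemma is_derive_scale (chi : V -> R^o) u x v (dchi : R) du : {for x, continuous chi} ->
  is_derive x v chi dchi -> is_derive x v u du ->
  is_derive x v (fun y => chi y *: u y) (chi x *: du + dchi *: u x).
Proof.
move=> cchi /is_derive_cvg hc /is_derive_cvg hu; apply: cvg_is_derive.
have cl : chi (h *: v + x) @[h --> (0:R)^'] --> chi x.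
  have e : h *: v + x @[h --> (0:R)^'] --> 0 *: v + x.
    by apply: cvgD; [apply: cvgZr_tmp; apply: cvg_within_filter; exact: cvg_id|exact: cvg_cst].
  by rewrite scale0r add0r in e; exact: cvg_comp e cchi.
have e : chi (s *: v + x) *: (s^-1 *: (u (s *: v + x) - u x)) +
    (s^-1 * (chi (s *: v + x) - chi x) : R) *: u x @[s --> (0:R)^'] -->
    chi x *: du + dchi *: u x.
  by apply: cvgD; [exact: cvgZ|exact: cvgZr_tmp].
apply: cvg_trans e; apply: near_eq_cvg; apply: nearW => s /=.
rewrite scalerA [_ * s^-1]mulrC -!scalerA -scalerDr.
by rewrite scalerBr scalerBl addrA subrK.
Qed.

End derivative_rules.

Section smooth_theory.
Context {R : realType} {n : nat}.

Section basic.
Context {X : normedModType R}.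
Implicit Types u f : 'rV[R]_n -> X.

Lemma iter_partial_partial s i u :
  iter_partial s (partial i u) = iter_partial (rcons s i) u.
Proof. by rewrite /iter_partial foldr_rcons. Qed.

Lemma smooth_partial i u : smooth u -> smooth (partial i u).
Proof. by move=> su s; rewrite iter_partial_partial; exact: su. Qed.

Lemma smooth_iter s u : smooth u -> smooth (iter_partial s u).
Proof. by move=> su; elim: s => //= i s; exact: smooth_partial. Qed.

Lemma smooth_continuous u : smooth u -> continuous u.
Proof. by move=> su; have [] := su [::]. Qed.
Arguments smooth_continuous {u} su x.

Lemma smooth_is_derive u i x : smooth u ->
  is_derive x (delta_mx 0 i) u (partial i u x).
Proof. by move=> su; apply: derivableP; have [_] := su [::]; apply. Qed.

(** A class of continuous functions that is stable under partial derivatives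
    consists of smooth functions; smoothness is established this way without
    computing iterated derivatives. *)
Lemma smooth_class (P : ('rV[R]_n -> X) -> Prop) :
  (forall u, P u -> continuous u /\
     forall i, exists2 du, P du & forall x, is_derive x (delta_mx 0 i) u (du x)) ->
  forall u, P u -> smooth u.
Proof.
move=> Pc u Pu s.
have Ps : P (iter_partial s u).
  elim: s => //= i s /Pc[_ /(_ i)[du Pdu dudu]].
  by rewrite (_ : partial _ _ = du)//; apply/funext => x; rewrite /partial derive_val.
have [? h] := Pc _ Ps; split => // i x.
by have [du _ /(_ x) [ex _]] := h i.
Qed.

Lemma partialE i u du : (forall x, is_derive x (delta_mx 0 i) u (du x)) ->
  partial i u = du.
Proof. by move=> h; apply/funext => x; rewrite /partial derive_val. Qed.

Lemma smooth_cst (c : X) : smooth (fun _ : 'rV[R]_n => c).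
Proof.
apply: (@smooth_class (fun u => exists c, u = fun=> c)); last by exists c.
move=> _ [{}c ->]; split => [|i]; first exact: cst_continuous.
exists (fun=> 0); [by exists 0|move=> x; exact: (@is_derive_cst R _ X c x)].
Qed.

Lemma partialD i u f : smooth u -> smooth f ->
  partial i (fun x => u x + f x) = fun x => partial i u x + partial i f x.
Proof.
move=> su sf; apply: partialE => x.
exact: is_deriveD (smooth_is_derive _ _ su) (smooth_is_derive _ _ sf).
Qed.

Lemma iter_partialD s u f : smooth u -> smooth f ->
  iter_partial s (fun x => u x + f x) = fun x => iter_partial s u x + iter_partial s f x.
Proof.
by move=> su sf; elim: s => //= i s ->; rewrite partialD//; exact: smooth_iter.
Qed.

Lemma smoothD u f : smooth u -> smooth f -> smooth (fun x => u x + f x).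
Proof.
move=> su sf; apply: (@smooth_class (fun w => exists u f,
  [/\ smooth u, smooth f & w = fun x => u x + f x])); last by exists u, f.
move=> _ [{su}u [{sf}f [su sf ->]]]; split => [x|i].
  exact: (cvgD (smooth_continuous su x) (smooth_continuous sf x)).
exists (fun x => partial i u x + partial i f x).
  by exists (partial i u), (partial i f); split => //; exact: smooth_partial.
by move=> x; exact: is_deriveD (smooth_is_derive _ _ su) (smooth_is_derive _ _ sf).
Qed.

Lemma smooth_sum (I : Type) (r : seq I) (F : I -> 'rV[R]_n -> X) :
  (forall k, smooth (F k)) -> smooth (fun x => \sum_(k <- r) F k x).
Proof.
move=> sF; elim: r => [|k r IH].
  by rewrite (_ : (fun x => _) = fun=> 0); [exact: smooth_cst|apply/funext => x; rewrite big_nil].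
rewrite (_ : (fun x => _) = fun x => F k x + \sum_(j <- r) F j x); first exact: smoothD.
by apply/funext => x; rewrite big_cons.
Qed.

Lemma iter_partial_sum s (I : Type) (r : seq I) (F : I -> 'rV[R]_n -> X) :
  (forall k, smooth (F k)) -> iter_partial s (fun x => \sum_(k <- r) F k x) =
  fun x => \sum_(k <- r) iter_partial s (F k) x.
Proof.
move=> sF; elim: r => [|k r IH].
  rewrite (_ : (fun x => _) = fun=> 0); last by apply/funext => x; rewrite big_nil.
  rewrite (_ : (fun x => \sum_(k <- [::]) iter_partial s _ _) = fun=> 0); last first.
    by apply/funext => x; rewrite big_nil.
  by elim: s => //= i s ->; apply: partialE => x; exact: is_derive_cst.
rewrite (_ : (fun x => _) = fun x => F k x + \sum_(j <- r) F j x); last first.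
  by apply/funext => x; rewrite big_cons.
rewrite iter_partialD//; last exact: smooth_sum.
by rewrite IH; apply/funext => x; rewrite big_cons.
Qed.

End basic.
Arguments smooth_continuous {X u} su x.

Section scale.
Context {X : normedModType R}.
Implicit Types u f : 'rV[R]_n -> X.

(** Products of smooth functions are not stable under differentiation, but
    finite sums of such products are. *)
Inductive smooth_products : ('rV[R]_n -> X) -> Prop :=
| smooth_products_mul (chi : 'rV[R]_n -> R^o) u : smooth chi -> smooth u ->
    smooth_products (fun x => chi x *: u x)
| smooth_products_add u f : smooth_products u -> smooth_products f ->
    smooth_products (fun x => u x + f x).

Lemma partial_scale i (chi : 'rV[R]_n -> R^o) u : smooth chi -> smooth u ->
  partial i (fun x => chi x *: u x) =
  fun x => chi x *: partial i u x + partial i chi x *: u x.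
Proof.
move=> sc su; apply: partialE => x.
exact: (is_derive_scale (smooth_continuous sc x) (smooth_is_derive _ _ sc) (smooth_is_derive _ _ su)).
Qed.

Lemma smooth_scale (chi : 'rV[R]_n -> R^o) u : smooth chi -> smooth u ->
  smooth (fun x => chi x *: u x).
Proof.
move=> sc su; apply: (@smooth_class _ smooth_products); last exact: smooth_products_mul.
move=> {sc su}w; elim=> {w} [{}chi {}u sc su|{}u f _ [cu hu] _ [cf hf]]; split.
- by move=> x; exact: (cvgZ (smooth_continuous sc x) (smooth_continuous su x)).
- move=> i; exists (fun x => chi x *: partial i u x + partial i chi x *: u x).
    exact: (smooth_products_add (smooth_products_mul sc (smooth_partial i su))
      (smooth_products_mul (smooth_partial i sc) su)).
  by move=> x; exact: (is_derive_scale (smooth_continuous sc x) (smooth_is_derive _ _ sc) (smooth_is_derive _ _ su)).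
- by move=> x; exact: (cvgD (cu x) (cf x)).
- move=> i; have [du Pdu hdu] := hu i; have [df Pdf hdf] := hf i.
  exists (fun x => du x + df x); first exact: smooth_products_add.
  by move=> x; exact: is_deriveD.
Qed.

End scale.

Section linear_image.
Context {X Y : normedModType R} (L : {linear X -> Y}).
Hypothesis cL : continuous L.

Lemma partial_linear i (u : 'rV[R]_n -> X) : smooth u ->
  partial i (L \o u) = L \o partial i u.
Proof.
move=> su; apply: partialE => x; apply: is_derive_linear => //.
exact: smooth_is_derive.
Qed.

Lemma iter_partial_linear s (u : 'rV[R]_n -> X) : smooth u ->
  iter_partial s (L \o u) = L \o iter_partial s u.
Proof.
by move=> su; elim: s => //= i s ->; rewrite partial_linear//; exact: smooth_iter.
Qed.

Lemma smooth_linear (u : 'rV[R]_n -> X) : smooth u -> smooth (L \o u).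
Proof.
move=> su; apply: (@smooth_class _ (fun w => exists2 u, smooth u & w = L \o u)); last by exists u.
move=> _ [{su}u su ->]; split => [x|i].
  by apply: (@continuous_comp _ _ _ u L); [exact: (smooth_continuous su x)|exact: cL].
exists (L \o partial i u); first by exists (partial i u) => //; exact: smooth_partial.
by move=> x; apply: is_derive_linear => //; exact: smooth_is_derive.
Qed.

End linear_image.

End smooth_theory.
Arguments smooth_continuous {R n X u} su x.

(** * Test functions *)

Section test_functions.
Context {R : realType} {n : nat}.

Lemma continuous_measurable_rV (f : 'rV[R]_n -> R) : continuous f ->
  measurable_fun setT f.
Proof.
move=> cf; apply: (measurability (@RGenOInfty.G R)); first exact: RGenOInfty.measurableE.
move=> _ [_ [a ->] <-]; rewrite setTI; apply: open_measurable_rV.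
by apply: open_comp => [x _|]; [exact: cf|exact: interval_open].
Qed.

Section vector_valued.
Context {X : normedModType R}.
Implicit Types u : 'rV[R]_n -> X.

Definition supported_in_ball u (M : R) := forall x, M < `|x| -> u x = 0.

Lemma closed_norm_ball_compact (M : R) : compact [set x : 'rV[R]_n | `|x| <= M].
Proof.
apply: bounded_closed_compact.
  by exists M; split; [exact: num_real|move=> y My x /= xM; exact: le_trans xM (ltW My)].
have := @preimage_closed _ _ (fun x : 'rV[R]_n => `|x|) [set r | r <= M].
by apply; [move=> x _; exact: norm_continuous|exact: closed_le].
Qed.

(** Closed balls of the sup norm are compact, so that compactness of the
    support amounts to its boundedness. *)
Lemma compact_tsupportP u :
  compact (tsupport u) <-> exists M, supported_in_ball u M.
Proof.
split=> [/compact_bounded[M [_ hM]]|[M hM]].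
  exists (M + 1) => x Mx; apply: contrapT => /eqP ux.
  have M1 : M < M + 1 by rewrite ltrDl.
  have /= := hM (M + 1) M1 x (@subset_closure _ _ x ux).
  by rewrite leNgt Mx.
apply: (@subclosed_compact _ _ [set x : 'rV[R]_n | `|x| <= M]).
- exact: closed_closure.
- exact: closed_norm_ball_compact.
have cB : closed [set x : 'rV[R]_n | `|x| <= M].
  have := @preimage_closed _ _ (fun x : 'rV[R]_n => `|x|) [set r | r <= M].
  by apply; [move=> x _; exact: norm_continuous|exact: closed_le].
rewrite /tsupport [X in _ `<=` X]((closure_id _).1 cB); apply: closureS => x /= ux.
by rewrite leNgt; apply/negP => /hM u0; rewrite u0 eqxx in ux.
Qed.

Lemma test_function_support u : test_function u -> exists2 M, 0 <= M & supported_in_ball u M.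
Proof.
move=> [_ /compact_tsupportP[M hM]]; exists (Num.max M 0); first by rewrite le_max lexx orbT.
by move=> x; rewrite gt_max => /andP[/hM].
Qed.

Lemma supported_in_ball_partial u M i : smooth u ->
  supported_in_ball u M -> supported_in_ball (partial i u) M.
Proof.
move=> su hM x Mx; rewrite /partial.
suff h : is_derive x (delta_mx 0 i) u 0 by rewrite derive_val.
apply: cvg_is_derive; apply: cvg_near_cst.
have e : h *: (delta_mx 0 i : 'rV[R]_n) + x @[h --> (0:R)^'] --> x.
  have e : h *: (delta_mx 0 i : 'rV[R]_n) + x @[h --> (0:R)^'] --> 0 *: (delta_mx 0 i : 'rV[R]_n) + x.
    by apply: cvgD; [apply: cvgZr_tmp; apply: cvg_within_filter; exact: cvg_id|exact: cvg_cst].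
  by rewrite scale0r add0r in e.
have H : \forall h \near (0:R)^', M < `|h *: (delta_mx 0 i : 'rV[R]_n) + x|.
  exact: (cvgr_gt `|x| (cvg_norm e) _ Mx).
near=> h; rewrite !hM ?subr0 ?scaler0//.
by near: h; exact: H.
Unshelve. all: by end_near.
Qed.

Lemma test_function_partial u i : test_function u -> test_function (partial i u).
Proof.
move=> [su /compact_tsupportP[M hM]]; split; first exact: smooth_partial.
by apply/compact_tsupportP; exists M; exact: supported_in_ball_partial.
Qed.

Lemma test_function_iter u s : test_function u -> test_function (iter_partial s u).
Proof. by move=> tu; elim: s => //= i s; exact: test_function_partial. Qed.

Lemma supported_uniform_continuity u M : continuous u -> supported_in_ball u M ->
  forall e, 0 < e -> exists2 d, 0 < d &
    forall x y : 'rV[R]_n, `|y| < d -> `|u (x + y) - u x| < e.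
Proof.
move=> cu hM e e0.
pose K := [set x : 'rV[R]_n | `|x| <= M + 1].
have cK : compact K by exact: closed_norm_ball_compact.
move/compact_near_coveringP : cK => /(_ _ (nbhs (0 : 'rV[R]_n))
  (fun y x => `|u (x + y) - u x| < e) _).
have hx x : K x -> \forall x' \near x & y \near (0 : 'rV[R]_n), `|u (x' + y) - u x'| < e.
  move=> _.
  have c1 : u (z.1 + z.2) - u z.1 @[z --> (x, 0 : 'rV[R]_n)] --> u (x + 0) - u x.
    have e1 : z.1 + z.2 @[z --> (x, 0 : 'rV[R]_n)] --> x + 0.
      by apply: cvgD; [exact: (@cvg_fst _ _ (nbhs x) (nbhs (0 : 'rV[R]_n)))|
        exact: (@cvg_snd _ _ (nbhs x) (nbhs (0 : 'rV[R]_n)))].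
    have e2 := cvg_comp _ _ e1 (cu (x + 0)).
    have e0' : z.1 @[z --> (x, 0 : 'rV[R]_n)] --> x.
      exact: (@cvg_fst _ _ (nbhs x) (nbhs (0 : 'rV[R]_n))).
    have e3 := cvg_comp _ _ e0' (cu x).
    exact: (cvgB e2 e3).
  move/cvg_norm : c1; rewrite addr0 subrr normr0 => /cvgr_lt /(_ e e0).
  by [].
move=> /(_ hx) /nbhs_ballP[d /= d0 hd].
exists (Num.min d 1); first by rewrite lt_min d0 ltr01.
move=> x y; rewrite lt_min => /andP[yd y1].
have [xK|xK] := leP `|x| (M + 1).
  by apply: (hd y) => //; rewrite -ball_normE/= sub0r normrN.
rewrite !hM ?subrr ?normr0//; first by rewrite (le_lt_trans _ xK)// lerDl.
have := lerB_normD x y; lra.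
Qed.

Lemma supported_bounded u M : continuous u -> supported_in_ball u M ->
  exists2 B, 0 <= B & forall x, `|u x| <= B.
Proof.
move=> cu hM.
have /compact_bounded[B [_ hB]] : compact (u @` [set x : 'rV[R]_n | `|x| <= M]).
  apply: continuous_compact; last exact: closed_norm_ball_compact.
  exact: continuous_subspaceT.
exists (Num.max (B + 1) 0); first by rewrite le_max lexx orbT.
move=> x; have [xM|/hM ->] := leP `|x| M; last by rewrite normr0 le_max lexx orbT.
rewrite le_max; apply/orP; left; apply: (hB (B + 1)); first by rewrite ltrDl.
by exists x.
Qed.

End vector_valued.

Lemma MVT_line (f df : 'rV[R]_n -> R) (v : 'rV[R]_n) (x : 'rV[R]_n) (h : R) :
  (forall y, is_derive y v (f : _ -> R^o) (df y)) ->
  exists2 c, `|c| <= `|h| & f (x + h *: v) - f x = h * df (x + c *: v).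
Proof.
move=> dfE; pose g (s : R) := f (x + s *: v).
have dg (s : R) : is_derive s (1 : R) g (df (x + s *: v)).
  exact: (@is_derive_line R _ R^o f x v s).
have cg : continuous g.
  by move=> s; apply/differentiable_continuous/derivable1_diffP; exact: ex_derive.
have g0 : g 0 = f x by rewrite /g scale0r addr0.
have [h0|h0|->] := ltgtP h 0; last first.
- by exists 0; rewrite // scale0r addr0 subrr mul0r.
- have [c] := MVT_segment (ltW h0) (fun s _ => dg s) (continuous_subspaceT cg).
  rewrite in_itv/= => /andP[c0 ch]; rewrite g0 subr0 mulrC => E.
  by exists c => //; rewrite !ger0_norm// ltW.
- have [c] := MVT_segment (ltW h0) (fun s _ => dg s) (continuous_subspaceT cg).
  rewrite in_itv/= => /andP[c0 ch]; rewrite g0 sub0r mulrN mulrC => E.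
  exists c; first by rewrite !ler0_norm ?lerN2// ltW.
  by apply: oppr_inj; rewrite -E opprB.
Qed.

(** By the mean value theorem a difference quotient is a value of the
    derivative nearby, and the derivative is uniformly continuous. Uniformity
    in [x] is what allows differentiation under a convolution integral. *)
Lemma uniform_difference_quotient (f df : 'rV[R]_n -> R) (v : 'rV[R]_n) M :
  (forall y, is_derive y v (f : _ -> R^o) (df y)) ->
  continuous df -> supported_in_ball (df : _ -> R^o) M ->
  forall e, 0 < e -> exists2 d, 0 < d & forall x h, h != 0 -> `|h| < d ->
    `|h^-1 * (f (h *: v + x) - f x) - df x| <= e.
Proof.
move=> dfE cdf hM e e0.
have [d d0 hd] := supported_uniform_continuity (X := R^o) cdf hM e0.
exists (d / (`|v| + 1)); first by rewrite divr_gt0// ltr_wpDl.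
move=> x h h0 hh.
have [c ch E] := MVT_line x h dfE.
rewrite [h *: v + x]addrC E mulrA mulVf// mul1r; apply/ltW/hd.
rewrite normrZ; apply: (@le_lt_trans _ _ (`|h| * (`|v| + 1))).
  by rewrite ler_pM// lerDl.
by rewrite -ltr_pdivlMr// ltr_wpDl.
Qed.

Lemma box_norm_ball (M : R) : 0 <= M ->
  [set x : 'rV[R]_n | `|x| <= M] `<=` box (fun=> `](-(M+1)), (M+1)[%classic).
Proof.
move=> M0 x /= xM i /=; rewrite in_itv/= -ltr_norml.
apply: (@le_lt_trans _ _ M); last by rewrite ltrDl.
apply: le_trans xM; rewrite -[`|x|]/(mx_norm x) mx_normrE.
exact: (le_bigmax _ (fun i : 'I_1 * 'I_n => `|x i.1 i.2|) (ord0, i)).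
Qed.

Lemma measurable_norm_ball (M : R) : measurable [set x : 'rV[R]_n | `|x| <= M].
Proof.
rewrite (_ : mkset _ = (fun x : 'rV[R]_n => `|x|) @^-1` `]-oo, M]); last first.
  by apply/seteqP; split => x /=; rewrite in_itv.
rewrite -[X in measurable X]setTI; apply: continuous_measurable_rV => //.
exact: norm_continuous.
Qed.

Lemma norm_ball_finite (M : R) : (lebesgue_rV n [set x : 'rV[R]_n | (`|x| <= M)%R] < +oo)%E.
Proof.
have [M0|M0] := leP 0 M; last first.
  rewrite (_ : mkset _ = set0) ?measure0// -subset0 => x /=.
  by rewrite leNgt (lt_le_trans M0).
apply: (@le_lt_trans _ _ (lebesgue_rV n (box (fun=> `](-(M+1)), (M+1)[%classic)))).
  apply: le_measure; rewrite ?inE; [exact: measurable_norm_ball| |exact: box_norm_ball].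
  by apply: measurable_box => i; exact: measurable_itv.
by rewrite lebesgue_rV_cube ?ltry// addr_ge0.
Qed.

Lemma supported_integrable (f : 'rV[R]_n -> R) M B : measurable_fun setT f ->
  (forall x, M < `|x| -> f x = 0) -> (forall x, `|f x| <= B) ->
  (lebesgue_rV n).-integrable setT (EFin \o f).
Proof.
move=> mf hM hB; apply/integrableP; split; first exact/measurable_EFinP.
pose K := [set x : 'rV[R]_n | `|x| <= M].
apply: (@le_lt_trans _ _ (\int[lebesgue_rV n]_(x in K) (cst B%:E) x)%E).
  rewrite [leRHS]integral_mkcond; apply: ge0_le_integral => //.
  - by apply: measurableT_comp => //; exact/measurable_EFinP.
  - apply/(measurable_restrictT _ _).1 => //; exact: measurable_norm_ball.
  move=> x _; rewrite patchE; case: ifPn; first by rewrite lee_fin.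
  by rewrite notin_setE/= => /negP; rewrite -ltNge => /hM ->; rewrite normr0.
rewrite integral_cst; last exact: measurable_norm_ball.
rewrite lte_mul_pinfty ?lee_fin ?norm_ball_finite//.
exact: le_trans (hB 0).
Qed.

End test_functions.

(** * Smooth bumps *)

Section flat_functions.
Context {R : realType}.
Implicit Types (t : R) (k : nat).

(** The factors [t^-1 ^+ k] make this family, for varying [k], stable under
    linear combinations of derivatives; [flat 0] is the classical smooth
    function that is flat at the origin. *)
Definition flat k t : R := if 0 < t then t^-1 ^+ k * expR (- t^-1) else 0.

Lemma flat_le0 k t : t <= 0 -> flat k t = 0.
Proof. by rewrite /flat leNgt => /negbTE ->. Qed.

Lemma flat_ge0 k t : 0 <= flat k t.
Proof.
by rewrite /flat; case: ifPn => // t0; rewrite mulr_ge0 ?expR_ge0// exprn_ge0// invr_ge0 ltW.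
Qed.

Lemma flat0_gt0 t : 0 < t -> 0 < flat 0 t.
Proof. by move=> t0; rewrite /flat t0 expr0 mul1r expR_gt0. Qed.

Lemma flat0_le1 t : flat 0 t <= 1.
Proof.
rewrite /flat; case: ifPn => // t0; rewrite expr0 mul1r -expR0 ler_expR.
by rewrite oppr_le0 invr_ge0 ltW.
Qed.

Lemma flatS k t : t * flat k.+1 t = flat k t.
Proof.
rewrite /flat; case: ifPn => t0; last by rewrite mulr0.
by rewrite exprS !mulrA divff ?mul1r// gt_eqF.
Qed.

(** Exponential decay beats every power, with an explicit constant: raising
    [1 + s <= exp s] at [s / m] to the power [m] gives [(s / m) ^ m <= exp s]. *)
Lemma flat_le k t : `|flat k t| <= k.+1%:R ^+ k.+1 * `|t|.
Proof.
rewrite ger0_norm ?flat_ge0//.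
have [t0|t0] := leP t 0; first by rewrite flat_le0// mulr_ge0// exprn_ge0.
rewrite gtr0_norm// -flatS mulrC ler_pM2r// /flat t0.
set m := k.+1; set s := t^-1.
have s0 : 0 < s by rewrite invr_gt0.
have m0 : 0 < m%:R :> R by rewrite ltr0n.
rewrite expRN ler_pdivrMr ?expR_gt0//.
have h : s / m%:R <= expR (s / m%:R).
  by apply: le_trans (expR_ge1Dx _); rewrite lerDr.
have : (s / m%:R) ^+ m <= expR s.
  apply: (@le_trans _ _ (expR (s / m%:R) ^+ m)).
    by rewrite lerXn2r ?nnegrE ?expR_ge0// ltW// divr_gt0.
  by rewrite -expRM_natl mulrCA divff ?mulr1// gt_eqF.
by rewrite expr_div_n ler_pdivrMr ?exprn_gt0// mulrC.
Qed.

Lemma is_derive_flat k t :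
  is_derive t (1 : R) (flat k) (flat k.+2 t - k%:R * flat k.+1 t).
Proof.
have [t0|t0|->] := ltgtP t 0.
- rewrite !flat_le0 ?ltW// mulr0 subrr; apply: cvg_is_derive; apply: cvg_near_cst.
  have e : h *: (1:R) + t @[h --> (0:R)^'] --> t.
    have e : h *: (1:R) + t @[h --> (0:R)^'] --> 0 *: (1:R) + t.
      by apply: cvgD; [apply: cvgZr_tmp; apply: cvg_within_filter; exact: cvg_id|exact: cvg_cst].
    by rewrite scale0r add0r in e.
  have H : \forall h \near (0:R)^', h *: (1:R) + t < 0 by exact: (cvgr_lt t e _ t0).
  near=> h; rewrite !flat_le0 ?ltW ?subrr ?scaler0//.
  by near: h; exact: H.
- pose F (s : R) := s^-1 ^+ k * expR (- s^-1).
  have tn0 : t != 0 by rewrite gt_eqF.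
  have dV : is_derive t (1 : R) (fun s : R => s^-1) (- t ^- 2 *: (1:R)).
    exact: (@is_deriveV R id t 1 1 tn0 (is_derive_id _ _)).
  have dF : is_derive t (1 : R) F (flat k.+2 t - k%:R * flat k.+1 t).
    have h1 := is_deriveX k dV.
    have h2 := @is_derive1_comp R expR (fun s : R => - s^-1) t _ _ (is_derive_expR _)
      (is_deriveN dV).
    have FE : F = ((fun s : R => s^-1) ^+ k) * (expR \o (fun s : R => - s^-1)).
      by apply/funext => s; rewrite /F -[RHS]/(_ * _) exprfctE.
    rewrite FE; apply: is_derive_eq (is_deriveM h1 h2) _.
    rewrite /flat t0 /= -![_ *: _]/(_ * _) !exprfctE /=.
    case: (k) => [|j] /=; rewrite ?exprS ?expr0; field; by [].
  apply: near_eq_is_derive dF.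
  have H : \forall h \near t, 0 < h by exact: (cvgr_gt t cvg_id _ t0).
  by apply: filterS H => h h0; rewrite /F /flat h0.
- rewrite !flat_le0// mulr0 subrr; apply: cvg_is_derive; rewrite flat_le0//.
  have sq : k.+2%:R ^+ k.+2 * `|h| @[h --> (0:R)^'] --> k.+2%:R ^+ k.+2 * `|0 : R|.
    by apply: cvgMl_tmp; apply: cvg_norm; apply: cvg_within_filter; exact: cvg_id.
  rewrite normr0 mulr0 in sq.
  apply/cvgr0Pnorm_lt => e e0.
  have H : \forall h \near (0:R)^', k.+2%:R ^+ k.+2 * `|h| < e.
    by exact: (cvgr_lt (0:R) sq _ e0).
  have H2 : \forall h \near (0:R)^', h != 0.
    exact: nbhs_dnbhs_neq.
  near=> h; have h0 : h != 0 by near: h; exact: H2.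
  rewrite subr0 addr0 -[_ *: 1]/(_ * 1) mulr1.
  have -> : h^-1 *: flat k h = flat k.+1 h.
    by rewrite -flatS -[LHS]/(_ * _) mulrA mulVf// mul1r.
  by apply: (le_lt_trans (flat_le _ _)); near: h; exact: H.
Unshelve. all: by end_near.
Qed.

End flat_functions.

Section smooth_of_flat.
Context {R : realType} {n : nat}.

(** A class of functions of one coordinate that differentiation preserves. *)
Inductive flat_combination (i : 'I_n) (a b : R) : ('rV[R]_n -> R^o) -> Prop :=
| flat_combination_base k c :
    flat_combination i a b (fun x => c * flat k (a * x ord0 i + b))
| flat_combination_add u f : flat_combination i a b u ->
    flat_combination i a b f -> flat_combination i a b (fun x => u x + f x).

Lemma is_derive_flat_coord (i j : 'I_n) (a b : R) k (x : 'rV[R]_n) :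
  is_derive x (delta_mx 0 j) (fun y : 'rV[R]_n => flat k (a * y ord0 i + b) : R^o)
   (a * (i == j)%:R * (flat k.+2 (a * x ord0 i + b) - k%:R * flat k.+1 (a * x ord0 i + b))).
Proof.
apply: is_derive_of_line.
set d := a * (i == j)%:R; set c := a * x ord0 i + b.
have -> : (fun s : R => flat k (a * (x + s *: delta_mx 0 j) ord0 i + b) : R^o) =
    flat k \o ((d \*: (@id R)) + cst c).
  apply/funext => s; rewrite /= -[((d \*: (@id R)) + cst c) s]/(d * s + c) /d /c.
  by congr flat; rewrite !mxE /=; ring.
have h1 : is_derive (0:R) (1:R) ((d \*: (@id R)) + cst c) (d *: (1:R) + 0).
  exact: is_deriveD (is_deriveZ d (is_derive_id _ _)) (is_derive_cst _ _ _).
have E : ((d \*: (@id R)) + cst c) 0 = c by rewrite -[LHS]/(d * 0 + c) mulr0 add0r.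
have h2 := is_derive_flat k c; rewrite -E in h2.
apply: is_derive_eq (is_derive1_comp h2 h1) _.
by rewrite E addr0 -[d *: 1]/(d * 1) mulr1 mulrC.
Qed.

Lemma smooth_flat_coord (i : 'I_n) (a b : R) :
  smooth (fun x : 'rV[R]_n => flat 0 (a * x ord0 i + b) : R^o).
Proof.
apply: (@smooth_class _ _ _ (flat_combination i a b)); last first.
  have := flat_combination_base i a b 0 1.
  have E : (fun x : 'rV[R]_n => 1 * flat 0 (a * x ord0 i + b)) =
      (fun x => flat 0 (a * x ord0 i + b)) by apply/funext => x; rewrite mul1r.
  by rewrite E.
have dbase k c j (x : 'rV[R]_n) : is_derive x (delta_mx 0 j)
    (fun y : 'rV[R]_n => c * flat k (a * y ord0 i + b) : R^o)
    (c * (a * (i == j)%:R) * flat k.+2 (a * x ord0 i + b) +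
     - (c * (a * (i == j)%:R) * k%:R) * flat k.+1 (a * x ord0 i + b)).
  apply: is_derive_eq (is_deriveZ c (is_derive_flat_coord i j a b k x)) _.
  by rewrite -[LHS]/(_ * _); ring.
move=> u; elim=> {u} [k c|u f _ [cu hu] _ [cf hf]]; split.
- move=> x.
  have cl : (fun y : 'rV[R]_n => a * y ord0 i + b) y @[y --> x] --> a * x ord0 i + b.
    have cc : {for x, continuous (fun y : 'rV[R]_n => y ord0 i)} by exact: coord_continuous.
    exact: (cvgD (cvgMl_tmp cc) (cvg_cst _)).
  have cfl : {for a * x ord0 i + b, continuous (flat k)}.
    by apply/differentiable_continuous/derivable1_diffP; have [] := is_derive_flat k (a * x ord0 i + b).
  exact: (cvgMl_tmp (continuous_cvg _ cfl cl)).
- move=> j; eexists; last by move=> x; exact: dbase.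
  exact: flat_combination_add (flat_combination_base _ _ _ _ _) (flat_combination_base _ _ _ _ _).
- by move=> x; exact: (cvgD (cu x) (cf x)).
- move=> j; have [du Pdu hdu] := hu j; have [df Pdf hdf] := hf j.
  exists (fun x => du x + df x); first exact: flat_combination_add.
  by move=> x; exact: is_deriveD.
Qed.

Lemma smooth_prod (I : Type) (r : seq I) (F : I -> 'rV[R]_n -> R^o) :
  (forall k, smooth (F k)) -> smooth (fun x => \prod_(k <- r) F k x : R^o).
Proof.
move=> sF; elim: r => [|k r IH].
  by rewrite (_ : (fun x => _) = fun=> 1); [exact: smooth_cst|apply/funext => x; rewrite big_nil].
rewrite (_ : (fun x => _) = fun x => F k x *: (\prod_(j <- r) F j x : R^o)).
  exact: (smooth_scale (sF k) IH).
by apply/funext => x; rewrite big_cons.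
Qed.

Definition flat_bump (x : 'rV[R]_n) : R^o :=
  \prod_(i < n) (flat 0 (1 * x ord0 i + 1) * flat 0 (- 1 * x ord0 i + 1)).

Lemma smooth_flat_bump : smooth flat_bump.
Proof.
apply: smooth_prod => i.
exact: (smooth_scale (smooth_flat_coord i 1 1) (smooth_flat_coord i (- 1) 1)).
Qed.

Lemma flat_bump_ge0 x : 0 <= flat_bump x.
Proof. by apply: prodr_ge0 => i _; rewrite mulr_ge0// flat_ge0. Qed.

Lemma flat_bump_support : supported_in_ball flat_bump 1.
Proof.
move=> x; rewrite -[`|x|]/(mx_norm x) => x1.
have : mx_norm x != 0 by rewrite gt_eqF// (lt_trans _ x1).
move=> /mx_norm_neq0[[i j] /= E]; move: x1; rewrite E (ord1 i) => x1.
rewrite /flat_bump (bigD1 j)//=.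
have [xj|xj] := leP 0 (x ord0 j).
  rewrite [flat 0 (- 1 * _ + _)]flat_le0 ?mulr0 ?mul0r//.
  by move: x1; rewrite ger0_norm//; lra.
rewrite [flat 0 (1 * _ + _)]flat_le0 ?mul0r//.
by move: x1; rewrite ltr0_norm//; lra.
Qed.

Lemma flat_bump0_gt0 : 0 < flat_bump 0.
Proof. by apply: prodr_gt0 => i _; rewrite mulr_gt0// flat0_gt0// mxE mulr0 add0r. Qed.

Lemma integrable_flat_bump : (lebesgue_rV n).-integrable setT (EFin \o flat_bump).
Proof.
have cb := smooth_continuous smooth_flat_bump.
have [B _ hB] := supported_bounded cb flat_bump_support.
apply: (supported_integrable _ flat_bump_support hB).
exact: continuous_measurable_rV.
Qed.

Lemma integral_flat_bump_gt0 : 0 < \int[lebesgue_rV n]_x flat_bump x.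
Proof.
have cb := smooth_continuous smooth_flat_bump.
pose c := flat_bump 0 / 2.
have c0 : 0 < c by rewrite divr_gt0// flat_bump0_gt0.
have /nbhs_ballP[d /= d0 hd] : \forall x \near (0 : 'rV[R]_n), c < flat_bump x.
  apply: (cvgr_gt (flat_bump 0) (cb 0)).
  by rewrite /c ltr_pdivrMr// ltr_pMr ?flat_bump0_gt0// ltr1n.
pose Q := box (fun _ : 'I_n => `](-d), d[%classic).
have mQ : measurable Q by apply: measurable_box => i; exact: measurable_itv.
rewrite -lte_fin fineK; last exact: integrable_fin_num integrable_flat_bump.
apply: (@lt_le_trans _ _ (\int[lebesgue_rV n]_(x in Q) (cst c%:E) x)%E).
  have QE : lebesgue_rV n Q = ((2 * d) ^+ n)%:E by exact: lebesgue_rV_cube (ltW d0).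
  rewrite integral_cst// [X in (_ < _ * X)%E]QE -EFinM lte_fin mulr_gt0//.
  by rewrite exprn_gt0// mulr_gt0.
apply: (@le_trans _ _ (\int[lebesgue_rV n]_(x in Q) (flat_bump x)%:E)%E).
  apply: ge0_le_integral => //.
  - by move=> x _; rewrite lee_fin ltW.
  - by apply/measurable_funTS/measurable_EFinP; exact: continuous_measurable_rV.
  - move=> x Qx; rewrite lee_fin ltW//; apply: hd; split => // i j.
    by rewrite (ord1 i) mxE /ball/= sub0r normrN ltr_norml; have := Qx j; rewrite /= in_itv.
apply: ge0_subset_integral => //.
  by apply/measurable_EFinP; exact: continuous_measurable_rV.
by move=> x _; rewrite lee_fin flat_bump_ge0.
Qed.

End smooth_of_flat.

(** * Convolution with an integrable kernel *)

Section convolution_scalar.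
Context {R : realType} {n : nat}.
Local Notation leb := (@lebesgue_rV R n).
Implicit Types (k f g : 'rV[R]_n -> R).

Definition sconv k f : 'rV[R]_n -> R := fun x => \int[leb]_y (k y * f (x - y)).

Lemma integrable_mul_bounded d (T : measurableType d) (m : {measure set T -> \bar R})
    (D : set T) (k f : T -> R) B : measurable D ->
  m.-integrable D (EFin \o k) -> measurable_fun D f ->
  (forall x, `|f x| <= B) -> m.-integrable D (EFin \o (fun x => k x * f x)).
Proof.
move=> mD ik mf hB.
have mk : measurable_fun D k by exact/measurable_EFinP/(measurable_int _ ik).
apply: (@le_integrable _ _ _ _ _ _ _ (fun x => B%:E * (EFin \o k) x)%E) => //.
- by apply/measurable_EFinP; exact: measurable_funM.
- move=> x _ /=; rewrite lee_fin !normrM mulrC ler_wpM2r//.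
  exact: le_trans (hB x) (ler_norm _).
- exact: integrableZl.
Qed.

Lemma measurable_subl (x : 'rV[R]_n) : measurable_fun setT (fun y : 'rV[R]_n => x - y).
Proof.
apply: measurable_fun_rV => i; under eq_fun do rewrite !mxE.
by apply: measurable_funB => //; exact: measurable_rV_coord.
Qed.

Lemma lebesgue_rV_subl (x : 'rV[R]_n) E : measurable E ->
  leb ((fun y : 'rV[R]_n => x - y) @^-1` E) = leb E.
Proof.
move=> mE; rewrite -(lebesgue_rV_translate x mE).
have mE' : measurable ((fun y : 'rV[R]_n => y + x) @^-1` E).
  by rewrite -[X in measurable X]setTI; exact: measurable_addrV.
rewrite -(lebesgue_rV_opp mE'); congr (leb _); apply/seteqP.
by split => y /=; rewrite addrC.
Qed.

Lemma integral_subl (f : 'rV[R]_n -> \bar R) (x : 'rV[R]_n) : measurable_fun setT f ->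
  (\int[leb]_y f (x - y)%R = \int[leb]_y f y)%E.
Proof.
by move=> mf; rewrite -(integral_image (measurable_subl x) (lebesgue_rV_subl x) mf).
Qed.

Lemma integrable_conv_integrand k f B x : leb.-integrable setT (EFin \o k) ->
  measurable_fun setT f -> (forall x, `|f x| <= B) ->
  leb.-integrable setT (EFin \o (fun y => k y * f (x - y))).
Proof.
move=> ik mf hB; apply: integrable_mul_bounded ik _ _ => //.
by apply: measurableT_comp => //; exact: measurable_subl.
Qed.

Lemma norm_integral_mul_bounded k f B : leb.-integrable setT (EFin \o k) ->
  measurable_fun setT f -> (forall x, `|f x| <= B) ->
  `|\int[leb]_y (k y * f y)| <= B * \int[leb]_y `|k y|.
Proof.
move=> ik mf hB.
have ikf : leb.-integrable setT (EFin \o (fun x => k x * f x)).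
  exact: integrable_mul_bounded hB.
have ink : leb.-integrable setT (EFin \o (fun x => `|k x|)) by exact: integrable_norm.
apply: (le_trans (le_normr_Rintegral _ ikf)) => //.
rewrite -RintegralZl//; apply: le_Rintegral => //.
- exact: (integrable_norm ikf).
- exact: (integrableZl measurableT B ink).
- by move=> x _; rewrite normrM mulrC ler_wpM2r.
Qed.

Lemma sconv_bound k f B x : leb.-integrable setT (EFin \o k) ->
  measurable_fun setT f -> (forall x, `|f x| <= B) ->
  `|sconv k f x| <= B * \int[leb]_y `|k y|.
Proof.
move=> ik mf hB; apply: norm_integral_mul_bounded => //.
by apply: measurableT_comp => //; exact: measurable_subl.
Qed.

Lemma sconv_lin k (a b : R) f g Bf Bg : leb.-integrable setT (EFin \o k) ->
  measurable_fun setT f -> (forall x, `|f x| <= Bf) ->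
  measurable_fun setT g -> (forall x, `|g x| <= Bg) ->
  sconv k (fun x => a * f x + b * g x) = fun x => a * sconv k f x + b * sconv k g x.
Proof.
move=> ik mf hf mg hg; apply/funext => x; rewrite /sconv.
have i1 := integrable_conv_integrand x ik mf hf.
have i2 := integrable_conv_integrand x ik mg hg.
rewrite -!RintegralZl// -RintegralD//.
- by apply: eq_Rintegral => y _; ring.
- exact: (integrableZl measurableT a i1).
- exact: (integrableZl measurableT b i2).
Qed.

Lemma sconv_continuous k f M : leb.-integrable setT (EFin \o k) ->
  continuous f -> supported_in_ball (f : _ -> R^o) M -> continuous (sconv k f).
Proof.
move=> ik cf hM x.
suff H e : 0 < e -> \forall z \near x, `|sconv k f x - sconv k f z| <= e.
  by have /cvgrPdist_le := H.
move=> e0.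
have mf := continuous_measurable_rV cf.
have [B B0 hB] := supported_bounded (X := R^o) cf hM.
set K := \int[leb]_y `|k y|.
have K0 : 0 <= K by exact: Rintegral_ge0.
have e1 : 0 < e / (K + 1) by rewrite divr_gt0// ltr_wpDl.
have [d d0 hd] := supported_uniform_continuity (X := R^o) cf hM e1.
have H : \forall z \near x, `|z - x| < d.
  by apply/nbhs_ballP; exists d => // z; rewrite -ball_normE/= distrC.
apply: filterS H => z zx.
rewrite distrC /sconv -RintegralB//=; last 2 first.
- exact: (integrable_conv_integrand z ik mf hB).
- exact: (integrable_conv_integrand x ik mf hB).
rewrite (@eq_Rintegral _ _ _ _ _ (fun y => k y * (f (z - y) - f (x - y)))); last first.
  by move=> y _; rewrite mulrBr.
apply: (@le_trans _ _ (e / (K + 1) * K)).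
  apply: norm_integral_mul_bounded => //.
    by apply: measurable_funB; apply: measurableT_comp => //; exact: measurable_subl.
  move=> y; apply/ltW; have -> : z - y = (x - y) + (z - x).
    by rewrite [RHS]addrC addrA subrK.
  exact: hd.
rewrite -mulrA ler_piMr ?(ltW e0)// mulrC ler_pdivrMr ?mul1r ?lerDl//.
by rewrite ltr_wpDl.
Qed.

(** The difference quotients of [f] converge uniformly, and the kernel is
    integrable. *)
Lemma is_derive_sconv k f df v M : leb.-integrable setT (EFin \o k) ->
  continuous f -> (forall y, is_derive y v (f : _ -> R^o) (df y)) ->
  continuous df -> supported_in_ball (f : _ -> R^o) M ->
  supported_in_ball (df : _ -> R^o) M ->
  forall x, is_derive x v (sconv k f : _ -> R^o) (sconv k df x).
Proof.
move=> ik cf dfE cdf hf hdf x; apply: cvg_is_derive; apply/cvgrPdist_le => e e0.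
have mf := continuous_measurable_rV cf.
have mdf := continuous_measurable_rV cdf.
have [B B0 hB] := supported_bounded (X := R^o) cf hf.
have [B' B'0 hB'] := supported_bounded (X := R^o) cdf hdf.
set K := \int[leb]_y `|k y|.
have K0 : 0 <= K by exact: Rintegral_ge0.
have e1 : 0 < e / (K + 1) by rewrite divr_gt0// ltr_wpDl.
have [d d0 hd] := uniform_difference_quotient dfE cdf hdf e1.
have H1 : \forall h \near (0:R)^', h != 0 by exact: nbhs_dnbhs_neq.
have H2 : \forall h \near (0:R)^', `|h| < d.
  exact: (@dnbhs0_lt R R^o d d0).
near=> h.
have h0 : h != 0 by near: h; exact: H1.
have hd' : `|h| < d by near: h; exact: H2.
rewrite distrC.
have ix := integrable_conv_integrand x ik mf hB.
have ihx := integrable_conv_integrand (h *: v + x) ik mf hB.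
have idf := integrable_conv_integrand x ik mdf hB'.
have -> : h^-1 *: (sconv k f (h *: v + x) - sconv k f x) - sconv k df x =
    \int[leb]_y (k y * (h^-1 * (f (h *: v + (x - y)) - f (x - y)) - df (x - y))).
  rewrite -[_ *: _]/(_ * _) /sconv -RintegralB// -RintegralZl//; last first.
    exact: (integrableB measurableT ihx ix).
  rewrite -RintegralB//; last first.
    exact: (integrableZl measurableT _ (integrableB measurableT ihx ix)).
  by apply: eq_Rintegral => y _; rewrite addrA; ring.
apply: (@le_trans _ _ (e / (K + 1) * K)).
  apply: norm_integral_mul_bounded => //.
    apply: measurable_funB; last by apply: measurableT_comp => //; exact: measurable_subl.
    apply: measurable_funM => //; apply: measurable_funB.
      rewrite (_ : (fun y => _) = fun y => f ((h *: v + x) - y)); last first.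
        by apply/funext => y; rewrite addrA.
      by apply: measurableT_comp => //; exact: measurable_subl.
    by apply: measurableT_comp => //; exact: measurable_subl.
  by move=> y; apply: hd.
rewrite -mulrA ler_piMr ?(ltW e0)// mulrC ler_pdivrMr ?mul1r ?lerDl//.
by rewrite ltr_wpDl.
Unshelve. all: by end_near.
Qed.

Lemma partial_sconv k (f : 'rV[R]_n -> R^o) i : leb.-integrable setT (EFin \o k) ->
  test_function f -> partial i (sconv k f : _ -> R^o) = sconv k (partial i f).
Proof.
move=> ik tf; have [sf _] := tf; have [M _ hM] := test_function_support tf.
apply: partialE; apply: (is_derive_sconv (M := M)) => //.
- exact: smooth_continuous.
- by move=> y; exact: smooth_is_derive.
- exact/smooth_continuous/smooth_partial.
- exact: supported_in_ball_partial.
Qed.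

Lemma iter_partial_sconv k (f : 'rV[R]_n -> R^o) s : leb.-integrable setT (EFin \o k) ->
  test_function f -> iter_partial s (sconv k f : _ -> R^o) = sconv k (iter_partial s f).
Proof.
by move=> ik tf; elim: s => //= i s ->; rewrite partial_sconv//; exact: test_function_iter.
Qed.

Lemma smooth_sconv k (f : 'rV[R]_n -> R^o) : leb.-integrable setT (EFin \o k) ->
  test_function f -> smooth (sconv k f : _ -> R^o).
Proof.
move=> ik tf; apply: (@smooth_class _ _ _ (fun u => exists2 f : 'rV[R]_n -> R^o,
  test_function f & u = sconv k f)); last by exists f.
move=> _ [{tf}{}f tf ->]; have [sf _] := tf; have [M _ hM] := test_function_support tf.
split; first exact: (sconv_continuous ik (smooth_continuous sf) hM).
move=> i; exists (sconv k (partial i f)).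
  exact: (ex_intro2 _ _ (partial i f) (test_function_partial i tf) erefl).
apply: (is_derive_sconv (M := M)) => //.
- exact: smooth_continuous.
- by move=> y; exact: smooth_is_derive.
- exact/smooth_continuous/smooth_partial.
- exact: supported_in_ball_partial.
Qed.

Lemma sconv_support k f N M : (forall x, N < `|x| -> k x = 0) ->
  (forall x, M < `|x| -> f x = 0) -> forall x, N + M < `|x| -> sconv k f x = 0.
Proof.
move=> hk hf x xNM; rewrite /sconv (@eq_Rintegral _ _ _ _ _ (cst 0)); last first.
  move=> y _ /=; have [yN|/hk ->] := leP `|y| N; last by rewrite mul0r.
  rewrite hf ?mulr0//; have := lerB_dist x y; lra.
by rewrite /Rintegral integral0.
Qed.

End convolution_scalar.

(** * Integral inequalities for convolutions *)

Lemma integrable_measurable_real d (T : measurableType d) (R : realType)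
    (m : {measure set T -> \bar R}) (D : set T) (f : T -> R) :
  m.-integrable D (EFin \o f) -> measurable_fun D f.
Proof. by move=> /integrableP[] /measurable_EFinP. Qed.

Section convolution_integral.
Context {R : realType} {n : nat}.
Local Notation leb := (@lebesgue_rV R n).
Implicit Types (k f g : 'rV[R]_n -> R).

Lemma measurable_sub_pair : measurable_fun setT
  (fun z : 'rV[R]_n * 'rV[R]_n => z.1 - z.2).
Proof.
apply: measurable_fun_rV => i; under eq_fun do rewrite !mxE.
by apply: measurable_funB; apply: (measurableT_comp (measurable_rV_coord i));
  [exact: measurable_fst|exact: measurable_snd].
Qed.

Lemma measurable_conv_pair k f : measurable_fun setT k -> measurable_fun setT f ->
  measurable_fun setT (fun z : 'rV[R]_n * 'rV[R]_n => k z.2 * f (z.1 - z.2)).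
Proof.
move=> mk mf; apply: measurable_funM.
  exact: (measurableT_comp mk measurable_snd).
exact: (measurableT_comp mf measurable_sub_pair).
Qed.

Lemma tonelli_conv k f : measurable_fun setT k -> measurable_fun setT f ->
  (forall x, 0 <= k x) -> (forall x, 0 <= f x) ->
  (\int[leb]_x \int[leb]_y (k y * f (x - y))%:E =
   (\int[leb]_y (k y)%:E) * (\int[leb]_x (f x)%:E))%E.
Proof.
move=> mk mf k0 f0.
have mkf := measurable_conv_pair mk mf.
pose F (z : 'rV[R]_n * 'rV[R]_n) := (k z.2 * f (z.1 - z.2))%:E.
have mF : measurable_fun setT F by exact/measurable_EFinP.
have F0 z : (0 <= F z)%E by rewrite lee_fin mulr_ge0.
have h := @fubini_tonelli _ _ _ _ R leb leb F mF F0.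
transitivity (\int[leb]_y \int[leb]_x F (x, y))%E; first exact: h.
transitivity (\int[leb]_y ((k y)%:E * \int[leb]_x (f x)%:E))%E.
  apply: eq_integral => y _.
  have mfy : measurable_fun setT (fun x : 'rV[R]_n => (f (x - y))%:E).
    by apply/measurable_EFinP; exact: (measurableT_comp mf (measurable_addrV (- y))).
  have tr : (\int[leb]_x (f (x - y))%:E = \int[leb]_x (f x)%:E)%E.
    exact: (integral_translate (- y) ((measurable_EFinP _ _).2 mf)).
  transitivity ((k y)%:E * \int[leb]_x (f (x - y))%:E)%E; last by rewrite tr.
  transitivity (\int[leb]_x ((k y)%:E * (f (x - y)%R)%:E))%E.
    by apply: eq_integral => x _; rewrite -EFinM.
  have fy0 (x : 'rV[R]_n) : setT x -> (0 <= (f (x - y))%:E)%E by rewrite lee_fin.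
  exact: (@ge0_integralZl _ _ _ leb setT measurableT _ mfy (k y)%:E fy0 (k0 y)).
have c0 : (0 <= \int[leb]_x (f x)%:E)%E by apply: integral_ge0 => x _; rewrite lee_fin.
have mkE : measurable_fun setT (EFin \o k) by exact/measurable_EFinP.
have kE0 (y : 'rV[R]_n) : setT y -> (0 <= (k y)%:E)%E by rewrite lee_fin.
transitivity (\int[leb]_y ((\int[leb]_x (f x)%:E) * (EFin \o k) y))%E.
  by apply: eq_integral => y _; rewrite muleC.
by rewrite (@ge0_integralZl _ _ _ leb setT measurableT _ mkE _ kE0 c0) muleC.
Qed.

Lemma integrable_tonelli_conv k f : leb.-integrable setT (EFin \o k) ->
  leb.-integrable setT (EFin \o f) ->
  (\int[leb]_x \int[leb]_y `|(k y * f (x - y))%:E| =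
   (\int[leb]_y `|k y|)%:E * (\int[leb]_x `|f x|)%:E)%E.
Proof.
move=> ik jf.
have mk : measurable_fun setT k by exact: integrable_measurable_real ik.
have mf : measurable_fun setT f by exact: integrable_measurable_real jf.
transitivity (\int[leb]_x \int[leb]_y (`|k y| * `|f (x - y)|)%:E)%E.
  by apply: eq_integral => x _; apply: eq_integral => y _; rewrite /= normrM.
rewrite (@tonelli_conv (fun y => `|k y|) (fun y => `|f y|))//; last 2 first.
- exact: measurableT_comp.
- exact: measurableT_comp.
by congr (_ * _)%E; rewrite fineK//; apply: integrable_fin_num => //; exact: integrable_norm.
Qed.

(** By Tonelli's theorem for the double integral, whose inner integral does
    not change under translation. *)
Lemma integrable_sconv k f B : leb.-integrable setT (EFin \o k) ->
  leb.-integrable setT (EFin \o f) -> measurable_fun setT (sconv k f) ->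
  (forall x, `|f x| <= B) ->
  leb.-integrable setT (EFin \o sconv k f) /\
  \int[leb]_x `|sconv k f x| <= (\int[leb]_y `|k y|) * (\int[leb]_x `|f x|).
Proof.
move=> ik jf mkf hB.
have mf : measurable_fun setT f by exact: integrable_measurable_real jf.
have le : (\int[leb]_x `|(sconv k f x)%:E| <=
    (\int[leb]_y `|k y|)%:E * (\int[leb]_x `|f x|)%:E)%E.
  rewrite -integrable_tonelli_conv//; apply: ge0_le_integral => //.
  - by apply: measurableT_comp => //; exact/measurable_EFinP.
  - have mk : measurable_fun setT k by exact: integrable_measurable_real ik.
    have := @measurable_fun_fubini_tonelli_F _ _ _ _ R leb
      (fun z : 'rV[R]_n * 'rV[R]_n => `|(k z.2 * f (z.1 - z.2))%:E|)%E.
    apply => //; apply: measurableT_comp => //; apply/measurable_EFinP.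
    exact: measurable_conv_pair.
  move=> x _; rewrite /sconv.
  have ix := integrable_conv_integrand x ik mf hB.
  have -> : (`|(\int[leb]_y (k y * f (x - y)))%:E| = `|\int[leb]_y (k y * f (x - y)%R)%:E|)%E.
    by rewrite fineK//; exact: integrable_fin_num.
  exact: le_abse_integral (measurable_int _ ix).
have ii : leb.-integrable setT (EFin \o sconv k f).
  apply/integrableP; split; first exact/measurable_EFinP.
  by apply: le_lt_trans le _; rewrite -EFinM ltry.
split=> //; rewrite -lee_fin EFinM fineK//.
by apply: integrable_fin_num => //; exact: (integrable_norm ii).
Qed.

(** By Fubini's theorem and the symmetry of the kernel. *)
Lemma integral_mul_sconv k f g Bf Bg : leb.-integrable setT (EFin \o k) ->
  (forall y, k (- y) = k y) ->
  leb.-integrable setT (EFin \o f) -> (forall x, `|f x| <= Bf) ->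
  measurable_fun setT g -> (forall x, `|g x| <= Bg) ->
  \int[leb]_x (g x * sconv k f x) = \int[leb]_x (sconv k g x * f x).
Proof.
move=> ik ke jf hf mg hg.
have mk : measurable_fun setT k by exact: integrable_measurable_real ik.
have mf : measurable_fun setT f by exact: integrable_measurable_real jf.
pose F (z : 'rV[R]_n * 'rV[R]_n) := g z.1 * (k z.2 * f (z.1 - z.2)).
have mF : measurable_fun setT F.
  apply: measurable_funM; first exact: (measurableT_comp mg measurable_fst).
  exact: measurable_conv_pair.
have iF : (leb \x leb)%E.-integrable setT (EFin \o F).
  apply/integrable12ltyP; first exact/measurable_EFinP.
  apply: (@le_lt_trans _ _ (\int[leb]_x (Bg%:E * \int[leb]_y `|(k y * f (x - y))%:E|))%E).
    apply: ge0_le_integral => //.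
    - by move=> x _; apply: integral_ge0.
    - have := @measurable_fun_fubini_tonelli_F _ _ _ _ R leb (fun z => `|(F z)%:E|)%E.
      by apply => //; apply: measurableT_comp => //; apply/measurable_EFinP.
    - apply: measurable_funeM.
      have := @measurable_fun_fubini_tonelli_F _ _ _ _ R leb
        (fun z : 'rV[R]_n * 'rV[R]_n => `|(k z.2 * f (z.1 - z.2))%:E|)%E.
      apply => //; apply: measurableT_comp => //; apply/measurable_EFinP.
      exact: measurable_conv_pair.
    move=> x _; have Bg0 : 0 <= Bg by exact: le_trans (hg x).
    have mkf : measurable_fun setT (fun y => k y * f (x - y)).
      by apply: measurable_funM => //; apply: (measurableT_comp mf); exact: measurable_subl.
    have mx : measurable_fun setT (fun y => `|(k y * f (x - y))%:E|)%E.
      by apply: measurableT_comp => //; exact/measurable_EFinP.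
    rewrite -ge0_integralZl//; apply: ge0_le_integral => //.
    + apply: measurableT_comp => //; apply/measurable_EFinP.
      exact: (measurable_funM (measurable_cst (g x)) mkf).
    + exact: measurable_funeM.
    move=> y _; rewrite /F /= -EFinM lee_fin normrM ler_wpM2r//.
  have Bg0 : 0 <= Bg by exact: le_trans (hg 0).
  rewrite ge0_integralZl//; last 2 first.
  - have := @measurable_fun_fubini_tonelli_F _ _ _ _ R leb
        (fun z : 'rV[R]_n * 'rV[R]_n => `|(k z.2 * f (z.1 - z.2))%:E|)%E.
    apply => //; apply: measurableT_comp => //; apply/measurable_EFinP.
    exact: measurable_conv_pair.
  - by move=> x _; apply: integral_ge0.
  by rewrite integrable_tonelli_conv// -!EFinM ltry.
have := Fubini iF.
have -> : (\int[leb]_x \int[leb]_y (EFin \o F) (x, y) =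
    \int[leb]_x (g x * sconv k f x)%:E)%E.
  apply: eq_integral => x _; rewrite /F /=.
  have ix := integrable_conv_integrand x ik mf hf.
  under eq_integral do rewrite EFinM.
  rewrite integralZl// EFinM; congr (_ * _)%E.
  by rewrite /sconv fineK//; exact: integrable_fin_num.
(* For fixed [y] shift the outer variable by [y]; the shifted product then has
   to be integrated in [y] first, which is Fubini for the transposed kernel. *)
pose G (z : 'rV[R]_n * 'rV[R]_n) := f z.1 * (k z.2 * g (z.1 - z.2)).
have mG : measurable_fun setT G.
  apply: measurable_funM; first exact: (measurableT_comp mf measurable_fst).
  exact: measurable_conv_pair.
have iG : (leb \x leb)%E.-integrable setT (EFin \o G).
  apply/integrable12ltyP; first exact/measurable_EFinP.
  have Bg0 : 0 <= Bg by exact: le_trans (hg 0).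
  apply: (@le_lt_trans _ _ (\int[leb]_x (`|f x|%:E * (Bg * \int[leb]_y `|k y|)%:E))%E).
    apply: ge0_le_integral => //.
    - by move=> x _; apply: integral_ge0.
    - have := @measurable_fun_fubini_tonelli_F _ _ _ _ R leb (fun z => `|(G z)%:E|)%E.
      by apply => //; apply: measurableT_comp => //; apply/measurable_EFinP.
    - apply: emeasurable_funM => //; apply/measurable_EFinP; exact: measurableT_comp.
    move=> x _.
    have -> : (Bg * \int[leb]_y `|k y|)%:E = (\int[leb]_y (Bg * `|k y|)%:E)%E.
      under eq_integral do rewrite EFinM.
      rewrite ge0_integralZl//; last first.
        by apply/measurable_EFinP; exact: measurableT_comp.
      by rewrite EFinM fineK//; apply: integrable_fin_num => //; exact: (integrable_norm ik).
    have mBk : measurable_fun setT (fun y => (Bg * `|k y|)%:E).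
      by apply/measurable_EFinP; apply: measurable_funM => //; exact: measurableT_comp.
    have mkg : measurable_fun setT (fun y => k y * g (x - y)).
      by apply: measurable_funM => //; apply: (measurableT_comp mg); exact: measurable_subl.
    rewrite -ge0_integralZl//; last by move=> y _; rewrite lee_fin mulr_ge0.
    apply: ge0_le_integral => //.
    + apply: measurableT_comp => //; apply/measurable_EFinP.
      exact: (measurable_funM (measurable_cst (f x)) mkg).
    + exact: measurable_funeM.
    by move=> y _; rewrite /G /= -EFinM lee_fin !normrM ler_wpM2l// mulrC ler_wpM2r.
  have mnf : measurable_fun setT (fun x => `|f x|%:E).
    by apply/measurable_EFinP; exact: measurableT_comp.
  have C0 : (0 <= (Bg * \int[leb]_y `|k y|)%:E)%E.
    by rewrite lee_fin mulr_ge0// Rintegral_ge0.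
  under eq_integral do rewrite muleC.
  rewrite ge0_integralZl//.
  rewrite lte_mul_pinfty ?lee_fin ?mulr_ge0 ?Rintegral_ge0//.
  by have [] := integrableP _ _ _ jf.
have -> : (\int[leb]_y \int[leb]_x (EFin \o F) (x, y) =
    \int[leb]_y \int[leb]_x (EFin \o G) (x, y))%E.
  rewrite -(integral_reflect (f := fun y => \int[leb]_x (EFin \o G) (x, y))%E); last first.
    exact: (measurable_fubini_G iG).
  apply: eq_integral => y _; rewrite /F /G /=.
  rewrite -(integral_translate (f := fun x => (g x * (k y * f (x - y)))%:E) y); last first.
    apply/measurable_EFinP; apply: measurable_funM => //; apply: measurable_funM => //.
    by apply: (measurableT_comp mf); exact: measurable_addrV.
  by apply: eq_integral => x _; rewrite addrK ke opprK; congr EFin; ring.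
rewrite -(Fubini iG) => E.
rewrite /Rintegral E; congr fine.
apply: eq_integral => x _; rewrite /G /=.
have ix := integrable_conv_integrand x ik mg hg.
under eq_integral do rewrite EFinM.
rewrite integralZl// muleC EFinM; congr (_ * _)%E.
by rewrite /sconv fineK//; exact: integrable_fin_num.
Qed.

Lemma integrable_conv_powR k f B q x : 1 <= q -> leb.-integrable setT (EFin \o k) ->
  measurable_fun setT f -> (forall y, `|f y| <= B) ->
  leb.-integrable setT (EFin \o (fun y => k y * `|f (x - y)| `^ q)).
Proof.
move=> q1 ik mf hf.
have q0 : 0 < q by exact: lt_le_trans q1.
have B0 : 0 <= B by exact: le_trans (hf 0).
have mfx : measurable_fun setT (fun y : 'rV[R]_n => f (x - y)).
  by apply: (measurableT_comp mf); exact: measurable_subl.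
have mq : measurable_fun setT (fun y : 'rV[R]_n => `|f (x - y)| `^ q).
  exact: (measurableT_comp (measurable_powR q) (measurableT_comp (@normr_measurable R setT) mfx)).
apply: (integrable_mul_bounded _ ik mq (B := B `^ q)) => // y.
by rewrite ger0_norm ?powR_ge0// ge0_ler_powR ?nnegrE// ltW.
Qed.

(** Jensen's inequality in the form of Young's inequality for numbers:
    [s ^ q] is below its tangent line at any other point, and integrating the
    tangent line at [s = k * f x] against [k] leaves the constant [1]. *)
Lemma powR_sconv_le k f B q x : 1 <= q -> leb.-integrable setT (EFin \o k) ->
  (forall y, 0 <= k y) -> \int[leb]_y k y <= 1 ->
  measurable_fun setT f -> (forall y, `|f y| <= B) ->
  `|sconv k f x| `^ q <= \int[leb]_y (k y * `|f (x - y)| `^ q).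
Proof.
move=> q1 ik k0 k1 mf hf.
have q0 : 0 < q by exact: lt_le_trans q1.
have B0 : 0 <= B by exact: le_trans (hf 0).
set s := `|sconv k f x|.
have mfx : measurable_fun setT (fun y : 'rV[R]_n => f (x - y)).
  by apply: (measurableT_comp mf); exact: measurable_subl.
have mnf : measurable_fun setT (fun y : 'rV[R]_n => `|f (x - y)|) by exact: measurableT_comp.
have inf1 : leb.-integrable setT (EFin \o (fun y => k y * `|f (x - y)|)).
  by apply: (integrable_mul_bounded _ ik mnf (B := B)) => // y; rewrite normr_id.
have inq := integrable_conv_powR x q1 ik mf hf.
have s_le : s <= \int[leb]_y (k y * `|f (x - y)|).
  apply: (le_trans (le_normr_Rintegral _ _)) => //.
    exact: (integrable_conv_integrand x ik mf hf).
  apply: le_Rintegral => //.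
  - exact: integrable_norm (integrable_conv_integrand x ik mf hf).
  - by move=> y _; rewrite normrM (ger0_norm (k0 y)).
have tangent a : 0 <= a -> q * s `^ (q - 1) * a - (q - 1) * s `^ q <= a `^ q.
  move=> a0; have [->|qn1] := eqVneq q 1.
    by rewrite subrr mul0r subr0 powRr0 mulr1 mul1r powRr1.
  have q1' : 1 < q by rewrite lt_neqAle eq_sym qn1.
  have qm1 : 0 < q - 1 by rewrite subr_gt0.
  have p0 : 0 < q / (q - 1) by rewrite divr_gt0.
  have pq : q^-1 + (q / (q - 1))^-1 = 1 by field; rewrite !gt_eqF.
  have := @conjugate_powR R a (s `^ (q - 1)) q (q / (q - 1)) a0 (powR_ge0 _ _) q0 p0 pq.
  rewrite -powRrM (_ : (q - 1) * (q / (q - 1)) = q); last by field; rewrite gt_eqF.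
  move=> h; have : q * (a * s `^ (q - 1)) <= q * (a `^ q / q + s `^ q / (q / (q - 1))).
    by rewrite ler_pM2l.
  have -> : q * (a `^ q / q + s `^ q / (q / (q - 1))) = a `^ q + (q - 1) * s `^ q.
    by field; rewrite !gt_eqF.
  by move=> h2; rewrite lerBlDr; apply: le_trans h2; rewrite mulrAC mulrA.
have sq : s `^ (q - 1) * s = s `^ q.
  rewrite -[X in _ * X]powRr1 ?normr_ge0// -powRD; first by rewrite subrK.
  by rewrite subrK (gt_eqF q0).
pose t y := k y * (q * s `^ (q - 1) * `|f (x - y)| - (q - 1) * s `^ q).
have it : leb.-integrable setT (EFin \o t).
  rewrite (_ : t = fun y => q * s `^ (q - 1) * (k y * `|f (x - y)|) - (q - 1) * s `^ q * k y).
    exact: (integrableB measurableT (integrableZl measurableT _ inf1) (integrableZl measurableT _ ik)).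
  by apply/funext => y; rewrite /t; ring.
apply: (@le_trans _ _ (\int[leb]_y t y)); last first.
  by apply: le_Rintegral => // y _; rewrite ler_wpM2l// tangent.
have -> : \int[leb]_y t y = q * s `^ (q - 1) * \int[leb]_y (k y * `|f (x - y)|)
    - (q - 1) * s `^ q * \int[leb]_y k y.
  rewrite -!RintegralZl// -RintegralB//.
  - by apply: eq_Rintegral => y _; rewrite /t; ring.
  - exact: (integrableZl measurableT _ inf1).
  - exact: (integrableZl measurableT _ ik).
have c0 : 0 <= q * s `^ (q - 1) by rewrite mulr_ge0 ?powR_ge0// ltW.
have h1 := ler_wpM2l c0 s_le.
have h2 : (q - 1) * s `^ q * \int[leb]_y k y <= (q - 1) * s `^ q.
  by rewrite ler_piMr// mulr_ge0 ?powR_ge0// subr_ge0.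
have h3 : q * s `^ (q - 1) * s = q * s `^ q by rewrite -mulrA sq.
by rewrite h3 in h1; lra.
Qed.

(** The pointwise bound [powR_sconv_le], integrated with Tonelli's theorem. *)
Lemma young_sconv k f B q : 1 <= q -> leb.-integrable setT (EFin \o k) ->
  (forall y, 0 <= k y) -> \int[leb]_y k y <= 1 ->
  measurable_fun setT f -> (forall y, `|f y| <= B) ->
  measurable_fun setT (sconv k f) ->
  (\int[leb]_x (`|sconv k f x| `^ q)%:E <= \int[leb]_x (`|f x| `^ q)%:E)%E.
Proof.
move=> q1 ik k0 k1 mf hf mkf.
have q0 : 0 < q by exact: lt_le_trans q1.
have mk := integrable_measurable_real ik.
have mq : measurable_fun setT (fun y => `|f y| `^ q).
  exact: (measurableT_comp (measurable_powR q) (measurableT_comp (@normr_measurable R setT) mf)).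
have tonelli := tonelli_conv mk mq k0 (fun y => powR_ge0 _ _).
apply: (@le_trans _ _ (\int[leb]_x \int[leb]_y (k y * `|f (x - y)| `^ q)%:E)%E).
  apply: ge0_le_integral => //.
  - apply/measurable_EFinP.
    exact: (measurableT_comp (measurable_powR q) (measurableT_comp (@normr_measurable R setT) mkf)).
  - have := @measurable_fun_fubini_tonelli_F _ _ _ _ R leb
      (fun z : 'rV[R]_n * 'rV[R]_n => (k z.2 * `|f (z.1 - z.2)| `^ q)%:E).
    apply; last by move=> z; rewrite lee_fin mulr_ge0// powR_ge0.
    by apply/measurable_EFinP; exact: (measurable_conv_pair mk mq).
  move=> x _; have h := powR_sconv_le x q1 ik k0 k1 mf hf.
  rewrite -(@fineK _ (\int[leb]_y (k y * `|f (x - y)| `^ q)%:E)) ?lee_fin//.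
  exact: (integrable_fin_num measurableT (integrable_conv_powR x q1 ik mf hf)).
rewrite tonelli -[leRHS]mul1e; apply: lee_wpmul2r.
  by apply: integral_ge0 => x _; rewrite lee_fin powR_ge0.
by rewrite -(@fineK _ (\int[leb]_y (k y)%:E)) ?lee_fin//; exact: integrable_fin_num.
Qed.

End convolution_integral.

(** * Approximate identities and cutoffs *)

Section approximate_identity.
Context {R : realType} {n : nat}.
Local Notation leb := (@lebesgue_rV R n).
Implicit Types (k : 'rV[R]_n -> R) (f : 'rV[R]_n -> R^o).

Lemma measurable_eballC (d : R) : measurable (~` @eball R n d).
Proof. by apply: measurableC; exact: measurable_eball. Qed.

Lemma test_function_facts f : test_function f ->
  [/\ continuous f, measurable_fun setT f,
      exists2 B, 0 <= B & forall x, `|f x| <= B &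
      leb.-integrable setT (EFin \o f)].
Proof.
move=> tf; have [M M0 hM] := test_function_support tf; have [sf _] := tf.
have cf : continuous f := smooth_continuous sf.
have mf : measurable_fun setT f := continuous_measurable_rV cf.
have [B B0 hB] := supported_bounded cf hM.
split => //; first by exists B.
exact: supported_integrable mf hM hB.
Qed.

(** Close to the point the test function hardly varies; far from it the kernel
    has little mass. The constants depend on the test function only, so they
    serve a whole family of kernels at once. *)
Lemma approximate_identity f (eta : R) : test_function f -> 0 < eta ->
  exists d tau, [/\ 0 < d, 0 < tau & forall k,
    leb.-integrable setT (EFin \o k) -> (forall y, 0 <= k y) ->
    \int[leb]_y k y = 1 -> \int[leb]_(y in ~` eball d) k y <= tau ->
    (forall x, `|sconv k f x - f x| <= eta) /\
    \int[leb]_x `|sconv k f x - f x| <= eta].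
Proof.
move=> tf eta0.
have [cf mf [B B0 hB] jf] := test_function_facts tf.
have [M M0 hM] := test_function_support tf.
pose v := fine (leb [set x : 'rV[R]_n | `|x| <= M + 1]).
have v0 : 0 <= v by exact: fine_ge0.
have vE : leb [set x : 'rV[R]_n | `|x| <= M + 1] = v%:E.
  by rewrite fineK// ge0_fin_numE// norm_ball_finite.
pose F := \int[leb]_x `|f x|.
have F0 : 0 <= F by exact: Rintegral_ge0.
have v1 : 0 < v + 1 by rewrite ltr_wpDl.
have BF0 : 0 < B + F + 1 by rewrite ltr_wpDl// addr_ge0.
pose e1 := eta / 4 / (v + 1).
pose tau := eta / 8 / (v + 1) / (B + F + 1).
have e10 : 0 < e1 by rewrite !divr_gt0.
have tau0 : 0 < tau by rewrite !divr_gt0.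
have tauE : tau * (B + F + 1) * (v + 1) = eta / 8 by rewrite /tau; field; rewrite !gt_eqF.
have e1E : e1 * (v + 1) = eta / 4 by rewrite /e1; field; rewrite gt_eqF.
have tauv : 0 <= tau * v by rewrite mulr_ge0// ltW.
have tauB : tau * B * (v + 1) <= eta / 8.
  by rewrite -tauE ler_wpM2r ?(ltW v1)// ler_wpM2l ?(ltW tau0)//; lra.
have tauF : tau * F <= eta / 8.
  rewrite -tauE; apply: (@le_trans _ _ (tau * (B + F + 1))).
    by rewrite ler_wpM2l ?(ltW tau0)//; lra.
  have h3 : 1 <= v + 1 by rewrite lerDr.
  have h4 : 0 <= tau * (B + F + 1) by apply: mulr_ge0; exact: ltW.
  by rewrite ler_peMr.
pose c := e1 + 2 * B * tau.
have cv : c * (v + 1) <= eta / 2.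
  have -> : c * (v + 1) = e1 * (v + 1) + 2 * (tau * B * (v + 1)) by rewrite /c; ring.
  by rewrite e1E; have := tauB; have := eta0; lra.
have c0 : 0 <= c.
  by apply: addr_ge0; [exact: ltW|apply: mulr_ge0; [exact: mulr_ge0|exact: ltW]].
have cle : c <= eta / 2 by apply: le_trans cv; rewrite ler_peMr// lerDr.
have [d0 d00 hd0] := supported_uniform_continuity cf hM e10.
pose d := Num.min d0 1.
have d_gt0 : 0 < d by rewrite lt_min d00 ltr01.
exists d, tau; split=> // k ik k0 k1 ktail.
have mk := integrable_measurable_real ik.
pose kt y := k y * \1_(~` eball d) y.
have mC := measurable_eballC d.
have iktE : \int[leb]_y kt y = \int[leb]_(y in ~` eball d) k y.
  rewrite [RHS]Rintegral_mkcond; apply: eq_Rintegral => y _.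
  by rewrite /kt patchE indicE; case: (y \in _); rewrite ?mulr1 ?mulr0.
have ikt : leb.-integrable setT (EFin \o kt).
  apply: (integrable_mul_bounded _ ik (B := 1)) => //.
  by move=> y; rewrite indicE; case: (y \in _); rewrite ?normr1 ?normr0.
have kt0 y : 0 <= kt y by rewrite /kt mulr_ge0.
have iktle : \int[leb]_y `|kt y| <= tau.
  rewrite (@eq_Rintegral _ _ _ _ _ kt) ?iktE// => y _.
  by rewrite ger0_norm.
have sup x : `|sconv k f x - f x| <= e1 + 2 * B * tau.
  have ix := integrable_conv_integrand x ik mf hB.
  have -> : sconv k f x - f x = \int[leb]_y (k y * (f (x - y) - f x)).
    rewrite -[X in _ - X]mul1r -k1 -RintegralZr// /sconv -RintegralB//.
      by apply: eq_Rintegral => y _; rewrite mulrBr.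
    exact: (integrableZr measurableT _ ik).
  have mfx : measurable_fun setT (fun y : 'rV[R]_n => f (x - y) - f x).
    apply: measurable_funB => //.
    by apply: (measurableT_comp mf); exact: measurable_subl.
  have ib : leb.-integrable setT (EFin \o (fun y => k y * (f (x - y) - f x))).
    apply: (integrable_mul_bounded _ ik mfx (B := B + B)) => // y.
    by rewrite (le_trans (ler_normB _ _))// lerD.
  apply: (le_trans (le_normr_Rintegral measurableT ib)).
  apply: (@le_trans _ _ (\int[leb]_y (e1 * k y + 2 * B * kt y))).
    apply: le_Rintegral => //.
    - exact: integrable_norm.
    - exact: (integrableD measurableT (integrableZl measurableT _ ik) (integrableZl measurableT _ ikt)).
    move=> y _; rewrite normrM (ger0_norm (k0 y)) /kt indicE.
    have [yd|yd] := boolP (y \in _).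
      rewrite mulr1 mulrC -mulrDl ler_wpM2r//.
      apply: (le_trans (ler_normB _ _)).
      have h1 := hB (x - y); have h2 := hB x; clear -h1 h2 e10; lra.
    rewrite mulr0 mulr0 addr0 mulrC ler_wpM2r//.
    have : eball d y by move: yd; rewrite notin_setE /= => /contrapT.
    rewrite /eball/= /d lt_min => /andP[yd0 _].
    rewrite -[x - y]/(x + - y); apply/ltW/hd0.
    by rewrite normrN (le_lt_trans (le_norm_enorm _)).
  rewrite RintegralD//; last 2 first.
  - exact: (integrableZl measurableT _ ik).
  - exact: (integrableZl measurableT _ ikt).
  rewrite !RintegralZl// k1 mulr1 lerD2l ler_wpM2l ?mulr_ge0//.
  by rewrite iktE.
split=> [x|]; first by apply: (le_trans (sup x)); rewrite -/c; have := cle; have := eta0; lra.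
have msk : measurable_fun setT (sconv k f) :=
  continuous_measurable_rV (sconv_continuous ik cf hM).
have mskt : measurable_fun setT (sconv kt f) :=
  continuous_measurable_rV (sconv_continuous ikt cf hM).
have [isk _] := integrable_sconv ik jf msk hB.
have [iskt isktle] := integrable_sconv ikt jf mskt hB.
pose K := [set x : 'rV[R]_n | `|x| <= M + 1].
have mK : measurable K by exact: measurable_norm_ball.
have iK : leb.-integrable setT (EFin \o \1_K).
  apply: (supported_integrable (M := M + 1) (B := 1)) => //.
    by move=> x xM; rewrite indicE memNset// /K/= => /le_lt_trans /(_ xM); rewrite ltxx.
  by move=> x; rewrite indicE; case: (x \in _); rewrite ?normr1 ?normr0.
have IK : \int[leb]_x \1_K x = v.
  by rewrite /Rintegral integral_indic// setIT.
have bound x : `|sconv k f x - f x| <= c * \1_K x + `|sconv kt f x|.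
  rewrite indicE; have [xK|xK] := boolP (x \in K).
    by rewrite mulr1; apply: (le_trans (sup x)); rewrite lerDl.
  have {}xK : M + 1 < `|x| by move: xK; rewrite notin_setE /K/= => /negP; rewrite -ltNge.
  rewrite mulr0 add0r hM ?subr0; last by rewrite (lt_trans _ xK)// ltrDl.
  rewrite le_eqVlt; apply/orP; left; apply/eqP; congr (`|_|).
  apply: eq_Rintegral => y _; rewrite /kt indicE.
  have [yd|yd] := boolP (y \in _); first by rewrite mulr1.
  have : eball d y by move: yd; rewrite notin_setE /= => /contrapT.
  rewrite /eball/= /d lt_min => /andP[_ y1].
  rewrite [f (x - y)]hM ?mulr0//.
  have h1 := lerB_dist x y; have h2 := le_norm_enorm y; clear -h1 h2 y1 xK; lra.
have iB : leb.-integrable setT (EFin \o (fun x => c * \1_K x + `|sconv kt f x|)).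
  exact: (integrableD measurableT (integrableZl measurableT _ iK) (integrable_norm iskt)).
apply: (@le_trans _ _ (\int[leb]_x (c * \1_K x + `|sconv kt f x|))).
  apply: (le_Rintegral measurableT _ iB); last by move=> x _; exact: bound.
  exact: (integrable_norm (integrableB measurableT isk jf)).
rewrite RintegralD//; last 2 first.
- exact: (integrableZl measurableT _ iK).
- exact: (integrable_norm iskt).
rewrite RintegralZl// IK.
have h1 : c * v <= eta / 2 by apply: le_trans cv; rewrite ler_wpM2l// lerDl.
have h2 : \int[leb]_x `|sconv kt f x| <= tau * F.
  by apply: (le_trans isktle); rewrite ler_wpM2r.
apply: (@le_trans _ _ (eta / 2 + eta / 8)).
  by apply: lerD => //; exact: le_trans h2 tauF.
by clear -eta0; lra.
Qed.

(** Smoothing the indicator of a ball by a bump of mass one leaves the value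
    one at the points whose unit neighbourhood lies in the ball. *)
Lemma smooth_cutoff (M : R) : 0 <= M -> exists chi : 'rV[R]_n -> R^o,
  [/\ test_function chi, forall x, 0 <= chi x <= 1,
      forall x, `|x| <= M -> chi x = 1 & supported_in_ball chi (M + 2)].
Proof.
move=> M0.
pose k : 'rV[R]_n -> R := \1_[set x : 'rV[R]_n | `|x| <= M + 1].
pose c := (\int[leb]_x flat_bump x)^-1.
have c0 : 0 < c by rewrite invr_gt0 integral_flat_bump_gt0.
pose eta : 'rV[R]_n -> R^o := fun x => c * flat_bump x.
have teta : test_function eta.
  split; first exact: (smooth_scale (smooth_cst (c : R^o)) smooth_flat_bump).
  by apply/compact_tsupportP; exists 1 => x x1; rewrite /eta flat_bump_support ?mulr0.
have seta : supported_in_ball eta 1 by move=> x x1; rewrite /eta flat_bump_support ?mulr0.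
have eta0 x : 0 <= eta x by rewrite mulr_ge0 ?flat_bump_ge0// ltW.
have [ceta meta [B B0 hB] ieta] := test_function_facts teta.
have eta1 : \int[leb]_x eta x = 1.
  rewrite /eta RintegralZl//; last exact: integrable_flat_bump.
  by rewrite mulVf// gt_eqF// integral_flat_bump_gt0.
have mk : measurable_fun setT k.
  by apply: measurable_indic; exact: measurable_norm_ball.
have ks x : M + 1 < `|x| -> k x = 0.
  by move=> xM; rewrite /k indicE memNset//= => /le_lt_trans /(_ xM); rewrite ltxx.
have k01 x : 0 <= k x <= 1 by rewrite /k indicE; case: (x \in _); rewrite ?lexx ?ler01.
have ik : leb.-integrable setT (EFin \o k).
  apply: (supported_integrable mk ks (B := 1)).
  by move=> x; rewrite ger0_norm; case/andP: (k01 x).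
have ieta_sub x : leb.-integrable setT (EFin \o (fun y => eta (x - y))).
  exact: (integrable_image (measurable_subl x) (lebesgue_rV_subl x) ieta).
have eta_sub x : \int[leb]_y eta (x - y) = 1.
  have mE : measurable_fun setT (EFin \o eta) by exact/measurable_EFinP.
  have h := integral_subl x mE.
  by rewrite -[RHS]eta1 /Rintegral -[in RHS]h.
have ix x := integrable_conv_integrand x ik meta hB.
exists (sconv k eta); split.
- split; first exact: smooth_sconv.
  apply/compact_tsupportP; exists (M + 1 + 1) => x; exact: (sconv_support ks seta).
- move=> x; apply/andP; split.
    by apply: Rintegral_ge0 => y _; rewrite mulr_ge0//; case/andP: (k01 y).
  rewrite -(eta_sub x); apply: le_Rintegral => //.
  by move=> y _; rewrite ler_piMl//; case/andP: (k01 y).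
- move=> x xM; rewrite -[RHS](eta_sub x); apply: eq_Rintegral => y _.
  have [yM|yM] := leP `|y| (M + 1).
    by rewrite /k indicE mem_set ?mul1r.
  rewrite [eta _]seta ?mulr0//; have := lerB_dist y x; rewrite distrC; lra.
- move=> x xM; apply: (sconv_support ks seta); lra.
Qed.

End approximate_identity.

(** * The kernel of a radial density *)

Section radial_kernel.
Context {R : realType} {n : nat}.
Local Notation leb := (@lebesgue_rV R n.+1).
Local Notation omega := (@unit_ball_volume R n.+1).
Implicit Types (rho : 'rV[R]_n.+1 -> R) (x y z : 'rV[R]_n.+1).

(** The uniform probability density of the ball of radius [enorm z], times
    [rho z]. It is set to zero at the origin, where the superposition of
    these densities may diverge. *)
Definition ball_density rho y z : R :=
  if (0 < enorm y) && (enorm y < enorm z)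
  then omega^-1 * rho z * enorm z ^- n.+1 else 0.

Definition radial_kernel rho y : R := \int[leb]_z ball_density rho y z.

Definition admissible_density rho :=
  [/\ measurable_fun setT rho, forall z, 0 <= rho z &
      leb.-integrable setT (EFin \o rho)].

Let omegaV_ge0 : 0 <= omega^-1.
Proof. by rewrite invr_ge0 ltW// unit_ball_volume_gt0. Qed.

Lemma ball_density_ge0 rho y z : (forall z, 0 <= rho z) -> 0 <= ball_density rho y z.
Proof.
move=> r0; rewrite /ball_density; case: ifP => // _.
by rewrite !mulr_ge0// invr_ge0 exprn_ge0// enorm_ge0.
Qed.

Lemma measurable_ball_density rho : measurable_fun setT rho ->
  measurable_fun setT (fun p : 'rV[R]_n.+1 * 'rV[R]_n.+1 => ball_density rho p.1 p.2).
Proof.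
move=> mr; rewrite /ball_density.
have m1 := measurableT_comp (@measurable_enorm R n.+1)
  (@measurable_fst _ _ 'rV[R]_n.+1 'rV[R]_n.+1).
have m2 := measurableT_comp (@measurable_enorm R n.+1)
  (@measurable_snd _ _ 'rV[R]_n.+1 'rV[R]_n.+1).
apply: measurable_fun_ifT.
- apply: measurable_and; apply: measurable_fun_ltr => //.
- apply: measurable_funM.
    apply: measurable_funM => //.
    exact: (measurableT_comp mr (@measurable_snd _ _ 'rV[R]_n.+1 'rV[R]_n.+1)).
  rewrite (_ : (fun p => _) = fun p : 'rV[R]_n.+1 * 'rV[R]_n.+1 => (enorm p.2 `^ (-1)) ^+ n.+1).
    by apply: measurable_funX; exact: (measurableT_comp (measurable_powR (-1)) m2).
  by apply/funext => p; rewrite powR_inv1 ?enorm_ge0// exprVn.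
- exact: measurable_cst.
Qed.

Lemma measurable_ball_density_slice rho y : measurable_fun setT rho ->
  measurable_fun setT (ball_density rho y).
Proof.
move=> mr; have := measurable_ball_density mr.
by move=> h; exact: (measurableT_comp h (pair1_measurable y)).
Qed.

Lemma ball_density_le rho y z : (forall z, 0 <= rho z) ->
  ball_density rho y z <= omega^-1 * enorm y ^- n.+1 * rho z.
Proof.
move=> r0; rewrite /ball_density; case: ifP => [/andP[y0 yz]|_]; last first.
  by rewrite !mulr_ge0// invr_ge0 exprn_ge0// enorm_ge0.
rewrite mulrAC ler_wpM2r// ler_wpM2l// lef_pV2 ?posrE ?exprn_gt0//.
- by rewrite lerXn2r ?nnegrE ?enorm_ge0// ltW.
- exact: lt_trans yz.
Qed.

Lemma integrable_ball_density rho y : admissible_density rho ->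
  leb.-integrable setT (EFin \o ball_density rho y).
Proof.
move=> [mr r0 ir].
apply: (@le_integrable _ _ _ _ _ _ _
  (fun z => (omega^-1 * enorm y ^- n.+1)%:E * (EFin \o rho) z)%E) => //.
- by apply/measurable_EFinP; exact: measurable_ball_density_slice.
- move=> z _ /=; rewrite lee_fin !ger0_norm ?ball_density_ge0 ?ball_density_le//.
  by rewrite !mulr_ge0// invr_ge0 exprn_ge0// enorm_ge0.
- exact: integrableZl.
Qed.

Lemma radial_kernelE rho y : admissible_density rho ->
  (radial_kernel rho y)%:E = (\int[leb]_z (ball_density rho y z)%:E)%E.
Proof.
by move=> ar; rewrite fineK//; apply: integrable_fin_num => //; exact: integrable_ball_density.
Qed.

Lemma radial_kernel_ge0 rho y : (forall z, 0 <= rho z) -> 0 <= radial_kernel rho y.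
Proof. by move=> r0; apply: Rintegral_ge0 => z _; exact: ball_density_ge0. Qed.

Lemma radial_kernel_even rho y : radial_kernel rho (- y) = radial_kernel rho y.
Proof. by rewrite /radial_kernel /ball_density enormN. Qed.

Lemma measurable_radial_kernel rho : admissible_density rho ->
  measurable_fun setT (radial_kernel rho).
Proof.
move=> ar; have [mr r0 _] := ar; apply/measurable_EFinP.
have := @measurable_fun_fubini_tonelli_F _ _ _ _ R leb
  (fun p : 'rV[R]_n.+1 * 'rV[R]_n.+1 => (ball_density rho p.1 p.2)%:E).
have -> : EFin \o radial_kernel rho = fun y => (\int[leb]_z (ball_density rho y z)%:E)%E.
  by apply/funext => y; rewrite /= radial_kernelE.
apply; first by apply/measurable_EFinP; exact: measurable_ball_density.
by move=> p; rewrite lee_fin ball_density_ge0.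
Qed.

Lemma tonelli_radial_kernel rho (g : 'rV[R]_n.+1 -> R) : admissible_density rho ->
  measurable_fun setT g -> (forall y, 0 <= g y) ->
  (\int[leb]_y (radial_kernel rho y * g y)%:E =
   \int[leb]_z \int[leb]_y (ball_density rho y z * g y)%:E)%E.
Proof.
move=> ar mg g0; have [mr r0 _] := ar.
pose F (p : 'rV[R]_n.+1 * 'rV[R]_n.+1) := (ball_density rho p.1 p.2 * g p.1)%:E.
have mF : measurable_fun setT F.
  apply/measurable_EFinP; apply: measurable_funM; first exact: measurable_ball_density.
  exact: (measurableT_comp mg (@measurable_fst _ _ 'rV[R]_n.+1 'rV[R]_n.+1)).
have F0 p : (0 <= F p)%E by rewrite lee_fin mulr_ge0// ball_density_ge0.
have <- := @fubini_tonelli _ _ _ _ R leb leb F mF F0.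
apply: eq_integral => y _; rewrite EFinM radial_kernelE// muleC.
have mb : measurable_fun setT (EFin \o ball_density rho y).
  by apply/measurable_EFinP; exact: measurable_ball_density_slice.
have b0 z : setT z -> (0 <= (EFin \o ball_density rho y) z)%E.
  by move=> _; rewrite lee_fin ball_density_ge0.
have gy0 : (0 <= (g y)%:E)%E by rewrite lee_fin.
rewrite -(@ge0_integralZl _ _ _ leb setT measurableT _ mb _ b0 gy0).
by apply: eq_integral => z _; rewrite /F /= EFinM muleC.
Qed.

Lemma set0_boxE : [set (0 : 'rV[R]_n.+1)] = box (fun=> [set (0:R)]).
Proof.
apply/seteqP; split => x /=; first by move=> -> i; rewrite mxE.
by move=> h; apply/rowP => i; rewrite mxE; exact: h.
Qed.

Lemma measurable_point0 : measurable [set (0 : 'rV[R]_n.+1)].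
Proof. by rewrite set0_boxE; apply: measurable_box => i; exact: measurable_set1. Qed.

Lemma lebesgue_rV_point : leb [set 0] = 0%E.
Proof.
rewrite set0_boxE lebesgue_rV_box => [|i]; last exact: measurable_set1.
by rewrite big_ord_recl lebesgue_measure_set1 mul0e.
Qed.

Lemma integral_ball_density rho z : 0 < enorm z ->
  (\int[leb]_y (ball_density rho y z)%:E = (rho z)%:E)%E.
Proof.
move=> z0; pose c := omega^-1 * rho z * enorm z ^- n.+1.
have mz := @measurable_eball R n.+1 (enorm z).
have m0 : measurable (@eball R n.+1 (enorm z) `\` [set 0]).
  by apply: measurableD => //; exact: measurable_point0.
transitivity (\int[leb]_(y in @eball R n.+1 (enorm z) `\` [set 0%R]) (cst c%:E) y)%E.
  rewrite [RHS]integral_mkcond; apply: eq_integral => y _.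
  rewrite patchE /ball_density enorm_gt0; case: ifPn => [/andP[y0 yz]|h].
    by rewrite mem_set//=; split => //=; apply/eqP.
  rewrite memNset//= => -[yz /eqP y0]; move/negP: h; apply.
  by rewrite y0.
rewrite integral_cst//.
have E : leb (eball (enorm z) `\` [set 0%R]) = leb (eball (enorm z)).
  rewrite [RHS](measureDI leb mz measurable_point0).
  have mI := measurableI _ _ mz measurable_point0.
  have E0 : leb (eball (enorm z) `&` [set 0%R]) = 0%E.
    apply: le_anti; rewrite measure_ge0 andbT -[leRHS]lebesgue_rV_point.
    apply: le_measure; rewrite ?inE//; first exact: measurable_point0.
  by rewrite [X in (_ + X)%E]E0 adde0.
rewrite [X in (_ * X)%E]E eball_volume// -EFinM; congr EFin; rewrite /c.
by field; rewrite !gt_eqF ?unit_ball_volume_gt0// exprn_gt0.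
Qed.

Lemma integral_ball_density_le rho z : (forall z, 0 <= rho z) ->
  (\int[leb]_y (ball_density rho y z)%:E <= (rho z)%:E)%E.
Proof.
move=> r0; have [z0|z0] := ltP 0 (enorm z); first by rewrite integral_ball_density.
rewrite integral0_eq; first by rewrite lee_fin.
move=> y _; rewrite /ball_density; case: ifP => // /andP[y0 yz].
by have := lt_trans y0 yz; rewrite ltNge z0.
Qed.

Lemma integral_off_point (g : 'rV[R]_n.+1 -> R) : measurable_fun setT g ->
  (forall z, 0 <= g z) ->
  (\int[leb]_z (if (0 < enorm z) then g z else 0)%:E = \int[leb]_z (g z)%:E)%E.
Proof.
move=> mg g0; apply: ge0_ae_eq_integral => //.
- apply/measurable_EFinP; apply: measurable_fun_ifT => //.
  by apply: measurable_fun_ltr => //; exact: measurable_enorm.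
- exact/measurable_EFinP.
- by move=> z _; case: ifP; rewrite lee_fin.
- by move=> z _; rewrite lee_fin.
have N0 : {ae leb, forall z, z <> 0}.
  exists [set 0]; split; [exact: measurable_point0|exact: lebesgue_rV_point|].
  by move=> z /= /contrapT.
by apply: filterS N0 => z z0 _; rewrite enorm_gt0; case: eqP.
Qed.

(** Tonelli's theorem: each ball density integrates to its weight [rho z]. *)
Lemma radial_kernel_mass rho : admissible_density rho ->
  (\int[leb]_y (radial_kernel rho y)%:E = \int[leb]_z (rho z)%:E)%E.
Proof.
move=> ar; have [mr r0 ir] := ar.
have := tonelli_radial_kernel ar (@measurable_cst _ _ 'rV[R]_n.+1 R setT 1) (fun=> ler01).
under eq_integral do rewrite mulr1; move=> ->.
rewrite -(integral_off_point mr r0); apply: eq_integral => z _.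
under eq_integral do rewrite mulr1.
case: ifPn => [|z0]; first exact: integral_ball_density.
rewrite integral0_eq// => y _; rewrite /ball_density; case: ifP => // /andP[y0 yz].
by rewrite (lt_trans y0 yz) in z0.
Qed.

Lemma integrable_radial_kernel rho : admissible_density rho ->
  leb.-integrable setT (EFin \o radial_kernel rho).
Proof.
move=> ar; have [mr r0 ir] := ar; apply/integrableP; split.
  by apply/measurable_EFinP; exact: measurable_radial_kernel.
under eq_integral do rewrite /= ger0_norm ?radial_kernel_ge0//.
rewrite radial_kernel_mass//; have [_] := integrableP _ _ _ ir.
by under eq_integral do rewrite /= ger0_norm//.
Qed.

(** A ball of radius at most [d] contributes nothing outside the ball of
    radius [d], and every ball contributes at most its weight. *)
Lemma radial_kernel_tail rho d : admissible_density rho -> 0 < d ->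
  (\int[leb]_(y in ~` eball d) (radial_kernel rho y)%:E <=
   \int[leb]_(z in ~` eball d) (rho z)%:E)%E.
Proof.
move=> ar d0; have [mr r0 ir] := ar.
have mC : measurable (~` @eball R n.+1 d) by exact: measurable_eballC.
pose g := \1_(~` @eball R n.+1 d) : 'rV[R]_n.+1 -> R.
have mg : measurable_fun setT g by exact: measurable_indic.
have gE (f : 'rV[R]_n.+1 -> R) : (\int[leb]_(y in ~` eball d) (f y)%:E =
    \int[leb]_y (f y * g y)%:E)%E.
  rewrite integral_mkcond; apply: eq_integral => y _.
  by rewrite patchE /g indicE; case: (y \in _); rewrite ?mulr1 ?mulr0.
rewrite !gE tonelli_radial_kernel//; apply: ge0_le_integral => //.
- by move=> z _; apply: integral_ge0 => y _; rewrite lee_fin mulr_ge0// ball_density_ge0.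
- have := @measurable_fun_fubini_tonelli_G _ _ _ _ R leb
    (fun p : 'rV[R]_n.+1 * 'rV[R]_n.+1 => (ball_density rho p.1 p.2 * g p.1)%:E).
  apply; last by move=> p; rewrite lee_fin mulr_ge0// ball_density_ge0.
  apply/measurable_EFinP; apply: measurable_funM; first exact: measurable_ball_density.
  exact: (measurableT_comp mg (@measurable_fst _ _ 'rV[R]_n.+1 'rV[R]_n.+1)).
- by apply/measurable_EFinP; exact: measurable_funM.
move=> z _; have [zd|zd] := ltP (enorm z) d.
  rewrite integral0_eq ?lee_fin ?mulr_ge0// => y _.
  rewrite /ball_density; case: ifP => [/andP[y0 yz]|]; last by rewrite mul0r.
  by rewrite /g indicE memNset ?mulr0// => /=; apply; rewrite /eball/= (lt_trans yz).
rewrite {2}/g indicE mem_set ?mulr1; last by rewrite /eball/=; apply/negP; rewrite -leNgt.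
rewrite -(integral_ball_density rho (lt_le_trans d0 zd)); apply: ge0_le_integral => //.
- by move=> y _; rewrite lee_fin mulr_ge0// ball_density_ge0.
- have mb : measurable_fun setT (fun y => ball_density rho y z).
    exact: (measurableT_comp (measurable_ball_density mr) (pair2_measurable z)).
  by apply/measurable_EFinP; exact: measurable_funM.
- have mb : measurable_fun setT (fun y => ball_density rho y z).
    exact: (measurableT_comp (measurable_ball_density mr) (pair2_measurable z)).
  exact/measurable_EFinP.
- move=> y _; rewrite lee_fin ler_piMr ?ball_density_ge0//.
  by rewrite /g indicE; case: (y \in _).
Qed.

Lemma radial_kernel_support rho M : (forall z, M < enorm z -> rho z = 0) ->
  forall y, M < enorm y -> radial_kernel rho y = 0.
Proof.
move=> hM y yM; rewrite /radial_kernel (@eq_Rintegral _ _ _ _ _ (cst 0)).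
  by rewrite /Rintegral integral0.
move=> z _ /=; rewrite /ball_density; case: ifP => // /andP[_ yz].
by rewrite hM ?mulr0 ?mul0r// (lt_trans yM).
Qed.

Lemma radial_kernelD rho1 rho2 y : admissible_density rho1 -> admissible_density rho2 ->
  radial_kernel (fun z => rho1 z + rho2 z) y = radial_kernel rho1 y + radial_kernel rho2 y.
Proof.
move=> a1 a2; rewrite /radial_kernel -RintegralD//; last 2 first.
- exact: integrable_ball_density.
- exact: integrable_ball_density.
apply: eq_Rintegral => z _; rewrite /ball_density; case: ifP => _; last by rewrite addr0.
by ring.
Qed.

Lemma integral_radial_kernel_mul rho (g : 'rV[R]_n.+1 -> R) B : admissible_density rho ->
  measurable_fun setT g -> (forall y, `|g y| <= B) ->
  \int[leb]_y (radial_kernel rho y * g y) =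
  \int[leb]_z (\int[leb]_y (ball_density rho y z * g y)) /\
  leb.-integrable setT (fun z => (\int[leb]_y (ball_density rho y z * g y))%:E).
Proof.
move=> ar mg hB; have [mr r0 ir] := ar.
pose F (p : 'rV[R]_n.+1 * 'rV[R]_n.+1) := (ball_density rho p.1 p.2 * g p.1)%:E.
have mF : measurable_fun setT F.
  apply/measurable_EFinP; apply: measurable_funM; first exact: measurable_ball_density.
  exact: (measurableT_comp mg (@measurable_fst _ _ 'rV[R]_n.+1 'rV[R]_n.+1)).
have B0 : 0 <= B by exact: le_trans (hB 0).
have ib y : leb.-integrable setT (EFin \o ball_density rho y) by exact: integrable_ball_density.
have iF : (leb \x leb)%E.-integrable setT F.
  apply/integrable12ltyP => //.
  have h := tonelli_radial_kernel ar (measurableT_comp (@normr_measurable R setT) mg)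
    (fun y => normr_ge0 _).
  have E : (\int[leb]_x \int[leb]_y `|F (x, y)| =
      \int[leb]_y (radial_kernel rho y * `|g y|)%:E)%E.
    apply: eq_integral => y _; rewrite EFinM radial_kernelE// muleC.
    have mb : measurable_fun setT (EFin \o ball_density rho y).
      by apply/measurable_EFinP; exact: measurable_ball_density_slice.
    have b0 z : setT z -> (0 <= (EFin \o ball_density rho y) z)%E.
      by move=> _; rewrite lee_fin ball_density_ge0.
    have gy0 : (0 <= `|g y|%:E)%E by rewrite lee_fin.
    rewrite -(@ge0_integralZl _ _ _ leb setT measurableT _ mb _ b0 gy0).
    by apply: eq_integral => z _; rewrite /F /= normrM (ger0_norm (ball_density_ge0 _ _ r0)) mulrC.
  rewrite E.
  have mng : measurable_fun setT (fun y => `|g y|) by exact: measurableT_comp.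
  have hB' y : `| `|g y| | <= B by rewrite normr_id.
  have := integrable_mul_bounded measurableT (integrable_radial_kernel ar) mng hB'.
  move=> /integrableP[_].
  by under eq_integral do rewrite /= ger0_norm ?mulr_ge0 ?radial_kernel_ge0//.
have E1 y : (\int[leb]_z F (y, z) = (radial_kernel rho y * g y)%:E)%E.
  rewrite /F /= mulrC EFinM radial_kernelE// -(integralZl measurableT (ib y)).
  by apply: eq_integral => z _; rewrite EFinM muleC.
have ibz z : leb.-integrable setT (EFin \o (fun y => ball_density rho y z)).
  have mb : measurable_fun setT (fun y => ball_density rho y z).
    exact: (measurableT_comp (measurable_ball_density mr) (pair2_measurable z)).
  apply/integrableP; split; first exact/measurable_EFinP.
  under eq_integral do rewrite /= ger0_norm ?ball_density_ge0//.
  exact: le_lt_trans (integral_ball_density_le z r0) (ltry _).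
have ig z : leb.-integrable setT (EFin \o (fun y => ball_density rho y z * g y)).
  exact: integrable_mul_bounded (ibz z) mg hB.
have E2 z : (\int[leb]_y F (y, z) = (\int[leb]_y (ball_density rho y z * g y))%:E)%E.
  by rewrite fineK//; exact: integrable_fin_num (ig z).
have FE := Fubini iF.
have E3 : (\int[leb]_y (radial_kernel rho y * g y)%:E =
  \int[leb]_z (\int[leb]_y (ball_density rho y z * g y))%:E)%E.
  rewrite (eq_integral (fun y => \int[leb]_z F (y, z)))%E => [|y _]; last by rewrite E1.
  rewrite FE; apply: eq_integral => z _; exact: E2.
split; first by rewrite /Rintegral E3.
have mG : measurable_fun setT (fun z => (\int[leb]_y (ball_density rho y z * g y))%:E).
  have := measurable_fubini_G iF; congr (measurable_fun _ _).
  by apply/funext => z; exact: E2.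
have iBr : leb.-integrable setT (fun z => B%:E * (EFin \o rho) z)%E by exact: integrableZl.
apply: (le_integrable measurableT mG _ iBr).
move=> z _; rewrite /= lee_fin (ger0_norm (mulr_ge0 B0 (r0 z))).
have mb : measurable_fun setT (fun y => ball_density rho y z).
  exact: (measurableT_comp (measurable_ball_density mr) (pair2_measurable z)).
apply: (le_trans (norm_integral_mul_bounded (ibz z) mg hB)).
apply: ler_wpM2l => //; rewrite -lee_fin fineK; last exact: integrable_fin_num (integrable_norm (ibz z)).
rewrite (eq_integral (fun y => (ball_density rho y z)%:E)) => [|y _]; last first.
  by rewrite ger0_norm// ball_density_ge0.
exact: integral_ball_density_le.
Qed.

End radial_kernel.

(** * Integration by parts on balls *)

Section radial_functions.
Context {R : realType} {n : nat}.
Local Notation leb := (@lebesgue_rV R n.+1).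
Local Notation omega := (@unit_ball_volume R n.+1).
Implicit Types (rho : 'rV[R]_n.+1 -> R) (x y z : 'rV[R]_n.+1).

Lemma enorm_delta (i : 'I_n.+1) (r : R) : enorm (r *: (delta_mx 0 i : 'rV[R]_n.+1)) = `|r|.
Proof.
rewrite enormZ; suff -> : enorm (delta_mx 0 i : 'rV[R]_n.+1) = 1 by rewrite mulr1.
rewrite /enorm (bigD1 i)//= big1 ?addr0; first by rewrite mxE !eqxx expr1n sqrtr1.
by move=> j ji; rewrite mxE (negbTE ji) andbF expr0n.
Qed.

Lemma measurable_scale_delta (i : 'I_n.+1) :
  measurable_fun setT (fun r : measurableTypeR R => r *: (delta_mx 0 i : 'rV[R]_n.+1)).
Proof.
apply: measurable_fun_rV => j; under eq_fun do rewrite mxE.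
exact: measurable_funM.
Qed.

(** Polar coordinates: the factor [n.+1%:R / r] in [mu_kernel] is the radial
    weight divided by the volume of the ball. *)
Lemma mu_kernelE rho (rhoh : R -> R) y : admissible_density rho ->
  (forall z, rho z = rhoh (enorm z)) -> y != 0 ->
  mu_kernel rhoh y = radial_kernel rho y.
Proof.
move=> [mr r0 ir] rE y0.
have ypos : 0 < enorm y by rewrite enorm_gt0.
pose h (r : R) := rho (r *: delta_mx 0 ord0).
have hE r : 0 < r -> h r = rhoh r by move=> rp; rewrite /h rE enorm_delta gtr0_norm.
have mh : measurable_fun setT h by exact: (measurableT_comp mr (measurable_scale_delta ord0)).
pose F (r : R) : R := if enorm y < r then omega^-1 * h r * (r `^ (-1)) ^+ n.+1 else 0.
have mF : measurable_fun setT (EFin \o F).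
  apply/measurable_EFinP; apply: measurable_fun_ifT.
  - exact: measurable_fun_ltr.
  - apply: measurable_funM; first exact: measurable_funM.
    by apply: measurable_funX; exact: measurable_powR.
  - exact: measurable_cst.
have F0 r : (0 <= (EFin \o F) r)%E.
  rewrite /= lee_fin /F; case: ifP => // yr.
  apply: mulr_ge0; last by rewrite exprn_ge0// powR_ge0.
  by apply: mulr_ge0; [rewrite invr_ge0 ltW// unit_ball_volume_gt0|exact: r0].
have bE z : ball_density rho y z = F (enorm z).
  rewrite /ball_density /F ypos/=; case: ifP => // yz.
  have z0 : 0 < enorm z by exact: lt_trans yz.
  by rewrite hE// rE powR_inv1 ?enorm_ge0// exprVn.
have E := ge0_integral_radial mF F0.
rewrite /radial_kernel /Rintegral.
rewrite (eq_integral (fun z => (EFin \o F) (enorm z))) => [|z _]; last by rewrite /= bE.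
rewrite E /mu_kernel /Rintegral; congr fine.
rewrite integral_mkcond; apply: eq_integral => r _.
have wE : radial_weight (n := n) r = n.+1%:R * omega * r ^+ n * (0 < r)%R%:R.
  by rewrite /radial_weight indicE mem_setE in_itv/= andbT.
rewrite patchE mem_setE in_itv/= andbT -EFinM wE.
case: (boolP (0 < r)) => rp /=; last by rewrite !mulr0.
congr EFin; rewrite /F indicE.
have [yr|yr] := ltP (enorm y) r; last first.
  by rewrite memNset ?mulr0 ?mul0r// /eball/=; apply/negP; rewrite -leNgt.
rewrite mem_set//= !mulr1 hE// powR_inv1 ?(ltW rp)// exprVn exprS.
by field; rewrite !gt_eqF ?unit_ball_volume_gt0// exprn_gt0.
Qed.

(** The vanishing of the integrals over balls means that the positive and
    negative parts of [q] have the same image under the Euclidean norm. *)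
Lemma zero_mean_radial (q : 'rV[R]_n.+1 -> R) (G : R -> R) :
  measurable_fun setT q ->
  (forall b, 0 < b -> leb.-integrable (eball b) (EFin \o q)) ->
  (forall b, 0 < b -> \int[leb]_(z in eball b) q z = 0) ->
  measurable_fun setT G -> (forall r, 0 <= G r) ->
  leb.-integrable setT (EFin \o (fun z => G (enorm z) * q z)) ->
  \int[leb]_z (G (enorm z) * q z) = 0.
Proof.
move=> mq iq q0 mG G0 iGq.
have mp : measurable_fun setT (funrpos q) by exact: measurable_funrpos.
have mn : measurable_fun setT (funrneg q) by exact: measurable_funrneg.
have me : measurable_fun [set: 'rV[R]_n.+1]
  ((@enorm R n.+1) : 'rV[R]_n.+1 -> measurableTypeR R) by exact: measurable_enorm.
pose dp := density_measure leb mp (funrpos_ge0 q).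
pose dn := density_measure leb mn (funrneg_ge0 q).
pose m1 := image_measure dp me.
pose m2 := image_measure dn me.
have eE b : @enorm R n.+1 @^-1` `]-oo, b[ = eball b.
  by apply/seteqP; split => x /=; rewrite in_itv.
have Q b : m1 `]-oo, b[%classic = m2 `]-oo, b[%classic.
  transitivity (dp (eball b)); first by congr (dp _); rewrite -eE.
  transitivity (dn (eball b)); last by congr (dn _); rewrite -eE.
  have [b0|b0] := leP b 0; first by rewrite !eball_le0// !measure0.
  transitivity (\int[leb]_(x in eball b) (funrpos q x)%:E)%E; first by [].
  transitivity (\int[leb]_(x in eball b) (funrneg q x)%:E)%E; last by [].
  have h := q0 b b0; rewrite /Rintegral in h.
  have fin := integrable_fin_num (@measurable_eball R n.+1 b) (iq b b0).
  have mE := @measurable_eball R n.+1 b.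
  have ip : leb.-integrable (eball b) (EFin \o funrpos q).
    by have := integrable_funepos mE (iq b b0); rewrite -funerpos.
  have inn : leb.-integrable (eball b) (EFin \o funrneg q).
    by have := integrable_funeneg mE (iq b b0); rewrite -funerneg.
  have fp := integrable_fin_num mE ip.
  have fn := integrable_fin_num mE inn.
  have : \int[leb]_(z in eball b) (funrpos q z - funrneg q z) = 0.
    rewrite -[RHS](q0 b b0); apply: eq_Rintegral => z _.
    by have := congr1 (fun h => h z) (funrposBneg q).
  rewrite RintegralB// => /eqP; rewrite subr_eq0 => /eqP.
  by rewrite /Rintegral => hh; rewrite -(fineK fp) -(fineK fn) hh.
have fin b : (m1 `]-oo, b[%classic < +oo)%E.
  rewrite [X in (X < _)%E](_ : _ = dp (eball b)); last by congr (dp _); rewrite -eE.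
  have [b0|b0] := leP b 0; first by rewrite eball_le0// measure0.
  have ip : leb.-integrable (eball b) (EFin \o funrpos q).
    by have := integrable_funepos (@measurable_eball R n.+1 b) (iq b b0); rewrite -funerpos.
  have [_] := integrableP _ _ _ ip; rewrite (_ : dp _ = (\int[leb]_(x in eball b) (funrpos q x)%:E)%E)//.
  by under eq_integral do rewrite /= ger0_norm ?funrpos_ge0//.
have m12 E : measurable E -> m1 E = m2 E.
  move=> mE.
  refine (@measure_unique _ R (measurableTypeR R) (@RGenInftyO.G R)
    (fun k => `]-oo, k%:R[%classic) _ _ _ _ m1 m2 _ _ E mE).
  - exact: RGenInftyO.measurableE.
  - move=> _ _ [x ->] [y ->]; exists (Num.min x y).
    by apply/seteqP; split => z /=; rewrite !in_itv/= lt_min; [move=> [-> ->]|move=> /andP[]].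
  - by move=> k; exists k%:R.
  - apply/seteqP; split => // x _; exists (Num.truncn x).+1 => //=.
    by rewrite in_itv/= truncnS_gt.
  - by move=> _ [x ->]; exact: Q.
  - by move=> k; exact: fin.
have mGE : measurable_fun setT (EFin \o G) by exact/measurable_EFinP.
have GE0 r : (0 <= (EFin \o G) r)%E by rewrite lee_fin.
have I12 : (\int[m1]_r (EFin \o G) r = \int[m2]_r (EFin \o G) r)%E.
  by apply: eq_measure_integral => // E mE _; exact: m12.
have mGe : measurable_fun setT (fun z => (G (enorm z))%:E).
  by apply/measurable_EFinP; exact: (measurableT_comp mG (@measurable_enorm R n.+1)).
have J1 : (\int[m1]_r (EFin \o G) r = \int[leb]_z ((G (enorm z))%:E * (funrpos q z)%:E))%E.
  rewrite -(ge0_integral_density leb mp (funrpos_ge0 q) mGe); last by move=> z; rewrite lee_fin.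
  by rewrite (ge0_integral_image (m1 := dp) (m2 := m1) me (fun E _ => erefl) mGE GE0).
have J2 : (\int[m2]_r (EFin \o G) r = \int[leb]_z ((G (enorm z))%:E * (funrneg q z)%:E))%E.
  rewrite -(ge0_integral_density leb mn (funrneg_ge0 q) mGe); last by move=> z; rewrite lee_fin.
  by rewrite (ge0_integral_image (m1 := dn) (m2 := m2) me (fun E _ => erefl) mGE GE0).
have E3 : (\int[leb]_z ((G (enorm z))%:E * (funrpos q z)%:E) =
  \int[leb]_z ((G (enorm z))%:E * (funrneg q z)%:E))%E by rewrite -J1 -J2.
have Ep : (\int[leb]_x ((EFin \o (fun z => (G (enorm z) * q z)%R))^\+ x) =
   \int[leb]_z ((G (enorm z))%:E * (funrpos q z)%:E))%E.
  by apply: eq_integral => z _; rewrite -EFinM funeposE /= -EFin_max /funrpos maxr_pMr// mulr0.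
have En : (\int[leb]_x ((EFin \o (fun z => (G (enorm z) * q z)%R))^\- x) =
   \int[leb]_z ((G (enorm z))%:E * (funrneg q z)%:E))%E.
  apply: eq_integral => z _.
  by rewrite -EFinM funenegE /= -EFin_max /funrneg maxr_pMr// mulr0 mulrN.
rewrite /Rintegral integralE Ep En E3 subee// -E3 -Ep.
exact: (integrable_fin_num measurableT (integrable_funepos measurableT iGq)).
Qed.

(** Integration by parts along the lines parallel to a coordinate axis. The
    weight is, on each line, a quadratic polynomial vanishing at both ends of
    the chord cut out by the ball, so there are no boundary terms. *)
Lemma ball_integration_by_parts (f df : 'rV[R]_n.+1 -> R) i b Bf Bdf :
  continuous f -> continuous df ->
  (forall y, is_derive y (delta_mx 0 i) (f : _ -> R^o) (df y)) ->
  (forall y, `|f y| <= Bf) -> (forall y, `|df y| <= Bdf) -> 0 < b ->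
  \int[leb]_(y in eball b) (y ord0 i * f y) =
  \int[leb]_(y in eball b) (df y * ((b ^+ 2 - enorm y ^+ 2) / 2)).
Proof.
move=> cf cdf dfE hf hdf b0.
have mf := continuous_measurable_rV cf.
have mdf := continuous_measurable_rV cdf.
have mB := @measurable_eball R n.+1 b.
have Bf0 : 0 <= Bf by exact: le_trans (hf 0).
have Bdf0 : 0 <= Bdf by exact: le_trans (hdf 0).
pose ind : 'rV[R]_n.+1 -> R := \1_(eball b).
have mind : measurable_fun setT ind by exact: measurable_indic.
pose g1 y := y ord0 i * f y * ind y.
pose g2 y := df y * ((b ^+ 2 - enorm y ^+ 2) / 2) * ind y.
have mkE (h : 'rV[R]_n.+1 -> R) : \int[leb]_(y in eball b) h y = \int[leb]_y (h y * ind y).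
  rewrite Rintegral_mkcond; apply: eq_Rintegral => y _.
  by rewrite patchE /ind indicE; case: (y \in _); rewrite ?mulr1 ?mulr0.
have mg1 : measurable_fun setT g1.
  apply: measurable_funM => //; apply: measurable_funM => //; exact: measurable_rV_coord.
have mg2 : measurable_fun setT g2.
  apply: measurable_funM => //; apply: measurable_funM => //; apply: measurable_funM => //.
  by apply: measurable_funB => //; apply: measurable_funX; exact: measurable_enorm.
have out y : b < `|y| -> ind y = 0.
  move=> yb; rewrite /ind indicE memNset// /eball/= => yb'.
  by have := lt_trans yb' yb; rewrite ltNge le_norm_enorm.
have ind_in y : ind y != 0 -> enorm y < b.
  by rewrite /ind indicE; have [/set_mem//|] := boolP (y \in _); rewrite eqxx.
have ind01 y : `|ind y| <= 1 by rewrite /ind indicE; case: (y \in _); rewrite ?normr1 ?normr0.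
have ig1 : leb.-integrable setT (EFin \o g1).
  apply: (supported_integrable mg1 (M := b) (B := b * Bf)).
    by move=> y yb; rewrite /g1 out ?mulr0.
  move=> y; rewrite /g1; have [->|/ind_in yb] := eqVneq (ind y) 0.
    by rewrite mulr0 normr0 mulr_ge0// ltW.
  rewrite normrM; apply: (@le_trans _ _ (`|y ord0 i * f y| * 1)); first by rewrite ler_wpM2l.
  rewrite mulr1 normrM ler_pM//; exact: le_trans (le_coord_enorm _ _) (ltW yb).
have ig2 : leb.-integrable setT (EFin \o g2).
  apply: (supported_integrable mg2 (M := b) (B := Bdf * b ^+ 2)).
    by move=> y yb; rewrite /g2 out ?mulr0.
  move=> y; rewrite /g2; have [->|/ind_in yb] := eqVneq (ind y) 0.
    by rewrite mulr0 normr0 mulr_ge0// sqr_ge0.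
  rewrite normrM; apply: (@le_trans _ _ (`|df y * ((b ^+ 2 - enorm y ^+ 2) / 2)| * 1)).
    by rewrite ler_wpM2l.
  rewrite mulr1 normrM ler_pM//.
  have h : enorm y ^+ 2 <= b ^+ 2 by rewrite lerXn2r ?nnegrE ?enorm_ge0 ?(ltW b0)// ltW.
  have h0 := sqr_ge0 (enorm y).
  by rewrite ger0_norm; clear -h h0; lra.
rewrite !mkE; apply/eqP; rewrite -subr_eq0 -RintegralB//; apply/eqP.
have ig : leb.-integrable setT (EFin \o (fun y => g1 y - g2 y)) by exact: (integrableB measurableT ig1 ig2).
rewrite /Rintegral [X in fine X](integral_insert_rV i ig).
rewrite [X in fine X]integral0_eq// => v _.
pose s2 := \sum_k v ord0 k ^+ 2.
pose p0 := insert_rV i (0, v).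
have insE (t : R) : insert_rV i (t, v) = p0 + t *: delta_mx 0 i.
  apply/rowP => j; rewrite /p0 /insert_rV !mxE /=.
  case: (unliftP i j) => [k|] ->; last by rewrite !eqxx/= mulr1 add0r.
  by rewrite [lift i k == i]eq_sym (negbTE (neq_lift i k)) mulr0 addr0.
have enE (t : R) : enorm (insert_rV i (t, v)) ^+ 2 = t ^+ 2 + s2.
  rewrite sqr_enorm (bigD1_ord i)//= insert_rV_eq/=; congr (_ + _).
  by apply: eq_bigr => k _; rewrite insert_rV_lift.
have [sb|sb] := leP (b ^+ 2) s2.
  rewrite integral0_eq// => t _; rewrite /g1 /g2/=.
  have -> : ind (insert_rV i (t, v)) = 0; last by rewrite !mulr0 subrr.
  apply/eqP/negPn/negP => /ind_in h.
  have : enorm (insert_rV i (t, v)) ^+ 2 < b ^+ 2.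
    by rewrite ltrXn2r ?nnegrE ?enorm_ge0 ?(ltW b0).
  by rewrite enE; have := sqr_ge0 t; clear -sb; lra.
pose c := Num.sqrt (b ^+ 2 - s2).
have c0 : 0 < c by rewrite sqrtr_gt0 subr_gt0.
have c2 : c ^+ 2 = b ^+ 2 - s2 by rewrite sqr_sqrtr// subr_ge0 ltW.
pose g (t : R) := f (p0 + t *: delta_mx 0 i).
pose dg (t : R) := df (p0 + t *: delta_mx 0 i).
have dgE (t : R) : is_derive t (1 : R) g (dg t).
  exact: (@is_derive_line R _ R^o f p0 (delta_mx 0 i) t).
have cline : continuous (fun t : R => p0 + t *: (delta_mx 0 i : 'rV[R]_n.+1)).
  by move=> t; apply: cvgD; [exact: cvg_cst|apply: cvgZr_tmp; exact: cvg_id].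
have cg : continuous g by move=> t; exact: (cvg_comp _ _ (cline t) (cf _)).
have cdg : continuous dg by move=> t; exact: (cvg_comp _ _ (cline t) (cdf _)).
pose phi (t : R) := t * g t - dg t * ((c ^+ 2 - t ^+ 2) / 2).
pose Phi (t : R) := - (g t * ((c ^+ 2 - t ^+ 2) / 2)).
have dPhi (t : R) : is_derive t (1 : R) Phi (phi t).
  pose w (t : R) := (c ^+ 2 - t ^+ 2) / 2.
  have dw : is_derive t (1:R) w (- t).
    rewrite (_ : w = (2^-1 : R) \*: (cst (c ^+ 2) - (@id R) ^+ 2)); last first.
      by apply/funext => r; rewrite /w /= -[RHS]/(2^-1 * (c ^+ 2 - r ^+ 2)) mulrC.
    have := is_deriveZ (2^-1 : R) (is_deriveB (is_derive_cst (c ^+ 2) t (1:R))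
      (is_deriveX 2 (is_derive_id t (1:R)))).
    move=> h; apply: is_derive_eq h _.
    rewrite -![_ *: _]/(_ * _) /=; by field.
  have h : is_derive t (1:R) Phi (- (g t *: (- t) + w t *: dg t)).
    exact: (is_deriveN (is_deriveM (dgE t) dw)).
  apply: is_derive_eq h _.
  by rewrite -![_ *: _]/(_ * _) /phi /w; ring.
have cphi : continuous phi.
  move=> t; apply: cvgB; first by apply: cvgM; [exact: cvg_id|exact: cg].
  apply: cvgM; first exact: cdg.
  apply: cvgMr_tmp; apply: cvgB; first exact: cvg_cst.
  exact: exprn_continuous.
transitivity (\int[lebesgue_measure]_(t in `](- c)%R, c[) (phi t)%:E)%E.
  rewrite [RHS]integral_mkcond; apply: eq_integral => t _.
  rewrite patchE /= /g1 /g2 mem_setE in_itv/= -ltr_norml.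
  have tc : (`|t| < c) = (enorm (insert_rV i (t, v)) < b).
    rewrite -(ltr_sqr (x := `|t|)) ?nnegrE ?(ltW c0)// real_normK ?num_real// c2.
    rewrite -(ltr_sqr (x := enorm _)) ?nnegrE ?enorm_ge0 ?(ltW b0)// enE.
    by rewrite ltrBrDr.
  rewrite /ind indicE; have [tcb|tcb] := boolP (`|t| < c).
    rewrite mem_set; last by rewrite /eball/= -tc.
    rewrite !mulr1 enE insert_rV_eq/= /phi /g /dg -insE c2; congr EFin.
    by congr (_ - _ * (_ / _)); ring.
  rewrite memNset ?mulr0 ?subrr// /eball/= -tc; exact/negP.
have cc : - c < c by rewrite gtrN.
rewrite -(@integral_itv_bndoo _ _ _ _ true false); last first.
  by apply/measurable_EFinP/measurable_funTS; exact: continuous_measurable_fun.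
rewrite (FTC2_derive cc dPhi cphi) /Phi sqrrN subrr mul0r !mulr0 subrr//.
Qed.

Lemma admissible_density_sub rho (P : pred R) : admissible_density rho ->
  measurable_fun setT P ->
  admissible_density (fun z => if P (enorm z) then rho z else 0).
Proof.
move=> [mr r0 ir] mP.
have mPe : measurable_fun setT (fun z => P (enorm z)).
  exact: (measurableT_comp mP (@measurable_enorm R n.+1)).
have mrP : measurable_fun setT (fun z => if P (enorm z) then rho z else 0).
  by apply: measurable_fun_ifT.
split=> //; first by move=> z; case: ifP.
apply: (le_integrable measurableT _ _ ir); first exact/measurable_EFinP.
by move=> z _ /=; rewrite lee_fin; case: ifP => // _; rewrite normr0.
Qed.

(** The test case for comparing kernels and densities: with polar coordinates
    the superposition can be computed, and it is the weight that occurs in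
    the integration by parts on the ball of radius [b]. *)
Lemma radial_kernel_quadratic b y : 0 < b -> y != 0 ->
  admissible_density (fun z => if enorm z < b then enorm z ^+ 2 else 0) /\
  radial_kernel (fun z => if enorm z < b then enorm z ^+ 2 else 0) y =
  if enorm y < b then n.+1%:R * ((b ^+ 2 - enorm y ^+ 2) / 2) else 0.
Proof.
move=> b0 y0; set rho := fun z => _.
have mr : measurable_fun setT rho.
  apply: measurable_fun_ifT => //; last by apply: measurable_funX; exact: measurable_enorm.
  by apply: measurable_fun_ltr => //; exact: measurable_enorm.
have ad : admissible_density rho.
  split=> //; first by move=> z; rewrite /rho; case: ifP => // _; exact: sqr_ge0.
  apply: (supported_integrable mr (M := b) (B := b ^+ 2)).
    by move=> z bz; rewrite /rho ltNge (le_trans (ltW bz) (le_norm_enorm z)).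
  move=> z; rewrite /rho; case: ifP => [zb|_]; last by rewrite normr0 sqr_ge0.
  by rewrite ger0_norm ?sqr_ge0// lerXn2r ?nnegrE ?enorm_ge0 ?(ltW b0)// ltW.
split=> //.
pose rhoh (r : R) := if r < b then r ^+ 2 else 0.
rewrite -(@mu_kernelE rho rhoh y ad)// /mu_kernel.
have ypos : 0 < enorm y by rewrite enorm_gt0.
have E (r : R) : n.+1%:R * rhoh r * \1_(eball r) y / r =
    if (enorm y < r) && (r < b) then n.+1%:R * r else 0.
  rewrite indicE /rhoh; have [yr|yr] := ltP (enorm y) r; last first.
    by rewrite memNset ?mulr0 ?mul0r// /eball/=; apply/negP; rewrite -leNgt.
  rewrite mem_set//= mulr1; case: ifP => _; last by rewrite mulr0 mul0r.
  by field; rewrite gt_eqF// (lt_trans ypos).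
transitivity (\int[lebesgue_measure]_(r in `]enorm y, b[) (n.+1%:R * r)).
  rewrite [LHS]Rintegral_mkcond [RHS]Rintegral_mkcond; apply: eq_Rintegral => r _.
  rewrite !patchE !mem_setE !in_itv/= andbT E.
  have [yr|yr] /= := ltP (enorm y) r; last by case: ifP.
  by rewrite (lt_trans ypos yr).
case: ltP => yb; last first.
  rewrite set_itv_ge ?Rintegral_set0// -leNgt bnd_simp//.
pose Phi (r : R) := n.+1%:R * (r ^+ 2 / 2).
have dPhi (r : R) : is_derive r (1:R) Phi (n.+1%:R * r).
  have h := is_deriveZ (n.+1%:R / 2 : R) (is_deriveX 2 (is_derive_id r (1:R))).
  have -> : Phi = (n.+1%:R / 2 : R) \*: ((@id R) ^+ 2).
    by apply/funext => t; rewrite /Phi /= -[RHS]/(_ * t ^+ 2); field.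
  apply: is_derive_eq h _; rewrite -![_ *: _]/(_ * _) /=; by field.
have cphi : continuous (fun r : R => n.+1%:R * r).
  by move=> r; apply: cvgMl_tmp; exact: cvg_id.
have F := FTC2_derive yb dPhi cphi.
rewrite /Rintegral -(@integral_itv_bndoo _ _ _ _ true false); last first.
  by apply/measurable_EFinP/measurable_funTS; exact: continuous_measurable_fun.
by rewrite [X in fine X]F /= /Phi; field.
Qed.

End radial_functions.

(** * Integration by parts against a radial density *)

Section radial_integration_by_parts.
Context {R : realType} {n : nat}.
Local Notation leb := (@lebesgue_rV R n.+1).
Local Notation omega := (@unit_ball_volume R n.+1).
Implicit Types (rho : 'rV[R]_n.+1 -> R) (x y z : 'rV[R]_n.+1).

Lemma measurable_section_integral (F : 'rV[R]_n.+1 * 'rV[R]_n.+1 -> \bar R) :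
  measurable_fun setT F -> measurable_fun setT (fun z => \int[leb]_y F (y, z))%E.
Proof.
move=> mF.
have h1 := @measurable_fun_fubini_tonelli_G _ _ _ _ R leb (funepos F)
  (measurable_funepos mF) (fun p => funepos_ge0 _ p).
have h2 := @measurable_fun_fubini_tonelli_G _ _ _ _ R leb (funeneg F)
  (measurable_funeneg mF) (fun p => funeneg_ge0 _ p).
rewrite (_ : (fun z => _) = (fun z => (\int[leb]_y (funepos F) (y, z) -
    \int[leb]_y (funeneg F) (y, z)))%E); first exact: emeasurable_funB.
apply/funext => z; rewrite integralE; congr (_ - _)%E.
  by apply: eq_integral => y _; rewrite !funeposE.
by apply: eq_integral => y _; rewrite !funenegE.
Qed.

Lemma Rintegral_off_point (g h : 'rV[R]_n.+1 -> R) :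
  measurable_fun setT g -> measurable_fun setT h ->
  (forall z, z != 0 -> g z = h z) -> \int[leb]_z g z = \int[leb]_z h z.
Proof.
move=> mg mh gh; rewrite /Rintegral; congr fine; apply: ae_eq_integral => //.
- exact/measurable_EFinP.
- exact/measurable_EFinP.
have N0 : {ae leb, forall z, z <> 0}.
  exists [set 0]; split; [exact: measurable_point0|exact: lebesgue_rV_point|].
  by move=> z /= /contrapT.
by apply: filterS N0 => z z0 _; rewrite gh//; apply/eqP.
Qed.

(** The divergence theorem on all centred balls at once. By [zero_mean_radial]
    it suffices to compare both sides for the densities [enorm z ^+ 2] cut
    off at radius [b]; for these the kernel is the weight of
    [ball_integration_by_parts]. *)
Lemma radial_integral_by_parts rho (rhoh : R -> R) (f df : 'rV[R]_n.+1 -> R) i d Bf Bdf :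
  admissible_density rho -> (forall z, rho z = rhoh (enorm z)) -> 0 < d ->
  (forall z, enorm z < d -> rho z = 0) ->
  continuous f -> continuous df ->
  (forall y, is_derive y (delta_mx 0 i) (f : _ -> R^o) (df y)) ->
  (forall y, `|f y| <= Bf) -> (forall y, `|df y| <= Bdf) ->
  leb.-integrable setT (EFin \o (fun z => rho z * enorm z ^- 2 * (z ord0 i * f z))) /\
  n.+1%:R * \int[leb]_z (rho z * enorm z ^- 2 * (z ord0 i * f z)) =
  \int[leb]_y (radial_kernel rho y * df y).
Proof.
move=> ar rE d0 rd cf cdf dfE hf hdf.
have [mr r0 ir] := ar.
have mf := continuous_measurable_rV cf.
have mdf := continuous_measurable_rV cdf.
have Bf0 : 0 <= Bf by exact: le_trans (hf 0).
have bE (r : 'rV[R]_n.+1 -> R) y z :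
    ball_density r y z = r z * ball_density (fun=> 1) y z.
  by rewrite /ball_density; case: ifP => _; rewrite ?mulr0//; ring.
pose m z := \int[leb]_y (ball_density (fun=> 1) y z * df y).
have mE (r : 'rV[R]_n.+1 -> R) z : 
    \int[leb]_y (ball_density r y z * df y) = r z * m z.
  have ib : leb.-integrable setT (EFin \o (fun y => ball_density (fun=> 1) y z)).
    have mb : measurable_fun setT (fun y => ball_density (fun=> (1 : R)) y z).
      exact: (measurableT_comp (measurable_ball_density (@measurable_cst _ _ 'rV[R]_n.+1 R setT 1))
        (pair2_measurable z)).
    apply/integrableP; split; first exact/measurable_EFinP.
    under eq_integral do rewrite /= ger0_norm ?ball_density_ge0//.
    exact: le_lt_trans (integral_ball_density_le z (fun=> ler01)) (ltry _).
  rewrite /m -RintegralZl//; last exact: integrable_mul_bounded ib mdf hdf.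
  by apply: eq_Rintegral => y _; rewrite bE mulrA.
have mm : measurable_fun setT m.
  have h := @measurable_section_integral
    (fun p => (ball_density (fun=> 1) p.1 p.2 * df p.1)%:E).
  apply: (measurableT_comp (f := @fine R)) => //; apply: h.
  apply/measurable_EFinP; apply: measurable_funM.
    exact: (measurable_ball_density (@measurable_cst _ _ 'rV[R]_n.+1 R setT 1)).
  exact: (measurableT_comp mdf (@measurable_fst _ _ 'rV[R]_n.+1 'rV[R]_n.+1)).
have men := @measurable_enorm R n.+1.
pose q1 z := n.+1%:R * (z ord0 i * f z).
pose q2 z := enorm z ^+ 2 * m z.
have mq1 : measurable_fun setT q1.
  apply: measurable_funM => //; apply: measurable_funM => //; exact: measurable_rV_coord.
have mq2 : measurable_fun setT q2.
  by apply: measurable_funM => //; exact: measurable_funX.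
have iq1 b : 0 < b -> leb.-integrable (eball b) (EFin \o q1).
  move=> b0; have mB := @measurable_eball R n.+1 b.
  have i1 : leb.-integrable (eball b) (EFin \o (fun=> n.+1%:R * (b * Bf))).
    apply/integrableP; split; first exact: measurable_cst.
    by rewrite /= integral_cst// lte_mul_pinfty ?eball_volume_fin.
  apply: (le_integrable mB _ _ i1); first by apply/measurable_EFinP/measurable_funTS.
  move=> z zb /=; rewrite lee_fin /q1 normrM ger0_norm// (ger0_norm (x := _ * (b * Bf))).
    rewrite ler_wpM2l// normrM ler_pM//.
    exact: le_trans (le_coord_enorm _ _) (ltW zb).
  by rewrite !mulr_ge0// ltW.
pose rb b z : R := if enorm z < b then enorm z ^+ 2 else 0.
have arb b : 0 < b -> admissible_density (rb b).
  move=> b0; pose e : 'rV[R]_n.+1 := delta_mx 0 ord0.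
  have e0 : e != 0 by rewrite -enorm_eq0 -[e]scale1r enorm_delta normr1 oner_eq0.
  by have [] := radial_kernel_quadratic b0 e0.
have q2E b : 0 < b -> q2 \_ (eball b) = fun z => \int[leb]_y (ball_density (rb b) y z * df y).
  move=> b0; apply/funext => z; rewrite mE patchE /rb.
  have [zb|zb] := ltP (enorm z) b; first by rewrite mem_set.
  by rewrite memNset ?mul0r// /eball/=; apply/negP; rewrite -leNgt.
have iq2 b : 0 < b -> leb.-integrable (eball b) (EFin \o q2) /\
    \int[leb]_(z in eball b) q2 z = \int[leb]_y (radial_kernel (rb b) y * df y).
  move=> b0; have [E I] := integral_radial_kernel_mul (arb b b0) mdf hdf; split.
    apply/(integrable_mkcond _ (@measurable_eball R n.+1 b)).
    rewrite (_ : _ \_ _ = EFin \o (q2 \_ (eball b))); last first.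
      by apply/funext => z; rewrite /= !patchE; case: ifP.
    by rewrite q2E.
  by rewrite Rintegral_mkcond q2E.
pose q z := q1 z - q2 z.
have mq : measurable_fun setT q by exact: measurable_funB.
have iq b : 0 < b -> leb.-integrable (eball b) (EFin \o q).
  move=> b0; have [h _] := iq2 b b0.
  exact: (integrableB (@measurable_eball R n.+1 b) (iq1 b b0) h).
have q0 b : 0 < b -> \int[leb]_(z in eball b) q z = 0.
  move=> b0; have [h hE] := iq2 b b0; have mB := @measurable_eball R n.+1 b.
  rewrite /q RintegralB//; last exact: iq1.
  have mxf : measurable_fun setT (fun z : 'rV[R]_n.+1 => z ord0 i * f z).
    by apply: measurable_funM => //; exact: measurable_rV_coord.
  have ixf : leb.-integrable (eball b) (EFin \o (fun z : 'rV[R]_n.+1 => z ord0 i * f z)).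
    have := integrableZl mB (n.+1%:R^-1) (iq1 b b0).
    apply: eq_integrable => // z _ /=; rewrite -EFinM; congr EFin.
    by rewrite /q1 mulKf// pnatr_eq0.
  rewrite /q1 RintegralZl// (ball_integration_by_parts cf cdf dfE hf hdf b0) hE.
  apply/eqP; rewrite subr_eq0; apply/eqP.
  have arbb := arb b b0.
  transitivity (\int[leb]_y ((if enorm y < b then n.+1%:R * ((b ^+ 2 - enorm y ^+ 2) / 2) else 0) * df y)).
    have mw : measurable_fun setT (fun y => df y * ((b ^+ 2 - enorm y ^+ 2) / 2)).
      apply: measurable_funM => //; apply: measurable_funM => //.
      by apply: measurable_funB => //; exact: measurable_funX.
    have iw : leb.-integrable (eball b) (EFin \o (fun y => df y * ((b ^+ 2 - enorm y ^+ 2) / 2))).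
      have Bdf0 : 0 <= Bdf by exact: le_trans (hdf 0).
      have i1 : leb.-integrable (eball b) (EFin \o (fun=> Bdf * b ^+ 2)).
        apply/integrableP; split; first exact: measurable_cst.
        by rewrite /= integral_cst// lte_mul_pinfty ?eball_volume_fin.
      apply: (le_integrable mB _ _ i1); first by apply/measurable_EFinP/measurable_funTS.
      have B2 : 0 <= Bdf * b ^+ 2 by apply: mulr_ge0 => //; exact: sqr_ge0.
      move=> z zb /=; rewrite lee_fin normrM (ger0_norm B2).
      rewrite ler_pM//.
      have h1 : enorm z ^+ 2 <= b ^+ 2 by rewrite lerXn2r ?nnegrE ?enorm_ge0 ?(ltW b0)// ltW.
      have h0 := sqr_ge0 (enorm z).
      by rewrite ger0_norm; clear -h1 h0; lra.
    rewrite -(RintegralZl n.+1%:R mB iw) Rintegral_mkcond; apply: eq_Rintegral => y _.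
    rewrite patchE; have [yb|yb] := ltP (enorm y) b; first by rewrite mem_set//; ring.
    by rewrite memNset ?mul0r// /eball/=; apply/negP; rewrite -leNgt.
  apply: Rintegral_off_point.
  - apply: measurable_funM => //; apply: measurable_fun_ifT => //.
      exact: measurable_fun_ltr.
    apply: measurable_funM => //; apply: measurable_funM => //.
    by apply: measurable_funB => //; exact: measurable_funX.
  - by apply: measurable_funM => //; exact: measurable_radial_kernel.
  - by move=> y y0; have [_ ->] := radial_kernel_quadratic b0 y0.
pose h (r : R) := rho (r *: delta_mx 0 ord0).
have hE z : h (enorm z) = rho z by rewrite /h !rE enorm_delta ger0_norm// enorm_ge0.
have mh : measurable_fun setT h by exact: (measurableT_comp mr (measurable_scale_delta ord0)).
pose G (r : R) := h r * (r `^ (-1)) ^+ 2.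
have mG : measurable_fun setT G.
  by apply: measurable_funM => //; apply: measurable_funX; exact: measurable_powR.
have G0 r : 0 <= G r by rewrite mulr_ge0 ?sqr_ge0// /h.
have GE z : G (enorm z) = rho z * enorm z ^- 2.
  by rewrite /G hE powR_inv1 ?enorm_ge0// exprVn.
have rz z : rho z != 0 -> d <= enorm z.
  by move=> rz0; rewrite leNgt; apply/negP => /rd rz'; rewrite rz' eqxx in rz0.
pose F1 z := rho z * enorm z ^- 2 * (z ord0 i * f z).
have mF1 : measurable_fun setT F1.
  apply: measurable_funM; last by apply: measurable_funM => //; exact: measurable_rV_coord.
  have := measurableT_comp mG men; congr (measurable_fun _ _).
  by apply/funext => z; exact: GE.
have iF1 : leb.-integrable setT (EFin \o F1).
  have iB : leb.-integrable setT (fun z => (d^-1 * Bf)%:E * (EFin \o rho) z)%E by exact: integrableZl.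
  apply: (le_integrable measurableT _ _ iB); first exact/measurable_EFinP.
  move=> z _ /=; rewrite lee_fin /F1.
  have [->|/rz dz] := eqVneq (rho z) 0; first by rewrite !mul0r mulr0 normr0.
  have z0 : 0 < enorm z by exact: lt_le_trans dz.
  have h1 : `|enorm z ^- 2| * `|z ord0 i| <= `|d^-1|.
    have z20 : 0 <= enorm z ^- 2 by rewrite invr_ge0 sqr_ge0.
    have dV0 : 0 <= d^-1 by rewrite invr_ge0 ltW.
    rewrite (ger0_norm z20) (ger0_norm dV0).
    apply: (@le_trans _ _ (enorm z ^- 2 * enorm z)); first by rewrite ler_wpM2l ?le_coord_enorm.
    rewrite expr2 invfM -mulrA mulVf ?mulr1 ?gt_eqF//.
    by rewrite lef_pV2 ?posrE.
  have h2 : `|f z| <= `|Bf| by rewrite (ger0_norm Bf0).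
  rewrite !normrM [leRHS]mulrC -[leLHS]mulrA ler_wpM2l// mulrA.
  by apply: ler_pM => //; exact: mulr_ge0.
have [KE iK] := integral_radial_kernel_mul ar mdf hdf.
have EG z : G (enorm z) * q z = n.+1%:R * F1 z - \int[leb]_y (ball_density rho y z * df y).
  rewrite mE GE /q mulrBr; congr (_ - _); first by rewrite /q1 /F1; ring.
  have [->|/rz dz] := eqVneq (rho z) 0; first by rewrite !mul0r.
  by rewrite /q2; field; rewrite gt_eqF// (lt_le_trans d0).
have iGq : leb.-integrable setT (EFin \o (fun z => G (enorm z) * q z)).
  rewrite (_ : _ \o _ = EFin \o (fun z => n.+1%:R * F1 z - \int[leb]_y (ball_density rho y z * df y))).
    exact: (integrableB measurableT (integrableZl measurableT n.+1%:R iF1) iK).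
  by apply/funext => z; rewrite /= EG.
have Z := zero_mean_radial mq iq q0 mG G0 iGq.
split=> //; apply/eqP; rewrite KE -subr_eq0 -Z; apply/eqP.
rewrite -RintegralZl// -RintegralB//; last exact: (integrableZl measurableT n.+1%:R iF1).
by apply: eq_Rintegral => z _; rewrite EG.
Qed.

End radial_integration_by_parts.

(** * Inner product spaces and vector-valued test functions *)

Section scalars_as_inner_space.
Context {R : realType}.

Lemma scalar_innerC (u v : R^o) : (u : R) * v = (v : R) * u.
Proof. exact: mulrC. Qed.

Lemma scalar_inner_linearl (a : R) (u v w : R^o) :
  ((a *: u + v : R^o) : R) * w = a * ((u : R) * w) + (v : R) * w.
Proof. by rewrite -[a *: u]/(a * u) mulrDl mulrA. Qed.

Lemma scalar_norm_inner (v : R^o) : `|v| ^+ 2 = (v : R) * v.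
Proof. by rewrite real_normK ?num_real// expr2. Qed.

End scalars_as_inner_space.

HB.instance Definition _ (R : realType) := NormedVector_isInner.Build R R^o
  scalar_innerC scalar_inner_linearl scalar_norm_inner.

Section inner_space.
Context {R : realType} {X : innerVectType R}.
Implicit Types u v w : X.

Lemma innerDl u v w : inner (u + v) w = inner u w + inner v w.
Proof. by rewrite -[u]scale1r inner_linearl mul1r scale1r. Qed.

Lemma innerZl (a : R) u w : inner (a *: u) w = a * inner u w.
Proof. by rewrite -[a *: u]addr0 inner_linearl inner0l addr0. Qed.

Lemma innerDr u v w : inner w (u + v) = inner w u + inner w v.
Proof. by rewrite innerC innerDl !(innerC _ w). Qed.

Lemma innerZr (a : R) u w : inner w (a *: u) = a * inner w u.
Proof. by rewrite innerC innerZl innerC. Qed.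

Lemma innerNl u w : inner (- u) w = - inner u w.
Proof. by rewrite -scaleN1r innerZl mulN1r. Qed.

Lemma innerBl u v w : inner (u - v) w = inner u w - inner v w.
Proof. by rewrite innerDl innerNl. Qed.

Lemma innerBr u v w : inner w (u - v) = inner w u - inner w v.
Proof. by rewrite innerC innerBl !(innerC _ w). Qed.

Lemma inner_sumr (I : Type) (r : seq I) (c : I -> R) (f : I -> X) v :
  inner v (\sum_(i <- r) c i *: f i) = \sum_(i <- r) c i * inner v (f i).
Proof. by rewrite innerC inner_suml; apply: eq_bigr => i _; rewrite innerC. Qed.

Lemma cauchy_schwarz u v : `|inner u v| <= `|u| * `|v|.
Proof.
have [->|v0] := eqVneq v 0; first by rewrite innerC inner0l !normr0 mulr0.
have vp : 0 < `|v| ^+ 2 by rewrite exprn_gt0// normr_gt0.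
rewrite -ler_sqr ?nnegrE ?mulr_ge0// real_normK ?num_real// exprMn.
pose t := inner u v / `|v| ^+ 2.
have : 0 <= `|u - t *: v| ^+ 2 by exact: sqr_ge0.
rewrite norm_inner innerBl !innerBr !innerZl !innerZr -!norm_inner (innerC v u).
rewrite (_ : _ - _ - _ = `|u| ^+ 2 - inner u v ^+ 2 / `|v| ^+ 2); last first.
  by rewrite /t; field; rewrite normr_eq0.
by rewrite subr_ge0 ler_pdivrMr.
Qed.

Local Notation b := (vbasis {:X}).

Lemma coord_decomposition v : v = \sum_k coord b k v *: b`_k.
Proof. exact: coord_vbasis (memvf v). Qed.

(** The basis need not be orthonormal: [dual_basis k] represents the
    [k]-th coordinate as an inner product. *)
Definition dual_basis (k : 'I_(\dim {:X})) : X :=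
  adjoint (linfun (coord b k : X -> R^o)) (1 : R^o).

Lemma inner_dual_basis k v : inner (dual_basis k) v = coord b k v.
Proof.
rewrite innerC -adjointP lfunE/= -[LHS]/(coord b k v * 1).
by rewrite mulr1.
Qed.

Lemma coord_bound k v : `|coord b k v| <= `|dual_basis k| * `|v|.
Proof. by rewrite -inner_dual_basis cauchy_schwarz. Qed.

Lemma coord_sum_basis (c : 'I_(\dim {:X}) -> R) k :
  coord b k (\sum_j c j *: b`_j) = c k.
Proof. by rewrite coord_sum_free//; exact: (basis_free (vbasisP _)). Qed.

Lemma coord_inj u v : (forall k, coord b k u = coord b k v) -> u = v.
Proof.
move=> uv; rewrite (coord_decomposition u) (coord_decomposition v).
by apply: eq_bigr => k _; rewrite uv.
Qed.

Lemma norm_le_coord v : `|v| <= \sum_k `|coord b k v| * `|b`_k|.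
Proof.
rewrite {1}(coord_decomposition v); apply: (le_trans (ler_norm_sum _ _ _)).
by apply: ler_sum => k _; rewrite normrZ.
Qed.

Lemma inner_coord u v :
  inner u v = \sum_(k < \dim {:X}) inner u b`_k * coord b k v.
Proof.
rewrite {1}(coord_decomposition v) inner_sumr.
by apply: eq_bigr => k _; rewrite mulrC.
Qed.

Lemma inner_prescribed (c : 'I_(\dim {:X}) -> R) :
  let f := \sum_k c k *: dual_basis k in
  forall k : 'I_(\dim {:X}), inner f b`_k = c k.
Proof.
move=> f k; rewrite /f inner_suml (bigD1 k)//= big1 ?addr0.
  rewrite inner_dual_basis (_ : b`_k = \sum_j (j == k)%:R *: b`_j).
    by rewrite coord_sum_basis eqxx mulr1.
  rewrite (bigD1 k)//= eqxx scale1r big1 ?addr0// => j jk.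
  by rewrite (negbTE jk) scale0r.
move=> j jk; rewrite inner_dual_basis (_ : b`_k = \sum_i (i == k)%:R *: b`_i).
  by rewrite coord_sum_basis (negbTE jk) mulr0.
rewrite (bigD1 k)//= eqxx scale1r big1 ?addr0// => i ik.
by rewrite (negbTE ik) scale0r.
Qed.

End inner_space.

Section linear_maps.
Context {R : realType} {X Y : innerVectType R}.

Lemma lfun_bound (L : 'Hom(X, Y)) : exists2 C, 0 <= C & forall v, `|L v| <= C * `|v|.
Proof.
exists (\sum_(k < \dim {:X}) `|dual_basis k| * `|L (vbasis {:X})`_k|).
  by apply: sumr_ge0 => k _; exact: mulr_ge0.
move=> v; rewrite {1}(coord_decomposition v) linear_sum/=.
apply: (le_trans (ler_norm_sum _ _ _)); rewrite mulr_suml; apply: ler_sum => k _.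
by rewrite linearZ/= normrZ mulrAC ler_wpM2r// coord_bound.
Qed.

Lemma lfun_continuous (L : 'Hom(X, Y)) : continuous L.
Proof.
have [C C0 hC] := lfun_bound L => v.
suff H e : 0 < e -> \forall z \near v, `|L v - L z| <= e by have /cvgrPdist_le := H.
move=> e0; have C1 : 0 < C + 1 by rewrite ltr_wpDl.
have : \forall z \near v, `|v - z| < e / (C + 1).
  by apply/nbhs_ballP; exists (e / (C + 1)) => /=; [rewrite divr_gt0|move=> z; rewrite -ball_normE].
apply: filterS => z zv; rewrite -linearB; apply: (le_trans (hC _)).
apply: (@le_trans _ _ ((C + 1) * (e / (C + 1)))).
  by rewrite ler_pM ?(ltW zv)// lerDl.
by rewrite mulrC mulfVK// gt_eqF.
Qed.

End linear_maps.

Section vector_test_functions.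
Context {R : realType} {n : nat}.

Lemma test_function_lfun (X Y : innerVectType R) (L : 'Hom(X, Y)) (u : 'rV[R]_n -> X) :
  test_function u -> test_function (L \o u).
Proof.
move=> tu; have [M _ hM] := test_function_support tu; have [su _] := tu.
split; first by apply: smooth_linear => //; exact: lfun_continuous.
by apply/compact_tsupportP; exists M => x xM; rewrite /= hM// linear0.
Qed.

Lemma iter_partial_lfun (X Y : innerVectType R) (L : 'Hom(X, Y)) s (u : 'rV[R]_n -> X) :
  smooth u -> iter_partial s (L \o u) = L \o iter_partial s u.
Proof. by apply: iter_partial_linear; exact: lfun_continuous. Qed.

Lemma test_function_sum (X : normedModType R) (I : Type) (r : seq I)
    (F : I -> 'rV[R]_n -> X) : (forall k, test_function (F k)) ->
  test_function (fun x => \sum_(k <- r) F k x).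
Proof.
move=> tF; split; first by apply: smooth_sum => k; have [] := tF k.
apply/compact_tsupportP; elim: r => [|k r [M hM]].
  by exists 0 => x _; rewrite big_nil.
have [N _ hN] := test_function_support (tF k).
exists (Num.max M N) => x; rewrite gt_max => /andP[xM xN].
by rewrite big_cons hN// add0r hM.
Qed.

Lemma test_function_diff_op (X Y : innerVectType R) (B : 'I_n -> 'Hom(X, Y)) u :
  test_function u -> test_function (diff_op B u).
Proof.
move=> tu; apply: test_function_sum => i.
exact: (test_function_lfun (B i) (test_function_partial i tu)).
Qed.

Section convolution_vector.
Context {X : innerVectType R}.
Local Notation b := (vbasis {:X}).
Local Notation leb := (@lebesgue_rV R n).
Implicit Types (k : 'rV[R]_n -> R) (u : 'rV[R]_n -> X).

(** Coordinate functions, by which the statements on vector-valued functions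
    reduce to scalar ones; [cmpE] presents them as compositions with linear
    maps, which commute with derivatives. *)
Definition cmp (j : 'I_(\dim {:X})) u : 'rV[R]_n -> R^o := fun x => coord b j (u x).

Definition coordL (j : 'I_(\dim {:X})) : 'Hom(X, R^o) := linfun (coord b j : X -> R^o).

Lemma coordLE j v : coordL j v = coord b j v.
Proof. by rewrite lfunE. Qed.

Lemma cmpE j u : cmp j u = coordL j \o u.
Proof. by apply/funext => x; rewrite /= coordLE. Qed.

Lemma test_function_cmp j u : test_function u -> test_function (cmp j u).
Proof. by rewrite cmpE; exact: test_function_lfun. Qed.

Lemma convolutionE k u x :
  convolution k u x = \sum_(j < \dim {:X}) sconv k (cmp j u) x *: b`_j.
Proof.
rewrite /convolution /vector_integral; apply: eq_bigr => j _; congr (_ *: _).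
by apply: eq_Rintegral => y _; rewrite linearZ.
Qed.

Lemma cmp_convolution k u j : cmp j (convolution k u) = sconv k (cmp j u).
Proof.
by apply/funext => x; rewrite /cmp convolutionE coord_sum_basis.
Qed.

Lemma scale_basis_linear (v : X) : linear (fun r : R^o => (r : R) *: v).
Proof. by move=> a r s; rewrite scalerDl scalerA. Qed.

(** Multiples of a fixed vector, as a linear map, so that scalar functions
    are turned into vector-valued ones by composition. *)
Definition scale_basis (v : X) : 'Hom(R^o, X) :=
  linfun (HB.pack_for {linear R^o -> X} (fun r : R^o => (r : R) *: v)
    (GRing.isLinear.Build R R^o X *:%R _ (scale_basis_linear v))).

Lemma scale_basisE (v : X) (r : R^o) : scale_basis v r = r *: v.
Proof. by rewrite lfunE. Qed.

Lemma convolution_sum k u : convolution k u =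
  fun x => \sum_(j < \dim {:X}) (scale_basis b`_j \o (sconv k (cmp j u) : 'rV[R]_n -> R^o)) x.
Proof.
apply/funext => x; rewrite convolutionE.
by apply: eq_bigr => j _; rewrite /= scale_basisE.
Qed.

Lemma smooth_convolution k u : leb.-integrable setT (EFin \o k) ->
  test_function u -> smooth (convolution k u).
Proof.
move=> ik tu; rewrite convolution_sum; apply: smooth_sum => j.
apply: smooth_linear; first exact: lfun_continuous.
exact: (smooth_sconv ik (test_function_cmp j tu)).
Qed.

Lemma iter_partial_convolution k u s : leb.-integrable setT (EFin \o k) ->
  test_function u -> iter_partial s (convolution k u) = convolution k (iter_partial s u).
Proof.
move=> ik tu; have [su _] := tu; rewrite !convolution_sum iter_partial_sum; last first.
  move=> j; apply: smooth_linear; first exact: lfun_continuous.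
  exact: (smooth_sconv ik (test_function_cmp j tu)).
apply/funext => x; apply: eq_bigr => j _.
rewrite iter_partial_lfun; last exact: (smooth_sconv ik (test_function_cmp j tu)).
rewrite /= (iter_partial_sconv s ik (test_function_cmp j tu)); congr (scale_basis _ (sconv _ _ _)).
by rewrite !cmpE iter_partial_lfun.
Qed.

Lemma convolution_support k u N M : (forall x, N < `|x| -> k x = 0) ->
  supported_in_ball u M -> supported_in_ball (convolution k u) (N + M).
Proof.
move=> hk hM x xNM; rewrite convolutionE big1// => j _.
rewrite (sconv_support hk (M := M)) ?scale0r// => y yM.
by rewrite /cmp hM// linear0.
Qed.

Lemma test_function_convolution k u N : leb.-integrable setT (EFin \o k) ->
  (forall x, N < `|x| -> k x = 0) -> test_function u -> test_function (convolution k u).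
Proof.
move=> ik hk tu; have [M _ hM] := test_function_support tu; split.
  exact: smooth_convolution.
by apply/compact_tsupportP; exists (N + M); exact: convolution_support.
Qed.

End convolution_vector.

(** Both sides are linear in the coordinates of [u]. *)
Lemma lfun_convolution (X Y : innerVectType R) (L : 'Hom(X, Y)) k (u : 'rV[R]_n -> X) x :
  (lebesgue_rV n).-integrable setT (EFin \o k) -> test_function u ->
  L (convolution k u x) = convolution k (L \o u) x.
Proof.
move=> ik tu; apply: coord_inj => j.
rewrite -[RHS]/(cmp j (convolution k (L \o u)) x) cmp_convolution convolutionE linear_sum linear_sum/=.
pose a (i : 'I_(\dim {:X})) := coord (vbasis {:Y}) j (L (vbasis {:X})`_i).
have E : cmp j (L \o u) = fun x => \sum_i a i * cmp i u x.
  apply/funext => y; rewrite /cmp/= {1}(coord_decomposition (u y)) !linear_sum/=.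
  by apply: eq_bigr => i _; rewrite !linearZ/= /a -[LHS]/(_ * _) mulrC.
rewrite E /sconv.
transitivity (\sum_i a i * sconv k (cmp i u) x).
  by apply: eq_bigr => i _; rewrite !linearZ/= -[LHS]/(_ * _) mulrC.
have ix i : (lebesgue_rV n).-integrable setT (EFin \o (fun y => k y * cmp i u (x - y))).
  have [_ mf [B _ hB] _] := test_function_facts (test_function_cmp i tu).
  exact: integrable_conv_integrand ik mf hB.
transitivity (\int[lebesgue_rV n]_y (\sum_i a i * (k y * cmp i u (x - y)))).
  rewrite /sconv; elim: (index_enum _) => [|i r IH].
    rewrite big_nil (@eq_Rintegral _ _ _ _ _ (cst 0)) ?/Rintegral ?integral0// => y _.
    by rewrite big_nil.
  rewrite big_cons IH -RintegralZl// -RintegralD//.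
  - by apply: eq_Rintegral => y _; rewrite big_cons.
  - exact: (integrableZl measurableT _ (ix i)).
  - elim: r {IH} => [|i' r IH].
      rewrite (_ : _ \o _ = cst 0%E); first exact: integrable0.
      by apply/funext => y; rewrite /= big_nil.
    rewrite (_ : _ \o _ = EFin \o (fun y => a i' * (k y * cmp i' u (x - y)) +
        \sum_(i <- r) a i * (k y * cmp i u (x - y)))); last first.
      by apply/funext => y; rewrite /= big_cons.
    exact: (integrableD measurableT (integrableZl measurableT _ (ix i')) IH).
apply: eq_Rintegral => y _; rewrite mulr_sumr; apply: eq_bigr => i _; ring.
Qed.

Lemma convolutionD (X : innerVectType R) k (u v : 'rV[R]_n -> X) :
  (lebesgue_rV n).-integrable setT (EFin \o k) -> test_function u -> test_function v ->
  convolution k (fun x => u x + v x) = fun x => convolution k u x + convolution k v x.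
Proof.
move=> ik tu tv; apply/funext => x; apply: coord_inj => j.
rewrite linearD/= -![coord _ j (convolution _ _ _)]/(cmp j (convolution _ _) x) !cmp_convolution.
have [_ mf [B _ hB] _] := test_function_facts (test_function_cmp j tu).
have [_ mg [B' _ hB'] _] := test_function_facts (test_function_cmp j tv).
have := sconv_lin 1 1 ik mf hB mg hB' => /(congr1 (@^~ x)); rewrite !mul1r => <-.
apply: eq_Rintegral => y _; congr (_ * _).
by rewrite /cmp linearD !mul1r.
Qed.

Lemma convolution0 (X : innerVectType R) k :
  convolution k (fun _ : 'rV[R]_n => 0 : X) = fun=> 0.
Proof.
apply/funext => x; rewrite convolutionE big1// => j _.
rewrite /sconv (@eq_Rintegral _ _ _ _ _ (cst 0)); first by rewrite /Rintegral integral0 scale0r.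
by move=> y _; rewrite /cmp linear0 mulr0.
Qed.

Lemma test_function_cst0 (X : innerVectType R) : test_function (fun _ : 'rV[R]_n => 0 : X).
Proof. by split; [exact: smooth_cst|apply/compact_tsupportP; exists 0]. Qed.

Lemma diff_op_convolution (X Y : innerVectType R) (B : 'I_n -> 'Hom(X, Y)) k
    (u : 'rV[R]_n -> X) : (lebesgue_rV n).-integrable setT (EFin \o k) ->
  test_function u -> diff_op B (convolution k u) = convolution k (diff_op B u).
Proof.
move=> ik tu; apply/funext => x; rewrite /diff_op.
transitivity (\sum_i convolution k (B i \o partial i u) x).
  apply: eq_bigr => i _.
  rewrite -(lfun_convolution (B i) x ik (test_function_partial i tu)).
  by have := iter_partial_convolution [:: i] ik tu => /= ->.
elim: (index_enum _) => [|i r IH].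
  rewrite big_nil -[LHS]/((fun=> 0) x) -(convolution0 Y k); congr (convolution k _ x).
  by apply/funext => y; rewrite big_nil.
rewrite big_cons IH -[LHS]/((fun x => convolution k (B i \o partial i u) x + _ x) x).
rewrite -convolutionD//.
- by congr (convolution k _ x); apply/funext => y; rewrite big_cons.
- exact: (test_function_lfun (B i) (test_function_partial i tu)).
- apply: test_function_sum => j.
  exact: (test_function_lfun (B j) (test_function_partial j tu)).
Qed.

End vector_test_functions.

(** * Truncated densities *)

Section kernel_dependence.
Context {R : realType} {n : nat}.
Local Notation leb := (@lebesgue_rV R n).
Implicit Types k : 'rV[R]_n -> R.

Lemma sconvDk k1 k2 (f : 'rV[R]_n -> R) B : leb.-integrable setT (EFin \o k1) ->
  leb.-integrable setT (EFin \o k2) -> measurable_fun setT f -> (forall x, `|f x| <= B) ->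
  sconv (fun y => k1 y + k2 y) f = fun x => sconv k1 f x + sconv k2 f x.
Proof.
move=> i1 i2 mf hf; apply/funext => x; rewrite /sconv.
have j1 := integrable_conv_integrand x i1 mf hf.
have j2 := integrable_conv_integrand x i2 mf hf.
by rewrite -RintegralD//; apply: eq_Rintegral => y _; rewrite mulrDl.
Qed.

Lemma convolutionDk (X : innerVectType R) k1 k2 (u : 'rV[R]_n -> X) :
  leb.-integrable setT (EFin \o k1) -> leb.-integrable setT (EFin \o k2) ->
  test_function u -> convolution (fun y => k1 y + k2 y) u =
  fun x => convolution k1 u x + convolution k2 u x.
Proof.
move=> i1 i2 tu; apply/funext => x; apply: coord_inj => j.
rewrite linearD/= -![coord _ j (convolution _ _ _)]/(cmp j (convolution _ _) x) !cmp_convolution.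
have [_ mf [B _ hB] _] := test_function_facts (test_function_cmp j tu).
by rewrite (sconvDk i1 i2 mf hB).
Qed.

Lemma convolution_bound (X : innerVectType R) (u : 'rV[R]_n -> X) : test_function u ->
  exists2 C, 0 <= C & forall k, leb.-integrable setT (EFin \o k) ->
    forall x, `|convolution k u x| <= C * \int[leb]_y `|k y|.
Proof.
move=> tu.
have hB j : exists B, 0 <= B /\ forall x, `|cmp j u x| <= B.
  by have [_ _ [B B0 h] _] := test_function_facts (test_function_cmp j tu); exists B.
have [B hB'] := choice hB.
exists (\sum_(j < \dim {:X}) B j * `|(vbasis {:X})`_j|).
  by apply: sumr_ge0 => j _; apply: mulr_ge0 => //; case: (hB' j).
move=> k ik x; apply: (le_trans (norm_le_coord _)); rewrite mulr_suml.
apply: ler_sum => j _; rewrite mulrAC ler_wpM2r//.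
rewrite -[coord _ j _]/(cmp j (convolution _ _) x) cmp_convolution.
have [_ mf _ _] := test_function_facts (test_function_cmp j tu).
by apply: sconv_bound => //; case: (hB' j).
Qed.

End kernel_dependence.

Section truncated_densities.
Context {R : realType} {n : nat}.
Local Notation leb := (@lebesgue_rV R n.+1).
Implicit Types (rho : 'rV[R]_n.+1 -> R) (x y z : 'rV[R]_n.+1).

Definition restrict_density rho (P : pred R) : 'rV[R]_n.+1 -> R :=
  fun z => if P (enorm z) then rho z else 0.

(** The superposition is additive in the density, and both parts are again
    radial densities. *)
Lemma radial_kernel_split rho (P : pred R) : admissible_density rho ->
  measurable_fun setT P ->
  radial_kernel rho = fun y => radial_kernel (restrict_density rho P) y +
    radial_kernel (restrict_density rho (predC P)) y.
Proof.
move=> ar mP; apply/funext => y.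
have mCP : measurable_fun setT (predC P) by exact: measurable_neg.
rewrite -(radial_kernelD y (admissible_density_sub ar mP) (admissible_density_sub ar mCP)).
congr (radial_kernel _ y); apply/funext => z; rewrite /=.
by case: (P (enorm z)); rewrite ?addr0 ?add0r.
Qed.

Lemma Rintegral_radial_kernel rho : admissible_density rho ->
  \int[leb]_y `|radial_kernel rho y| = \int[leb]_z rho z.
Proof.
move=> ar; have [_ r0 _] := ar.
rewrite (@eq_Rintegral _ _ _ _ _ (radial_kernel rho)); last first.
  by move=> y _; rewrite ger0_norm// radial_kernel_ge0.
by rewrite /Rintegral radial_kernel_mass.
Qed.

Lemma restricted_mass_vanishes rho (P : nat -> pred R) : admissible_density rho ->
  (forall k, measurable_fun setT (P k)) ->
  (forall r, 0 < r -> \forall k \near \oo, ~~ P k r) ->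
  (\int[leb]_z restrict_density rho (P k) z) @[k --> \oo] --> (0 : R).
Proof.
move=> ar mP hP; have [mr r0 ir] := ar.
have ak k := admissible_density_sub ar (mP k).
have [] := @dominated_convergence _ _ R leb setT measurableT
  (fun k z => (restrict_density rho (P k) z)%:E) (cst 0%E) (EFin \o rho).
- by move=> k; have [m _ _] := ak k; exact/measurable_EFinP.
- exact: measurable_cst.
- have N0 : {ae leb, forall z, z <> 0}.
    exists [set 0]; split; [exact: measurable_point0|exact: lebesgue_rV_point|].
    by move=> z /= /contrapT.
  apply: filterS N0 => z z0 _.
  have zp : 0 < enorm z by rewrite enorm_gt0; apply/eqP.
  apply: cvg_near_cst; apply: filterS (hP _ zp) => k /negbTE h.
  by rewrite /restrict_density h.
- exact: ir.
- apply: aeW => z k _; rewrite /= lee_fin /restrict_density.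
  by case: ifP => _; rewrite ?normr0// ger0_norm.
move=> _ _; rewrite integral0 => /fine_cvg /=.
by [].
Qed.

Lemma restricted_mass_le rho (P Q : pred R) : admissible_density rho ->
  measurable_fun setT P -> measurable_fun setT Q -> (forall r, P r -> Q r) ->
  \int[leb]_z restrict_density rho P z <= \int[leb]_z restrict_density rho Q z.
Proof.
move=> ar mP mQ PQ; have [_ r0 _] := ar.
have [_ _ i1] := admissible_density_sub ar mP.
have [_ _ i2] := admissible_density_sub ar mQ.
apply: le_Rintegral => // z _; rewrite /restrict_density.
by case: ifP => [/PQ ->//|_]; case: ifP.
Qed.

Lemma small_ball_mass rho : admissible_density rho -> forall e, 0 < e ->
  exists2 d0, 0 < d0 & forall d, d <= d0 ->
    \int[leb]_z restrict_density rho (fun r => r < d) z <= e.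
Proof.
move=> ar e e0.
have mP d : measurable_fun setT (fun r : R => r < d) by exact: measurable_fun_ltr.
have hP (r : R) : 0 < r -> \forall k \near \oo, ~~ (r < k.+1%:R^-1).
  move=> r0; have /cvgrPdist_lt /(_ r r0) := @cvg_harmonic R.
  apply: filterS => m; rewrite sub0r normrN /harmonic/= ger0_norm// => h1.
  by rewrite -leNgt ltW.
have /cvgrPdist_le /(_ e e0) [k _ /(_ k (leqnn k)) /=] :=
  @restricted_mass_vanishes rho (fun k r => r < k.+1%:R^-1) ar (fun k => mP _) hP.
rewrite sub0r normrN => /(le_trans (ler_norm _)) h.
exists k.+1%:R^-1; first by rewrite invr_gt0.
move=> d dk; apply: le_trans h.
by apply: restricted_mass_le => // r rd; exact: lt_le_trans dk.
Qed.

Lemma large_ball_mass rho : admissible_density rho -> forall e, 0 < e ->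
  exists M0, forall M, M0 <= M ->
    \int[leb]_z restrict_density rho (predC (fun r => r < M)) z <= e.
Proof.
move=> ar e e0.
have mP d : measurable_fun setT (predC (fun r : R => r < d)).
  by apply: measurable_neg; exact: measurable_fun_ltr.
have hP (r : R) : 0 < r -> \forall k \near \oo, ~~ predC (fun r : R => r < k%:R) r.
  by move=> r0; near=> m; rewrite /= negbK; near: m; exact: nbhs_infty_gtr.
have /cvgrPdist_le /(_ e e0) [k _ /(_ k (leqnn k)) /=] :=
  @restricted_mass_vanishes rho (fun k => predC (fun r => r < k%:R)) ar (fun k => mP _) hP.
rewrite sub0r normrN => /(le_trans (ler_norm _)) h.
exists k%:R => M kM; apply: le_trans h.
by apply: restricted_mass_le => // r /=; rewrite -!leNgt; exact: le_trans.
Unshelve. all: by end_near. Qed.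

End truncated_densities.

(** * The radial operator on test functions *)

Lemma Rintegral_sum {R : realType} d (T : measurableType d)
    (m : {measure set T -> \bar R}) (D : set T) (I : Type) (r : seq I) (F : I -> T -> R) :
  measurable D -> (forall i, m.-integrable D (EFin \o F i)) ->
  \int[m]_(x in D) (\sum_(i <- r) F i x) = \sum_(i <- r) \int[m]_(x in D) F i x.
Proof.
move=> mD iF; rewrite /Rintegral.
under eq_integral do rewrite -sumEFin.
rewrite integral_sum//.
rewrite (eq_bigr (fun i => (fine (\int[m]_(x in D) (F i x)%:E))%:E)) ?sumEFin// => i _.
by rewrite fineK//; exact: (integrable_fin_num mD (iF i)).
Qed.

Section radial_operator.
Context {R : realType} {n : nat} {X Y : innerVectType R}.
Local Notation leb := (@lebesgue_rV R n.+1).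
Implicit Types (B : 'I_n.+1 -> 'Hom(X, Y)) (rho : 'rV[R]_n.+1 -> R) (x y z : 'rV[R]_n.+1).

Lemma continuous_addl x : continuous (fun z => x + z).
Proof.
move=> z; exact: (@cvgD R 'rV[R]_n.+1 'rV[R]_n.+1 (nbhs z) _ (cst x) id x z (cvg_cst x) cvg_id).
Qed.

Lemma measurable_addl x : measurable_fun setT (fun z => x + z).
Proof.
apply: (eq_measurable_fun (fun y => y + x)); last exact: measurable_addrV.
by move=> y _; rewrite addrC.
Qed.

Lemma radial_kernel_reflect rho (h : 'rV[R]_n.+1 -> R) x : admissible_density rho ->
  measurable_fun setT h ->
  \int[leb]_y (radial_kernel rho y * h (x - y)) =
  \int[leb]_y (radial_kernel rho y * h (x + y)).
Proof.
move=> ar mh; have [_ _ _] := ar.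
have mk := measurable_radial_kernel ar.
have m1 : measurable_fun setT (fun y => (radial_kernel rho y * h (x + y))%:E).
  apply/measurable_EFinP; apply: measurable_funM => //.
  exact: (measurableT_comp mh (@measurable_addl x)).
have e := integral_reflect m1.
rewrite /Rintegral; congr fine; apply: (etrans _ e).
by apply: eq_integral => y _; rewrite /= radial_kernel_even.
Qed.

Lemma measurable_geb (d : R) : measurable_fun setT (predC (fun r : R => r < d)).
Proof. by apply: measurable_neg; exact: measurable_fun_ltr. Qed.

(** Away from the origin every term of the symbol is integrable by itself, so
    integration by parts applies to each coordinate and each direction; the
    kernel is even, which turns the correlation into a convolution. *)
Lemma truncated_radial_op B rho (rhoh : R -> R) (u : 'rV[R]_n.+1 -> X) d x :
  admissible_density rho -> (forall z, rho z = rhoh (enorm z)) -> 0 < d ->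
  test_function u ->
  n.+1%:R *: vector_integral (~` eball d) (fun xi =>
        rho xi *: Omega B xi ((enorm xi)^-1 *: (u (x + xi) - u x))) =
  convolution (radial_kernel (restrict_density rho (predC (fun r => r < d)))) (diff_op B u) x.
Proof.
move=> ar rE d0 tu; apply: coord_inj => k.
have [su _] := tu.
set rd := restrict_density _ _.
have ard : admissible_density rd by exact: (admissible_density_sub ar (measurable_geb d)).
pose h i : 'rV[R]_n.+1 -> R^o := cmp k (B i \o u).
have th i : test_function (h i) by apply: test_function_cmp; exact: test_function_lfun.
have dh i : partial i (h i) = cmp k (B i \o partial i u).
  rewrite /h cmpE -[LHS]/(iter_partial [:: i] _) iter_partial_lfun; last first.
    by have [] := test_function_lfun (B i) tu.
  by rewrite iter_partial_lfun// cmpE.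
have ct := @continuous_addl x.
have H i : leb.-integrable setT (EFin \o (fun z => rd z * enorm z ^- 2 *
      (z ord0 i * (h i (x + z) - h i x)))) /\
    n.+1%:R * \int[leb]_z (rd z * enorm z ^- 2 * (z ord0 i * (h i (x + z) - h i x))) =
    \int[leb]_y (radial_kernel rd y * partial i (h i) (x + y)).
  have [ch _ [Bh Bh0 hB] _] := test_function_facts (th i).
  have [cd _ [Bd _ hdB] _] := test_function_facts (test_function_partial i (th i)).
  apply: (@radial_integral_by_parts _ _ rd (fun r => if predC (fun r => r < d) r then rhoh r else 0)
    (fun z => h i (x + z) - h i x) (fun z => partial i (h i) (x + z)) i d (Bh + Bh) Bd) => //.
  - by move=> z; rewrite /rd /restrict_density rE.
  - by move=> z zd; rewrite /rd /restrict_density /= zd.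
  - by move=> z; exact: (cvgB (cvg_comp (fun z => x + z) (h i) (ct z) (ch (x + z))) (cvg_cst (h i x))).
  - by move=> z; exact: (cvg_comp (fun z => x + z) (partial i (h i)) (ct z) (cd (x + z))).
  - move=> y; have := @smooth_is_derive _ _ _ (h i) i (x + y) (proj1 (th i)).
    move=> /is_derive_cvg hh; apply: cvg_is_derive; apply: cvg_trans hh.
    apply: near_eq_cvg; apply: nearW => s /=; congr (_ *: _).
    have e : x + (s *: delta_mx 0 i + y) = s *: delta_mx 0 i + (x + y) := addrCA _ _ _.
    rewrite e; set a := h i _; set b := h i (x + y); set c := h i x.
    have : (a : R) - b = a - c - (b - c) by ring.
    by move=> ->.
  - by move=> y; apply: (le_trans (ler_normB _ _)); exact: lerD.
rewrite linearZ/= /vector_integral coord_sum_basis.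
rewrite Rintegral_mkcond (@eq_Rintegral _ _ _ _ _ (fun z => \sum_i
   (rd z * enorm z ^- 2 * (z ord0 i * (h i (x + z) - h i x))))); last first.
  move=> z _; rewrite patchE.
  have -> : (z \in ~` eball d) = ~~ (enorm z < d) 
    by rewrite in_setC; congr (~~ _); apply/idP/idP => [/set_mem|zd] //; exact/mem_set.
  rewrite /rd /restrict_density /=; case: ifP => zd; last first.
    by rewrite big1// => i _; rewrite !mul0r.
  rewrite !linearZ/= /Omega /symbol sum_lfunE linear_sum/= !mulr_sumr.
  apply: eq_bigr => i _; rewrite scale_lfunE linearZ/= !mxE /h /cmp /= -linearB/= -linearB/=.
  by rewrite expr2 invfM; ring.
rewrite -[LHS]/(n.+1%:R * _).
transitivity (\sum_i \int[leb]_y (radial_kernel rd y * partial i (h i) (x + y))).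
  transitivity (n.+1%:R * \sum_i \int[leb]_z
      (rd z * enorm z ^- 2 * (z ord0 i * (h i (x + z) - h i x)))).
    congr (_ * _); rewrite -Rintegral_sum//.
    by move=> i; case: (H i).
  by rewrite mulr_sumr; apply: eq_bigr => i _; case: (H i).
rewrite -[RHS]/(cmp k (convolution _ _) x) cmp_convolution /sconv.
have th' := test_function_cmp k (test_function_diff_op B tu).
have [_ mh [Bh _ hB] _] := test_function_facts th'.
rewrite radial_kernel_reflect//.
rewrite (@eq_Rintegral _ _ _ _ _ (fun y => \sum_i radial_kernel rd y * partial i (h i) (x + y))).
  rewrite Rintegral_sum// => i.
  have [cd md [Bd _ hdB] _] := test_function_facts (test_function_partial i (th i)).
  have mdx : measurable_fun setT (fun y => partial i (h i) (x + y) : R).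
    exact: (measurableT_comp md (@measurable_addl x)).
  exact: (integrable_mul_bounded measurableT (integrable_radial_kernel ard) mdx (fun y => hdB (x + y))).
move=> y _; rewrite -mulr_sumr; congr (_ * _); rewrite /cmp /diff_op linear_sum/=.
by apply: eq_bigr => i _; rewrite dh.
Qed.

(** The density near the origin has small mass, hence so has the part of the
    kernel that the truncation removes. *)
Theorem radial_opE B rho (rhoh : R -> R) (u : 'rV[R]_n.+1 -> X) :
  admissible_density rho -> (forall z, rho z = rhoh (enorm z)) -> test_function u ->
  radial_op B rho u = convolution (radial_kernel rho) (diff_op B u).
Proof.
move=> ar rE tu; apply/funext => x; rewrite /radial_op.
apply: cvg_lim; first exact: norm_hausdorff.
apply/cvgrPdist_le => e e0.
have [C C0 hC] := convolution_bound (test_function_diff_op B tu).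
have C1 : 0 < C + 1 by rewrite ltr_wpDl.
have [d0 d00 hd] := small_ball_mass ar (divr_gt0 e0 C1).
near=> d.
have dp : 0 < d by near: d; exact: nbhs_right_gt.
have dd0 : d <= d0 by near: d; exact: nbhs_right_le.
rewrite (truncated_radial_op B x ar rE dp tu).
have mP : measurable_fun setT (fun r : R => r < d) by exact: measurable_fun_ltr.
have a1 := admissible_density_sub ar mP.
have a2 := admissible_density_sub ar (measurable_geb d).
rewrite {1}(radial_kernel_split ar mP).
rewrite (convolutionDk (integrable_radial_kernel a1) (integrable_radial_kernel a2))//; last first.
  exact: test_function_diff_op.
rewrite addrK; apply: (le_trans (hC _ (integrable_radial_kernel a1) x)).
rewrite (Rintegral_radial_kernel a1).
apply: (@le_trans _ _ ((C + 1) * (e / (C + 1)))); last by rewrite mulrC mulfVK// gt_eqF.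
apply: ler_pM => //; [|by rewrite lerDl|exact: hd].
by apply: Rintegral_ge0 => z _; have [_ h _] := a1; exact: h.
Unshelve. all: by end_near. Qed.

End radial_operator.

(** * Smooth approximation of measurable sets *)

Section smooth_approximation_of_sets.
Context {R : realType} {n : nat}.
Local Notation leb := (@lebesgue_rV R n).
Variables (D : set 'rV[R]_n) (mD : measurable D) (finD : (leb D < +oo)%E).
Implicit Types (E : set 'rV[R]_n) (phi : 'rV[R]_n -> R^o).

(** The sets whose indicator is a limit in the mean on [D] of smooth
    functions with values between 0 and 1. That range is preserved by
    complements and unions, and it controls the powers of the error. *)
Definition smoothly_approximable E := measurable E /\ forall e : R, 0 < e ->
  exists2 phi : 'rV[R]_n -> R^o, smooth phi /\ (forall x, 0 <= phi x <= 1) &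
    (\int[leb]_(x in D) `|\1_E x - phi x|%:E <= e%:E)%E.

Lemma smooth_measurable phi : smooth phi -> measurable_fun [set: 'rV[R]_n] (phi : _ -> R).
Proof. by move=> s; apply: continuous_measurable_rV => x; exact: smooth_continuous. Qed.

Lemma smooth_opp phi : smooth phi -> smooth (fun x => - phi x : R^o).
Proof.
move=> s; have := smooth_scale (smooth_cst (-1 : R^o)) s.
by rewrite (_ : (fun x => _) = (fun x => - phi x : R^o))//; apply/funext => x; rewrite scaleN1r.
Qed.

(** Dominated convergence: the error is at most 1 and [D] has finite measure. *)
Lemma vanishing_error E (g : nat -> 'rV[R]_n -> R) : measurable E ->
  (forall k, measurable_fun setT (g k)) -> (forall k x, `|\1_E x - g k x| <= 1) ->
  (forall x, g k x @[k --> \oo] --> (\1_E x : R)) -> forall e, 0 < e ->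
  exists k, (\int[leb]_(x in D) `|\1_E x - g k x|%:E <= e%:E)%E.
Proof.
move=> mE mg hg cg e e0.
have mE1 : measurable_fun setT (\1_E : 'rV[R]_n -> R) by exact: measurable_indic.
have mh k : measurable_fun D (fun x => `|\1_E x - g k x|%:E).
  apply/measurable_EFinP; apply: measurable_funTS; apply: measurableT_comp => //.
  exact: measurable_funB.
have [] := @dominated_convergence _ _ R leb D mD
  (fun k x => `|\1_E x - g k x|%:E) (cst 0%E) (cst 1%E) mh.
- exact: measurable_cst.
- apply: aeW => x _; apply/fine_cvgP; split; first by near=> k.
  apply/cvgrPdist_le => d d0; have /cvgrPdist_le /(_ d d0) := cg x.
  by apply: filterS => k /=; rewrite sub0r normrN normr_id.
- apply/integrableP; split; first exact: measurable_cst.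
  rewrite (eq_integral (cst 1%E)); last by move=> x _; rewrite /= normr1.
  by rewrite integral_cst// mul1e.
- by apply: aeW => x k _; rewrite /= lee_fin normr_id.
move=> _ _; rewrite integral0 => /fine_cvgP[[N _ hN] /cvgrPdist_le /(_ e e0) [M _ hM]].
exists (maxn N M); have := hM _ (leq_maxr N M); rewrite /= sub0r normrN => h.
have /= hf := fineK (hN _ (leq_maxl N M)).
rewrite -hf lee_fin; exact: le_trans (ler_norm _) h.
Unshelve. all: by end_near. Qed.

Lemma smoothly_approximable0 : smoothly_approximable set0.
Proof.
split => // e e0; exists (fun=> 0); first by split; [exact: smooth_cst|move=> x; rewrite lexx ler01].
rewrite (eq_integral (cst 0%E)); first by rewrite integral0 lee_fin ltW.
by move=> x _; rewrite indic0 subrr normr0.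
Qed.

Lemma smoothly_approximableC E : smoothly_approximable E -> smoothly_approximable (~` E).
Proof.
move=> [mE h]; split; first exact: measurableC.
move=> e e0; have [phi [sp p01] hp] := h e e0.
exists (fun x => 1 + - phi x).
  split; first exact: smoothD (smooth_cst (1 : R^o)) (smooth_opp sp).
  by move=> x; have /andP[p0 p1] := p01 x; rewrite subr_ge0 p1 gerBl.
rewrite (eq_integral (fun x => `|\1_E x - phi x|%:E))// => x _; congr (_%:E).
rewrite !indicE in_setC; case: (x \in E) => /=.
  by rewrite -[RHS]normrN; congr (`|_|); ring.
by rewrite -[RHS]normrN; congr (`|_|); ring.
Qed.

(** The probabilistic sum [f + g - f g] approximates the union. *)
Lemma smoothly_approximableU E F : smoothly_approximable E -> smoothly_approximable F ->
  smoothly_approximable (E `|` F).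
Proof.
move=> [mE hE] [mF hF]; split; first exact: measurableU.
move=> e e0; have e20 : 0 < e / 2 by rewrite divr_gt0.
have [f [sf f01] If] := hE _ e20; have [g [sg g01] Ig] := hF _ e20.
exists (fun x => f x + (g x + - (f x *: g x))).
  split; first exact: smoothD sf (smoothD sg (smooth_opp (smooth_scale sf sg))).
  move=> x; have /andP[f0 f1] := f01 x; have /andP[g0 g1] := g01 x.
  rewrite -[f x *: g x]/(f x * g x); clear -f0 f1 g0 g1.
  apply/andP; split; nra.
have mabs (G : set 'rV[R]_n) (k : 'rV[R]_n -> R) : measurable G -> measurable_fun setT k ->
    measurable_fun D (fun x => `|\1_G x - k x|%:E).
  move=> mG mk; apply/measurable_EFinP; apply: measurable_funTS; apply: measurableT_comp => //.
  by apply: measurable_funB => //; exact: measurable_indic.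
have mf := smooth_measurable sf; have mg := smooth_measurable sg.
apply: (@le_trans _ _ (\int[leb]_(x in D) (`|\1_E x - f x|%:E + `|\1_F x - g x|%:E))%E).
  apply: ge0_le_integral => //.
  - apply: mabs; first exact: measurableU.
    by apply: measurable_funD => //; apply: measurable_funB => //; exact: measurable_funM.
  - by apply: emeasurable_funD; exact: mabs.
  move=> x _; rewrite -EFinD lee_fin !indicE in_setU -[f x *: g x]/(f x * g x).
  have /andP[f0 f1] := f01 x; have /andP[g0 g1] := g01 x.
  clear -f0 f1 g0 g1; rewrite ler_norml.
  have := ler_norm (f x); have := ler_norm (g x).
  by case: (x \in E); case: (x \in F) => /=;
    rewrite ?sub0r ?normrN ?[`|1 - f x|]ger0_norm ?[`|1 - g x|]ger0_norm
     ?[`|f x|]ger0_norm ?[`|g x|]ger0_norm ?subr_ge0//; move=> _ _; apply/andP; split; nra.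
rewrite ge0_integralD//; last 2 first.
  exact: mabs.
  exact: mabs.
by rewrite [e]splitr EFinD; exact: leeD.
Qed.

Lemma smoothly_approximable_bigcup (F : (set 'rV[R]_n)^nat) :
  (forall k, smoothly_approximable (F k)) -> smoothly_approximable (\bigcup_k F k).
Proof.
move=> hF; have mF k : measurable (F k) by case: (hF k).
have mU : measurable (\bigcup_k F k) by exact: bigcupT_measurable.
split => // e e0; have e20 : 0 < e / 2 by rewrite divr_gt0.
pose U K := \big[setU/set0]_(k < K) F k.
have hU K : smoothly_approximable (U K).
  elim: K => [|K IH]; first by rewrite /U big_ord0; exact: smoothly_approximable0.
  by rewrite /U big_ord_recr/=; exact: smoothly_approximableU.
have sub K : U K `<=` \bigcup_k F k.
  by rewrite /U -bigcup_mkord => x [k _ Fx]; exists k.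
have [K hK] : exists K, (\int[leb]_(x in D) `|\1_(\bigcup_k F k) x - \1_(U K) x|%:E <= (e / 2)%:E)%E.
  apply: vanishing_error => //.
  - by move=> K; apply: measurable_indic; case: (hU K).
  - move=> K x; rewrite !indicE; have [xU|xU] := boolP (x \in U K).
      by rewrite (mem_set (sub _ _ (set_mem xU))) subrr normr0.
    by rewrite subr0 normr_nat; case: (_ \in _).
  - move=> x; apply: cvg_near_cst; rewrite !indicE; have [xU|xU] := boolP (x \in \bigcup_k F k).
      have [k _ Fx] := set_mem xU; exists k.+1 => // K /= kK.
      rewrite indicE mem_set// /U -bigcup_mkord; by exists k.
    apply: nearW => K; rewrite indicE; case: (boolP (x \in U K)) => // xK.
    by rewrite (mem_set (sub _ _ (set_mem xK))) in xU.
have [mUK hUK] := hU K; have [phi [sp p01] Ip] := hUK _ e20.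
exists phi => //.
have mp := smooth_measurable sp.
have mabs (G : set 'rV[R]_n) (k : 'rV[R]_n -> R) : measurable G -> measurable_fun setT k ->
    measurable_fun D (fun x => `|\1_G x - k x|%:E).
  move=> mG mk; apply/measurable_EFinP; apply: measurable_funTS; apply: measurableT_comp => //.
  by apply: measurable_funB => //; exact: measurable_indic.
have mi : measurable_fun setT (\1_(U K) : 'rV[R]_n -> R) by exact: measurable_indic.
apply: (@le_trans _ _ (\int[leb]_(x in D)
    (`|\1_(\bigcup_k F k) x - \1_(U K) x|%:E + `|\1_(U K) x - phi x|%:E))%E).
  apply: ge0_le_integral => //.
  - exact: mabs.
  - by apply: emeasurable_funD; exact: mabs.
  by move=> x _; rewrite -EFinD lee_fin; exact: ler_distD.
rewrite ge0_integralD//; last 2 first.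
  exact: mabs.
  exact: mabs.
by rewrite [e]splitr EFinD; exact: leeD.
Qed.

(** Steepening the flat function turns it into the indicator of a half-space. *)
Lemma smoothly_approximable_ray i (a : R) :
  smoothly_approximable ((fun x : 'rV[R]_n => x ord0 i) @^-1` `]a, +oo[).
Proof.
set E := _ @^-1` _.
have mE : measurable E.
  by rewrite -[E]setTI; apply: measurable_rV_coord.
split => // e e0.
pose g k (x : 'rV[R]_n) : R^o := flat 0 (k.+1%:R * x ord0 i + - (k.+1%:R * a)).
have gE k x : g k x = flat 0 (k.+1%:R * (x ord0 i - a)) by rewrite /g mulrBr.
have sg k : smooth (g k) by exact: smooth_flat_coord.
have g01 k x : 0 <= g k x <= 1 by rewrite /g flat_ge0 flat0_le1.
have Ein x : (x \in E) = (a < x ord0 i).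
  apply/idP/idP => [/set_mem|h]; first by rewrite /E/= in_itv/= andbT.
  by apply/mem_set; rewrite /E/= in_itv/= andbT.
have [k hk] : exists k, (\int[leb]_(x in D) `|\1_E x - (g k x : R)|%:E <= e%:E)%E.
  apply: vanishing_error => //.
  - by move=> k; exact: smooth_measurable.
  - move=> k x; have /andP[h1 h2] := g01 k x; rewrite indicE ler_norml.
    by case: (x \in E) => /=; clear -h1 h2; lra.
  - move=> x; rewrite indicE Ein; have [ax|ax] := ltP a (x ord0 i); last first.
      apply: cvg_near_cst; apply: nearW => k; rewrite gE flat_le0//.
      by rewrite mulr_ge0_le0// subr_le0.
    apply/cvgrPdist_le => d d0.
    have xa : 0 < x ord0 i - a by rewrite subr_gt0.
    have da : 0 < d * (x ord0 i - a) by rewrite mulr_gt0.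
    have /cvgrPdist_le /(_ _ da) := @cvg_harmonic R; apply: filterS => k.
    rewrite sub0r normrN /harmonic/= ger0_norm// => h.
    have kx : 0 < k.+1%:R * (x ord0 i - a) by rewrite mulr_gt0.
    have /andP[h1 h2] := g01 k x.
    rewrite ger0_norm ?subr_ge0// gE /flat kx expr0 mul1r.
    have := @expR_ge1Dx R (- (k.+1%:R * (x ord0 i - a))^-1).
    set t := (_ * _)^-1; suff td : t <= d by move=> h0; clear -td h0; lra.
    by rewrite /t invfM -ler_pdivlMr ?invr_gt0// invrK.
by exists (g k).
Qed.

(** The approximable sets form a sigma-algebra, and the half-spaces given by
    coordinates generate all measurable sets. *)
Lemma measurable_smoothly_approximable E : measurable E -> smoothly_approximable E.
Proof.
have sa : sigma_algebra setT smoothly_approximable.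
  split => [|A hA|F hF]; first exact: smoothly_approximable0.
    by rewrite setTD; exact: smoothly_approximableC.
  exact: smoothly_approximable_bigcup.
apply: smallest_sub => //.
rewrite -bigcup_seq/=; apply: bigcup_sub => i _ _ [B mB <-] /=; rewrite setTI.
move: B mB; suff : @measurable _ R `<=`
    [set B | smoothly_approximable ((fun x : 'rV[R]_n => x ord0 i) @^-1` B)] by [].
have -> : @measurable _ R = (@RGenOInfty.G R).-sigma.-measurable.
  exact: RGenOInfty.measurableE.
apply: smallest_sub; last by move=> _ [a ->] /=; exact: smoothly_approximable_ray.
split => /=.
- by rewrite preimage_set0; exact: smoothly_approximable0.
- by move=> A sA; rewrite setTD preimage_setC; exact: smoothly_approximableC.
- by move=> F sF; rewrite preimage_bigcup; exact: smoothly_approximable_bigcup.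
Qed.

End smooth_approximation_of_sets.

(** * Density of test functions in Lebesgue spaces *)

Section test_function_operations.
Context {R : realType} {n : nat} {X : normedModType R}.
Implicit Types (u v : 'rV[R]_n -> X).

Lemma test_functionD u v : test_function u -> test_function v ->
  test_function (fun x => u x + v x).
Proof.
move=> tu tv; have [M M0 hM] := test_function_support tu.
have [N N0 hN] := test_function_support tv.
have [su _] := tu; have [sv _] := tv; split; first exact: smoothD.
apply/compact_tsupportP; exists (M + N) => x MNx.
by rewrite hM ?hN ?addr0//; apply: le_lt_trans MNx; rewrite ?lerDl ?lerDr.
Qed.

Lemma test_functionM (chi : 'rV[R]_n -> R^o) u : smooth chi -> test_function u ->
  test_function (fun x => chi x *: u x).
Proof.
move=> sc tu; have [M M0 hM] := test_function_support tu; have [su _] := tu.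
split; first exact: smooth_scale.
by apply/compact_tsupportP; exists M => x Mx; rewrite hM// scaler0.
Qed.

Lemma test_functionZ (c : R) u : test_function u -> test_function (fun x => c *: u x).
Proof. exact: (test_functionM (smooth_cst (c : R^o))). Qed.

End test_function_operations.

Section density_of_test_functions.
Context {R : realType} {n : nat}.
Local Notation leb := (@lebesgue_rV R n).
Variable q : R.
Hypothesis q1 : 1 <= q.
Implicit Types (f g : 'rV[R]_n -> R) (phi : 'rV[R]_n -> R^o).

Let q0 : 0 < q. Proof. exact: lt_le_trans q1. Qed.

Lemma powR_le_self (a : R) : 0 <= a -> a <= 1 -> a `^ q <= a.
Proof.
move=> a0 a1; have [->|an0] := eqVneq a 0; first by rewrite powR0// gt_eqF.
by apply: ge1r_powR => //; rewrite lt_neqAle eq_sym an0 a0.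
Qed.

(** Sealed, so that two power integrals are never compared by unfolding the
    integral. *)
Fact power_integral_key : unit. Proof. exact: tt. Qed.

Definition power_integral f : \bar R :=
  locked_with power_integral_key (fun f => \int[leb]_x (`|f x| `^ q)%:E)%E f.

Lemma power_integralE f : power_integral f = (\int[leb]_x (`|f x| `^ q)%:E)%E.
Proof. by rewrite /power_integral locked_withE. Qed.

Definition test_approximable f := measurable_fun setT f /\ forall e : R, 0 < e ->
  exists2 phi : 'rV[R]_n -> R^o, test_function phi &
    (power_integral (fun x => f x - phi x)%R <= e%:E)%E.

Lemma measurable_power f : measurable_fun setT f ->
  measurable_fun setT (fun x => (`|f x| `^ q)%:E).
Proof.
move=> mf; apply/measurable_EFinP.
apply: (measurableT_comp (measurable_powR q)); exact: measurableT_comp.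
Qed.

Lemma power_integral_ge0 f : (0 <= power_integral f)%E.
Proof. by rewrite power_integralE; apply: integral_ge0 => x _; rewrite lee_fin powR_ge0. Qed.

Lemma power_integral_le f g : measurable_fun setT f -> measurable_fun setT g ->
  (forall x, `|f x| <= `|g x|) -> (power_integral f <= power_integral g)%E.
Proof.
move=> mf mg fg; rewrite !power_integralE; apply: ge0_le_integral => //.
- exact: measurable_power.
- exact: measurable_power.
- by move=> x _; rewrite lee_fin ge0_ler_powR// ?nnegrE// ltW.
Qed.

Lemma power_add (a b : R) : `|a + b| `^ q <= 2 `^ q * (`|a| `^ q + `|b| `^ q).
Proof.
apply: (@le_trans _ _ ((2 * Num.max `|a| `|b|) `^ q)).
  have m0 : 0 <= 2 * Num.max `|a| `|b| by apply: mulr_ge0 => //; rewrite le_max normr_ge0.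
  apply: ge0_ler_powR; rewrite ?nnegrE ?(ltW q0)//.
  by apply: (le_trans (ler_normD _ _)); rewrite mulr_natl mulr2n lerD// le_max lexx ?orbT.
rewrite powRM ?le_max ?normr_ge0// ler_wpM2l ?powR_ge0//.
by case: (leP `|a| `|b|) => _; rewrite ?lerDl ?lerDr powR_ge0.
Qed.

Lemma power_integralD f g : measurable_fun setT f -> measurable_fun setT g ->
  (power_integral (fun x => f x + g x)%R <=
   (2 `^ q)%:E * (power_integral f + power_integral g))%E.
Proof.
move=> mf mg; have m1 := measurable_power mf; have m2 := measurable_power mg.
have p0 h x : setT x -> (0 <= (`|h x| `^ q)%:E :> \bar R)%E by rewrite lee_fin powR_ge0.
rewrite !power_integralE -ge0_integralD//.
rewrite -(ge0_integralZl _ measurableT)//; last 2 first.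
- exact: emeasurable_funD.
- by move=> x _; rewrite -EFinD lee_fin addr_ge0// powR_ge0.
apply: ge0_le_integral => //.
- by apply: measurable_power; exact: measurable_funD.
- by apply: measurable_funeM; exact: emeasurable_funD.
- by move=> x _; rewrite -EFinD -EFinM lee_fin power_add.
Qed.

Lemma power_integralZ c f : measurable_fun setT f ->
  (power_integral (fun x => c * f x)%R = (`|c| `^ q)%:E * power_integral f)%E.
Proof.
move=> mf; rewrite !power_integralE -ge0_integralZl//.
- by apply: eq_integral => x _; rewrite normrM powRM// EFinM.
- exact: measurable_power.
Qed.

Lemma power_integralN f : power_integral (fun x => - f x) = power_integral f.
Proof. by rewrite !power_integralE; apply: eq_integral => x _; rewrite normrN. Qed.

Lemma measurable_test phi : test_function phi -> measurable_fun [set: 'rV[R]_n] (phi : _ -> R).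
Proof. by case=> s _; exact: smooth_measurable. Qed.

Lemma test_approximable_limit f : measurable_fun setT f ->
  (forall e : R, 0 < e -> exists2 g, test_approximable g &
     (power_integral (fun x => f x - g x)%R <= e%:E)%E) -> test_approximable f.
Proof.
move=> mf h; split => // e e0.
have c0 : 0 < 2 `^ q :> R by rewrite powR_gt0.
have e1 : 0 < e / (2 `^ q * 2) by rewrite divr_gt0// mulr_gt0.
have [g [mg hg] fg] := h _ e1; have [phi tp gp] := hg _ e1.
exists phi => //; have mp := measurable_test tp.
rewrite (_ : (fun x => f x - phi x) = (fun x => (f x - g x) + (g x - phi x))); last first.
  by apply/funext => x; rewrite addrA subrK.
apply: le_trans (power_integralD _ _) _; [exact: measurable_funB|exact: measurable_funB|].
apply: (@le_trans _ _ ((2 `^ q)%:E * ((e / (2 `^ q * 2))%:E + (e / (2 `^ q * 2))%:E))%E).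
  by apply: lee_wpmul2l; [rewrite lee_fin ltW|exact: (leeD fg gp)].
by rewrite -EFinD -EFinM lee_fin le_eqVlt; apply/orP; left; apply/eqP; field; rewrite gt_eqF.
Qed.

Lemma test_approximableD f g : test_approximable f -> test_approximable g ->
  test_approximable (fun x => f x + g x).
Proof.
move=> [mf hf] [mg hg]; split; first exact: measurable_funD.
move=> e e0.
have c0 : 0 < 2 `^ q :> R by rewrite powR_gt0.
have e1 : 0 < e / (2 `^ q * 2) by rewrite divr_gt0// mulr_gt0.
have [phi tp fp] := hf _ e1; have [psi ts gp] := hg _ e1.
exists (fun x => phi x + psi x : R^o); first exact: test_functionD.
have mp := measurable_test tp; have ms := measurable_test ts.
rewrite (_ : (fun x => _) = (fun x => (f x - phi x) + (g x - psi x))); last first.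
  by apply/funext => x; rewrite opprD addrACA.
apply: le_trans (power_integralD _ _) _; [exact: measurable_funB|exact: measurable_funB|].
apply: (@le_trans _ _ ((2 `^ q)%:E * ((e / (2 `^ q * 2))%:E + (e / (2 `^ q * 2))%:E))%E).
  by apply: lee_wpmul2l; [rewrite lee_fin ltW|exact: (leeD fp gp)].
by rewrite -EFinD -EFinM lee_fin le_eqVlt; apply/orP; left; apply/eqP; field; rewrite gt_eqF.
Qed.

Lemma test_approximable0 : test_approximable (fun=> 0).
Proof.
split => // e e0; exists (fun=> 0); first exact: (test_function_cst0 R^o).
rewrite !power_integralE (eq_integral (cst 0%E)); first by rewrite integral0 lee_fin ltW.
by move=> x _; rewrite subrr normr0 powR0// gt_eqF.
Qed.

Lemma test_approximableZ c f : test_approximable f -> test_approximable (fun x => c * f x).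
Proof.
move=> [mf hf]; split; first exact: measurable_funM.
move=> e e0; have e1 : 0 < e / (`|c| `^ q + 1) by rewrite divr_gt0// ltr_wpDl ?powR_ge0.
have [phi tp fp] := hf _ e1.
exists (fun x => c *: phi x); first exact: test_functionZ.
have mp := measurable_test tp.
rewrite (_ : (fun x => _) = (fun x => c * (f x - phi x))); last first.
  by apply/funext => x; rewrite mulrBr.
rewrite power_integralZ; last exact: measurable_funB.
apply: (@le_trans _ _ ((`|c| `^ q + 1)%:E * (e / (`|c| `^ q + 1))%:E)%E).
  apply: lee_pmul => //; rewrite ?lee_fin ?powR_ge0 ?lerDl//; exact: power_integral_ge0.
by rewrite -EFinM mulrC mulfVK// gt_eqF// ltr_wpDl ?powR_ge0.
Qed.

Lemma test_approximable_sum (I : Type) (r : seq I) (F : I -> 'rV[R]_n -> R) :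
  (forall i, test_approximable (F i)) -> test_approximable (fun x => \sum_(i <- r) F i x).
Proof.
move=> hF; elim: r => [|i r IH].
  rewrite (_ : (fun x => _) = fun=> 0); first exact: test_approximable0.
  by apply/funext => x; rewrite big_nil.
rewrite (_ : (fun x => _) = fun x => F i x + \sum_(j <- r) F j x).
  exact: (test_approximableD (hF i) IH).
by apply/funext => x; rewrite big_cons.
Qed.

(** A bounded set is approximated by a smooth function multiplied by a cutoff
    that equals 1 on the set. Since the error is at most 1, its power is at
    most the error itself. *)
Lemma test_approximable_indic (E : set 'rV[R]_n) M : 0 <= M -> measurable E ->
  (forall x, E x -> `|x| <= M) -> test_approximable (\1_E).
Proof.
move=> M0 mE EM; split; first exact: measurable_indic.
move=> e e0; pose D := [set x : 'rV[R]_n | `|x| <= M + 2].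
have [chi [tc c01 c1 cM]] := @smooth_cutoff R n M M0.
have [_ /(_ e e0)[phi [sp p01] hp]] := measurable_smoothly_approximable
  (measurable_norm_ball (M + 2)) (norm_ball_finite (M + 2)) mE.
have tcp : test_function (fun x => phi x *: chi x) := test_functionM sp tc.
exists (fun x => phi x *: chi x); first exact: tcp.
have mcp := measurable_test tcp; have mp := smooth_measurable sp.
have mi : measurable_fun setT (\1_E : 'rV[R]_n -> R) by exact: measurable_indic.
apply: le_trans hp; rewrite power_integralE [leRHS]integral_mkcond.
apply: ge0_le_integral => //.
- by apply: measurable_power; exact: measurable_funB.
- apply/(measurable_restrictT _ (measurable_norm_ball (M + 2))).
  apply: measurable_funTS; apply/measurable_EFinP; apply: measurableT_comp => //.
  exact: measurable_funB.
move=> x _; rewrite patchE -[phi x *: chi x]/(phi x * chi x) [phi x * _]mulrC.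
have /andP[p0 p1] := p01 x; have /andP[c0 c1'] := c01 x.
case: ifPn => [/set_mem xD|/negP xD].
  rewrite lee_fin.
  have a1 : `|\1_E x - chi x * phi x| <= `|\1_E x - phi x|.
    rewrite indicE; have [xE|xE] := boolP (x \in E).
      by rewrite c1 ?mul1r//; apply: EM; exact: set_mem.
    rewrite !sub0r !normrN ger0_norm ?mulr_ge0// ger0_norm// ler_piMl//.
  have a2 : `|\1_E x - phi x| <= 1.
    by rewrite indicE ler_norml; case: (x \in E) => /=; clear -p0 p1; lra.
  apply: (le_trans _ a1); apply: powR_le_self => //; exact: le_trans a1 a2.
have xM : M + 2 < `|x|.
  by rewrite ltNge; apply/negP => h; apply: xD; exact/mem_set.
rewrite cM// mul0r subr0 indicE memNset; first by rewrite normr0 powR0 ?gt_eqF.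
by move=> /EM; rewrite leNgt (lt_trans _ xM)// ltrDl.
Qed.

Lemma power_integral_vanishes f (g : nat -> 'rV[R]_n -> R) : measurable_fun setT f ->
  (power_integral f < +oo)%E -> (forall k, measurable_fun setT (g k)) ->
  (forall k x, `|f x - g k x| <= `|f x|) -> (forall x, g k x @[k --> \oo] --> f x) ->
  forall e, 0 < e -> \forall k \near \oo, (power_integral (fun x => f x - g k x)%R <= e%:E)%E.
Proof.
move=> mf ff mg hg cg e e0.
have mfg k : measurable_fun setT (fun x => f x - g k x) by exact: measurable_funB.
have [] := @dominated_convergence _ _ R leb setT measurableT
  (fun k x => (`|f x - g k x| `^ q)%:E) (cst 0%E) (fun x => (`|f x| `^ q)%:E)
  (fun k => measurable_power (mfg k)).
- exact: measurable_cst.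
- apply: aeW => x _; apply/fine_cvgP; split; first by near=> k.
  apply/cvgrPdist_le => d d0; pose d' := Num.min d 1.
  have d'0 : 0 < d' by rewrite lt_min d0 ltr01.
  have /cvgrPdist_le /(_ d' d'0) := cg x.
  apply: filterS => k /=; rewrite sub0r normrN (ger0_norm (powR_ge0 _ _)) => h.
  have h1 : `|f x - g k x| <= 1 by apply: (le_trans h); rewrite ge_min lexx orbT.
  apply: (@le_trans _ _ (`|f x - g k x|)); first exact: powR_le_self.
  by apply: (le_trans h); rewrite ge_min lexx.
- apply/integrableP; split; first exact: measurable_power.
  rewrite (eq_integral (fun x => (`|f x| `^ q)%:E)); first by rewrite -power_integralE.
  move=> x _.
  by rewrite gee0_abs// lee_fin powR_ge0.
- apply: aeW => x k _; rewrite /= lee_fin ger0_norm ?powR_ge0//.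
  by rewrite ge0_ler_powR ?nnegrE// ltW.
move=> _ _; rewrite integral0 => /fine_cvgP[[N _ hN] /cvgrPdist_le /(_ e e0) [M _ hM]].
exists (maxn N M) => // k /=; rewrite geq_max => /andP[Nk Mk].
have := hM _ Mk; rewrite /= sub0r normrN => h.
have /= hf := fineK (hN _ Nk).
rewrite !power_integralE -hf lee_fin; exact: le_trans (ler_norm _) h.
Unshelve. all: by end_near. Qed.

Import HBNNSimple.

Lemma test_approximable_ge0 f : measurable_fun setT f -> (forall x, 0 <= f x) ->
  (power_integral f < +oo)%E -> test_approximable f.
Proof.
move=> mf f0 ff; apply: test_approximable_limit => // e e0.
have mEf : measurable_fun setT (EFin \o f) by exact/measurable_EFinP.
have [s [nds cs]] := approximation measurableT mEf (fun x _ => f0 x).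
pose B k := [set x : 'rV[R]_n | `|x| <= k%:R].
have mB k : measurable (B k) by exact: measurable_norm_ball.
pose g k (x : 'rV[R]_n) := s k x * \1_(B k) x.
have mg k : measurable_fun setT (g k).
  by apply: measurable_funM; [exact: measurable_funPT|exact: measurable_indic].
have sc x : s k x @[k --> \oo] --> f x by have := cs x I; move=> /fine_cvg.
have sle k x : s k x <= f x.
  have ndx : nondecreasing_seq (fun k => s k x) by move=> i j /nds /lefP.
  by have := nondecreasing_cvgn_le ndx (cvgP _ (sc x)) k; rewrite (cvg_lim _ (sc x)).
have s0 k x : 0 <= s k x by exact: fun_ge0.
have hg k x : `|f x - g k x| <= `|f x|.
  rewrite /g indicE; have h1 := sle k x; have h2 := s0 k x; have h3 := f0 x.
  rewrite [`|f x|]ger0_norm//; case: (x \in B k); rewrite ?mulr1 ?mulr0 ?subr0; last by rewrite ger0_norm.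
  by rewrite ger0_norm ?subr_ge0// gerBl.
have cg x : g k x @[k --> \oo] --> f x.
  have := sc x; apply: cvg_trans; apply: near_eq_cvg.
  near=> k; rewrite /g indicE mem_set ?mulr1// /B/=.
  by near: k; exact: nbhs_infty_ger.
have [k _ /(_ k (leqnn k)) hk] := power_integral_vanishes mf ff mg hg cg e0.
exists (g k) => //.
have [N [c hc]] : exists N (c : 'I_N -> R),
    forall x, s k x = \sum_(i < N) c i * \1_(s k @^-1` [set c i]) x.
  by eexists; eexists; exact: (fimfunEord (s k)).
rewrite (_ : g k = fun x => \sum_(i < N) c i * \1_(s k @^-1` [set c i] `&` B k) x); last first.
  apply/funext => x; rewrite /g hc mulr_suml; apply: eq_bigr => i _.
  by rewrite indicI -mulrA.
apply: test_approximable_sum => i; apply: test_approximableZ.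
apply: (@test_approximable_indic _ k%:R) => //; last by move=> x [].
by apply: measurableI.
Unshelve. all: by end_near. Qed.

(** Nonnegative functions are increasing limits of simple functions, which may
    be restricted to balls. *)
Theorem test_functions_dense f : measurable_fun setT f -> (power_integral f < +oo)%E ->
  test_approximable f.
Proof.
move=> mf ff.
have h g : measurable_fun setT g -> (forall x, 0 <= g x <= `|f x|) -> test_approximable g.
  move=> mg gf; apply: (test_approximable_ge0 mg); first by move=> x; case/andP: (gf x).
  apply: le_lt_trans ff; apply: power_integral_le => // x.
  by case/andP: (gf x) => g0 gx; rewrite ger0_norm.
rewrite (_ : f = fun x => Num.max (f x) 0 + -1 * Num.max (- f x) 0); last first.
  apply/funext => x; have [fx|fx] := leP (f x) 0.
    by rewrite (@max_l _ _ (- f x)) ?oppr_ge0// mulN1r opprK add0r.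
  by rewrite (@max_r _ _ (- f x)) ?mulr0 ?addr0// oppr_le0 ltW.
apply: test_approximableD; [|apply: test_approximableZ]; apply: h => //.
- exact: measurable_maxr.
- by move=> x; rewrite le_max lexx orbT/= ge_max ler_norm normr_ge0.
- by apply: measurable_maxr => //; exact: measurableT_comp.
- by move=> x; rewrite le_max lexx orbT/= ge_max -normrN ler_norm normr_ge0.
Qed.

Definition power_integrable f := measurable_fun setT f /\ (power_integral f < +oo)%E.

Lemma power_integral_fin f : power_integrable f -> power_integral f \is a fin_num.
Proof. by case=> _ ff; rewrite ge0_fin_numE// power_integral_ge0. Qed.

(** Sealed for the same reason. *)
Fact power_norm_key : unit. Proof. exact: tt. Qed.

Definition power_norm f : R :=
  locked_with power_norm_key (fun f => fine (power_integral f) `^ q^-1) f.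

Lemma power_normE f : power_norm f = fine (power_integral f) `^ q^-1.
Proof. by rewrite /power_norm locked_withE. Qed.

Lemma power_norm_root f : power_integrable f ->
  (power_norm f)%:E = (power_integral f `^ q^-1)%E.
Proof. by move=> /power_integral_fin pf; rewrite power_normE -[in RHS](fineK pf) poweR_EFin. Qed.

Lemma power_norm_ge0 f : 0 <= power_norm f.
Proof. by rewrite power_normE powR_ge0. Qed.

End density_of_test_functions.

(** * Extension of bounded functionals *)

Section power_norm.
Context {R : realType} {n : nat}.
Local Notation leb := (@lebesgue_rV R n).
Variable q : R.
Hypothesis q1 : 1 <= q.
Implicit Types (f g : 'rV[R]_n -> R) (phi psi : 'rV[R]_n -> R^o).

Let q0 : 0 < q. Proof. exact: lt_le_trans q1. Qed.

Lemma Lnorm_power_integral f :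
  Lnorm leb q%:E (EFin \o f) = (power_integral q f `^ q^-1)%E.
Proof. by rewrite unlock power_integralE. Qed.

Lemma EFin_power_norm f : power_integrable q f ->
  (power_norm q f)%:E = Lnorm leb q%:E (EFin \o f).
Proof. by move=> pf; rewrite (power_norm_root pf) Lnorm_power_integral. Qed.

Lemma power_integrable_le f g : measurable_fun setT f -> power_integrable q g ->
  (forall x, `|f x| <= `|g x|) -> power_integrable q f.
Proof.
move=> mf [mg gf] fg; split; first exact: mf.
exact: le_lt_trans (power_integral_le q1 mf mg fg) gf.
Qed.

Lemma power_root_le (a b : \bar R) : (0 <= a -> a <= b -> a `^ q^-1 <= b `^ q^-1)%E.
Proof.
move=> a0 ab; apply: gt0_ler_poweR => //; first by rewrite invr_ge0 ltW.
  by rewrite in_itv/= a0 leey.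
by rewrite in_itv/= (le_trans a0 ab) leey.
Qed.

Lemma power_norm_le f g : measurable_fun setT f -> power_integrable q g ->
  (forall x, `|f x| <= `|g x|) -> power_norm q f <= power_norm q g.
Proof.
move=> mf pg fg; have pf := power_integrable_le mf pg fg.
have [mg _] := pg.
rewrite -lee_fin (power_norm_root pf) (power_norm_root pg).
exact: power_root_le (power_integral_ge0 _ _) (power_integral_le q1 mf mg fg).
Qed.

Lemma power_norm_small f (e : R) : measurable_fun setT f -> 0 <= e ->
  (power_integral q f <= (e `^ q)%:E)%E -> power_integrable q f /\ power_norm q f <= e.
Proof.
move=> mf e0 h; have pf : power_integrable q f by split; [exact: mf|exact: le_lt_trans h (ltry _)].
split; first exact: pf.
rewrite -lee_fin (power_norm_root pf).
apply: (@le_trans _ _ ((e `^ q)%:E `^ q^-1)%E).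
  exact: power_root_le (power_integral_ge0 _ _) h.
by rewrite poweR_EFin -powRrM mulfV ?powRr1// gt_eqF.
Qed.

Lemma power_integrableD f g : power_integrable q f -> power_integrable q g ->
  power_integrable q (fun x => f x + g x).
Proof.
move=> [mf ff] [mg gf]; split; first exact: (measurable_funD mf mg).
apply: (le_lt_trans (power_integralD q1 mf mg)).
by apply: lte_mul_pinfty; [by rewrite lee_fin; exact: powR_ge0|by []|exact: (lte_add_pinfty ff gf)].
Qed.

Lemma power_integrableZ c f : power_integrable q f -> power_integrable q (fun x => c * f x).
Proof.
move=> [mf ff]; split; first exact: (measurable_funM (measurable_cst _) mf).
rewrite (power_integralZ q c mf).
by apply: lte_mul_pinfty; [by rewrite lee_fin; exact: powR_ge0|by []|exact: ff].
Qed.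

Lemma power_integrableB f g : power_integrable q f -> power_integrable q g ->
  power_integrable q (fun x => f x - g x).
Proof.
move=> pf pg; rewrite (_ : (fun x => _) = fun x => f x + -1 * g x).
  exact: power_integrableD pf (power_integrableZ _ pg).
by apply/funext => x; rewrite mulN1r.
Qed.

Lemma power_normD f g : power_integrable q f -> power_integrable q g ->
  power_norm q (fun x => f x + g x) <= power_norm q f + power_norm q g.
Proof.
move=> pf pg; have [mf _] := pf; have [mg _] := pg.
rewrite -lee_fin EFinD (EFin_power_norm pf) (EFin_power_norm pg).
rewrite (EFin_power_norm (power_integrableD pf pg)).
exact: (minkowski_EFin leb mf mg q1).
Qed.

Lemma power_normN f : power_norm q (fun x => - f x) = power_norm q f.
Proof. by rewrite !power_normE power_integralN. Qed.

Lemma power_normZ c f : power_integrable q f -> power_norm q (fun x => c * f x) = `|c| * power_norm q f.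
Proof.
move=> pf; have [mf _] := pf; rewrite !power_normE (power_integralZ q c mf) (fineM _ (power_integral_fin pf)); last by [].
rewrite (powRM _ (powR_ge0 _ _) (fine_ge0 (power_integral_ge0 _ _))).
by rewrite -powRrM mulfV ?powRr1// gt_eqF.
Qed.

Lemma power_norm0 : power_norm q (fun _ : 'rV[R]_n => 0 : R) = 0.
Proof.
have p0 : power_integral q (fun _ : 'rV[R]_n => 0 : R) = 0%E.
  rewrite power_integralE (eq_integral (cst 0%E)) ?integral0// => x _.
  by rewrite normr0 powR0// gt_eqF.
by rewrite power_normE p0 powR0// invr_eq0 gt_eqF.
Qed.

Lemma power_norm_dist f g h : power_integrable q f -> power_integrable q g -> power_integrable q h ->
  power_norm q (fun x => f x - g x) <= power_norm q (fun x => h x - f x) + power_norm q (fun x => h x - g x).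
Proof.
move=> pf pg ph; rewrite -(power_normN (fun x => h x - f x)).
have -> : (fun x => - (h x - f x)) = (fun x => f x - h x) by apply/funext => x; rewrite opprB.
have -> : (fun x => f x - g x) = (fun x => (f x - h x) + (h x - g x)).
  by apply/funext => x; rewrite addrA subrK.
by apply: power_normD; exact: power_integrableB.
Qed.

(** The power [q] of a value in [0, B] is at most [B `^ (q - 1)] times the
    value. *)
Lemma power_integrable_bounded f B : leb.-integrable setT (EFin \o f) ->
  (forall x, `|f x| <= B) -> power_integrable q f.
Proof.
move=> /[dup] /integrable_measurable_real mf /integrableP[_ ifin] hB.
have B0 : 0 <= B by exact: le_trans (hB 0).
split; first exact: mf.
have bd x : `|f x| `^ q <= B `^ (q - 1) * `|f x|.
  have [->|f0] := eqVneq (f x) 0; first by rewrite normr0 mulr0 powR0// gt_eqF.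
  rewrite -(mulr_powRB1 (normr_ge0 _) q0) mulrC ler_wpM2r//.
  by rewrite ge0_ler_powR ?nnegrE ?subr_ge0.
rewrite power_integralE; apply: (@le_lt_trans _ _ ((B `^ (q - 1))%:E * \int[leb]_x `|(f x)%:E|)%E).
  rewrite -ge0_integralZl//; last 2 first.
  - by apply/measurable_EFinP; exact: measurableT_comp.
  - by rewrite lee_fin powR_ge0.
  apply: ge0_le_integral => //.
  - exact: measurable_power.
  - by apply/measurable_EFinP; apply: measurable_funM => //; exact: measurableT_comp.
  by move=> x _; rewrite -EFinM lee_fin bd.
by apply: lte_mul_pinfty; [rewrite lee_fin; exact: powR_ge0|by []|exact: ifin].
Qed.

Lemma power_integrable_test phi : test_function phi -> power_integrable q (phi : _ -> R).
Proof.
move=> tp; have [_ mp [B _ hB] ip] := test_function_facts tp.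
exact: power_integrable_bounded ip hB.
Qed.

Lemma power_norm_approximation f : power_integrable q f -> forall e : R, 0 < e ->
  exists2 phi : 'rV[R]_n -> R^o, test_function phi & power_norm q (fun x => f x - phi x) <= e.
Proof.
move=> [mf ff] e e0.
have [_ /(_ _ (powR_gt0 q e0))[phi tp hp]] := test_functions_dense q1 mf ff.
exists phi => //; have mp := measurable_test tp.
by have [] := power_norm_small (measurable_funB mf mp) (ltW e0) hp.
Qed.

End power_norm.

Section extension_of_functionals.
Context {R : realType} {n : nat}.
Variable q C : R.
Hypothesis q1 : 1 <= q.
Hypothesis C0 : 0 <= C.
Variable L : ('rV[R]_n -> R^o) -> R.
Hypothesis L_linear : forall (a : R) (u v : 'rV[R]_n -> R^o), test_function u -> test_function v ->
  L (fun x => a *: u x + v x) = a * L u + L v.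
Hypothesis L_bounded : forall u : 'rV[R]_n -> R^o, test_function u -> `|L u| <= C * power_norm q u.
Implicit Types (f g : 'rV[R]_n -> R) (phi psi : 'rV[R]_n -> R^o).

Let LD phi psi : test_function phi -> test_function psi ->
  L (fun x => phi x + psi x) = L phi + L psi.
Proof.
move=> tp ts; rewrite -[L phi]mul1r -L_linear//; congr L.
by apply/funext => x; rewrite scale1r.
Qed.

Let L0 : L (fun=> 0) = 0.
Proof.
have t0 := @test_function_cst0 R n R^o.
have := LD t0 t0; have -> : (fun x : 'rV[R]_n => 0 + 0 : R^o) = fun=> 0 by apply/funext => x; rewrite addr0.
by move=> /eqP; rewrite -subr_eq subrr eq_sym => /eqP.
Qed.

Let LZ c phi : test_function phi -> L (fun x => c *: phi x) = c * L phi.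
Proof.
move=> tp; have t0 := @test_function_cst0 R n R^o.
rewrite -[RHS]addr0 -L0 -L_linear//; congr L.
by apply/funext => x; rewrite addr0.
Qed.

Let LB phi psi : test_function phi -> test_function psi ->
  L (fun x => phi x - psi x) = L phi - L psi.
Proof.
move=> tp ts; rewrite -mulN1r -LZ// -LD//; last exact: test_functionZ.
by congr L; apply/funext => x; rewrite scaleN1r.
Qed.

Let test_functionB phi psi : test_function phi -> test_function psi ->
  test_function (fun x => phi x - psi x : R^o).
Proof.
move=> tp ts; have := test_functionD tp (test_functionZ (-1) ts).
by congr test_function; apply/funext => x; rewrite scaleN1r.
Qed.

(** The values of a bounded functional at the test functions near a power
    integrable function determine its value there: any number compatible
    with the bound is an admissible extension, and density makes it unique. *)
Definition extended f : R :=
  sup [set L phi - C * power_norm q (fun x => f x - phi x) | phi in @test_function R n R^o].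

Lemma extended_dist f phi : power_integrable q f -> test_function phi ->
  `|extended f - L phi| <= C * power_norm q (fun x => f x - phi x).
Proof.
move=> pf tp; rewrite /extended; set S := (X in sup X).
have key u v : test_function u -> test_function v ->
    L u - C * power_norm q (fun x => f x - u x) <= L v + C * power_norm q (fun x => f x - v x).
  move=> tu tv; rewrite lerBlDr -addrA -lerBlDl -LB//.
  apply: (le_trans (ler_norm _)); apply: (le_trans (L_bounded (test_functionB tu tv))).
  rewrite -mulrDr ler_wpM2l// addrC.
  by apply: power_norm_dist => //; exact: power_integrable_test.
have ub : ubound S (L phi + C * power_norm q (fun x => f x - phi x)).
  by move=> _ [u tu <-]; exact: key.
have hS : has_sup S.
  by split; [exists (L phi - C * power_norm q (fun x => f x - phi x)), phi|
    exists (L phi + C * power_norm q (fun x => f x - phi x))].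
rewrite ler_distl; apply/andP; split.
  by apply: sup_upper_bound => //; exists phi.
by apply: sup_le_ub => //; case: hS.
Qed.

(** Uniqueness of the extension, the source of its linearity. *)
Lemma extended_eq f a K : power_integrable q f -> 0 <= K ->
  (forall e : R, 0 < e -> exists2 phi, test_function phi &
     power_norm q (fun x => f x - phi x) <= e /\ `|a - L phi| <= K * e) -> extended f = a.
Proof.
move=> pf K0 h; apply/eqP; rewrite -subr_eq0 -normr_le0; apply/ler_addgt0Pr => e e0.
rewrite add0r; have CK : 0 < C + K + 1 by rewrite ltr_wpDl// addr_ge0.
have [phi tp [h1 h2]] := h _ (divr_gt0 e0 CK); set d := e / _ in h1 h2.
have d0 : 0 < d by exact: divr_gt0.
have -> : extended f - a = (extended f - L phi) - (a - L phi) by ring.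
apply: (le_trans (ler_normB _ _)).
apply: (@le_trans _ _ (C * d + K * d)).
  apply: lerD => //; apply: (le_trans (extended_dist pf tp)); exact: ler_wpM2l.
rewrite -mulrDl; apply: (@le_trans _ _ ((C + K + 1) * d)).
  by rewrite ler_wpM2r ?(ltW d0)// lerDl.
by rewrite /d mulrC mulfVK// gt_eqF.
Qed.

Lemma extended_test phi : test_function phi -> extended phi = L phi.
Proof.
move=> tp; apply: (@extended_eq _ _ 0) => //; first exact: power_integrable_test.
move=> e e0; exists phi => //; rewrite subrr normr0 mul0r; split => //.
by rewrite (_ : (fun x => _) = fun=> 0) ?power_norm0 ?(ltW e0)//; apply/funext => x; rewrite subrr.
Qed.

Lemma extended_bound f : power_integrable q f -> `|extended f| <= C * power_norm q f.
Proof.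
move=> pf; have := extended_dist pf (@test_function_cst0 R n R^o); rewrite L0 subr0.
by under eq_fun do rewrite subr0.
Qed.

Lemma extendedD f g : power_integrable q f -> power_integrable q g ->
  extended (fun x => f x + g x) = extended f + extended g.
Proof.
move=> pf pg; apply: (@extended_eq _ _ (C + C)); [exact: power_integrableD|exact: addr_ge0|].
move=> e e0; have e20 : 0 < e / 2 by rewrite divr_gt0.
have [phi tp hp] := power_norm_approximation q1 pf e20.
have [psi ts hs] := power_norm_approximation q1 pg e20.
exists (fun x => phi x + psi x); first exact: test_functionD.
have pp := power_integrable_test q1 tp; have ps := power_integrable_test q1 ts.
split.
  have -> : (fun x => f x + g x - (phi x + psi x)) = (fun x => (f x - phi x) + (g x - psi x)).
    by apply/funext => x; rewrite opprD addrACA.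
  apply: (le_trans (power_normD q1 (power_integrableB q1 pf pp) (power_integrableB q1 pg ps))).
  by rewrite [leRHS]splitr lerD.
rewrite LD// opprD addrACA; apply: (le_trans (ler_normD _ _)); rewrite mulrDl.
apply: lerD.
  apply: (le_trans (extended_dist pf tp)); apply: ler_wpM2l => //; apply: (le_trans hp).
  by rewrite ler_pdivrMr// ler_pMr// ler1n.
apply: (le_trans (extended_dist pg ts)); apply: ler_wpM2l => //; apply: (le_trans hs).
by rewrite ler_pdivrMr// ler_pMr// ler1n.
Qed.

Lemma extendedZ c f : power_integrable q f -> extended (fun x => c * f x) = c * extended f.
Proof.
move=> pf; have c1 : 0 < `|c| + 1 by rewrite ltr_wpDl.
apply: (@extended_eq _ _ C) => //; first exact: power_integrableZ.
move=> e e0; have [phi tp hp] := power_norm_approximation q1 pf (divr_gt0 e0 c1).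
have pp := power_integrable_test q1 tp; have pb := power_integrableB q1 pf pp.
have small : `|c| * power_norm q (fun x => f x - phi x) <= e.
  apply: (@le_trans _ _ ((`|c| + 1) * (e / (`|c| + 1)))); last by rewrite mulrC mulfVK// gt_eqF.
  by apply: ler_pM => //; [exact: power_norm_ge0|rewrite lerDl].
exists (fun x => c *: phi x); first exact: test_functionZ.
split.
  have -> : (fun x => c * f x - c *: phi x) = (fun x => c * (f x - phi x)).
    by apply/funext => x; rewrite mulrBr.
  by rewrite power_normZ.
rewrite LZ// -mulrBr normrM.
apply: (@le_trans _ _ (`|c| * (C * power_norm q (fun x => f x - phi x)))).
  by apply: ler_wpM2l => //; exact: extended_dist.
by rewrite mulrCA ler_wpM2l.
Qed.

Lemma extendedB f g : power_integrable q f -> power_integrable q g ->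
  extended (fun x => f x - g x) = extended f - extended g.
Proof.
move=> pf pg; rewrite -mulN1r -extendedZ// -extendedD//; last exact: power_integrableZ.
by congr extended; apply/funext => x; rewrite mulN1r.
Qed.

End extension_of_functionals.

(** * An integrable weight *)

Section weight_function.
Context {R : realType} {n : nat}.
Local Notation leb := (@lebesgue_rV R n.+1).
Local Notation omega := (@unit_ball_volume R n.+1).

Definition weight_profile (r : R) : R := expR (- `|r|) / (1 + `|r| ^+ n).

Lemma weight_profile_gt0 r : 0 < weight_profile r.
Proof. by rewrite divr_gt0 ?expR_gt0// ltr_wpDr// exprn_ge0. Qed.

Lemma measurable_weight_profile : measurable_fun setT weight_profile.
Proof.
apply: continuous_measurable_fun => r.
have c1 : continuous (fun r : R => expR (- `|r|)).
  by move=> s; apply: (cvg_comp _ _ (cvgN (@norm_continuous R R^o s))); exact: continuous_expR.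
have c2 : continuous (fun r : R => 1 + `|r| ^+ n).
  move=> s; apply: cvgD; first exact: cvg_cst.
  exact: (cvg_comp (fun r : R => `|r|) (fun r : R => r ^+ n) (@norm_continuous R R^o s) (@exprn_continuous R n `|s|)).
apply: (cvgM (c1 r)); apply: cvgV; last exact: c2.
by rewrite gt_eqF// ltr_wpDr// exprn_ge0.
Qed.

(** An integrable weight that is bounded below on bounded sets turns Lebesgue
    measure into a finite measure with the same null sets. *)
Lemma integrable_weight : exists w : 'rV[R]_n.+1 -> R,
  [/\ leb.-integrable setT (EFin \o w), forall x, 0 < w x <= 1 &
      forall M, exists2 c, 0 < c & forall x, `|x| <= M -> c <= w x].
Proof.
exists (fun x => weight_profile (enorm x)); split.
- apply/integrableP; split.
    apply/measurable_EFinP; apply: (measurableT_comp measurable_weight_profile).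
    exact: measurable_enorm.
  rewrite (eq_integral (fun z => (weight_profile (enorm z))%:E)); last first.
    by move=> x _; rewrite /= ger0_norm// ltW// weight_profile_gt0.
  rewrite (@ge0_integral_radial R n (fun r => (weight_profile r)%:E)); last 2 first.
  + apply/measurable_EFinP; exact: measurable_weight_profile.
  + by move=> r; rewrite lee_fin ltW// weight_profile_gt0.
  pose K := n.+1%:R * omega.
  have K0 : 0 <= K by rewrite mulr_ge0// ltW// unit_ball_volume_gt0.
  have ip : (\int[lebesgue_measure]_r (exponential_pdf (1 : R) r)%:E = 1)%E.
    by apply: integral_exponential_pdf.
  apply: (@le_lt_trans _ _ (\int[lebesgue_measure]_r (K%:E * (exponential_pdf (1 : R) r)%:E))%E); last first.
    rewrite ge0_integralZl//; first by rewrite ip mule1 ltry.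
    * by apply/measurable_EFinP; exact: measurable_exponential_pdf.
    * by move=> r _; rewrite lee_fin exponential_pdf_ge0.
  apply: ge0_le_integral => //.
  + by move=> r _; rewrite -EFinM lee_fin mulr_ge0 ?radial_weight_ge0// ltW// weight_profile_gt0.
  + apply/measurable_EFinP; apply: measurable_funM; first exact: measurable_weight_profile.
    exact: measurable_radial_weight.
  + by apply/measurable_EFinP; apply: measurable_funM => //; exact: measurable_exponential_pdf.
  move=> r _; rewrite -!EFinM lee_fin /radial_weight.
  have [r0|r0] := ltP 0 r; last first.
    have rN : (r \in `]0, +oo[%classic) = false.
      by apply/negbTE/negP => /set_mem; rewrite /= in_itv/= andbT ltNge r0.
    by rewrite indicE rN !mulr0; apply: mulr_ge0 => //; exact: exponential_pdf_ge0.
  rewrite exponential_pdfE ?(ltW r0)// mul1r /weight_profile gtr0_norm//.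
  rewrite indicE mem_set ?mulr1; last by rewrite /= in_itv/= r0.
  have rn : 0 <= r ^+ n by rewrite exprn_ge0// ltW.
  rewrite mulN1r -/K; set E := expR (- r); set t := r ^+ n.
  have -> : E / (1 + t) * (K * t) = K * E * (t / (1 + t)) by ring.
  apply: ler_piMr; first by apply: mulr_ge0 => //; exact: expR_ge0.
  by rewrite ler_pdivrMr ?mul1r ?lerDr// ltr_wpDr.
- move=> x; rewrite weight_profile_gt0/= /weight_profile.
  have en : 0 <= `|enorm x| ^+ n by rewrite exprn_ge0.
  rewrite ler_pdivrMr ?mul1r; last by rewrite ltr_wpDr.
  apply: (@le_trans _ _ 1); last by rewrite lerDl.
  by rewrite -expR0 ler_expR oppr_le0.
- move=> M; pose N := n.+1%:R * `|M|.
  have N0 : 0 <= N by rewrite mulr_ge0.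
  exists (weight_profile N); first exact: weight_profile_gt0.
  move=> x xM.
  have eN : enorm x <= N.
    apply: (le_trans (le_enorm_norm _)); rewrite ler_wpM2l//.
    exact: le_trans xM (ler_norm _).
  have e0 := enorm_ge0 x.
  rewrite /weight_profile !ger0_norm//.
  have p1 : 0 < 1 + enorm x ^+ n by rewrite ltr_wpDr// exprn_ge0.
  apply: ler_pM; rewrite ?expR_ge0 ?invr_ge0 ?addr_ge0 ?exprn_ge0//.
    by rewrite ler_expR lerN2.
  rewrite lef_pV2 ?posrE ?ltr_wpDr ?exprn_ge0//.
  by rewrite lerD2l; apply: lerXn2r.
Qed.

End weight_function.

(** * Bounded functionals as charges *)

Section riesz_representation.
Context {R : realType} {n : nat}.
Local Notation leb := (@lebesgue_rV R n.+1).
Variable q C : R.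
Hypothesis q1 : 1 <= q.
Hypothesis C0 : 0 <= C.
Variable L : ('rV[R]_n.+1 -> R^o) -> R.
Hypothesis L_linear : forall (a : R) (u v : 'rV[R]_n.+1 -> R^o),
  test_function u -> test_function v ->
  L (fun x => a *: u x + v x) = a * L u + L v.
Hypothesis L_bounded : forall u : 'rV[R]_n.+1 -> R^o,
  test_function u -> `|L u| <= C * power_norm q u.
Variable w : 'rV[R]_n.+1 -> R.
Hypothesis iw : leb.-integrable setT (EFin \o w).
Hypothesis w01 : forall x, 0 < w x <= 1.
Implicit Types (f g b : 'rV[R]_n.+1 -> R) (E F : set 'rV[R]_n.+1).

Let q0 : 0 < q. Proof. exact: lt_le_trans q1. Qed.
Let ext := extended q C L.
Let w0 x : 0 <= w x. Proof. by case/andP: (w01 x) => /ltW. Qed.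
Let w1 x : `|w x| <= 1. Proof. by rewrite ger0_norm//; case/andP: (w01 x). Qed.

Lemma weighted_power_integrable b B : measurable_fun setT b -> (forall x, `|b x| <= B) ->
  power_integrable q (fun x => w x * b x).
Proof.
move=> mb hB; apply: (@power_integrable_bounded _ _ _ q1 _ B).
  exact: integrable_mul_bounded hB.
move=> x; rewrite normrM -[B]mul1r; exact: ler_pM.
Qed.

Definition weighted_indicator E : 'rV[R]_n.+1 -> R := fun x => w x * \1_E x.

Lemma indic_bound E x : `|\1_E x : R| <= 1.
Proof. by rewrite indicE normr_nat lern1 leq_b1. Qed.

Lemma power_integrable_weighted_indicator E : measurable E ->
  power_integrable q (weighted_indicator E).
Proof.
move=> mE; apply: (@weighted_power_integrable _ 1); last exact: indic_bound.
exact: measurable_indic.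
Qed.

(** The weight makes the indicator of every measurable set power integrable,
    so that the charge is finite. *)
Definition extension_charge E : \bar R := (ext (weighted_indicator E))%:E.

Let nu0 : extension_charge set0 = 0%E.
Proof.
rewrite /extension_charge (_ : weighted_indicator set0 = fun x => 0 * w x).
  rewrite /ext extendedZ//; first by rewrite mul0r.
  by have := power_integrable_bounded q1 iw w1.
by apply/funext => x; rewrite /weighted_indicator indic0 mulr0 mul0r.
Qed.

Let nu_fin E : measurable E -> extension_charge E \is a fin_num.
Proof. by []. Qed.

Lemma ext_indicatorU E F : measurable E -> measurable F -> E `&` F = set0 ->
  ext (weighted_indicator (E `|` F)) = ext (weighted_indicator E) + ext (weighted_indicator F).
Proof.
move=> mE mF EF; rewrite /ext -extendedD//; last 2 first.
- exact: power_integrable_weighted_indicator.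
- exact: power_integrable_weighted_indicator.
congr (extended _ _ _ _); apply/funext => x; rewrite /weighted_indicator -mulrDr; congr (_ * _).
rewrite !indicE in_setU.
have [xE|] := boolP (x \in E); have [xF|] := boolP (x \in F); rewrite ?addr0 ?add0r//.
by have : (E `&` F) x by [split; exact: set_mem]; rewrite EF.
Qed.

(** Continuity of the extension along dominated pointwise limits. It gives both
    the countable additivity of the charge and the passage from simple
    functions to bounded ones. *)
Lemma weighted_approximation_vanishes b (s : nat -> 'rV[R]_n.+1 -> R) B :
  measurable_fun setT b -> (forall x, `|b x| <= B) -> (forall k, measurable_fun setT (s k)) ->
  (forall k x, `|b x - s k x| <= `|b x|) -> (forall x, s k x @[k --> \oo] --> b x) ->
  ext (fun x => w x * s k x) @[k --> \oo] --> ext (fun x => w x * b x).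
Proof.
move=> mb hB ms hs cs; apply/cvgrPdist_le => e e0.
have C1 : 0 < C + 1 by rewrite ltr_wpDl.
have pb := weighted_power_integrable mb hB.
have ps k : power_integrable q (fun x => w x * s k x).
  apply: (@weighted_power_integrable _ (B + B)) => // x.
  have -> : s k x = b x - (b x - s k x) by rewrite opprB addrC subrK.
  apply: (le_trans (ler_normB _ _)); apply: lerD => //; exact: le_trans (hs k x) (hB x).
have d0 := divr_gt0 e0 C1; set d := e / _ in d0.
have := @power_integral_vanishes _ _ q q1 (fun x => w x * b x) (fun k x => w x * s k x).
move=> /(_ (proj1 pb) (proj2 pb) (fun k => proj1 (ps k))) /=.
have h1 k x : `|w x * b x - w x * s k x| <= `|w x * b x|.
  by rewrite -mulrBr !normrM ler_wpM2l.
have h2 x : w x * s k x @[k --> \oo] --> w x * b x by apply: cvgM; [exact: cvg_cst|exact: cs].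
move=> /(_ h1 h2 _ (powR_gt0 q d0)); apply: filterS => k hk.
have pbk := power_integrableB q1 pb (ps k).
have [_ nk] := power_norm_small q1 (proj1 pbk) (ltW d0) hk.
rewrite /ext -extendedB//; apply: (le_trans (extended_bound q1 C0 L_linear L_bounded pbk)).
apply: (@le_trans _ _ ((C + 1) * d)); last by rewrite /d mulrC mulfVK// gt_eqF.
by apply: ler_pM => //; [exact: power_norm_ge0|rewrite lerDl].
Qed.

Let nu_sigma_additive : semi_sigma_additive extension_charge.
Proof.
move=> F mF tF mU.
pose U K := \big[setU/set0]_(k < K) F k.
have mUK K : measurable (U K) by exact: bigsetU_measurable.
have sumE K : (\sum_(0 <= k < K) extension_charge (F k) = (ext (weighted_indicator (U K)))%:E)%E.
  elim: K => [|K IH]; first by rewrite big_geq// /U big_ord0 -nu0.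
  have UE : U K.+1 = U K `|` F K by rewrite /U big_ord_recr.
  rewrite big_nat_recr//= IH UE (ext_indicatorU (mUK K) (mF K))//.
  rewrite -subset0 => x [+ FK]; rewrite /U -bigcup_mkord => -[k /= kK Fk].
  have := tF k K I I; move=> h; have : k = K by apply: h; exists x.
  by move=> kE; rewrite kE ltnn in kK.
under eq_fun do rewrite sumE.
apply/fine_cvgP; split; first by near=> k.
have sub K : U K `<=` \bigcup_k F k.
  by rewrite /U -bigcup_mkord => x [k _ Fx]; exists k.
apply: (@weighted_approximation_vanishes _ (fun K => \1_(U K)) 1).
- exact: measurable_indic.
- exact: indic_bound.
- by move=> K; exact: measurable_indic.
- move=> K x; rewrite !indicE; have [xU|xU] := boolP (x \in U K).
    by rewrite (mem_set (sub _ _ (set_mem xU))) subrr normr0.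
  by rewrite subr0.
- move=> x; apply: cvg_near_cst; rewrite !indicE; have [xU|xU] := boolP (x \in \bigcup_k F k).
    have [k _ Fx] := set_mem xU; exists k.+1 => // K /= kK.
    rewrite indicE mem_set// /U -bigcup_mkord; by exists k.
  apply: nearW => K; rewrite indicE; case: (boolP (x \in U K)) => // xK.
  by rewrite (mem_set (sub _ _ (set_mem xK))) in xU.
Unshelve. all: by end_near. Qed.

HB.instance Definition _ := isCharge.Build _ _ _ extension_charge nu0 nu_fin nu_sigma_additive.

(** A null set has a weighted indicator of norm zero, so the charge is
    absolutely continuous and has a Radon-Nikodym derivative. *)
Lemma extension_charge_density : exists2 h : 'rV[R]_n.+1 -> R,
  leb.-integrable setT (EFin \o h) & forall E, measurable E ->
    ext (weighted_indicator E) = \int[leb]_(x in E) h x.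
Proof.
have dom : extension_charge `<< leb.
  apply/null_content_dominatesP => E mE E0; rewrite /extension_charge; congr EFin.
  apply/eqP; rewrite -normr_le0; have pE := power_integrable_weighted_indicator mE.
  apply: (le_trans (extended_bound q1 C0 L_linear L_bounded pE)).
  rewrite power_normE (_ : power_integral q _ = 0%E) ?powR0 ?mulr0 ?invr_eq0 ?gt_eqF//.
  rewrite power_integralE; apply/eqP; rewrite eq_le integral_ge0 ?andbT; last first.
    by move=> x _; rewrite lee_fin powR_ge0.
  apply: (@le_trans _ _ (\int[leb]_x (\1_E x)%:E)%E).
    apply: ge0_le_integral => //.
    - by apply: measurable_power; case: pE.
    - by apply/measurable_EFinP; exact: measurable_indic.
    move=> x _; rewrite lee_fin /weighted_indicator indicE; case: (x \in E).
      by rewrite mulr1; apply: le_trans (w1 x); exact: powR_le_self.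
    by rewrite mulr0 normr0 powR0// gt_eqF.
  by rewrite integral_indic// setIT E0.
pose h := Radon_Nikodym extension_charge leb.
have hfin x : h x \is a fin_num by exact: Radon_Nikodym_fin_num.
have hE : EFin \o (fine \o h) = h by apply/funext => x /=; rewrite fineK.
exists (fine \o h); first by rewrite hE; exact: Radon_Nikodym_integrable.
move=> E mE; have := Radon_Nikodym_integral dom mE; rewrite /extension_charge => e.
rewrite /Rintegral -[X in fine (integral _ _ X)]/(EFin \o (fine \o h)) hE.
by rewrite -/h in e; rewrite -e.
Qed.

Lemma ext_sum (I : Type) (r : seq I) (c : I -> R) (f : I -> 'rV[R]_n.+1 -> R) :
  (forall i, power_integrable q (f i)) ->
  power_integrable q (fun x => \sum_(i <- r) c i * f i x) /\
  ext (fun x => \sum_(i <- r) c i * f i x) = \sum_(i <- r) c i * ext (f i).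
Proof.
move=> pf; elim: r => [|i r [p1 IH]].
  have -> : (fun x : 'rV[R]_n.+1 => \sum_(i <- [::]) c i * f i x) = fun x => 0 * w x.
    by apply/funext => x; rewrite big_nil mul0r.
  have pw : power_integrable q w := power_integrable_bounded q1 iw w1.
  by split; [exact: power_integrableZ|rewrite /ext extendedZ// big_nil mul0r].
have -> : (fun x => \sum_(j <- i :: r) c j * f j x) =
    fun x => c i * f i x + \sum_(j <- r) c j * f j x by apply/funext => x; rewrite big_cons.
split; first exact: (power_integrableD q1 (power_integrableZ (c i) (pf i)) p1).
by rewrite /ext extendedD//; [rewrite extendedZ// -/ext IH big_cons|exact: power_integrableZ].
Qed.

Section density_representation.
Variable h : 'rV[R]_n.+1 -> R.
Hypothesis ih : leb.-integrable setT (EFin \o h).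
Hypothesis hE : forall E, measurable E -> ext (weighted_indicator E) = \int[leb]_(x in E) h x.

Import HBNNSimple.

Lemma ext_density_ge0 b B : measurable_fun setT b -> (forall x, 0 <= b x <= B) ->
  ext (fun x => w x * b x) = \int[leb]_x (h x * b x).
Proof.
move=> mb hb.
have b0 x : 0 <= b x by case/andP: (hb x).
have mEb : measurable_fun setT (EFin \o b) by exact/measurable_EFinP.
have [s [nds cs]] := approximation measurableT mEb (fun x _ => b0 x).
have sc x : s k x @[k --> \oo] --> b x by have := cs x I; move=> /fine_cvg.
have sle k x : s k x <= b x.
  have ndx : nondecreasing_seq (fun k => s k x) by move=> i j /nds /lefP.
  by have := nondecreasing_cvgn_le ndx (cvgP _ (sc x)) k; rewrite (cvg_lim _ (sc x)).
have s0 k x : 0 <= s k x by exact: fun_ge0.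
have ms k : measurable_fun setT (s k : _ -> R) by exact: measurable_funPT.
have sE k : ext (fun x => w x * s k x) = \int[leb]_x (h x * s k x).
  have [N [c hc]] : exists N (c : 'I_N -> R),
      forall x, s k x = \sum_(i < N) c i * \1_(s k @^-1` [set c i]) x.
    by eexists; eexists; exact: (fimfunEord (s k)).
  pose E i := s k @^-1` [set c i].
  have mE i : measurable (E i).
    by rewrite -[E i]setTI; exact: (ms k measurableT [set c i]).
  have -> : (fun x => w x * s k x) = fun x => \sum_(i < N) c i * weighted_indicator (E i) x.
    by apply/funext => x; rewrite hc mulr_sumr; apply: eq_bigr => i _; rewrite mulrCA.
  have [_ ->] := ext_sum (index_enum 'I_N) c (fun i => power_integrable_weighted_indicator (mE i)).
  have ii i : leb.-integrable setT (EFin \o (fun x => h x * \1_(E i) x)).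
    by apply: (integrable_mul_bounded measurableT ih) (indic_bound (E i)); exact: measurable_indic.
  rewrite (@eq_Rintegral _ _ _ _ _ (fun x => \sum_(i < N) c i * (h x * \1_(E i) x))); last first.
    by move=> x _; rewrite hc mulr_sumr; apply: eq_bigr => i _; rewrite mulrCA.
  rewrite Rintegral_sum//; last by move=> i; exact: (integrableZl measurableT (c i) (ii i)).
  apply: eq_bigr => i _; rewrite RintegralZl//; congr (_ * _); rewrite hE//.
  rewrite Rintegral_mkcond; apply: eq_Rintegral => x _; rewrite patchE indicE.
  by case: (x \in E i); rewrite ?mulr1 ?mulr0.
have l1 : ext (fun x => w x * s k x) @[k --> \oo] --> ext (fun x => w x * b x).
  apply: (@weighted_approximation_vanishes b (fun k => s k) B) => //.
    by move=> x; rewrite ger0_norm//; case/andP: (hb x).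
  by move=> k x; rewrite ger0_norm ?subr_ge0// ger0_norm// gerBl.
have l2 : \int[leb]_x (h x * s k x) @[k --> \oo] --> \int[leb]_x (h x * b x).
  have ihb : leb.-integrable setT (EFin \o (fun x => h x * b x)).
    apply: (integrable_mul_bounded measurableT ih mb (B := B)) => x.
    by rewrite ger0_norm//; case/andP: (hb x).
  have mh : measurable_fun setT h by exact: integrable_measurable_real ih.
  have [] := @dominated_convergence _ _ R leb setT measurableT
    (fun k x => (h x * s k x)%:E) (fun x => (h x * b x)%:E) (fun x => `|(h x * b x)%:E|%E).
  - by move=> k; apply/measurable_EFinP; exact: measurable_funM.
  - by case/integrableP: ihb.
  - apply: aeW => x _; apply/fine_cvgP; split; first by near=> k.
    by apply: cvgM; [exact: cvg_cst|exact: sc].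
  - exact: integrable_abse.
  - apply: aeW => x k _; rewrite /= lee_fin !normrM ler_wpM2l// ger0_norm// ger0_norm//.
  move=> _ _; have fhb := integrable_fin_num measurableT ihb.
  rewrite -[X in _ --> X](fineK fhb) => /fine_cvg; exact.
apply: (cvg_unique (@norm_hausdorff R R^o) l1).
apply: cvg_trans l2; apply: near_eq_cvg; apply: nearW => k /=.
by rewrite sE.
Unshelve. all: by end_near. Qed.

Lemma ext_density b B : measurable_fun setT b -> (forall x, `|b x| <= B) ->
  ext (fun x => w x * b x) = \int[leb]_x (h x * b x).
Proof.
move=> mb hB.
have hp : forall x, 0 <= Num.max (b x) 0 <= B.
  move=> x; rewrite le_max lexx orbT/= ge_max; have := hB x; move=> hb.
  by rewrite (le_trans (ler_norm _) hb) (le_trans (normr_ge0 _) hb).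
have hn : forall x, 0 <= Num.max (- b x) 0 <= B.
  move=> x; rewrite le_max lexx orbT/= ge_max; have := hB x; move=> hb.
  by rewrite (le_trans _ hb) ?(le_trans (normr_ge0 _) hb)// -normrN ler_norm.
have mp : measurable_fun setT (fun x => Num.max (b x) 0) by exact: measurable_maxr.
have mn : measurable_fun setT (fun x => Num.max (- b x) 0).
  by apply: measurable_maxr => //; exact: measurableT_comp.
have bE x : b x = Num.max (b x) 0 - Num.max (- b x) 0.
  have [bx|bx] := leP (b x) 0.
    by rewrite (@max_l _ _ (- b x)) ?oppr_ge0// opprK add0r.
  by rewrite (@max_r _ _ (- b x)) ?subr0// oppr_le0 ltW.
have nrm (f : 'rV[R]_n.+1 -> R) : (forall x, 0 <= f x <= B) -> forall x, `|f x| <= B.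
  by move=> hf x; have /andP[f0 fB] := hf x; rewrite ger0_norm.
have p1 := weighted_power_integrable mp (nrm _ hp).
have p2 := weighted_power_integrable mn (nrm _ hn).
have -> : (fun x => w x * b x) = (fun x => w x * Num.max (b x) 0 - w x * Num.max (- b x) 0).
  by apply/funext => x; rewrite [in LHS]bE mulrBr.
rewrite /ext extendedB// -/ext (ext_density_ge0 mp hp) (ext_density_ge0 mn hn).
rewrite -RintegralB//; last 2 first.
- exact: (integrable_mul_bounded measurableT ih mp (nrm _ hp)).
- exact: (integrable_mul_bounded measurableT ih mn (nrm _ hn)).
by apply: eq_Rintegral => x _; rewrite [in RHS]bE mulrBr.
Qed.

End density_representation.

End riesz_representation.

(** * Norms by duality *)

Section dual_bounds.
Context {R : realType} {n : nat}.
Local Notation leb := (@lebesgue_rV R n).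
Implicit Types (g u : 'rV[R]_n -> R).

(** Bounded functions with bounded support are test objects that are rich
    enough to compute the norm of [g] while all the integrals are finite. *)
Definition tested_against q (C : R) g := forall u (M B : R),
  measurable_fun setT u -> (forall x, M < `|x| -> u x = 0) -> (forall x, `|u x| <= B) ->
  leb.-integrable setT (EFin \o (fun x => g x * u x)) /\
  `|\int[leb]_x (g x * u x)| <= C * power_norm q u.

Lemma measurable_truncation g (k : R) : measurable_fun setT g ->
  measurable [set x : 'rV[R]_n | `|g x| <= k /\ `|x| <= k].
Proof.
move=> mg; have m1 : measurable [set x : 'rV[R]_n | `|g x| <= k].
  rewrite (_ : mkset _ = (fun x => `|g x|) @^-1` `]-oo, k]); last first.
    by apply/seteqP; split => x /=; rewrite in_itv.
  rewrite -[X in measurable X]setTI; apply: (measurableT_comp (@normr_measurable R setT) mg) => //.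
exact: measurableI m1 (measurable_norm_ball k).
Qed.

(** Testing against the power [p - 1] of [g], with the sign of [g] and cut off
    where [g] or the argument is large, gives [I <= C * I `^ q^-1] for the
    truncated integral [I] of the power [p], which is finite; monotone
    convergence removes the cutoff. *)
Lemma dual_bound_finite g q C : 1 < q -> 0 <= C -> measurable_fun setT g ->
  tested_against q C g -> (power_integral (q / (q - 1)) g <= (C `^ (q / (q - 1)))%:E)%E.
Proof.
move=> q1 C0 mg tg; set p := q / (q - 1).
have q0 : 0 < q by apply: lt_trans q1.
have qm : 0 < q - 1 by rewrite subr_gt0.
have p1 : 1 < p by rewrite /p ltr_pdivlMr// mul1r ltrBlDr ltrDl.
have p0 : 0 < p by apply: lt_trans p1.
have pq : (p - 1) * q = p by rewrite /p; field; rewrite gt_eqF.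
have qp : (1 - q^-1) * p = 1.
  by rewrite /p; field; rewrite !gt_eqF.
pose F (k : nat) := [set x : 'rV[R]_n | `|g x| <= k%:R /\ `|x| <= k%:R].
have mF k : measurable (F k) by exact: measurable_truncation.
pose G k (x : 'rV[R]_n) := `|g x| `^ p * \1_(F k) x.
have mgp (r : R) : measurable_fun setT (fun x => `|g x| `^ r).
  by apply: (measurableT_comp (measurable_powR r)); exact: measurableT_comp.
have mG k : measurable_fun setT (G k).
  by apply: measurable_funM => //; exact: measurable_indic.
have G0 k x : 0 <= G k x by rewrite mulr_ge0// powR_ge0.
have bound k : (\int[leb]_x (G k x)%:E <= (C `^ p)%:E)%E.
  pose u x := g x * `|g x| `^ (p - 2) * \1_(F k) x.
  have mu : measurable_fun setT u.
    by apply: measurable_funM; [exact: measurable_funM|exact: measurable_indic].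
  have absE x : `|g x * `|g x| `^ (p - 2)| = `|g x| `^ (p - 1).
    rewrite normrM (ger0_norm (powR_ge0 _ _)).
    have [->|g0] := eqVneq (g x) 0.
      by rewrite normr0 mul0r powR0// subr_eq0 gt_eqF.
    rewrite -{1}(powRr1 (normr_ge0 (g x))) -powRD; first by congr (_ `^ _); ring.
    by rewrite normr_eq0 g0 implybT.
  have guE x : g x * u x = G k x.
    rewrite /G /u !mulrA; congr (_ * _).
    have [->|g0] := eqVneq (g x) 0; first by rewrite !mul0r normr0 powR0// gt_eqF.
    rewrite -expr2 -real_normK ?num_real// -powR_mulrn// -powRD; first by congr (_ `^ _); ring.
    by rewrite normr_eq0 g0 implybT.
  have uq x : `|u x| `^ q = G k x.
    rewrite /u normrM absE normr_nat /G indicE.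
    case: (x \in F k) => /=; last by rewrite !mulr0 powR0// gt_eqF.
    by rewrite !mulr1 -powRrM pq.
  have uB x : `|u x| <= k%:R `^ (p - 1).
    rewrite /u normrM absE indicE; have [/set_mem[gk _]|_] := boolP (x \in F k).
      rewrite normr1 mulr1 ge0_ler_powR ?nnegrE// subr_ge0; exact: ltW.
    by rewrite normr0 mulr0 powR_ge0.
  have uM x : k%:R < `|x| -> u x = 0.
    move=> kx; rewrite /u indicE memNset ?mulr0//= => -[_].
    by rewrite leNgt kx.
  have [igu hgu] := tg u k%:R _ mu uM uB.
  have iG : leb.-integrable setT (EFin \o G k).
    by move: igu; congr (_.-integrable _ (EFin \o _)); apply/funext => x; exact: guE.
  have fG := integrable_fin_num measurableT iG.
  have I0 : 0 <= \int[leb]_x G k x by apply: Rintegral_ge0.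
  rewrite -(fineK fG) lee_fin -[fine _]/(\int[leb]_x G k x).
  set I := \int[leb]_x G k x in I0 *.
  have : I <= C * I `^ q^-1.
    apply: le_trans (le_trans hgu _).
      rewrite (@eq_Rintegral _ _ _ _ _ (G k)); last by move=> x _; exact: guE.
      by rewrite ger0_norm.
    rewrite power_normE power_integralE (eq_integral (EFin \o G k)); first by [].
    by move=> x _; rewrite /= uq.
  have [->|In0] := eqVneq I 0; first by rewrite powR_ge0.
  have Ip : 0 < I by rewrite lt_neqAle eq_sym In0 I0.
  have Iq : 0 < I `^ q^-1 by exact: powR_gt0.
  have IE : I = I `^ (1 - q^-1) * I `^ q^-1.
    by rewrite -powRD ?subrK ?powRr1// In0 implybT.
  rewrite {1}IE ler_pM2r// => h.
  have : (I `^ (1 - q^-1)) `^ p <= C `^ p.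
    by apply: ge0_ler_powR; rewrite ?nnegrE ?powR_ge0// ltW.
  by rewrite -powRrM qp powRr1.
have ndG x : nondecreasing_seq (fun k => (G k x)%:E).
  move=> i j ij; rewrite lee_fin ler_wpM2l ?powR_ge0// !indicE.
  have [/set_mem[h1 h2]|_] := boolP (x \in F i); last by [].
  rewrite mem_set//; split; [apply: le_trans h1 _|apply: le_trans h2 _]; by rewrite ler_nat.
have limG x : limn (fun k => (G k x)%:E) = (`|g x| `^ p)%:E.
  apply: cvg_lim => //; apply: cvg_near_cst; near=> k.
  rewrite /G indicE mem_set ?mulr1//; split; near: k; exact: nbhs_infty_ger.
have mc := @cvg_monotone_convergence _ _ R leb setT measurableT (fun k x => (G k x)%:E)
  (fun k => ltac:(apply/measurable_EFinP; exact: mG)) (fun k x _ => ltac:(rewrite lee_fin; exact: G0))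
  (fun x _ => ndG x).
rewrite power_integralE (eq_integral (fun x => limn (fun k => (G k x)%:E))); last first.
  by move=> x _; rewrite limG.
rewrite -(cvg_lim _ mc)//; apply: lime_le; first by apply/cvg_ex; eexists; exact: mc.
exact: nearW.
Unshelve. all: by end_near. Qed.

(** Testing against the sign of [g] on a bounded part of the set where
    [g] exceeds [C] in absolute value shows that this part is null. *)
Lemma dual_bound_sup g C : 0 <= C -> measurable_fun setT g ->
  tested_against 1 C g -> {ae leb, forall x, `|g x| <= C}.
Proof.
move=> C0 mg tg.
pose E (k : nat) := [set x : 'rV[R]_n | `|g x| <= k%:R /\ `|x| <= k%:R] `&` [set x | C < `|g x|].
have mE k : measurable (E k).
  apply: measurableI; first exact: measurable_truncation.
  rewrite (_ : mkset _ = (fun x => `|g x|) @^-1` `]C, +oo[); last first.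
    by apply/seteqP; split => x /=; rewrite in_itv/= andbT.
  rewrite -[X in measurable X]setTI; apply: (measurableT_comp (@normr_measurable R setT) mg) => //.
have null k : {ae leb, forall x, ~ E k x}.
  pose u x := g x * `|g x|^-1 * \1_(E k) x.
  have gN0 x : E k x -> `|g x| != 0 by move=> [_ /= h]; rewrite gt_eqF// (le_lt_trans C0).
  have mu : measurable_fun setT u.
    apply: measurable_funM; last exact: measurable_indic.
    apply: measurable_funM => //; rewrite (_ : (fun x => _) = fun x => `|g x| `^ (-1)).
      by apply: (measurableT_comp (measurable_powR (-1))); exact: measurableT_comp.
    by apply/funext => x; rewrite powR_inv1.
  have uE x : `|u x| = \1_(E k) x.
    rewrite /u normrM normr_nat indicE; have [/set_mem/gN0 h|_] := boolP (x \in E k); last by rewrite mulr0.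
    by rewrite normrM normrV ?unitfE// normr_id divff// mulr1.
  have guE x : g x * u x = `|g x| * \1_(E k) x.
    rewrite /u !mulrA indicE; have [/set_mem/gN0 h|_] := boolP (x \in E k); last by rewrite !mulr0.
    rewrite -expr2 -[g x ^+ 2]real_normK ?num_real// expr2 mulfK//.
  have uB x : `|u x| <= 1 by rewrite uE indicE; case: (_ \in _).
  have uM x : k%:R < `|x| -> u x = 0.
    move=> kx; rewrite /u indicE memNset ?mulr0//= => -[[_ xk]] _.
    by move: xk; rewrite leNgt kx.
  have [igu hgu] := tg u k%:R 1 mu uM uB.
  have ig : leb.-integrable setT (EFin \o (fun x => `|g x| * \1_(E k) x)).
    by move: igu; congr (_.-integrable _ (EFin \o _)); apply/funext => x; exact: guE.
  have i1 : leb.-integrable setT (EFin \o (\1_(E k) : 'rV[R]_n -> R)).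
    apply: (@supported_integrable _ _ _ k%:R 1); first exact: measurable_indic.
      by move=> x kx; rewrite -uE uM// normr0.
    by move=> x; rewrite indicE normr_nat lern1 leq_b1.
  have iC := integrableZl measurableT C i1.
  have le : \int[leb]_x (`|g x| * \1_(E k) x) <= \int[leb]_x (C * \1_(E k) x).
    rewrite [leRHS]RintegralZl//; apply: le_trans (le_trans hgu _).
      rewrite (@eq_Rintegral _ _ _ _ _ (fun x => g x * u x)); first exact: ler_norm.
      by move=> x _; rewrite guE.
    rewrite power_normE power_integralE invr1 powRr1; last by rewrite fine_ge0// integral_ge0.
    rewrite (eq_integral (EFin \o (\1_(E k) : 'rV[R]_n -> R))); first by [].
    by move=> x _; rewrite /= powRr1// uE.
  pose D x := (`|g x| - C) * \1_(E k) x.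
  have D0 x : 0 <= D x.
    rewrite /D indicE; have [/set_mem[_ /= h]|_] := boolP (x \in E k); rewrite ?mulr0// mulr1.
    by rewrite subr_ge0 ltW.
  have DE : D = fun x => `|g x| * \1_(E k) x - C * \1_(E k) x.
    by apply/funext => x; rewrite /D mulrBl.
  have iD : leb.-integrable setT (EFin \o D).
    by rewrite DE; exact: (integrableB measurableT ig iC).
  have ID : \int[leb]_x D x <= 0 by rewrite DE RintegralB// subr_le0.
  have I0 : (\int[leb]_x `|(D x)%:E| = 0)%E.
    rewrite (eq_integral (EFin \o D)); last by move=> x _; rewrite /= ger0_norm.
    apply/eqP; rewrite eq_le integral_ge0 ?andbT; last by move=> x _; rewrite lee_fin.
    by rewrite -(fineK (integrable_fin_num measurableT iD)) lee_fin.
  have mD : measurable_fun setT (EFin \o D) by case/integrableP: iD.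
  have [/(_ I0) aeD _] := ae_eq_integral_abs leb measurableT mD.
  apply: filterS aeD => x /(_ I) /= [] Dx Ex.
  move: Dx; rewrite /D indicE mem_set// mulr1 => /eqP; rewrite subr_eq0 => /eqP gx.
  by case: Ex => _ /=; rewrite gx ltxx.
have := ae_foralln null.
apply: filterS => x hx; rewrite leNgt; apply/negP => Cg.
pose k := maxn (Num.truncn `|g x|).+1 (Num.truncn `|x|).+1.
apply: (hx k); split => //; split.
  by apply: (le_trans (ltW (truncnS_gt _))); rewrite ler_nat leq_maxl.
by apply: (le_trans (ltW (truncnS_gt _))); rewrite ler_nat leq_maxr.
Qed.

End dual_bounds.

(** * The Riesz representation theorem for scalar functions *)

Section scalar_riesz.
Context {R : realType} {n : nat}.
Local Notation leb := (@lebesgue_rV R n.+1).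
Variable q C : R.
Hypothesis q1 : 1 <= q.
Hypothesis C0 : 0 <= C.
Variable L : ('rV[R]_n.+1 -> R^o) -> R.
Hypothesis L_linear : forall (a : R) (u v : 'rV[R]_n.+1 -> R^o),
  test_function u -> test_function v ->
  L (fun x => a *: u x + v x) = a * L u + L v.
Hypothesis L_bounded : forall u : 'rV[R]_n.+1 -> R^o,
  test_function u -> `|L u| <= C * power_norm q u.

(** The quotient of a bounded function of bounded support by the weight is
    bounded, so the density [h] of the charge yields the representing
    function [h / w]. *)
Theorem riesz_scalar : exists g : 'rV[R]_n.+1 -> R,
  [/\ measurable_fun setT g, tested_against q C g &
      forall u : 'rV[R]_n.+1 -> R^o, test_function u -> L u = \int[leb]_x (g x * u x)].
Proof.
have [w [iw w01 wl]] := @integrable_weight R n.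
have [h ih hE] := extension_charge_density q1 C0 L_linear L_bounded iw w01.
have mh : measurable_fun setT h by exact: integrable_measurable_real ih.
have mw : measurable_fun setT w by exact: integrable_measurable_real iw.
have wp x : 0 < w x by case/andP: (w01 x).
have mwV : measurable_fun setT (fun x => (w x)^-1).
  rewrite (_ : (fun x => _) = fun x => w x `^ (-1)).
    by apply: (measurableT_comp (measurable_powR (-1))).
  by apply/funext => x; rewrite powR_inv1// ltW.
have key (u : 'rV[R]_n.+1 -> R) M B : measurable_fun setT u ->
    (forall x, M < `|x| -> u x = 0) -> (forall x, `|u x| <= B) ->
    [/\ leb.-integrable setT (EFin \o (fun x => h x / w x * u x)),
        power_integrable q u & extended q C L u = \int[leb]_x (h x / w x * u x)].
  move=> mu uM uB; have [c c0 cw] := wl M.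
  have B0 : 0 <= B by exact: le_trans (uB 0).
  pose b x := (w x)^-1 * u x.
  have mb : measurable_fun setT b by exact: measurable_funM.
  have bB x : `|b x| <= c^-1 * B.
    rewrite /b normrM gtr0_norm ?invr_gt0//.
    have [xM|xM] := leP `|x| M; last by rewrite uM// normr0 mulr0 mulr_ge0// invr_ge0 ltW.
    apply: ler_pM => //; first by rewrite invr_ge0 ltW.
    by rewrite lef_pV2 ?posrE//; exact: cw.
  have wb : (fun x => w x * b x) = u.
    by apply/funext => x; rewrite /b mulrA divff ?mul1r// gt_eqF.
  have hb : (fun x => h x * b x) = (fun x => h x / w x * u x).
    by apply/funext => x; rewrite /b mulrA.
  split.
  - by rewrite -hb; exact: (integrable_mul_bounded measurableT ih mb bB).
  - by rewrite -wb; exact: (weighted_power_integrable q1 iw w01 mb bB).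
  - by rewrite -hb -{1}wb; exact: (ext_density q1 C0 L_linear L_bounded iw w01 ih hE mb bB).
exists (fun x => h x / w x); split.
- exact: measurable_funM.
- move=> u M B mu uM uB; have [i1 pu e] := key u M B mu uM uB; split => //.
  by rewrite -e; exact: extended_bound.
move=> u tu; have [_ mu [B _ hB] _] := test_function_facts tu.
have [M _ hM] := test_function_support tu.
have [_ _ <-] := key u M B mu hM hB.
by rewrite extended_test.
Qed.

End scalar_riesz.

Section dual_norms.
Context {R : realType} {n : nat}.
Local Notation leb := (@lebesgue_rV R n).
Implicit Types (f g u : 'rV[R]_n -> R).

Lemma Lnorm_le (p : \bar R) f g : (1 <= p)%E -> measurable_fun setT f -> measurable_fun setT g ->
  (forall x, `|f x| <= `|g x|) ->
  (Lnorm leb p (EFin \o f) <= Lnorm leb p (EFin \o g))%E.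
Proof.
case: p => [r||//] + mf mg fg; last first.
  move=> _; rewrite unlock; case: ifP => // _; apply: le_ess_sup; apply: aeW => x.
  by rewrite /= lee_fin.
rewrite lee_fin => r1; rewrite !Lnorm_power_integral.
exact: power_root_le (power_integral_ge0 _ _) (power_integral_le r1 mf mg fg).
Qed.

Lemma tested_againstZ q C c g : 1 <= q -> tested_against q C g ->
  tested_against q (`|c| * C) (fun x => c * g x).
Proof.
move=> q1 tg u M B mu uM uB; have [i1 h1] := tg u M B mu uM uB.
have E : (fun x => c * g x * u x) = fun x => c * (g x * u x) by apply/funext => x; rewrite mulrA.
rewrite E; split; first exact: (integrableZl measurableT c i1).
by rewrite RintegralZl// normrM -mulrA ler_wpM2l.
Qed.

Lemma tested_againstD q C1 C2 g1 g2 : tested_against q C1 g1 -> tested_against q C2 g2 ->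
  tested_against q (C1 + C2) (fun x => g1 x + g2 x).
Proof.
move=> t1 t2 u M B mu uM uB; have [i1 h1] := t1 u M B mu uM uB.
have [i2 h2] := t2 u M B mu uM uB.
have E : (fun x => (g1 x + g2 x) * u x) = fun x => g1 x * u x + g2 x * u x.
  by apply/funext => x; rewrite mulrDl.
rewrite E; split; first exact: (integrableD measurableT i1 i2).
by rewrite RintegralD// mulrDl; apply: (le_trans (ler_normD _ _)); exact: lerD.
Qed.

(** The sign of [g] may be moved to the function tested against. *)
Lemma tested_against_norm q C g : 1 <= q -> 0 <= C -> measurable_fun setT g ->
  tested_against q C g -> tested_against q C (fun x => `|g x|).
Proof.
move=> q1 C0 mg tg u M B mu uM uB.
pose v x := g x * `|g x|^-1 * u x.
have vu x : `|v x| <= `|u x|.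
  rewrite /v !normrM normfV normr_id.
  by have [->|g0] := eqVneq (g x) 0; rewrite ?normr0 ?mul0r// divff ?mul1r// normr_eq0.
have gv x : g x * v x = `|g x| * u x.
  rewrite /v !mulrA; congr (_ * _).
  have [->|g0] := eqVneq (g x) 0; first by rewrite normr0 !mul0r.
  by rewrite -expr2 -[g x ^+ 2]real_normK ?num_real// expr2 mulfK// normr_eq0.
have mv : measurable_fun setT v.
  apply: measurable_funM => //; apply: measurable_funM => //.
  rewrite (_ : (fun x => _) = fun x => `|g x| `^ (-1)).
    by apply: (measurableT_comp (measurable_powR (-1))); exact: measurableT_comp.
  by apply/funext => x; rewrite powR_inv1.
have [i1 h1] := tg v M B mv (fun x xM => ltac:(by rewrite /v uM// mulr0))
  (fun x => le_trans (vu x) (uB x)).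
have E : (fun x => g x * v x) = fun x => `|g x| * u x by apply/funext => x; exact: gv.
rewrite E in i1 h1; split => //; apply: (le_trans h1); apply: ler_wpM2l => //.
apply: power_norm_le => //; apply: (@power_integrable_bounded _ _ _ q1 _ B) => //.
exact: supported_integrable mu uM uB.
Qed.

Lemma tested_against_sum q (I : Type) (r : seq I) (C : I -> R) (g : I -> 'rV[R]_n -> R) :
  (forall i, tested_against q (C i) (g i)) ->
  tested_against q (\sum_(i <- r) C i) (fun x => \sum_(i <- r) g i x).
Proof.
move=> tg; elim: r => [|i r IH].
  move=> u M B mu uM uB.
  have -> : (fun x => (\sum_(i <- [::]) g i x) * u x) = cst 0 by apply/funext => x; rewrite big_nil mul0r.
  split; first exact: integrable0.
  by rewrite /Rintegral integral0 big_nil mul0r normr0.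
rewrite big_cons; have -> : (fun x => \sum_(j <- i :: r) g j x) = fun x => g i x + \sum_(j <- r) g j x.
  by apply/funext => x; rewrite big_cons.
exact: tested_againstD.
Qed.

(** Collects, for finite and infinite [p] alike, the two dual bounds in terms
    of the conjugate exponent, which is finite because [1 < p]. *)
Lemma conjugate_real (p : \bar R) : (1 < p)%E -> exists q : R,
  [/\ 1 <= q, hoelder_conjugate p = q%:E &
      forall g C, 0 <= C -> measurable_fun setT g -> tested_against q C g ->
        (Lnorm leb p (EFin \o g) <= C%:E)%E].
Proof.
case: p => [r|_|//]; last first.
  exists 1; split; [by []|exact: hoelder_conjugatey|].
  move=> g C C0 mg tg; rewrite unlock; case: ifP => // _.
  apply/ess_supP; apply: filterS (dual_bound_sup C0 mg tg) => x /=.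
  by rewrite lee_fin.
rewrite lte_fin => r1; have r0 : 0 < r by exact: lt_trans r1.
have rm : 0 < r - 1 by rewrite subr_gt0.
have q1 : 1 < r / (r - 1) by rewrite ltr_pdivlMr// mul1r ltrBlDr ltrDl.
exists (r / (r - 1)); split; first exact: ltW.
  rewrite /hoelder_conjugate/= eqe gt_eqF// -EFinD inver gt_eqF//.
move=> g C C0 mg tg.
have := dual_bound_finite q1 C0 mg tg.
have -> : r / (r - 1) / (r / (r - 1) - 1) = r.
  by field; rewrite !gt_eqF//; lra.
move=> h; rewrite Lnorm_power_integral.
apply: (@le_trans _ _ ((C `^ r)%:E `^ r^-1)%E).
  by apply: power_root_le => //; [exact: ltW|exact: power_integral_ge0].
by rewrite poweR_EFin -powRrM mulfV ?powRr1// gt_eqF.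
Qed.

End dual_norms.

(** * Vector-valued Lebesgue spaces *)

Section hoelder_pairing.
Context {R : realType} {n : nat}.
Local Notation leb := (@lebesgue_rV R n).
Implicit Types (f u : 'rV[R]_n -> R).

Lemma hoelder_pairing (p : \bar R) q f u : (1 < p)%E -> 1 <= q -> hoelder_conjugate p = q%:E ->
  measurable_fun setT f -> (Lnorm leb p (EFin \o f) < +oo)%E -> power_integrable q u ->
  leb.-integrable setT (EFin \o (fun x => f x * u x)) /\
  \int[leb]_x `|f x * u x| <= fine (Lnorm leb p (EFin \o f)) * power_norm q u.
Proof.
move=> p1 q1 pq mf fp pu; have [mu ufin] := pu.
have Lf : Lnorm leb p (EFin \o f) \is a fin_num by rewrite ge0_fin_numE ?Lnorm_ge0.
suff H : (\int[leb]_x `|(f x * u x)%:E| <= Lnorm leb p (EFin \o f) * (power_norm q u)%:E)%E.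
  have ifu : leb.-integrable setT (EFin \o (fun x => f x * u x)).
    apply/integrableP; split; first by apply/measurable_EFinP; exact: measurable_funM.
    by apply: (le_lt_trans H); rewrite -(fineK Lf) -EFinM ltry.
  split => //; rewrite -lee_fin EFinM (fineK Lf); apply: le_trans H.
  by rewrite /Rintegral fineK//; have := integrable_fin_num measurableT (integrable_norm ifu).
move: p p1 pq fp Lf => [r|_|//].
  rewrite lte_fin => r1 pq fp Lf; rewrite (EFin_power_norm pu) -Lnorm1.
  have r0 : 0 < r by exact: lt_trans r1.
  have q0 : 0 < q by exact: lt_le_trans q1.
  apply: hoelder => //.
  have := @hoelder_conjugate_eq1 R r%:E; rewrite pq eqe gt_eqF// !inver !gt_eqF// -EFinD.
  by move=> /(_ (ltNyr _) isT) [].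
rewrite hoelder_conjugatey => -[qE] fp Lf; rewrite -qE in pu ufin *.
set M := Lnorm leb +oo (EFin \o f) in fp Lf *.
have M0 : (0 <= M)%E by exact: Lnorm_ge0.
have [leb0|leb0] := boolP (0 < leb [set: 'rV[R]_n])%E; last first.
  have leb00 : leb setT = 0%E by apply/eqP; rewrite eq_le measure_ge0 andbT leNgt.
  rewrite (_ : (\int[leb]_x _)%E = 0%E); first by rewrite mule_ge0// lee_fin power_norm_ge0.
  apply: null_set_integral => //.
  by apply/measurable_EFinP; apply: measurableT_comp => //; exact: measurable_funM.
have fM : {ae leb, forall x, (`|f x|%:E <= M)%E}.
  rewrite /M unlock leb0; apply: filterS (ess_sup_ge leb (abse \o (EFin \o f))) => x /=.
  exact.
rewrite (power_norm_root pu) invr1 poweRe1 ?power_integral_ge0// power_integralE.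
rewrite -ge0_integralZl//; last first.
  by apply: measurable_power; case: pu.
apply: ae_ge0_le_integral => //.
- by apply/measurable_EFinP; apply: measurableT_comp => //; exact: measurable_funM.
- by move=> x _; rewrite mule_ge0// lee_fin powR_ge0.
- by apply: measurable_funeM; apply: measurable_power; case: pu.
apply: filterS fM => x fx _; rewrite /= powRr1// normrM EFinM.
by apply: lee_wpmul2r => //; rewrite lee_fin.
Qed.

End hoelder_pairing.

Section vector_lebesgue_spaces.
Context {R : realType} {n : nat} {X : innerVectType R}.
Local Notation leb := (@lebesgue_rV R n).
Local Notation b := (vbasis {:X}).
Implicit Types (f g u : 'rV[R]_n -> X).

Definition weakly_measurable f := forall v, measurable_fun [set: 'rV[R]_n] (fun x => inner v (f x)).

Lemma measurable_inner f g : weakly_measurable f -> weakly_measurable g ->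
  measurable_fun setT (fun x => inner (f x) (g x)).
Proof.
move=> mf mg; rewrite (_ : (fun x => _) = fun x =>
    \sum_(k < \dim {:X}) inner b`_k (f x) * inner (dual_basis k) (g x)).
  by apply: measurable_sum => k; apply: measurable_funM; [exact: mf|exact: mg].
apply/funext => x; rewrite inner_coord; apply: eq_bigr => k _.
by rewrite inner_dual_basis innerC.
Qed.

Lemma measurable_vector_norm f : weakly_measurable f -> measurable_fun setT (fun x => `|f x|).
Proof.
move=> mf; rewrite (_ : (fun x => _) = fun x => inner (f x) (f x) `^ 2^-1).
  by apply: (measurableT_comp (measurable_powR _)); exact: measurable_inner.
apply/funext => x; rewrite -norm_inner powR12_sqrt ?sqr_ge0//.
by rewrite sqrtr_sqr ger0_norm.
Qed.

Lemma weakly_measurable_test u : test_function u -> weakly_measurable u.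
Proof.
move=> tu v; rewrite (_ : (fun x => _) = fun x => \sum_(k < \dim {:X}) inner v b`_k * cmp k u x).
  by apply: measurable_sum => k; apply: measurable_funM => //;
    have [] := test_function_facts (test_function_cmp k tu).
by apply/funext => x; rewrite inner_coord.
Qed.

Lemma weakly_measurableD f g : weakly_measurable f -> weakly_measurable g ->
  weakly_measurable (fun x => f x + g x).
Proof.
move=> mf mg v; rewrite (_ : (fun x => _) = fun x => inner v (f x) + inner v (g x)).
  by apply: measurable_funD; [exact: mf|exact: mg].
by apply/funext => x; rewrite innerDr.
Qed.

Definition vector_norm q u := power_norm q (fun x => `|u x|).

Lemma test_vector_bound u : test_function u -> exists2 B, 0 <= B & forall x, `|u x| <= B.
Proof.
move=> tu; have hB k : exists B, 0 <= B /\ forall x, `|cmp k u x| <= B.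
  by have [_ _ [B B0 h] _] := test_function_facts (test_function_cmp k tu); exists B.
have [B hB'] := choice hB.
exists (\sum_(j < \dim {:X}) B j * `|b`_j|).
  by apply: sumr_ge0 => j _; apply: mulr_ge0 => //; case: (hB' j).
move=> x; apply: (le_trans (norm_le_coord _)); apply: ler_sum => j _.
by apply: ler_wpM2r => //; case: (hB' j) => _; exact.
Qed.

Lemma power_integrable_vector_test q u : 1 <= q -> test_function u ->
  power_integrable q (fun x => `|u x|).
Proof.
move=> q1 tu; have [B _ hB] := test_vector_bound tu.
have [M _ hM] := test_function_support tu.
have mu := measurable_vector_norm (weakly_measurable_test tu).
have hB' x : `| `|u x| | <= B by rewrite normr_id.
apply: (power_integrable_bounded q1 _ hB'); apply: (@supported_integrable _ _ _ M B mu _ hB').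
by move=> x xM; rewrite (hM x xM) normr0.
Qed.

Lemma Lpnorm_test q u : 1 <= q -> test_function u -> Lpnorm q%:E u = (vector_norm q u)%:E.
Proof. by move=> q1 tu; rewrite /vector_norm (EFin_power_norm (power_integrable_vector_test q1 tu)). Qed.

Lemma vector_norm_ge0 q u : 0 <= vector_norm q u.
Proof. exact: power_norm_ge0. Qed.

Lemma vector_normZ q c u : 1 <= q -> test_function u ->
  vector_norm q (fun x => c *: u x) = `|c| * vector_norm q u.
Proof.
move=> q1 tu; have pu := power_integrable_vector_test q1 tu.
rewrite /vector_norm -[in RHS](normr_id c) -(power_normZ q1 `|c| pu).
by congr power_norm; apply/funext => x; rewrite normrZ.
Qed.

Lemma LpD p f g : (1 <= p)%E -> Lp p f -> Lp p g -> Lp p (fun x => f x + g x).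
Proof.
move=> p1 [mf lf] [mg lg]; split; first exact: weakly_measurableD.
have nf := measurable_vector_norm mf; have ng := measurable_vector_norm mg.
apply: (@le_lt_trans _ _ (Lpnorm p f + Lpnorm p g)%E); last exact: lte_add_pinfty.
apply: le_trans (eminkowski leb nf ng p1).
apply: Lnorm_le => //.
- by apply: measurable_vector_norm; exact: weakly_measurableD.
- exact: measurable_funD.
- move=> x; rewrite normr_id [leRHS]ger0_norm; first exact: ler_normD.
  exact: addr_ge0.
Qed.

Lemma fun_dist_pairing p q f u : (1 < p)%E -> 1 <= q -> hoelder_conjugate p = q%:E ->
  Lp p f -> weakly_measurable u -> power_integrable q (fun x => `|u x|) ->
  leb.-integrable setT (EFin \o (fun x => inner (f x) (u x))) /\
  \int[leb]_x `|inner (f x) (u x)| <= fine (Lpnorm p f) * vector_norm q u.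
Proof.
move=> p1 q1 pq [mf lf] mu pu.
have [i1 h1] := hoelder_pairing p1 q1 pq (measurable_vector_norm mf) lf pu.
have mi := measurable_inner mf mu.
have i2 : leb.-integrable setT (EFin \o (fun x => inner (f x) (u x))).
  apply: (le_integrable measurableT _ _ i1); first exact/measurable_EFinP.
  by move=> x _; rewrite /= lee_fin [leRHS]ger0_norm ?mulr_ge0// cauchy_schwarz.
split => //; apply: le_trans h1; apply: le_Rintegral => //.
- exact: (integrable_norm i2).
- exact: (integrable_norm i1).
- by move=> x _; rewrite [leRHS]ger0_norm ?mulr_ge0// cauchy_schwarz.
Qed.

End vector_lebesgue_spaces.

(** * The Riesz representation theorem for vector-valued functions *)

Section vector_riesz.
Context {R : realType} {n : nat} {X : innerVectType R}.
Local Notation leb := (@lebesgue_rV R n.+1).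
Local Notation b := (vbasis {:X}).
Implicit Types (T : ('rV[R]_n.+1 -> X) -> R).

Definition linear_on_tests T := forall (a : R) (u v : 'rV[R]_n.+1 -> X),
  test_function u -> test_function v -> T (fun x => a *: u x + v x) = a * T u + T v.

Lemma linear_on_tests0 T : linear_on_tests T -> T (fun=> 0) = 0.
Proof.
move=> hT; have t0 := @test_function_cst0 R n.+1 X.
have := hT 1 _ _ t0 t0.
have -> : (fun x : 'rV[R]_n.+1 => 1 *: 0 + 0 : X) = fun=> 0.
  by apply/funext => x; rewrite scaler0 addr0.
by move=> /eqP; rewrite mul1r -subr_eq subrr eq_sym => /eqP.
Qed.

Lemma linear_on_testsZ T c u : linear_on_tests T -> test_function u ->
  T (fun x => c *: u x) = c * T u.
Proof.
move=> hT tu; rewrite -[RHS]addr0 -(linear_on_tests0 hT) -hT//; last exact: test_function_cst0.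
by congr T; apply/funext => x; rewrite addr0.
Qed.

Lemma linear_on_tests_sum T (I : Type) (r : seq I) (u : I -> 'rV[R]_n.+1 -> X) :
  linear_on_tests T -> (forall i, test_function (u i)) ->
  T (fun x => \sum_(i <- r) u i x) = \sum_(i <- r) T (u i).
Proof.
move=> hT tu; elim: r => [|i r IH].
  rewrite big_nil -(linear_on_tests0 hT); congr T; apply/funext => x.
  by rewrite big_nil.
rewrite big_cons -IH -[T (u i)]mul1r -hT//; last exact: test_function_sum.
by congr T; apply/funext => x; rewrite big_cons scale1r.
Qed.

Definition basis_constant : R := \sum_(k < \dim {:X}) `|dual_basis k| * `|b`_k|.

Lemma basis_constant_ge0 : 0 <= basis_constant.
Proof. by apply: sumr_ge0 => k _; exact: mulr_ge0. Qed.

(** The bound is controlled up to the geometry of the chosen basis, which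
    is enough because only finiteness and convergence to zero matter. *)
Theorem riesz_vector T (p : \bar R) q C : (1 < p)%E -> 1 <= q -> hoelder_conjugate p = q%:E ->
  0 <= C -> linear_on_tests T ->
  (forall u, test_function u -> `|T u| <= C * vector_norm q u) ->
  exists f : 'rV[R]_n.+1 -> X, [/\ weakly_measurable f, eq_dist T (fun_dist f) &
    (Lpnorm p f <= (basis_constant * C)%:E)%E].
Proof.
move=> p1 q1 pq C0 hT bT.
pose L (k : 'I_(\dim {:X})) (phi : 'rV[R]_n.+1 -> R^o) := T (fun x => phi x *: b`_k).
have tL (k : 'I_(\dim {:X})) (phi : 'rV[R]_n.+1 -> R^o) : test_function phi -> test_function (fun x => phi x *: b`_k).
  move=> tp; have := test_function_lfun (scale_basis b`_k) tp.
  by congr test_function; apply/funext => x; rewrite /= scale_basisE.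
have linL k (a : R) (u v : 'rV[R]_n.+1 -> R^o) : test_function u -> test_function v ->
    L k (fun x => a *: u x + v x) = a * L k u + L k v.
  move=> tu tv; rewrite /L -hT//; [|exact: tL|exact: tL].
  by congr T; apply/funext => x; rewrite scalerDl scalerA.
have bL k (u : 'rV[R]_n.+1 -> R^o) : test_function u -> `|L k u| <= C * `|b`_k| * power_norm q u.
  move=> tu; apply: (le_trans (bT _ (tL k u tu))); rewrite -mulrA ler_wpM2l//.
  have pu := power_integrable_test q1 tu.
  rewrite /vector_norm -[`|b`_k|]normr_id -(power_normZ q1 _ pu).
  have pc := power_integrableZ `|b`_k| pu.
  apply: power_norm_le => //.
    exact: measurable_vector_norm (weakly_measurable_test (tL k u tu)).
  by move=> x; rewrite normrZ !normrM !normr_id mulrC.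
have rk (k : 'I_(\dim {:X})) : exists g : 'rV[R]_n.+1 -> R,
  [/\ measurable_fun setT g, tested_against q (C * `|b`_k|) g &
      forall u : 'rV[R]_n.+1 -> R^o, test_function u -> L k u = \int[leb]_x (g x * u x)].
  by apply: riesz_scalar => //; [exact: mulr_ge0|exact: linL|exact: bL].
have [g hg] := choice rk.
pose f x := \sum_(k < \dim {:X}) g k x *: dual_basis k.
have fb x (k : 'I_(\dim {:X})) : inner (f x) b`_k = g k x by exact: (@inner_prescribed R X (fun k => g k x) k).
have wf : weakly_measurable f.
  move=> v; rewrite (_ : (fun x => _) = fun x => \sum_(k < \dim {:X}) g k x * inner v (dual_basis k)).
    by apply: measurable_sum => k; apply: measurable_funM => //; case: (hg k).
  by apply/funext => x; rewrite inner_sumr.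
exists f; split => //.
- move=> u tu.
  have -> : u = fun x => \sum_(k < \dim {:X}) cmp k u x *: b`_k.
    by apply/funext => x; exact: coord_decomposition.
  rewrite linear_on_tests_sum//; last by move=> k; apply: tL; exact: test_function_cmp.
  transitivity (\sum_(k < \dim {:X}) \int[leb]_x (g k x * cmp k u x)).
    by apply: eq_bigr => k _; have [_ _ <-] := hg k; last exact: test_function_cmp.
  rewrite /fun_dist -Rintegral_sum//.
    apply: eq_Rintegral => x _; rewrite -coord_decomposition inner_coord.
    by apply: eq_bigr => k _; rewrite fb.
  move=> k; have [_ tg _] := hg k; have tc := test_function_cmp k tu.
  have [_ mc [B _ hB] _] := test_function_facts tc; have [M _ hM] := test_function_support tc.
  by have [] := tg _ M B mc hM hB.
pose N x := \sum_(k < \dim {:X}) `|dual_basis k| * `|g k x|.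
have mN : measurable_fun setT N.
  apply: measurable_sum => k; apply: measurable_funM => //; apply: measurableT_comp => //.
  by case: (hg k).
have tN : tested_against q (basis_constant * C) N.
  rewrite /basis_constant mulr_suml; apply: tested_against_sum => k.
  have -> : `|dual_basis k| * `|b`_k| * C = `| `|dual_basis k| | * (C * `|b`_k|).
    by rewrite normr_id -mulrA [_ * C]mulrC.
  apply: tested_againstZ => //; have [mg tg _] := hg k.
  by apply: tested_against_norm => //; exact: mulr_ge0.
have [q' [q1' pq' hN]] := @conjugate_real R n.+1 p p1.
have qq : q' = q by move: pq'; rewrite pq => -[].
rewrite qq in hN.
apply: le_trans (hN N _ _ mN tN); last exact: mulr_ge0 basis_constant_ge0 C0.
apply: Lnorm_le => //; [exact: ltW|exact: measurable_vector_norm|].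
move=> x; rewrite normr_id [leRHS]ger0_norm; last by apply: sumr_ge0 => k _; exact: mulr_ge0.
apply: (le_trans (ler_norm_sum _ _ _)); apply: ler_sum => k _.
by rewrite normrZ mulrC.
Qed.

(** By homogeneity. The number [t] above the norm, instead of the norm
    itself, covers test functions of norm zero. *)
Lemma dual_norm_bound T (p : \bar R) q C : 1 <= q -> hoelder_conjugate p = q%:E ->
  linear_on_tests T -> (dual_norm p T <= C%:E)%E ->
  forall u, test_function u -> `|T u| <= C * vector_norm q u.
Proof.
move=> q1 pq hT hC u tu.
have unit v : test_function v -> vector_norm q v <= 1 -> T v <= C.
  move=> tv nv; rewrite -lee_fin; apply: le_trans hC; apply: ereal_sup_ubound.
  exists v => //; split => //.
  by rewrite -[hoelder_conjugate p]/(hoelder_conjugate p) pq Lpnorm_test// lee_fin.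
have C0 : 0 <= C.
  have t0 := @test_function_cst0 R n.+1 X.
  rewrite -(linear_on_tests0 hT); apply: unit => //.
  rewrite /vector_norm (_ : (fun x => _) = fun _ : 'rV[R]_n.+1 => 0 : R); first by rewrite power_norm0.
  by apply/funext => x; rewrite normr0.
have N0 := vector_norm_ge0 q u.
have key (t : R) : vector_norm q u < t -> `|T u| <= C * t.
  move=> Nt; have t0 : 0 < t by exact: le_lt_trans Nt.
  have hs (s : R) : `|s| = t^-1 -> s * T u <= C.
    move=> st; rewrite -linear_on_testsZ//; apply: unit; first exact: test_functionZ.
    by rewrite vector_normZ// st mulrC ler_pdivrMr// mul1r ltW.
  rewrite -ler_pdivrMr//; have [Tu|Tu] := ger0P (T u).
    by rewrite mulrC; apply: hs; rewrite gtr0_norm// invr_gt0.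
  rewrite mulNr mulrC -mulNr; apply: hs.
  by rewrite normrN gtr0_norm// invr_gt0.
have C1 : 0 < C + 1 by rewrite ltr_wpDl.
apply/ler_addgt0Pr => e e0.
apply: (@le_trans _ _ (C * (vector_norm q u + e / (C + 1)))).
  by apply: key; rewrite ltrDl divr_gt0.
rewrite mulrDr lerD2l mulrA ler_pdivrMr// mulrC ler_wpM2l ?(ltW e0)//.
by rewrite lerDl.
Qed.

Lemma dual_norm_le T (p : \bar R) q C : 1 <= q -> hoelder_conjugate p = q%:E -> 0 <= C ->
  (forall u, test_function u -> `|T u| <= C * vector_norm q u) -> (dual_norm p T <= C%:E)%E.
Proof.
move=> q1 pq C0 hT; apply: ub_ereal_sup => _ [u [tu nu] <-].
rewrite lee_fin; apply: (le_trans (ler_norm _)); apply: (le_trans (hT u tu)).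
rewrite ler_piMr// -lee_fin -Lpnorm_test// -pq; exact: nu.
Qed.

End vector_riesz.

(** * Integral functionals *)

Section integral_functionals.
Context {R : realType} {n : nat} {X : innerVectType R}.
Local Notation leb := (@lebesgue_rV R n).
Local Notation b := (vbasis {:X}).
Implicit Types (h f : 'rV[R]_n -> X).

(** The functions on which every functional given by integration against a
    function of some class Lp or against a measure is defined and bounded. *)
Definition bounded_integrable h (B J : R) :=
  [/\ weakly_measurable h, forall x, `|h x| <= B,
      leb.-integrable setT (EFin \o (fun x => `|h x|)) & \int[leb]_x `|h x| <= J].

Definition basis_norm : R := \sum_(j < \dim {:X}) `|b`_j|.

Lemma basis_norm_ge0 : 0 <= basis_norm.
Proof. by apply: sumr_ge0. Qed.

Lemma weakly_measurable_coords h : (forall j, measurable_fun setT (cmp j h : _ -> R)) ->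
  weakly_measurable h.
Proof.
move=> mh v; rewrite (_ : (fun x => _) = fun x => \sum_(k < \dim {:X}) inner v b`_k * cmp k h x).
  by apply: measurable_sum => k; exact: measurable_funM.
by apply/funext => x; rewrite inner_coord.
Qed.

Lemma bounded_integrable_coords h B J : 
  (forall j, [/\ leb.-integrable setT (EFin \o (cmp j h : _ -> R)),
     forall x, `|cmp j h x| <= B & \int[leb]_x `|cmp j h x| <= J]) ->
  bounded_integrable h (basis_norm * B) (basis_norm * J).
Proof.
move=> hc.
have mc j : measurable_fun setT (cmp j h : _ -> R).
  by have [i1 _ _] := hc j; exact: integrable_measurable_real i1.
have wh := weakly_measurable_coords mc.
have hle x : `|h x| <= \sum_(j < \dim {:X}) `|b`_j| * `|cmp j h x|.
  apply: (le_trans (norm_le_coord _)); apply: ler_sum => j _; by rewrite mulrC.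
have ij (j : 'I_(\dim {:X})) : leb.-integrable setT (EFin \o (fun x => `|b`_j| * `|cmp j h x|)).
  by have [i1 _ _] := hc j; exact: (integrableZl measurableT _ (integrable_norm i1)).
have isum : leb.-integrable setT (EFin \o (fun x => \sum_(j < \dim {:X}) `|b`_j| * `|cmp j h x|)).
  rewrite (_ : EFin \o _ = fun x => (\sum_(j < \dim {:X}) (`|b`_j| * `|cmp j h x|)%:E)%E).
    by apply: integrable_sum => // j _; exact: ij.
  by apply/funext => x; rewrite /= sumEFin.
have ih : leb.-integrable setT (EFin \o (fun x => `|h x|)).
  apply: (le_integrable measurableT _ _ isum).
    by apply/measurable_EFinP; exact: measurable_vector_norm.
  by move=> x _; rewrite /= lee_fin normr_id (le_trans (hle x))// ler_norm.
split => //.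
  move=> x; apply: (le_trans (hle x)); rewrite /basis_norm mulr_suml; apply: ler_sum => j _.
  by apply: ler_wpM2l => //; have [_ hB _] := hc j; exact: hB.
apply: (le_trans (le_Rintegral measurableT ih isum (fun x _ => hle x))).
rewrite Rintegral_sum// /basis_norm mulr_suml; apply: ler_sum => j _.
have [i1 _ hJ] := hc j; rewrite RintegralZl//; first exact: ler_wpM2l.
exact: integrable_norm.
Qed.

Definition additive_on_bounded (I : ('rV[R]_n -> X) -> R) := forall h1 h2 B1 J1 B2 J2,
  bounded_integrable h1 B1 J1 -> bounded_integrable h2 B2 J2 ->
  I (fun x => h1 x + h2 x) = I h1 + I h2.

Definition bounded_functional (I : ('rV[R]_n -> X) -> R) := exists2 C, 0 <= C &
  forall h B J, bounded_integrable h B J -> `|I h| <= C * (B + J).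

Lemma bounded_integrable_ge0 h B J : bounded_integrable h B J -> 0 <= B /\ 0 <= J.
Proof.
move=> [_ hB _ hJ]; split; first exact: le_trans (hB 0).
by apply: le_trans hJ; apply: Rintegral_ge0.
Qed.

(** Interpolation between the bounds in the sup norm and in the mean. *)
Lemma bounded_integrable_power h B J q : 1 <= q -> bounded_integrable h B J ->
  power_integrable q (fun x => `|h x|) /\ vector_norm q h <= B + J.
Proof.
move=> q1 hh; have [B0 J0] := bounded_integrable_ge0 hh; have [wh hB ih hJ] := hh.
have q0 : 0 < q by exact: lt_le_trans q1.
have mn := measurable_vector_norm wh.
apply: power_norm_small => //; first exact: addr_ge0.
have bd x : `| `|h x| | `^ q <= B `^ (q - 1) * `|h x|.
  rewrite normr_id; have [->|f0] := eqVneq `|h x| 0; first by rewrite mulr0 powR0// gt_eqF.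
  rewrite -(mulr_powRB1 (normr_ge0 _) q0) mulrC ler_wpM2r//.
  by rewrite ge0_ler_powR ?nnegrE ?subr_ge0.
rewrite power_integralE; apply: (@le_trans _ _ ((B `^ (q - 1))%:E * \int[leb]_x (`|h x|)%:E)%E).
  rewrite -ge0_integralZl//; last 2 first.
  - exact/measurable_EFinP.
  - by rewrite lee_fin powR_ge0.
  apply: ge0_le_integral => //.
  - exact: measurable_power.
  - by apply/measurable_EFinP; exact: measurable_funM.
  by move=> x _; rewrite -EFinM lee_fin bd.
rewrite -(fineK (integrable_fin_num measurableT ih)) -EFinM lee_fin.
apply: (@le_trans _ _ (B `^ (q - 1) * J)); first by rewrite ler_wpM2l ?powR_ge0.
have [BJ0|BJ0] := eqVneq (B + J) 0.
  have -> : J = 0 by lra.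
  by rewrite mulr0 powR_ge0.
rewrite -(mulr_powRB1 (addr_ge0 B0 J0) q0) mulrC.
apply: ler_pM; rewrite ?powR_ge0// ?lerDr//.
by apply: ge0_ler_powR; rewrite ?nnegrE ?subr_ge0// ?addr_ge0// lerDl.
Qed.

Lemma fun_dist_integrable p f h B J : (1 <= p)%E -> Lp p f -> bounded_integrable h B J ->
  leb.-integrable setT (EFin \o (fun x => inner (f x) (h x))) /\
  `|fun_dist f h| <= fine (Lpnorm p f) * (B + J).
Proof.
move=> p1 lpf hh; have [B0 J0] := bounded_integrable_ge0 hh; have [mf lf] := lpf.
have [wh hB ih hJ] := hh.
move: p1; rewrite le_eqVlt => /predU1P[pE|p1]; last first.
  have [q [q1 pq _]] := @conjugate_real R n p p1.
  have [pu nu] := bounded_integrable_power q1 hh.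
  have [i1 h1] := fun_dist_pairing p1 q1 pq lpf wh pu; split => //.
  apply: (le_trans (le_normr_Rintegral measurableT i1)); apply: (le_trans h1).
  by apply: ler_wpM2l => //; rewrite fine_ge0// Lnorm_ge0.
have Lf : Lpnorm p f \is a fin_num by rewrite ge0_fin_numE ?Lnorm_ge0.
rewrite -pE in lf Lf *; rewrite /Lpnorm Lnorm1 in lf Lf *.
have if1 : leb.-integrable setT (EFin \o (fun x => `|f x|)).
  apply/integrableP; split; last exact: lf.
  by apply/measurable_EFinP; exact: measurable_vector_norm.
have le x : `|inner (f x) (h x)| <= `|f x| * B.
  by apply: (le_trans (cauchy_schwarz _ _)); exact: ler_wpM2l.
have ifB := integrableZr measurableT B if1.
have i2 : leb.-integrable setT (EFin \o (fun x => inner (f x) (h x))).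
  apply: (le_integrable measurableT _ _ ifB).
    by apply/measurable_EFinP; exact: measurable_inner.
  by move=> x _; rewrite /= lee_fin [leRHS]ger0_norm ?mulr_ge0.
split => //; apply: (le_trans (le_normr_Rintegral measurableT i2)).
apply: (@le_trans _ _ (\int[leb]_x (`|f x| * B))).
  by apply: le_Rintegral => //; exact: integrable_norm.
rewrite RintegralZr//; apply: ler_pM => //; first exact: Rintegral_ge0.
  rewrite /Rintegral le_eqVlt; apply/orP; left; apply/eqP; congr fine.
  by apply: eq_integral => x _; rewrite /= normr_id.
by rewrite lerDl.
Qed.

Lemma bounded_finite_integrable (m : {finite_measure set 'rV[R]_n -> \bar R})
    (g : 'rV[R]_n -> R) B : measurable_fun setT g -> (forall x, `|g x| <= B) ->
  m.-integrable setT (EFin \o g) /\ `|\int[m]_x g x| <= B * fine (m setT).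
Proof.
move=> mg gB; have ic : m.-integrable setT (EFin \o cst B).
  by apply: finite_measure_integrable_cst.
have ig : m.-integrable setT (EFin \o g).
  apply: (le_integrable measurableT _ _ ic); first exact/measurable_EFinP.
  move=> x _; rewrite /= lee_fin; apply: le_trans (ler_norm _); exact: gB.
split => //; apply: (le_trans (le_normr_Rintegral measurableT ig)).
apply: (le_trans (le_Rintegral measurableT (integrable_norm ig) ic (fun x _ => gB x))).
by rewrite Rintegral_cst.
Qed.

Lemma integral_functional_bounded I : integral_functional I ->
  additive_on_bounded I /\ bounded_functional I.
Proof.
case=> [[p [f [p1 lf ->]]]|[nu ->]].
  split.
    move=> h1 h2 B1 J1 B2 J2 n1 n2.
    have [i1 _] := fun_dist_integrable p1 lf n1; have [i2 _] := fun_dist_integrable p1 lf n2.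
    rewrite /fun_dist -RintegralD//; apply: eq_Rintegral => x _; exact: innerDr.
  exists (fine (Lpnorm p f)); first by rewrite fine_ge0// Lnorm_ge0.
  by move=> h B J hh; have [_] := fun_dist_integrable p1 lf hh.
have mk (k : 'I_(\dim {:X})) h B J : bounded_integrable h B J ->
    measurable_fun setT (fun x => inner b`_k (h x)) /\ forall x, `|inner b`_k (h x)| <= `|b`_k| * B.
  move=> [wh hB _ _]; split; first exact: wh.
  by move=> x; apply: (le_trans (cauchy_schwarz _ _)); exact: ler_wpM2l.
split.
  move=> h1 h2 B1 J1 B2 J2 n1 n2; rewrite /measure_dist -big_split/=.
  apply: eq_bigr => k _; rewrite /charge_integral/=; set jp := jordan_pos _; set jn := jordan_neg _.
  have [m1 b1] := mk k _ _ _ n1; have [m2 b2] := mk k _ _ _ n2.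
  have [ip1 _] := bounded_finite_integrable jp m1 b1.
  have [ip2 _] := bounded_finite_integrable jp m2 b2.
  have [in1 _] := bounded_finite_integrable jn m1 b1.
  have [in2 _] := bounded_finite_integrable jn m2 b2.
  have e (m : {measure set 'rV[R]_n -> \bar R}) :
      m.-integrable setT (EFin \o (fun x => inner b`_k (h1 x))) ->
      m.-integrable setT (EFin \o (fun x => inner b`_k (h2 x))) ->
      \int[m]_x inner b`_k (h1 x + h2 x) = \int[m]_x inner b`_k (h1 x) + \int[m]_x inner b`_k (h2 x).
    by move=> i1 i2; rewrite -RintegralD//; apply: eq_Rintegral => x _; rewrite innerDr.
  by rewrite !e// opprD addrACA.
have hk (k : 'I_(\dim {:X})) : exists C, 0 <= C /\ forall h B J, bounded_integrable h B J ->
    `|charge_integral (nu k) (fun x => inner b`_k (h x))| <= C * (B + J).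
  rewrite /charge_integral/=; set jp := jordan_pos _; set jn := jordan_neg _.
  pose c := fine (jp setT) + fine (jn setT).
  have c0 : 0 <= c by apply: addr_ge0; exact: fine_ge0.
  exists (`|b`_k| * c); split; first exact: mulr_ge0.
  move=> h B J nh; have [m1 b1] := mk k _ _ _ nh; have [B0 J0] := bounded_integrable_ge0 nh.
  have [_ h1] := bounded_finite_integrable jp m1 b1.
  have [_ h2] := bounded_finite_integrable jn m1 b1.
  apply: (le_trans (ler_normB _ _)); apply: (le_trans (lerD h1 h2)).
  rewrite -mulrDr -/c mulrAC; apply: ler_wpM2l; first exact: mulr_ge0.
  by rewrite lerDl.
have [C hC] := choice hk.
exists (\sum_k C k); first by apply: sumr_ge0 => k _; case: (hC k).
move=> h B J nh; rewrite /measure_dist mulr_suml; apply: (le_trans (ler_norm_sum _ _ _)).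
by apply: ler_sum => k _; case: (hC k) => _; exact.
Qed.

End integral_functionals.

(** * Uniform estimates for mollifications *)

Section good_kernels.
Context {R : realType} {n : nat}.
Local Notation leb := (@lebesgue_rV R n).
Implicit Types (k : 'rV[R]_n -> R).

Definition concentrated (d tau : R) k := [/\ leb.-integrable setT (EFin \o k),
  forall y, 0 <= k y, \int[leb]_y k y = 1 & \int[leb]_(y in ~` eball d) k y <= tau].

(** Statements that hold for all kernels of mass 1 that are sufficiently
    concentrated at the origin; they are closed under finite conjunctions. *)
Definition for_concentrated (Q : ('rV[R]_n -> R) -> Prop) := exists d tau : R,
  [/\ 0 < d, 0 < tau & forall k, concentrated d tau k -> Q k].

Lemma concentratedW d1 d2 tau1 tau2 k : d1 <= d2 -> tau1 <= tau2 ->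
  concentrated d1 tau1 k -> concentrated d2 tau2 k.
Proof.
move=> d12 t12 [ik k0 k1 kt]; split => //; apply: le_trans t12; apply: le_trans kt.
have m1 := @measurable_eballC R n d1; have m2 := @measurable_eballC R n d2.
rewrite [leLHS]Rintegral_mkcond [leRHS]Rintegral_mkcond.
have ip d : measurable (~` @eball R n d) ->
    leb.-integrable setT (EFin \o (k \_ (~` eball d))).
  move=> md; apply: (le_integrable measurableT _ _ ik).
    apply/measurable_EFinP/(measurable_restrictT _ md); apply: measurable_funTS.
    exact: integrable_measurable_real ik.
  move=> x _; rewrite /= lee_fin patchE; case: ifP => //; rewrite ?normr0//.
apply: le_Rintegral => //; [exact: ip|exact: ip|].
move=> x _; rewrite !patchE; case: ifP => [/set_mem h|_]; last by case: ifP.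
rewrite mem_set// /eball/= => xd; apply: h; exact: lt_le_trans d12.
Qed.

Lemma for_concentratedI Q1 Q2 : for_concentrated Q1 -> for_concentrated Q2 ->
  for_concentrated (fun k => Q1 k /\ Q2 k).
Proof.
move=> [d1 [t1 [d10 t10 h1]]] [d2 [t2 [d20 t20 h2]]].
exists (Num.min d1 d2), (Num.min t1 t2); split; rewrite ?lt_min ?d10 ?t10//.
move=> k hk; split.
  by apply: h1; apply: concentratedW hk; rewrite ge_min lexx.
by apply: h2; apply: concentratedW hk; rewrite ge_min lexx orbT.
Qed.

Lemma for_concentratedS Q1 Q2 : (forall k, Q1 k -> Q2 k) ->
  for_concentrated Q1 -> for_concentrated Q2.
Proof. by move=> h [d [t [d0 t0 hQ]]]; exists d, t; split => // k /hQ; exact: h. Qed.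

Lemma for_concentrated_all (I : eqType) (s : seq I) (Q : I -> ('rV[R]_n -> R) -> Prop) :
  (forall i, for_concentrated (Q i)) ->
  for_concentrated (fun k => forall i, i \in s -> Q i k).
Proof.
move=> hQ; elim: s => [|i s IH]; first by exists 1, 1.
have := for_concentratedI (hQ i) IH; apply: for_concentratedS => k [h1 h2] j.
by rewrite in_cons => /predU1P[->//|]; exact: h2.
Qed.

Lemma concentrated_integrable d tau k : concentrated d tau k -> leb.-integrable setT (EFin \o k).
Proof. by case. Qed.

End good_kernels.

Section multi_indices.
Variable n : nat.

(** A distribution on a compact set only sees finitely many derivatives. *)
Definition multi_indices N : seq (seq 'I_n) :=
  flatten [seq map val (enum {:m.-tuple 'I_n}) | m <- iota 0 N.+1].

Lemma mem_multi_indices N s : (size s <= N)%N -> s \in multi_indices N.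
Proof.
move=> sN; apply/flattenP; exists (map val (enum {:(size s).-tuple 'I_n})).
  by apply/mapP; exists (size s) => //; rewrite mem_iota.
by apply/mapP; exists (in_tuple s) => //; rewrite mem_enum.
Qed.

End multi_indices.

Section vector_approximate_identity.
Context {R : realType} {n : nat} {X : innerVectType R}.
Local Notation leb := (@lebesgue_rV R n).
Implicit Types (u : 'rV[R]_n -> X).

Lemma bounded_integrable_convolution u : test_function u -> exists2 C, 0 <= C &
  forall k, leb.-integrable setT (EFin \o k) ->
  bounded_integrable (convolution k u) (C * \int[leb]_y `|k y|) (C * \int[leb]_y `|k y|).
Proof.
move=> tu.
have hj j : exists C, 0 <= C /\ forall k, leb.-integrable setT (EFin \o k) ->
    [/\ leb.-integrable setT (EFin \o (cmp j (convolution k u) : _ -> R)),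
     forall x, `|cmp j (convolution k u) x| <= C * \int[leb]_y `|k y| &
     \int[leb]_x `|cmp j (convolution k u) x| <= C * \int[leb]_y `|k y|].
  have tc := test_function_cmp j tu; have [cu mu [B B0 hB] iu] := test_function_facts tc.
  have J0 : 0 <= \int[leb]_x `|cmp j u x| by exact: Rintegral_ge0.
  exists (B + \int[leb]_x `|cmp j u x|); split; first exact: addr_ge0.
  move=> k ik; rewrite cmp_convolution.
  have k0 : 0 <= \int[leb]_y `|k y| by exact: Rintegral_ge0.
  have mk : measurable_fun setT (sconv k (cmp j u)).
    exact: smooth_measurable (smooth_sconv ik tc).
  have [i1 h1] := integrable_sconv ik iu mk hB; split => //.
    move=> x; apply: (le_trans (sconv_bound x ik mu hB)).
    by rewrite ler_wpM2r// lerDl.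
  by apply: (le_trans h1); rewrite mulrC ler_wpM2r// lerDr.
have [C hC] := choice hj.
have C0 : 0 <= \sum_j C j by apply: sumr_ge0 => j _; case: (hC j).
exists (@basis_norm R X * \sum_j C j); first exact: mulr_ge0 basis_norm_ge0 C0.
move=> k ik; rewrite -mulrA; apply: bounded_integrable_coords => j.
have k0 : 0 <= \int[leb]_y `|k y| by exact: Rintegral_ge0.
have Cj : C j <= \sum_j C j.
  by rewrite (bigD1 j)//= lerDl; apply: sumr_ge0 => i _; case: (hC i).
have [_ /(_ k ik)[i1 h1 h2]] := hC j; split => //.
  by move=> x; apply: (le_trans (h1 x)); exact: ler_wpM2r.
by apply: (le_trans h2); exact: ler_wpM2r.
Qed.

Lemma convolution_approximates u (eta : R) : test_function u -> 0 < eta ->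
  for_concentrated (fun k => bounded_integrable (fun x => convolution k u x - u x) eta eta).
Proof.
move=> tu eta0; have b1 : 0 < @basis_norm R X + 1 by rewrite ltr_wpDl// basis_norm_ge0.
have e0 := divr_gt0 eta0 b1; set e := eta / _ in e0.
have hj j : for_concentrated (fun k => (forall x, `|sconv k (cmp j u) x - cmp j u x| <= e) /\
    \int[leb]_x `|sconv k (cmp j u) x - cmp j u x| <= e).
  have [d [tau [d0 t0 h]]] := approximate_identity (test_function_cmp j tu) e0.
  by exists d, tau; split => // k [ik k0 k1 kt]; exact: h.
have ik0 : for_concentrated (fun k => leb.-integrable setT (EFin \o k)).
  by exists 1, 1; split => // k; exact: concentrated_integrable.
have := for_concentratedI ik0 (for_concentrated_all (index_enum _) hj).
apply: for_concentratedS => k [ik hk].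
have ebn : @basis_norm R X * e <= eta.
  rewrite /e mulrA ler_pdivrMr// mulrC ler_wpM2l ?(ltW eta0)// lerDl//.
have [wh hB ih hJ] : bounded_integrable (fun x => convolution k u x - u x)
    (@basis_norm R X * e) (@basis_norm R X * e).
  apply: bounded_integrable_coords => j.
  have [hB hJ] := hk j (mem_index_enum j).
  have tc := test_function_cmp j tu; have [cu mu [B B0 hB'] iu] := test_function_facts tc.
  have mk : measurable_fun setT (sconv k (cmp j u)).
    exact: smooth_measurable (smooth_sconv ik tc).
  have [i1 _] := integrable_sconv ik iu mk hB'.
  have E : cmp j (fun x => convolution k u x - u x) = fun x => sconv k (cmp j u) x - cmp j u x.
    by apply/funext => x; rewrite -cmp_convolution /cmp linearB.
  by rewrite E; split => //; exact: (integrableB measurableT i1 iu).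
split => //; last exact: le_trans ebn.
by move=> x; exact: le_trans (hB x) ebn.
Qed.

End vector_approximate_identity.

Section leibniz_bound.
Context {R : realType} {n : nat} {X : innerVectType R}.
Implicit Types (h : 'rV[R]_n -> X) (chi : 'rV[R]_n -> R^o).

Definition derivatives_bounded N h (M : R) := forall s x, (size s <= N)%N -> `|iter_partial s h x| <= M.

(** Induction on the order with the Leibniz rule for the innermost derivative;
    the induction covers all cutoffs at once, as derivatives fall on the
    cutoff. *)
Lemma leibniz_bound N chi : test_function chi -> exists2 C, 0 <= C &
  forall h M, smooth h -> derivatives_bounded N h M ->
  derivatives_bounded N (fun x => chi x *: h x) (C * M).
Proof.
elim: N chi => [|N IH] chi tc.
  have [_ _ [B B0 hB] _] := test_function_facts tc.
  exists B => // h M sh hM s x; rewrite leqn0 size_eq0 => /eqP -> /=.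
  by rewrite normrZ; apply: ler_pM => //; exact: (hM [::]).
have [_ _ [B B0 hB] _] := test_function_facts tc; have [sc _] := tc.
have [C0 C00 h0] := IH _ tc.
have hi i : exists C, 0 <= C /\ forall h M, smooth h -> derivatives_bounded N h M ->
    derivatives_bounded N (fun x => partial i chi x *: h x) (C * M).
  by have [C c h] := IH _ (test_function_partial i tc); exists C.
have [C hC] := choice hi.
have sC : 0 <= \sum_i C i by apply: sumr_ge0 => i _; case: (hC i).
exists (B + (C0 + \sum_i C i)); first by rewrite !addr_ge0.
move=> h M sh hM s x.
have M0 : 0 <= M by apply: le_trans (hM [::] 0 _).
case: (lastP s) => [_|s' i] /=.
  rewrite normrZ; apply: (@le_trans _ _ (B * M)); first by apply: ler_pM => //; exact: (hM [::]).
  by apply: ler_wpM2r => //; rewrite lerDl addr_ge0.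
rewrite size_rcons ltnS => sN.
rewrite /iter_partial foldr_rcons -/(iter_partial s' _).
have sp : smooth (partial i h) by exact: smooth_partial.
have spc : smooth (partial i chi) by exact: smooth_partial.
have -> : partial i (fun x => chi x *: h x) =
    fun x => chi x *: partial i h x + partial i chi x *: h x.
  by rewrite (partial_scale i sc sh).
rewrite iter_partialD; [|exact: (smooth_scale sc sp)|exact: (smooth_scale spc sh)].
apply: (le_trans (ler_normD _ _)).
have b1 : `|iter_partial s' (fun x => chi x *: partial i h x) x| <= C0 * M.
  apply: (h0 _ _ sp) => // t y tN.
  have := hM (rcons t i) y; rewrite size_rcons /iter_partial foldr_rcons; exact.
have b2 : `|iter_partial s' (fun x => partial i chi x *: h x) x| <= C i * M.
  have [_ hCi] := hC i; apply: (hCi _ _ sh) => // t y tN; apply: hM; exact: leqW.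
apply: (le_trans (lerD b1 b2)); rewrite -mulrDl; apply: ler_wpM2r => //.
rewrite -[leLHS]add0r; apply: lerD => //; apply: lerD => //.
by rewrite (bigD1 i)//= lerDl; apply: sumr_ge0 => j _; case: (hC j).
Qed.

End leibniz_bound.

(** * Pairings with mollifiers *)

Section tame_functionals.
Context {R : realType} {n : nat} {X : innerVectType R}.
Local Notation leb := (@lebesgue_rV R n).
Implicit Types (u : 'rV[R]_n -> X) (Phi : ('rV[R]_n -> X) -> R).

(** A pairing with mollifiers that is continuous in the mollifier and
    reproduces the number [a] for approximate identities. Every reading of the
    radial operator of a distribution, applied to a fixed test function, is
    the value of such a pairing at the kernel. *)
Record tame (Psi : ('rV[R]_n -> R) -> R) (a : R) : Prop := Tame {
  tame_additive : forall k1 k2, leb.-integrable setT (EFin \o k1) ->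
    leb.-integrable setT (EFin \o k2) -> Psi (fun y => k1 y + k2 y) = Psi k1 + Psi k2 ;
  tame_bounded : exists2 C, 0 <= C & forall k, leb.-integrable setT (EFin \o k) ->
    `|Psi k| <= C * \int[leb]_y `|k y| ;
  tame_concentrated : forall eta : R, 0 < eta ->
    for_concentrated (fun k => `|Psi k - a| <= eta) }.

(** Mollifications of a test function are bounded and integrable, with both
    bounds proportional to the mass of the mollifier. *)
Lemma tame_integral Phi u : integral_functional Phi -> test_function u ->
  tame (fun k => Phi (convolution k u)) (Phi u).
Proof.
move=> iPhi tu; have [addP [C C0 hC]] := integral_functional_bounded iPhi.
have [Cu Cu0 hu] := bounded_integrable_convolution tu.
split.
- by move=> k1 k2 i1 i2; rewrite (convolutionDk i1 i2 tu) (addP _ _ _ _ _ _ (hu k1 i1) (hu k2 i2)).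
- exists (C * (Cu + Cu)); first by rewrite mulr_ge0// addr_ge0.
  move=> k ik; apply: (le_trans (hC _ _ _ (hu k ik))).
  by rewrite -mulrDl mulrA.
move=> eta eta0; have C1 : 0 < C + 1 by rewrite ltr_wpDl.
have e0 : 0 < eta / (C + 1) / 2 by rewrite !divr_gt0.
have ik0 : @for_concentrated R n (fun k => leb.-integrable setT (EFin \o k)).
  by exists 1, 1; split => // k; exact: concentrated_integrable.
have := for_concentratedI ik0 (convolution_approximates tu e0).
apply: for_concentratedS => k [ik hk].
set d := fun x => convolution k u x - u x in hk.
have [B [J nu]] : exists B J, bounded_integrable u B J.
  have [B B0 hB] := test_vector_bound tu.
  exists B, (\int[leb]_x `|u x|); split => //; first exact: weakly_measurable_test.
  have [M _ hM] := test_function_support tu.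
  have mn := measurable_vector_norm (weakly_measurable_test tu).
  apply: (@supported_integrable _ _ _ M B mn); last by move=> x; rewrite normr_id.
  by move=> x xM; rewrite (hM x xM) normr0.
have -> : convolution k u = fun x => u x + d x.
  by apply/funext => x; rewrite /d addrC subrK.
rewrite (addP _ _ _ _ _ _ nu hk) addrC addKr.
apply: (le_trans (hC _ _ _ hk)); rewrite -splitr.
apply: (@le_trans _ _ ((C + 1) * (eta / (C + 1)))); last by rewrite mulrC mulfVK// gt_eqF.
by apply: ler_wpM2r; [rewrite ltW// divr_gt0|rewrite lerDl].
Qed.

Lemma derivatives_convolution u N : test_function u -> exists2 C, 0 <= C &
  forall k, leb.-integrable setT (EFin \o k) ->
  derivatives_bounded N (convolution k u) (C * \int[leb]_y `|k y|).
Proof.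
move=> tu; have hs s : exists C, 0 <= C /\ forall k, leb.-integrable setT (EFin \o k) ->
    forall x, `|convolution k (iter_partial s u) x| <= C * \int[leb]_y `|k y|.
  by have [C C0 h] := convolution_bound (test_function_iter s tu); exists C.
have [C hC] := choice hs.
exists (\sum_(s <- multi_indices n N) C s).
  by apply: sumr_ge0 => s _; case: (hC s).
move=> k ik s x sN; rewrite iter_partial_convolution//.
have [_ h] := hC s; apply: (le_trans (h k ik x)); apply: ler_wpM2r; first exact: Rintegral_ge0.
rewrite (big_rem s (mem_multi_indices sN))/= lerDl; apply: sumr_ge0 => t _; by case: (hC t).
Qed.

(** Derivatives commute with the convolution, so each of them is approximated
    as a test function in its own right. *)
Lemma derivatives_approximate u N (eta : R) : test_function u -> 0 < eta ->
  for_concentrated (fun k => smooth (fun x => convolution k u x - u x) /\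
    derivatives_bounded N (fun x => convolution k u x - u x) eta).
Proof.
move=> tu eta0; have [su _] := tu.
have ik0 : @for_concentrated R n (fun k => leb.-integrable setT (EFin \o k)).
  by exists 1, 1; split => // k; exact: concentrated_integrable.
have := for_concentratedI ik0 (for_concentrated_all (multi_indices n N)
  (fun s => convolution_approximates (test_function_iter s tu) eta0)).
apply: for_concentratedS => k [ik hk].
pose L : 'Hom(X, X) := (-1 *: \1)%VF.
have LE v : L v = - v by rewrite /L scale_lfunE id_lfunE scaleN1r.
have E : (fun x => convolution k u x - u x) = fun x => convolution k u x + (L \o u) x.
  by apply/funext => x; rewrite /= LE.
have sc := smooth_convolution ik tu.
have sL : smooth (L \o u) by have [] := test_function_lfun L tu.
split; first by rewrite E; exact: smoothD.
move=> s x sN; rewrite E iter_partialD// iter_partial_convolution// iter_partial_lfun//= LE.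
by have [_ + _ _] := hk s (mem_multi_indices sN); exact.
Qed.

Definition cutoff_functional (T : ('rV[R]_n -> X) -> R) (chi : 'rV[R]_n -> R^o) :
  ('rV[R]_n -> X) -> R := fun f => T (fun x => chi x *: f x).

Lemma test_function_cutoff (chi : 'rV[R]_n -> R^o) (f : 'rV[R]_n -> X) :
  test_function chi -> smooth f -> test_function (fun x => chi x *: f x).
Proof.
move=> tc sf; have [sc _] := tc; have [M _ hM] := test_function_support tc.
split; first exact: smooth_scale.
by apply/compact_tsupportP; exists M => x xM; rewrite hM// scale0r.
Qed.

(** The cutoff confines everything to one compact set, on which the
    distribution is bounded by finitely many derivatives. *)
Lemma tame_cutoff T chi u : is_distribution T -> test_function chi -> test_function u ->
  tame (fun k => cutoff_functional T chi (convolution k u)) (cutoff_functional T chi u).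
Proof.
move=> [linT contT] tc tu; have [sc ctc] := tc; have [su _] := tu.
have [C [N hT]] := contT _ ctc.
have [CL CL0 hL] := @leibniz_bound R n X N chi tc.
have bound h M : smooth h -> derivatives_bounded N h M ->
    `|cutoff_functional T chi h| <= `|C| * CL * M.
  move=> sh hM; have tch := test_function_cutoff tc sh.
  have M0 : 0 <= M by apply: le_trans (hM [::] 0 _).
  apply: (@le_trans _ _ (C * (CL * M))).
    apply: hT => //; last by move=> s x sN; exact: hL.
    apply: closureS => x /=; apply: contra_neq => ->; exact: scale0r.
  rewrite mulrA; apply: ler_wpM2r => //; apply: ler_wpM2r => //; exact: ler_norm.
have addT h1 h2 : smooth h1 -> smooth h2 ->
    cutoff_functional T chi (fun x => h1 x + h2 x) =
    cutoff_functional T chi h1 + cutoff_functional T chi h2.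
  move=> s1 s2; rewrite -[X in _ = X + _]mul1r -linT; last 2 first.
  - exact: test_function_cutoff.
  - exact: test_function_cutoff.
  by congr T; apply/funext => x; rewrite scale1r scalerDr.
split.
- move=> k1 k2 i1 i2; rewrite (convolutionDk i1 i2 tu).
  by apply: addT; exact: smooth_convolution.
- have [D D0 hD] := derivatives_convolution N tu.
  exists (`|C| * CL * D); first by rewrite !mulr_ge0.
  move=> k ik; rewrite -[leRHS]mulrA; apply: bound; first exact: smooth_convolution.
  exact: hD.
move=> eta eta0; have K1 : 0 < `|C| * CL + 1 by rewrite ltr_wpDl// mulr_ge0.
have ik0 : @for_concentrated R n (fun k => leb.-integrable setT (EFin \o k)).
  by exists 1, 1; split => // k; exact: concentrated_integrable.
have := for_concentratedI ik0 (derivatives_approximate N tu (divr_gt0 eta0 K1)).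
apply: for_concentratedS => k [ik [sd hd]].
have -> : convolution k u = fun x => u x + (convolution k u x - u x).
  by apply/funext => x; rewrite addrC subrK.
rewrite addT// addrC addKr; apply: (le_trans (bound _ _ sd hd)).
apply: (@le_trans _ _ ((`|C| * CL + 1) * (eta / (`|C| * CL + 1)))); last first.
  by rewrite mulrC mulfVK// gt_eqF.
by apply: ler_wpM2r; [rewrite ltW// divr_gt0|rewrite lerDl].
Qed.

End tame_functionals.

(** * Mollified distributions *)

Section linear_operations.
Context {R : realType} {n : nat} {X Y : innerVectType R}.
Implicit Types (u v : 'rV[R]_n -> X).

Lemma convolution_linear k (a : R) u v : (lebesgue_rV n).-integrable setT (EFin \o k) ->
  test_function u -> test_function v ->
  convolution k (fun x => a *: u x + v x) = fun x => a *: convolution k u x + convolution k v x.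
Proof.
move=> ik tu tv; rewrite (convolutionD ik (test_functionZ a tu) tv).
apply/funext => x; congr (_ + _).
pose L : 'Hom(X, X) := (a *: \1)%VF.
have LE w : L w = a *: w by rewrite /L scale_lfunE id_lfunE.
by rewrite -LE (lfun_convolution L x ik tu); congr (convolution _ _ _); apply/funext => y; rewrite /= LE.
Qed.

Lemma diff_op_linear (B : 'I_n -> 'Hom(X, Y)) (a : R) u v : smooth u -> smooth v ->
  diff_op B (fun x => a *: u x + v x) = fun x => a *: diff_op B u x + diff_op B v x.
Proof.
move=> su sv; pose L : 'Hom(X, X) := (a *: \1)%VF.
have LE w : L w = a *: w by rewrite /L scale_lfunE id_lfunE.
have sL : smooth (L \o u) by apply: smooth_linear => //; exact: lfun_continuous.
have E : (fun x => a *: u x) = L \o u by apply/funext => y; rewrite /= LE.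
apply/funext => x; rewrite /diff_op scaler_sumr -big_split/=; apply: eq_bigr => i _.
rewrite (_ : (fun x => a *: u x + v x) = fun x => (L \o u) x + v x); last first.
  by apply/funext => y; rewrite /= LE.
rewrite partialD// -[partial i (L \o u)]/(iter_partial [:: i] (L \o u)).
by rewrite iter_partial_lfun//= LE linearD linearZ.
Qed.

End linear_operations.

Section distribution_kernels.
Context {R : realType} {n : nat} {V W : innerVectType R}.
Variable A : 'I_n.+1 -> 'Hom(V, W).
Variable T : ('rV[R]_n.+1 -> V) -> R.
Hypothesis hT : is_distribution T.
Local Notation leb := (@lebesgue_rV R n.+1).
Local Notation D := (diff_op (formal_adjoint A)).
Implicit Types (psi : 'rV[R]_n.+1 -> W) (k : 'rV[R]_n.+1 -> R).

(** The radial operator applied to [T], with the kernel [k], whenever the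
    convolution is a test function. *)
Definition mollified_dist k psi : R := T (convolution k (D psi)).

Lemma mollified_distE k psi : leb.-integrable setT (EFin \o k) -> test_function psi ->
  mollified_dist k psi = dist_op A T (convolution k psi).
Proof. by move=> ik tp; rewrite /mollified_dist /dist_op (diff_op_convolution _ ik tp). Qed.

Lemma dist_op_linear : linear_on_tests (dist_op A T).
Proof.
move=> a u v tu tv; have [su _] := tu; have [sv _] := tv.
rewrite /dist_op (diff_op_linear _ a su sv); have [linT _] := hT.
by apply: linT; exact: test_function_diff_op.
Qed.

Lemma mollified_dist_linear k N : leb.-integrable setT (EFin \o k) ->
  (forall x, N < `|x| -> k x = 0) -> linear_on_tests (mollified_dist k).
Proof.
move=> ik hk a u v tu tv; rewrite !(mollified_distE ik)//; last first.
  exact: (test_functionD (test_functionZ a tu) tv).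
rewrite (convolution_linear a ik tu tv) dist_op_linear//; exact: test_function_convolution hk _.
Qed.

(** The difference of [f] and its cutoff vanishes near the support of [T]. *)
Lemma cutoff_near_support K U (chi : 'rV[R]_n.+1 -> R^o) f : dist_support_in T K ->
  open U -> K `<=` U -> test_function chi -> (forall x, U x -> chi x = 1) ->
  test_function f -> T f = cutoff_functional T chi f.
Proof.
move=> sT oU KU tc c1 tf; have [sf _] := tf; have [linT _] := hT.
have tcf := test_function_cutoff tc sf.
have tg : test_function (fun x => (-1) *: (chi x *: f x) + f x).
  exact: (test_functionD (test_functionZ _ tcf) tf).
have : T (fun x => (-1) *: (chi x *: f x) + f x) = 0.
  apply: sT => //; rewrite -subset0 => x [cx Kx].
  have Ux : nbhs x U by apply: open_nbhs_nbhs; split => //; exact: KU.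
  have [y [/= ny Uy]] := cx _ Ux.
  by move: ny; rewrite c1// scale1r scaleN1r addNr eqxx.
by rewrite linT// mulN1r addrC => /eqP; rewrite subr_eq0 => /eqP.
Qed.

Lemma cutoff_on_ball M (chi : 'rV[R]_n.+1 -> R^o) f : (forall x, `|x| <= M -> chi x = 1) ->
  supported_in_ball f M -> T f = cutoff_functional T chi f.
Proof.
move=> c1 fM; congr T; apply/funext => x.
have [xM|xM] := leP `|x| M; first by rewrite c1// scale1r.
by rewrite fM// scaler0.
Qed.

(** The pairing extends the mollified distribution from kernels of bounded
    support, subject to [P], to all integrable kernels. *)
Definition tame_on (P : ('rV[R]_n.+1 -> R) -> Prop) psi := exists Psi,
  tame Psi (dist_op A T psi) /\
  forall k N, leb.-integrable setT (EFin \o k) -> (forall x, N < `|x| -> k x = 0) -> P k ->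
    mollified_dist k psi = Psi k.

(** A distribution of compact support is extended by a cutoff; the other cases
    of admissibility provide an integral functional, applied either to the
    derivative of the test function or to the test function itself. *)
Lemma strongly_admissible_tame psi : strongly_admissible A T -> test_function psi ->
  tame_on (fun=> True) psi.
Proof.
move=> adm tp; have td := test_function_diff_op (formal_adjoint A) tp.
case: adm => [[K cK sK]|[I iI eI]|[I iI eI]].
- have [M [_ hM]] := compact_bounded cK.
  have KM x : K x -> `|x| <= `|M| + 1.
    move=> Kx; apply: hM => //; apply: le_lt_trans (ler_norm _) _; by rewrite ltrDl.
  have M0 : 0 <= `|M| + 2 by rewrite addr_ge0.
  have [chi [tc _ c1 _]] := @smooth_cutoff R n.+1 _ M0.
  pose U := [set x : 'rV[R]_n.+1 | `|x| < `|M| + 2].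
  have oU : open U.
    rewrite (_ : U = ball (0 : 'rV[R]_n.+1) (`|M| + 2)); first exact: ball_open.
    by apply/seteqP; split => x; rewrite -ball_normE/= sub0r normrN.
  have KU : K `<=` U.
    by move=> x /KM h; rewrite /U/=; apply: le_lt_trans h _; rewrite ltrD2l ltr1n.
  have c1U x : U x -> chi x = 1 by move=> /ltW; exact: c1.
  exists (fun k => cutoff_functional T chi (convolution k (D psi))); split.
    rewrite /dist_op (cutoff_near_support sK oU KU tc c1U td).
    exact: tame_cutoff.
  move=> k N ik hk _; apply: (cutoff_near_support sK oU KU tc c1U).
  exact: test_function_convolution hk td.
- exists (fun k => I (convolution k (D psi))); split.
    by rewrite /dist_op (eI _ td); exact: tame_integral.
  by move=> k N ik hk _; apply: eI; exact: test_function_convolution hk td.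
- exists (fun k => I (convolution k psi)); split.
    by rewrite (eI _ tp); exact: tame_integral.
  move=> k N ik hk _; rewrite (mollified_distE ik tp); apply: eI.
  exact: test_function_convolution hk tp.
Qed.

(** If the kernels live on one ball, the mollifications of a test function
    do as well, and a cutoff that equals 1 there changes nothing. *)
Lemma bounded_kernels_tame N psi : test_function psi ->
  tame_on (fun k => forall x, N < `|x| -> k x = 0) psi.
Proof.
move=> tp; have td := test_function_diff_op (formal_adjoint A) tp.
have [M M0 hM] := test_function_support td.
have NM0 : 0 <= `|N| + M by rewrite addr_ge0.
have [chi [tc _ c1 _]] := @smooth_cutoff R n.+1 _ NM0.
exists (fun k => cutoff_functional T chi (convolution k (D psi))); split.
  rewrite /dist_op (cutoff_on_ball c1); first exact: tame_cutoff.
  by move=> x xM; apply: hM; apply: le_lt_trans xM; rewrite lerDr.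
move=> k _ ik _ hk; apply: (cutoff_on_ball c1).
apply: convolution_support => // x Nx; apply: hk; apply: le_lt_trans Nx; exact: ler_norm.
Qed.

End distribution_kernels.

(** * The readings of the radial operator *)

Section truncated_kernels.
Context {R : realType} {n : nat}.
Local Notation leb := (@lebesgue_rV R n.+1).
Implicit Types (rho : 'rV[R]_n.+1 -> R) (M : R).

Definition truncated_density rho M := restrict_density rho (fun r => r < M).

Definition truncated_kernel rho M := radial_kernel (truncated_density rho M).

Lemma admissible_truncated rho M : admissible_density rho ->
  admissible_density (truncated_density rho M).
Proof.
have mP : measurable_fun setT (fun r : R => r < M) by exact: measurable_fun_ltr.
by move=> ar; exact: (admissible_density_sub ar mP).
Qed.

Lemma integrable_truncated_kernel rho M : admissible_density rho ->
  leb.-integrable setT (EFin \o truncated_kernel rho M).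
Proof. by move=> ar; apply: integrable_radial_kernel; exact: admissible_truncated. Qed.

Lemma truncated_kernel_ge0 rho M y : admissible_density rho -> 0 <= truncated_kernel rho M y.
Proof. by move=> ar; apply: radial_kernel_ge0; case: (admissible_truncated M ar). Qed.

Lemma truncated_kernel_mass rho M : admissible_density rho ->
  \int[leb]_y truncated_kernel rho M y <= \int[leb]_z rho z.
Proof.
move=> ar; have at_ := admissible_truncated M ar; have [_ r0 ir] := ar; have [_ _ it] := at_.
rewrite /Rintegral (radial_kernel_mass at_) -/(Rintegral leb setT _).
apply: le_Rintegral => // z _; rewrite /truncated_density /restrict_density.
by case: ifP.
Qed.

Lemma truncated_kernel_support rho M x : M < `|x| -> truncated_kernel rho M x = 0.
Proof.
move=> Mx; apply: (@radial_kernel_support _ _ _ M); last exact: lt_le_trans Mx (le_norm_enorm x).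
by move=> z Mz; rewrite /truncated_density /restrict_density ltNge (ltW Mz).
Qed.

(** By additivity and boundedness in the kernel, since the mass of the
    discarded part of the density tends to zero. *)
Lemma truncated_limit rho Psi a : admissible_density rho -> tame Psi a ->
  Psi (truncated_kernel rho M%:R) @[M --> \oo] --> Psi (radial_kernel rho).
Proof.
move=> ar [addP [C C0 hC] _]; apply/cvgrPdist_le => e e0.
have C1 : 0 < C + 1 by rewrite ltr_wpDl.
have [M0 hM0] := large_ball_mass ar (divr_gt0 e0 C1); set d := e / _ in hM0.
near=> M; have M0M : M0 <= M%:R by near: M; exact: nbhs_infty_ger.
have mP : measurable_fun setT (fun r : R => r < M%:R) by exact: measurable_fun_ltr.
have ac : admissible_density (restrict_density rho (predC (fun r => r < M%:R))).
  by apply: (admissible_density_sub ar); exact: measurable_geb.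
have E : Psi (radial_kernel rho) = Psi (truncated_kernel rho M%:R) +
    Psi (radial_kernel (restrict_density rho (predC (fun r => r < M%:R)))).
  rewrite (radial_kernel_split ar mP) addP//; first exact: integrable_truncated_kernel.
  exact: integrable_radial_kernel.
rewrite E addrAC subrr add0r; apply: (le_trans (hC _ (integrable_radial_kernel ac))).
rewrite (Rintegral_radial_kernel ac).
apply: (@le_trans _ _ ((C + 1) * d)); last by rewrite /d mulrC mulfVK// gt_eqF.
apply: ler_pM => //; [|by rewrite lerDl|exact: hM0].
by apply: Rintegral_ge0 => z _; case: ac.
Unshelve. all: by end_near. Qed.

Lemma measurable_mu_kernel rho (rhoh : R -> R) : admissible_density rho ->
  (forall x, rho x = rhoh (enorm x)) -> measurable_fun setT (@mu_kernel R n.+1 rhoh).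
Proof.
move=> ar rE; have mk := measurable_radial_kernel ar.
pose c := \1_[set 0] : 'rV[R]_n.+1 -> R.
have mc : measurable_fun setT c by apply: measurable_indic; exact: measurable_point0.
apply: (eq_measurable_fun (fun y => radial_kernel rho y +
    c y * (mu_kernel rhoh (0 : 'rV[R]_n.+1) - radial_kernel rho 0))); last first.
  by apply: measurable_funD => //; exact: measurable_funM.
move=> y _; rewrite /c indicE; have [->|y0] := eqVneq y 0.
  by rewrite mem_set// mul1r addrC subrK.
by rewrite memNset ?mul0r ?addr0 ?(mu_kernelE ar rE y0)//= => yE; rewrite yE eqxx in y0.
Qed.

End truncated_kernels.

Section radial_distributions.
Context {R : realType} {n : nat} {V W : innerVectType R}.
Variable A : 'I_n.+1 -> 'Hom(V, W).
Variable T : ('rV[R]_n.+1 -> V) -> R.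
Hypothesis hT : is_distribution T.
Local Notation leb := (@lebesgue_rV R n.+1).
Local Notation D := (diff_op (formal_adjoint A)).
Implicit Types (psi : 'rV[R]_n.+1 -> W).

Lemma compact_vanishing (K : set 'rV[R]_n.+1) (rho : 'rV[R]_n.+1 -> R) :
  compact K -> vanishes_off K rho -> exists2 M : R, 0 <= M & forall x, M < `|x| -> rho x = 0.
Proof.
move=> cK hK; have [M [_ hM]] := compact_bounded cK.
exists (`|M| + 1); first by rewrite addr_ge0.
move=> x xM; apply: hK => Kx; move: xM; rewrite ltNge => /negP; apply; apply: hM => //.
by apply: le_lt_trans (ler_norm _) _; rewrite ltrDl.
Qed.

Lemma vanishing_norm_enorm (rho : 'rV[R]_n.+1 -> R) M : (forall x, M < `|x| -> rho x = 0) ->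
  forall x, n.+1%:R * M < enorm x -> rho x = 0.
Proof.
move=> h x hx; apply: h; rewrite -(ltr_pM2l (_ : 0 < n.+1%:R))//.
exact: lt_le_trans hx (le_enorm_norm x).
Qed.

Lemma truncated_kernel_id (rho : 'rV[R]_n.+1 -> R) N M :
  (forall x, N < enorm x -> rho x = 0) -> N < M -> truncated_kernel rho M = radial_kernel rho.
Proof.
move=> h NM; congr radial_kernel; apply/funext => z.
rewrite /truncated_density /restrict_density; case: ifP => // /negbT.
by rewrite -leNgt => Mz; rewrite h//; exact: lt_le_trans Mz.
Qed.

(** Whatever reading of the radial operator applies, its value is the limit of
    the values obtained from the compactly supported truncated kernels, which
    only involve test functions. In particular the readings agree. *)
Lemma radial_dist_limit rho (rhoh : R -> R) S psi : admissible_density rho ->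
  (forall x, rho x = rhoh (enorm x)) -> is_radial_dist A rho rhoh T S -> test_function psi ->
  mollified_dist A T (truncated_kernel rho M%:R) psi @[M --> \oo] --> S psi.
Proof.
move=> ar rE rS tp; have td := test_function_diff_op (formal_adjoint A) tp.
have ik M := integrable_truncated_kernel M ar.
have sk M := @truncated_kernel_support R n rho M.
have by_tame Psi a : tame Psi a -> Psi (radial_kernel rho) = S psi ->
    (forall k N, leb.-integrable setT (EFin \o k) -> (forall x, N < `|x| -> k x = 0) ->
      mollified_dist A T k psi = Psi k) ->
    mollified_dist A T (truncated_kernel rho M%:R) psi @[M --> \oo] --> S psi.
  move=> tP <- h; have := truncated_limit ar tP; apply: cvg_trans; apply: near_eq_cvg.
  by apply: nearW => M; rewrite (h _ _ (ik _) (sk _)).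
case: rS => [[[K cK hK] eS]|[T' [K [U [chi [cK sK [oU KU tc c1] ->]]]] eS]|[I [iI eI] eS]|[I [iI eI] eS]].
- have [N N0 hN] := compact_vanishing cK hK.
  have hN' := vanishing_norm_enorm hN.
  rewrite (eS _ tp) (radial_opE _ ar rE tp).
  apply: cvg_near_cst; near=> M; rewrite /mollified_dist (truncated_kernel_id hN')//.
  by near: M; exact: nbhs_infty_gtr.
- apply: (by_tame _ _ (tame_cutoff hT tc td)).
    by rewrite (eS _ tp) (radial_opE _ ar rE tp).
  move=> k N i1 h1; apply: (cutoff_near_support hT sK oU KU tc c1).
  exact: test_function_convolution h1 td.
- apply: (by_tame _ _ (tame_integral iI td)).
    by rewrite (eS _ tp) (radial_opE _ ar rE tp).
  by move=> k N i1 h1; apply: eI; exact: test_function_convolution h1 td.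
apply: (by_tame _ _ (tame_integral iI tp)).
  rewrite (eS _ tp); congr I.
  apply/funext => x; apply: coord_inj => j.
  rewrite -![coord _ j (convolution _ _ _)]/(cmp j (convolution _ _) x) !cmp_convolution.
  have [_ mc _ _] := test_function_facts (test_function_cmp j tp).
  have mcx : measurable_fun setT (fun y : 'rV[R]_n.+1 => cmp j psi (x - y) : R).
    exact: (measurableT_comp mc (@measurable_subl R n.+1 x)).
  have mk := measurable_radial_kernel ar.
  apply: Rintegral_off_point.
  - exact: measurable_funM.
  - by apply: measurable_funM => //; exact: measurable_mu_kernel ar rE.
  - by move=> y y0; rewrite (mu_kernelE ar rE y0).
move=> k N i1 h1; rewrite (mollified_distE A T i1 tp); apply: eI.
exact: test_function_convolution h1 tp.
Unshelve. all: by end_near. Qed.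

End radial_distributions.

(** * Mollification in the mean *)

Section coordinate_norms.
Context {R : realType} {n : nat} {X : innerVectType R}.
Local Notation leb := (@lebesgue_rV R n).
Local Notation b := (vbasis {:X}).
Variable q : R.
Hypothesis q1 : 1 <= q.
Implicit Types (h u g : 'rV[R]_n -> X).

Lemma power_norm_sum (I : Type) (r : seq I) (F : I -> 'rV[R]_n -> R) :
  (forall i, power_integrable q (F i)) ->
  power_integrable q (fun x => \sum_(i <- r) F i x) /\
  power_norm q (fun x => \sum_(i <- r) F i x) <= \sum_(i <- r) power_norm q (F i).
Proof.
move=> pF; elim: r => [|i r [p1 IH]].
  have -> : (fun x => \sum_(i <- [::]) F i x) = fun=> 0 by apply/funext => x; rewrite big_nil.
  rewrite big_nil power_norm0//; split => //.
  exact: (power_integrable_test q1 (@test_function_cst0 R n R^o)).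
have -> : (fun x => \sum_(j <- i :: r) F j x) = fun x => F i x + \sum_(j <- r) F j x.
  by apply/funext => x; rewrite big_cons.
split; first exact: power_integrableD.
rewrite big_cons; apply: (le_trans (power_normD q1 (pF i) p1)); exact: lerD.
Qed.

Lemma vector_norm_coords h : (forall j, power_integrable q (cmp j h : _ -> R)) ->
  power_integrable q (fun x => `|h x|) /\
  vector_norm q h <= \sum_(j < \dim {:X}) `|b`_j| * power_norm q (cmp j h).
Proof.
move=> pc; have wh : weakly_measurable h by apply: weakly_measurable_coords => j; case: (pc j).
have pa (j : 'I_(\dim {:X})) : power_integrable q (fun x => `|b`_j| * `|cmp j h x|).
  apply: power_integrableZ; apply: power_integrable_le (pc j) _ => //.
    by apply: measurableT_comp => //; case: (pc j).
  by move=> x; rewrite normr_id.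
have [ps ns] := power_norm_sum (index_enum _) pa.
have le x : `| `|h x| | <= `|\sum_(j < \dim {:X}) `|b`_j| * `|cmp j h x| |.
  rewrite normr_id [leRHS]ger0_norm; last by apply: sumr_ge0 => j _; exact: mulr_ge0.
  by apply: (le_trans (norm_le_coord _)); apply: ler_sum => j _; rewrite mulrC.
have mh := measurable_vector_norm wh.
split; first exact: power_integrable_le ps le.
apply: (le_trans (power_norm_le q1 mh ps le)); apply: (le_trans ns).
apply: ler_sum => j _; rewrite power_normZ ?normr_id//; last first.
  apply: power_integrable_le (pc j) _ => //; last by move=> x; rewrite normr_id.
  by apply: measurableT_comp => //; case: (pc j).
apply: ler_wpM2l => //; apply: power_norm_le => //; last by move=> x; rewrite normr_id.
by apply: measurableT_comp => //; case: (pc j).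
Qed.

Lemma power_norm_coord h j : weakly_measurable h -> power_integrable q (fun x => `|h x|) ->
  power_integrable q (cmp j h : _ -> R) /\
  power_norm q (cmp j h) <= `|dual_basis j| * vector_norm q h.
Proof.
move=> wh ph; have mc : measurable_fun setT (cmp j h : _ -> R).
  rewrite (_ : (cmp j h : _ -> R) = fun x => inner (dual_basis j) (h x)); first exact: wh.
  by apply/funext => x; rewrite inner_dual_basis.
have le x : `|cmp j h x| <= `| `|dual_basis j| * `|h x| |.
  by rewrite [leRHS]ger0_norm ?mulr_ge0//; exact: coord_bound.
have pz := power_integrableZ `|dual_basis j| ph.
split; first exact: power_integrable_le pz le.
apply: (le_trans (power_norm_le q1 mc pz le)).
by rewrite power_normZ// normr_id.
Qed.

(** Young's inequality for each coordinate; passing to coordinates and back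
    costs the factor [basis_constant]. *)
Lemma young_vector k u : leb.-integrable setT (EFin \o k) -> (forall y, 0 <= k y) ->
  \int[leb]_y k y <= 1 -> test_function u ->
  power_integrable q (fun x => `|convolution k u x|) /\
  vector_norm q (convolution k u) <= @basis_constant R X * vector_norm q u.
Proof.
move=> ik k0 k1 tu; have pu := power_integrable_vector_test q1 tu.
have wu := weakly_measurable_test tu.
have hj j : power_integrable q (cmp j (convolution k u) : _ -> R) /\
    power_norm q (cmp j (convolution k u)) <= power_norm q (cmp j u).
  have tc := test_function_cmp j tu; have [_ mc [B _ hB] _] := test_function_facts tc.
  have [pj _] := power_norm_coord j wu pu.
  have mk : measurable_fun setT (sconv k (cmp j u)) := smooth_measurable (smooth_sconv ik tc).
  have yo : (power_integral q (sconv k (cmp j u)) <= power_integral q (cmp j u))%E.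
    by rewrite !power_integralE; exact: young_sconv hB mk.
  have pk : power_integrable q (sconv k (cmp j u)) by split => //; apply: le_lt_trans yo _; case: pj.
  rewrite cmp_convolution; split => //.
  rewrite -lee_fin (power_norm_root pk) (power_norm_root pj).
  exact: power_root_le (power_integral_ge0 _ _) yo.
have [p1 h1] := vector_norm_coords (fun j => proj1 (hj j)).
split => //; apply: (le_trans h1); rewrite /basis_constant mulr_suml; apply: ler_sum => j _.
rewrite [`|dual_basis j| * _]mulrC -mulrA; apply: ler_wpM2l => //.
have [_ h2] := power_norm_coord j wu pu; exact: le_trans (proj2 (hj j)) h2.
Qed.

Lemma test_functions_dense_vector g (e : R) : weakly_measurable g ->
  power_integrable q (fun x => `|g x|) -> 0 < e ->
  exists2 u, test_function u & power_integrable q (fun x => `|g x - u x|) /\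
    vector_norm q (fun x => g x - u x) <= e.
Proof.
move=> wg pg e0; have b1 : 0 < @basis_norm R X + 1 by rewrite ltr_wpDl// basis_norm_ge0.
have d0 := divr_gt0 e0 b1; set d := e / _ in d0.
have hj (j : 'I_(\dim {:X})) : exists phi : 'rV[R]_n -> R^o, test_function phi /\
    power_norm q (fun x => cmp j g x - phi x) <= d.
  have [pj _] := power_norm_coord j wg pg.
  by have [phi tp hp] := power_norm_approximation q1 pj d0; exists phi.
have [phi hphi] := choice hj.
pose u x := \sum_(j < \dim {:X}) (scale_basis b`_j \o phi j) x.
have tu : test_function u.
  by apply: test_function_sum => j; apply: test_function_lfun; case: (hphi j).
have cu j : cmp j (fun x => g x - u x) = fun x => cmp j g x - phi j x.
  apply/funext => x; rewrite /cmp linearB/=; congr (_ - _).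
  rewrite -[RHS](coord_sum_basis (fun j => phi j x) j); congr (coord _ _ _).
  by apply: eq_bigr => i _; rewrite /= scale_basisE.
have pc j : power_integrable q (cmp j (fun x => g x - u x) : _ -> R).
  rewrite cu; have [pj _] := power_norm_coord j wg pg.
  by apply: power_integrableB => //; apply: power_integrable_test => //; case: (hphi j).
have [p1 h1] := vector_norm_coords pc.
exists u => //; split => //; apply: (le_trans h1).
apply: (@le_trans _ _ (@basis_norm R X * d)).
  rewrite /basis_norm mulr_suml; apply: ler_sum => j _; apply: ler_wpM2l => //.
  by rewrite cu; case: (hphi j).
by rewrite /d mulrA ler_pdivrMr// mulrC ler_wpM2l ?(ltW e0)// lerDl.
Qed.

End coordinate_norms.

Section approximation_in_the_mean.
Context {R : realType} {n : nat} {X : innerVectType R}.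
Local Notation leb := (@lebesgue_rV R n).
Local Notation b := (vbasis {:X}).

Lemma test_function_inner (u : 'rV[R]_n -> X) (v : X) : test_function u ->
  test_function (fun x => inner (u x) v : R^o).
Proof.
move=> tu; have -> : (fun x => inner (u x) v : R^o) =
    fun x => \sum_(j < \dim {:X}) inner v b`_j *: cmp j u x.
  by apply/funext => x; rewrite innerC inner_coord.
by apply: test_function_sum => j; apply: test_functionZ; exact: test_function_cmp.
Qed.

Lemma power_norm_bounded (r : R) (h : 'rV[R]_n -> R) B J : 1 <= r -> measurable_fun setT h ->
  (forall x, `|h x| <= B) -> leb.-integrable setT (EFin \o h) -> \int[leb]_x `|h x| <= J ->
  power_integrable r h /\ power_norm r h <= B + J.
Proof.
move=> r1 mh hB ih hJ.
have hh : @bounded_integrable R n R^o (h : _ -> R^o) B J.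
  split => //; last exact: integrable_norm ih.
  by move=> v; exact: measurable_funM.
have [p1 n1] := bounded_integrable_power r1 hh.
have le x : `|h x| <= `| `|h x| | by rewrite normr_id.
split; first exact: power_integrable_le p1 le.
exact: le_trans (power_norm_le r1 mh p1 le) n1.
Qed.

(** Moving the mollifier to the fixed factor, which is legitimate as the
    kernel is even, gives an estimate that is uniform in the other factor. *)
Lemma mollified_pairing (r q : R) (phi : 'rV[R]_n -> X) (eta : R) : 1 < r -> 1 <= q ->
  hoelder_conjugate r%:E = q%:E -> test_function phi -> 0 < eta ->
  for_concentrated (fun k => (forall y, k (- y) = k y) -> forall psi, test_function psi ->
    `|fun_dist phi (convolution k psi) - fun_dist phi psi| <= eta * vector_norm q psi).
Proof.
move=> r1 q1 rq tp eta0.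
pose al (j : 'I_(\dim {:X})) : 'rV[R]_n -> R^o := fun x => inner (phi x) b`_j.
have tal j : test_function (al j) by exact: test_function_inner.
pose S := \sum_(j < \dim {:X}) `|@dual_basis R X j|.
have S0 : 0 <= S by apply: sumr_ge0.
have S1 : 0 < S + 1 by rewrite ltr_wpDl.
have d0 : 0 < eta / (S + 1) / 2 by rewrite !divr_gt0.
set d := eta / (S + 1) / 2 in d0.
have dE : S * (d + d) <= eta.
  rewrite -splitr mulrA ler_pdivrMr// mulrC ler_wpM2l ?(ltW eta0)// lerDl//.
have hj j : for_concentrated (fun k => (forall x, `|sconv k (al j) x - al j x| <= d) /\
    \int[leb]_x `|sconv k (al j) x - al j x| <= d).
  have [d1 [tau [d10 t0 h]]] := approximate_identity (tal j) d0.
  by exists d1, tau; split => // k [ik k0 k1 kt]; exact: h.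
have ik0 : @for_concentrated R n (fun k => leb.-integrable setT (EFin \o k)).
  by exists 1, 1; split => // k; exact: concentrated_integrable.
have := for_concentratedI ik0 (for_concentrated_all (index_enum _) hj).
apply: for_concentratedS => k [ik hk] ke psi ts.
have ps := power_integrable_vector_test q1 ts; have ws := weakly_measurable_test ts.
have N0 := vector_norm_ge0 q psi.
have facts j := test_function_facts (test_function_cmp j ts).
have msk j : measurable_fun setT (sconv k (cmp j psi)).
  exact: smooth_measurable (smooth_sconv ik (test_function_cmp j ts)).
have isk j : leb.-integrable setT (EFin \o sconv k (cmp j psi)).
  have [_ mc [B _ hB] ic] := facts j.
  by have [] := integrable_sconv ik ic (msk j) hB.
have i1 j : leb.-integrable setT (EFin \o (fun x => sconv k (cmp j psi) x * al j x)).
  have [_ ma [B _ hB] _] := test_function_facts (tal j).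
  exact: (integrable_mul_bounded measurableT (isk j) ma hB).
have i2 j : leb.-integrable setT (EFin \o (fun x => (cmp j psi x : R) * al j x)).
  have [_ ma [B _ hB] _] := test_function_facts (tal j); have [_ _ _ ic] := facts j.
  exact: (integrable_mul_bounded measurableT ic ma hB).
have e1 : fun_dist phi (convolution k psi) = \sum_(j < \dim {:X}) \int[leb]_x (sconv k (cmp j psi) x * al j x).
  rewrite -Rintegral_sum//; apply: eq_Rintegral => x _; rewrite inner_coord.
  by apply: eq_bigr => j _; rewrite mulrC -cmp_convolution.
have e2 : fun_dist phi psi = \sum_(j < \dim {:X}) \int[leb]_x ((cmp j psi x : R) * al j x).
  rewrite -Rintegral_sum//; apply: eq_Rintegral => x _; rewrite inner_coord.
  by apply: eq_bigr => j _; rewrite mulrC.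
rewrite e1 e2 -sumrB; apply: (le_trans (ler_norm_sum _ _ _)).
apply: (@le_trans _ _ (S * (d + d) * vector_norm q psi)); last exact: ler_wpM2r.
rewrite /S mulr_suml mulr_suml; apply: ler_sum => j _.
have [_ ma [Ba _ hBa] ia] := test_function_facts (tal j).
have [_ mc [B _ hB] ic] := facts j.
have msa : measurable_fun setT (sconv k (al j)).
  exact: smooth_measurable (smooth_sconv ik (tal j)).
have [isa _] := integrable_sconv ik ia msa hBa.
have [hs hl] := hk j (mem_index_enum j).
have mda : measurable_fun setT (fun x => sconv k (al j) x - al j x : R) by exact: measurable_funB.
have [pd nd] := power_norm_bounded (ltW r1) mda hs (integrableB measurableT isa ia) hl.
have [pc nc] := power_norm_coord q1 j ws ps.
have := @hoelder_pairing R n r%:E q (fun x => sconv k (al j) x - al j x) (cmp j psi) _ q1 rq mda _ pc.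
rewrite lte_fin r1 -(EFin_power_norm pd) ltry => /(_ isT isT)[i3 h3].
(* The even kernel moves from [psi] to [phi]. *)
have -> : \int[leb]_x (sconv k (cmp j psi) x * al j x) - \int[leb]_x ((cmp j psi x : R) * al j x) =
    \int[leb]_x ((sconv k (al j) x - al j x) * cmp j psi x).
  rewrite (@eq_Rintegral _ _ _ _ _ (fun x => al j x * sconv k (cmp j psi) x)); last first.
    by move=> x _; rewrite mulrC.
  rewrite (integral_mul_sconv ik ke ic hB ma hBa) -RintegralB//.
    by apply: eq_Rintegral => x _; rewrite mulrBl [al j x * _]mulrC.
  have [B' hB'] : exists B', forall x, `|sconv k (al j) x| <= B'.
    by eexists => x; exact: (sconv_bound x ik ma hBa).
  have := integrable_mul_bounded measurableT ic msa hB'.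
  by congr (_.-integrable _ (EFin \o _)); apply/funext => x; rewrite mulrC.
apply: (le_trans (le_normr_Rintegral measurableT i3)); apply: (le_trans h3).
apply: (le_trans (ler_pM (power_norm_ge0 _ _) (power_norm_ge0 _ _) nd nc)).
by rewrite mulrCA mulrA.
Qed.

End approximation_in_the_mean.

(** * Families of radial densities *)

Section lower_limits.
Context {R : realType}.

Lemma limf_einf_le (f : R -> \bar R) (F : set_system R) (C : \bar R) : ProperFilter F ->
  (\forall x \near F, (f x <= C)%E) -> (limf_einf f F <= C)%E.
Proof.
move=> PF hC; rewrite limf_einfE; apply: ub_ereal_sup => _ [V FV <-].
have [x [Vx fx]] := filter_ex (filterI FV hC).
by apply: le_trans fx; apply: ereal_inf_lbound; exists x.
Qed.

Lemma limf_einf_frequently (f : R -> \bar R) (F : set_system R) : (limf_einf f F < +oo)%E ->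
  exists2 C : R, 0 <= C & forall V, F V -> exists2 x, V x & (f x <= C%:E)%E.
Proof.
move=> h; have [c hc] : exists c : R, (limf_einf f F < c%:E)%E.
  by case: (limf_einf f F) h => [r _|//|_]; [exists (r + 1); rewrite lte_fin ltrDl|exists 0; exact: ltNyr].
exists (Num.max c 0); first by rewrite le_max lexx orbT.
move=> V FV; have : (ereal_inf (f @` V) < c%:E)%E.
  apply: le_lt_trans hc; rewrite limf_einfE; apply: ereal_sup_ubound; by exists V.
move=> /ereal_inf_lt[_ [x Vx <-] fx]; exists x => //.
by apply: (le_trans (ltW fx)); rewrite lee_fin le_max lexx.
Qed.

Lemma limit_bound (u : nat -> R) (l B : R) : u k @[k --> \oo] --> l ->
  (forall k, `|u k| <= B) -> `|l| <= B.
Proof.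
move=> ul hB; apply/ler_addgt0Pr => e e0.
have /cvgrPdist_le /(_ e e0)[k _ /(_ k (leqnn k)) /= h] := ul.
have -> : l = u k + (l - u k) by rewrite addrC subrK.
by apply: (le_trans (ler_normD _ _)); exact: lerD.
Qed.

End lower_limits.

Section radial_families.
Context {R : realType} {n : nat} {V W : innerVectType R}.
Variable A : 'I_n.+1 -> 'Hom(V, W).
Variable T : ('rV[R]_n.+1 -> V) -> R.
Variables (rho : R -> 'rV[R]_n.+1 -> R) (rhoh : R -> R -> R).
Variable Arho : R -> ('rV[R]_n.+1 -> W) -> R.
Local Notation leb := (@lebesgue_rV R n.+1).
Hypothesis hrho : forall e, 0 < e ->
    [/\ measurable_fun [set: 'rV[R]_n.+1] (rho e),
        (forall x, 0 <= rho e x),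
        (forall x, rho e x = rhoh e (enorm x)) &
        (\int[leb]_x (rho e x)%:E = 1)%E].
Hypothesis htail : forall d, 0 < d ->
    (\int[leb]_(x in ~` eball d) (rho e x)%:E)%E @[e --> (0 : R)^'+] --> 0%E.
Hypothesis hT : is_distribution T.
Hypothesis hadm : strongly_admissible A T \/
    (exists2 K : set 'rV[R]_n.+1, compact K & forall e, 0 < e -> vanishes_off K (rho e)).
Hypothesis hS : forall e, 0 < e -> is_radial_dist A (rho e) (rhoh e) T (Arho e).
Implicit Types (psi : 'rV[R]_n.+1 -> W).

Lemma family_admissible e : 0 < e -> admissible_density (rho e).
Proof.
move=> e0; have [m r0 _ I1] := hrho e0; split => //.
apply/integrableP; split; first exact/measurable_EFinP.
rewrite (eq_integral (fun x => (rho e x)%:E)); first by rewrite I1 ltry.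
by move=> x _; rewrite /= ger0_norm.
Qed.

Lemma family_mass e : 0 < e -> \int[leb]_z rho e z = 1.
Proof. by move=> e0; have [_ _ _ I1] := hrho e0; rewrite /Rintegral I1. Qed.

Lemma kernel_mass e : 0 < e -> \int[leb]_z radial_kernel (rho e) z = 1.
Proof.
move=> e0; rewrite /Rintegral (radial_kernel_mass (family_admissible e0)).
exact: family_mass.
Qed.

Lemma truncated_mass_le1 e M : 0 < e -> \int[leb]_z truncated_kernel (rho e) M z <= 1.
Proof.
by move=> e0; rewrite -(family_mass e0); exact: truncated_kernel_mass (family_admissible e0).
Qed.

Lemma family_limit e psi : 0 < e -> test_function psi ->
  mollified_dist A T (truncated_kernel (rho e) M%:R) psi @[M --> \oo] --> Arho e psi.
Proof.
move=> e0 tp; have [_ _ rE _] := hrho e0.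
exact: (radial_dist_limit hT (family_admissible e0) rE (hS e0) tp).
Qed.

Lemma radial_dist_linear e : 0 < e -> linear_on_tests (Arho e).
Proof.
move=> e0 a u v tu tv; have ar := family_admissible e0.
have l1 := family_limit e0 (test_functionD (test_functionZ a tu) tv).
have l2 : a * mollified_dist A T (truncated_kernel (rho e) M%:R) u +
    mollified_dist A T (truncated_kernel (rho e) M%:R) v @[M --> \oo] --> a * Arho e u + Arho e v.
  by apply: cvgD; [apply: cvgM; [exact: cvg_cst|exact: family_limit]|exact: family_limit].
apply: (cvg_unique (@norm_hausdorff R R^o) l1).
apply: cvg_trans l2; apply: near_eq_cvg; apply: nearW => M /=.
by rewrite (mollified_dist_linear A hT (integrable_truncated_kernel M%:R ar)
  (@truncated_kernel_support R n (rho e) M%:R) a tu tv).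
Qed.

(** The tail of the kernel is dominated by the tail of the density. *)
Lemma kernels_concentrate (d tau : R) : 0 < d -> 0 < tau ->
  \forall e \near (0 : R)^'+, concentrated d tau (radial_kernel (rho e)).
Proof.
move=> d0 t0; have /fine_cvgP[finN /cvgrPdist_le /(_ tau t0) tailN] := htail d0.
near=> e; have e0 : 0 < e by near: e; exact: nbhs_right_gt.
have ar := family_admissible e0; have [_ r0 _] := ar.
have fin_e : (\int[leb]_(x in ~` eball d) (rho e x)%:E)%E \is a fin_num by near: e.
have tail_e : `|0 - fine (\int[leb]_(x in ~` eball d) (rho e x)%:E)%E| <= tau by near: e.
split; [exact: integrable_radial_kernel|by move=> y; exact: radial_kernel_ge0|exact: kernel_mass|].
have tl := radial_kernel_tail ar d0.
have k0 : (0 <= \int[leb]_(y in ~` eball d) (radial_kernel (rho e) y)%:E)%E.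
  by apply: integral_ge0 => y _; rewrite lee_fin radial_kernel_ge0.
have fk : (\int[leb]_(y in ~` eball d) (radial_kernel (rho e) y)%:E)%E \is a fin_num.
  by rewrite ge0_fin_numE//; apply: (le_lt_trans tl); rewrite -(fineK fin_e) ltry.
rewrite sub0r normrN in tail_e; apply: le_trans (le_trans (ler_norm _) tail_e).
by rewrite -lee_fin /Rintegral !fineK.
Unshelve. all: by end_near. Qed.

Lemma family_tame psi : test_function psi -> exists Psi, tame Psi (dist_op A T psi) /\
  forall e M, 0 < e -> mollified_dist A T (truncated_kernel (rho e) M) psi =
    Psi (truncated_kernel (rho e) M).
Proof.
move=> tp; case: hadm => [adm|[K cK hK]].
  have [Psi [tP hP]] := strongly_admissible_tame hT adm tp.
  exists Psi; split => // e M e0; have ar := family_admissible e0.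
  exact: (hP _ M (integrable_truncated_kernel M ar) (@truncated_kernel_support R n _ M)).
have vK : vanishes_off K (\1_K : 'rV[R]_n.+1 -> R) by move=> x Kx; rewrite indicE memNset.
have [N N0 hN] := compact_vanishing cK vK.
have KN x : N < `|x| -> ~ K x.
  by move=> /hN; rewrite indicE; case: (boolP (x \in K)) => [_ /eqP|/negP h _ /mem_set//]; rewrite oner_eq0.
have [Psi [tP hP]] := bounded_kernels_tame A hT (n.+1%:R * N) tp.
exists Psi; split => // e M e0; have ar := family_admissible e0.
apply: (hP _ M (integrable_truncated_kernel M ar) (@truncated_kernel_support R n _ M)).
move=> x xN; apply: (@radial_kernel_support _ _ _ (n.+1%:R * N)); last first.
  exact: lt_le_trans xN (le_norm_enorm x).
move=> z zN; rewrite /truncated_density /restrict_density.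
rewrite (@vanishing_norm_enorm R n (rho e) N)//; first by case: ifP.
by move=> y /KN Ky; exact: hK.
Qed.

Lemma radial_dist_cvg psi : test_function psi ->
  Arho e psi @[e --> (0 : R)^'+] --> dist_op A T psi.
Proof.
move=> tp; have [Psi [tP hP]] := family_tame tp.
have E e : 0 < e -> Arho e psi = Psi (radial_kernel (rho e)).
  move=> e0; have l1 := family_limit e0 tp.
  have l2 := truncated_limit (family_admissible e0) tP.
  apply: (cvg_unique (@norm_hausdorff R R^o) l1); apply: cvg_trans l2.
  by apply: near_eq_cvg; apply: nearW => M; rewrite hP.
apply/cvgrPdist_le => eta eta0.
have [d [tau [d0 t0 hc]]] := tame_concentrated tP eta0.
near=> e.
have e0 : 0 < e by near: e; exact: nbhs_right_gt.
rewrite (E e e0) distrC; apply: hc; near: e; exact: kernels_concentrate.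
Unshelve. all: by end_near. Qed.

Section represented.
Variables (p : \bar R) (q : R) (g : 'rV[R]_n.+1 -> W).
Hypothesis p1 : (1 < p)%E.
Hypothesis q1 : 1 <= q.
Hypothesis pq : hoelder_conjugate p = q%:E.
Hypothesis lg : Lp p g.
Hypothesis eg : eq_dist (dist_op A T) (fun_dist g).

Lemma mollified_dist_represented e M psi : 0 < e -> test_function psi ->
  mollified_dist A T (truncated_kernel (rho e) M) psi =
  fun_dist g (convolution (truncated_kernel (rho e) M) psi).
Proof.
move=> e0 tp; have ik := integrable_truncated_kernel M (family_admissible e0).
have sk := @truncated_kernel_support R n (rho e) M.
by rewrite (mollified_distE A T ik tp); apply: eg; exact: test_function_convolution sk tp.
Qed.

Lemma fun_dist_bound f psi : Lp p f -> test_function psi ->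
  `|fun_dist f psi| <= fine (Lpnorm p f) * vector_norm q psi.
Proof.
move=> lf tp; have [i1 h1] := fun_dist_pairing p1 q1 pq lf (weakly_measurable_test tp)
  (power_integrable_vector_test q1 tp).
exact: le_trans (le_normr_Rintegral measurableT i1) h1.
Qed.

Lemma truncated_fun_dist_bound f e M psi : Lp p f -> 0 < e -> test_function psi ->
  `|fun_dist f (convolution (truncated_kernel (rho e) M) psi)| <=
  fine (Lpnorm p f) * (@basis_constant R W * vector_norm q psi).
Proof.
move=> lf e0 tp; have ar := family_admissible e0.
have ik := integrable_truncated_kernel M ar.
have tc := test_function_convolution ik (@truncated_kernel_support R n (rho e) M) tp.
apply: (le_trans (fun_dist_bound lf tc)); apply: ler_wpM2l; first by rewrite fine_ge0// Lnorm_ge0.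
have [_ h] := young_vector q1 ik (fun y => truncated_kernel_ge0 M y ar) (truncated_mass_le1 M e0) tp.
exact: h.
Qed.

(** The truncated kernels have mass at most 1. *)
Lemma radial_dist_bound e psi : 0 < e -> test_function psi ->
  `|Arho e psi| <= fine (Lpnorm p g) * @basis_constant R W * vector_norm q psi.
Proof.
move=> e0 tp; apply: (limit_bound (family_limit e0 tp)) => M.
by rewrite mollified_dist_represented// -mulrA; exact: truncated_fun_dist_bound.
Qed.

End represented.

(** Let [phi] be a test function close to [g] in the mean. Mollification is
    bounded, so the contribution of [g - phi] is small with respect to the
    norm of [psi], and that of [phi] is handled by [mollified_pairing]. *)
Lemma radial_dist_uniform_cvg (r q : R) g (eta : R) : 1 < r -> 1 <= q ->
  hoelder_conjugate r%:E = q%:E -> Lp r%:E g -> eq_dist (dist_op A T) (fun_dist g) -> 0 < eta ->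
  \forall e \near (0 : R)^'+, forall psi, test_function psi ->
    `|Arho e psi - dist_op A T psi| <= eta * vector_norm q psi.
Proof.
move=> r1 q1 rq lg eg eta0; have r1' : (1 < r%:E)%E by rewrite lte_fin.
have r1w := ltW r1; have [wg fg] := lg.
have pg : power_integrable r (fun x => `|g x|).
  split; first exact: measurable_vector_norm.
  move: fg; rewrite /Lpnorm Lnorm_power_integral; apply: lty_poweRy.
  by rewrite invr_eq0 gt_eqF// (lt_trans ltr01).
have c1 : 0 < @basis_constant R W + 1 by rewrite ltr_wpDl// basis_constant_ge0.
have c2 : 0 < eta / 2 / (@basis_constant R W + 1) by rewrite !divr_gt0.
have [phi tphi [pd nd]] := test_functions_dense_vector r1w wg pg c2.
have lphi : Lp r%:E phi.
  split; first exact: weakly_measurable_test.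
  by rewrite Lpnorm_test// ltry.
pose f x := g x - phi x.
have wf : weakly_measurable f.
  move=> v; rewrite (_ : (fun x => _) = fun x => inner v (g x) - inner v (phi x)).
    by apply: measurable_funB; [exact: wg|exact: weakly_measurable_test].
  by apply/funext => x; rewrite innerBr.
have fE : Lpnorm r%:E f = (vector_norm r f)%:E.
  by rewrite /vector_norm (EFin_power_norm pd).
have lf : Lp r%:E f by split => //; rewrite fE ltry.
have split_g h : weakly_measurable h -> power_integrable q (fun x => `|h x|) ->
    fun_dist g h = fun_dist f h + fun_dist phi h.
  move=> wh ph.
  have [i1 _] := fun_dist_pairing r1' q1 rq lf wh ph.
  have [i2 _] := fun_dist_pairing r1' q1 rq lphi wh ph.
  rewrite /fun_dist -RintegralD//; apply: eq_Rintegral => x _.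
  by rewrite -innerDl /f subrK.
have e20 : 0 < eta / 2 by rewrite divr_gt0.
have [d [tau [d0 t0 hc]]] := mollified_pairing r1 q1 rq tphi e20.
near=> e; have e0 : 0 < e by near: e; exact: nbhs_right_gt.
have ce : concentrated d tau (radial_kernel (rho e)) by near: e; exact: kernels_concentrate.
have ar := family_admissible e0.
move=> psi tp; have N0 := vector_norm_ge0 q psi.
have ps := power_integrable_vector_test q1 tp; have ws := weakly_measurable_test tp.
have b2 := hc _ ce (@radial_kernel_even R n (rho e)) psi tp.
have tI : tame (fun k => fun_dist phi (convolution k psi)) (fun_dist phi psi).
  apply: tame_integral => //; left; exists r%:E, phi; split => //; exact: ltW.
have l2 := truncated_limit ar tI.
have b1 : `|Arho e psi - fun_dist phi (convolution (radial_kernel (rho e)) psi)| <=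
    vector_norm r f * (@basis_constant R W * vector_norm q psi).
  have l3 : mollified_dist A T (truncated_kernel (rho e) M%:R) psi -
      fun_dist phi (convolution (truncated_kernel (rho e) M%:R) psi) @[M --> \oo] -->
      Arho e psi - fun_dist phi (convolution (radial_kernel (rho e)) psi).
    by apply: cvgB => //; exact: family_limit.
  apply: (limit_bound l3) => M.
  have ik := integrable_truncated_kernel M%:R ar.
  have tc := test_function_convolution ik (@truncated_kernel_support R n (rho e) M%:R) tp.
  rewrite (mollified_dist_represented eg _ e0 tp) split_g; last 2 first.
  - exact: weakly_measurable_test.
  - exact: power_integrable_vector_test.
  rewrite addrK; have := truncated_fun_dist_bound r1' q1 rq M%:R lf e0 tp.
  by rewrite fE.
have b3 : `|fun_dist phi psi - dist_op A T psi| <= vector_norm r f * vector_norm q psi.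
  rewrite (eg _ tp) (split_g psi ws ps) distrC addrK.
  by have := fun_dist_bound r1' q1 rq lf tp; rewrite fE.
have -> : Arho e psi - dist_op A T psi =
  (Arho e psi - fun_dist phi (convolution (radial_kernel (rho e)) psi)) +
  (fun_dist phi (convolution (radial_kernel (rho e)) psi) - fun_dist phi psi) +
  (fun_dist phi psi - dist_op A T psi) by ring.
apply: (le_trans (ler_normD _ _)); apply: (le_trans (lerD (ler_normD _ _) (lexx _))).
apply: (le_trans (lerD (lerD b1 b2) b3)).
set N := vector_norm q psi in N0 *; set F := vector_norm r f in nd *.
have -> : F * (@basis_constant R W * N) + eta / 2 * N + F * N =
  (F * (@basis_constant R W + 1) + eta / 2) * N by ring.
apply: ler_wpM2r => //; rewrite [leRHS]splitr; apply: lerD => //.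
by rewrite -ler_pdivlMr.
Unshelve. all: by end_near. Qed.

End radial_families.

(** * The characterization of integrability *)

Section radial_characterization.
Context {R : realType} {n : nat} {V W : innerVectType R}.
Variable A : 'I_n.+1 -> 'Hom(V, W).
Variable T : ('rV[R]_n.+1 -> V) -> R.
Variables (rho : R -> 'rV[R]_n.+1 -> R) (rhoh : R -> R -> R).
Variable Arho : R -> ('rV[R]_n.+1 -> W) -> R.
Variable p : \bar R.
Local Notation leb := (@lebesgue_rV R n.+1).
Hypothesis p1 : (1 < p)%E.
Hypothesis hrho : forall e, 0 < e ->
    [/\ measurable_fun [set: 'rV[R]_n.+1] (rho e),
        (forall x, 0 <= rho e x),
        (forall x, rho e x = rhoh e (enorm x)) &
        (\int[leb]_x (rho e x)%:E = 1)%E].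
Hypothesis htail : forall d, 0 < d ->
    (\int[leb]_(x in ~` eball d) (rho e x)%:E)%E @[e --> (0 : R)^'+] --> 0%E.
Hypothesis hT : is_distribution T.
Hypothesis hadm : strongly_admissible A T \/
    (exists2 K : set 'rV[R]_n.+1, compact K & forall e, 0 < e -> vanishes_off K (rho e)).
Hypothesis hS : forall e, 0 < e -> is_radial_dist A (rho e) (rhoh e) T (Arho e).

Lemma limf_einf_of_in_Lp : in_Lp p (dist_op A T) ->
  (limf_einf (fun e => dual_norm p (Arho e)) (0 : R)^'+ < +oo)%E.
Proof.
move=> [g lg eg]; have [q [q1 pq _]] := @conjugate_real R n.+1 p p1.
pose C := fine (Lpnorm p g) * @basis_constant R W.
apply: (@le_lt_trans _ _ C%:E); last exact: ltry.
apply: limf_einf_le; near=> e; have e0 : 0 < e by near: e; exact: nbhs_right_gt.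
apply: (dual_norm_le q1 pq); last first.
  by move=> u tu; exact: (radial_dist_bound hrho hT hS p1 q1 pq lg eg e0 tu).
by apply: mulr_ge0; [rewrite fine_ge0// Lnorm_ge0|exact: basis_constant_ge0].
Unshelve. all: by end_near. Qed.

Lemma in_Lp_of_limf_einf :
  (limf_einf (fun e => dual_norm p (Arho e)) (0 : R)^'+ < +oo)%E -> in_Lp p (dist_op A T).
Proof.
move=> /limf_einf_frequently[C C0 hC]; have [q [q1 pq _]] := @conjugate_real R n.+1 p p1.
have bound u : test_function u -> `|dist_op A T u| <= C * vector_norm q u.
  move=> tu; apply/ler_addgt0Pr => eta eta0.
  have /cvgrPdist_le /(_ eta eta0) hc := radial_dist_cvg hrho htail hT hadm hS tu.
  (* Some parameter is close to the limit on [u] and satisfies the bound. *)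
  have [e [/= he e0] hCe] := hC _ (filterI hc (nbhs_right_gt (0 : R))).
  have lin := radial_dist_linear hrho hT hS e0.
  have := dual_norm_bound q1 pq lin hCe tu; move: he.
  set a := dist_op A T u; set b := Arho e u => h1 h2.
  have -> : a = (a - b) + b by rewrite subrK.
  by apply: (le_trans (ler_normD _ _)); rewrite [leRHS]addrC; exact: lerD.
have [f [wf ef nf]] := riesz_vector p1 q1 pq C0 (dist_op_linear A hT) bound.
by exists f => //; split => //; exact: le_lt_trans nf (ltry _).
Qed.

(** The difference to [g] is represented with a bound by its dual norm, which
    tends to zero. *)
Lemma strong_convergence g : (p < +oo)%E -> Lp p g -> eq_dist (dist_op A T) (fun_dist g) ->
  exists ge : R -> 'rV[R]_n.+1 -> W,
    (forall e, 0 < e -> Lp p (ge e) /\ eq_dist (Arho e) (fun_dist (ge e))) /\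
    Lpnorm p (fun x => ge e x - g x) @[e --> (0 : R)^'+] --> 0%E.
Proof.
move=> py lg eg; have [q [q1 pq _]] := @conjugate_real R n.+1 p p1.
pose Del e (u : 'rV[R]_n.+1 -> W) := Arho e u - dist_op A T u.
have linD e : 0 < e -> linear_on_tests (Del e).
  move=> e0 a u v tu tv; rewrite /Del (radial_dist_linear hrho hT hS e0)//.
  by rewrite (dist_op_linear A hT)//; ring.
have K0 := @basis_constant_ge0 R W.
have L0 : 0 <= fine (Lpnorm p g) by rewrite fine_ge0// Lnorm_ge0.
have fin e : 0 < e -> exists C : R, [/\ 0 <= C, dual_norm p (Del e) = C%:E &
    forall u, test_function u -> `|Del e u| <= C * vector_norm q u].
  move=> e0; pose B := fine (Lpnorm p g) * @basis_constant R W + fine (Lpnorm p g).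
  have dB : (dual_norm p (Del e) <= B%:E)%E.
    apply: (dual_norm_le q1 pq); first by apply: addr_ge0 => //; exact: mulr_ge0.
    move=> u tu; rewrite /Del mulrDl; apply: (le_trans (ler_normB _ _)); apply: lerD.
      exact: (radial_dist_bound hrho hT hS p1 q1 pq lg eg e0 tu).
    by rewrite (eg _ tu); exact: fun_dist_bound.
  have d0 : (0 <= dual_norm p (Del e))%E.
    have t0 := @test_function_cst0 R n.+1 W.
    apply: ereal_sup_ubound; exists (fun=> 0); last by rewrite (linear_on_tests0 (linD e e0)).
    split => //; rewrite -[hoelder_conjugate p]/(hoelder_conjugate p) pq Lpnorm_test// lee_fin.
    rewrite /vector_norm (_ : (fun x => _) = fun _ : 'rV[R]_n.+1 => 0 : R); first by rewrite power_norm0.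
    by apply/funext => x; rewrite normr0.
  have df : dual_norm p (Del e) \is a fin_num by rewrite ge0_fin_numE//; exact: le_lt_trans dB (ltry _).
  exists (fine (dual_norm p (Del e))); split; [exact: fine_ge0|by rewrite fineK|].
  by apply: (dual_norm_bound q1 pq (linD e e0)); rewrite fineK.
(* The best constant for each difference is its dual norm, so the function
   chosen for it satisfies every bound that holds for the difference. *)
have hf e : exists f : 'rV[R]_n.+1 -> W, 0 < e -> [/\ weakly_measurable f,
    eq_dist (Del e) (fun_dist f) & (Lpnorm p f <= (@basis_constant R W)%:E * dual_norm p (Del e))%E].
  have [e0|e0] := ltP 0 e; last by exists (fun=> 0).
  have [C [C0 dC hC]] := fin e e0.
  have [f [wf ef nf]] := riesz_vector p1 q1 pq C0 (linD e e0) hC.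
  by exists f => _; split => //; rewrite dC -EFinM.
have [f hf'] := choice hf.
have lf e : 0 < e -> Lp p (f e).
  move=> e0; have [wf _ nf] := hf' e e0; split => //; apply: (le_lt_trans nf).
  by have [C [_ -> _]] := fin e e0; rewrite -EFinM ltry.
exists (fun e x => g x + f e x); split.
  move=> e e0; have [wf ef nf] := hf' e e0; split; first exact: (LpD (ltW p1) lg (lf e e0)).
  move=> u tu; have -> : Arho e u = dist_op A T u + Del e u by rewrite /Del addrC subrK.
  have wu := weakly_measurable_test tu; have pu := power_integrable_vector_test q1 tu.
  have [i1 _] := fun_dist_pairing p1 q1 pq lg wu pu.
  have [i2 _] := fun_dist_pairing p1 q1 pq (lf e e0) wu pu.
  rewrite (eg _ tu) (ef _ tu) /fun_dist -RintegralD//; apply: eq_Rintegral => x _.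
  by rewrite innerDl.
have E e : (fun x => g x + f e x - g x) = f e by apply/funext => x; rewrite addrC addKr.
under eq_fun do rewrite E.
have [r [rE r1]] : exists r : R, p = r%:E /\ 1 < r.
  by move: p1 py; case: (p) => [r|//|//]; rewrite lte_fin => r1 _; exists r.
have rq : hoelder_conjugate r%:E = q%:E by rewrite -rE.
have lgr : Lp r%:E g by rewrite -rE.
apply/fine_cvgP; split.
  near=> e; have e0 : 0 < e by near: e; exact: nbhs_right_gt.
  by have [_ h] := lf e e0; rewrite ge0_fin_numE// Lnorm_ge0.
apply/cvgrPdist_le => eta eta0; have K1 : 0 < @basis_constant R W + 1 by rewrite ltr_wpDl.
have d0 := divr_gt0 eta0 K1; set d := eta / _ in d0.
near=> e; have e0 : 0 < e by near: e; exact: nbhs_right_gt.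
have hd : forall psi, test_function psi ->
    `|Arho e psi - dist_op A T psi| <= d * vector_norm q psi.
  near: e; exact: (radial_dist_uniform_cvg hrho htail hT hS r1 q1 rq lgr eg d0).
have dd : (dual_norm p (Del e) <= d%:E)%E by apply: (dual_norm_le q1 pq (ltW d0)).
have [_ _ nf] := hf' e e0; have [_ ff] := lf e e0.
have n0 : (0 <= Lpnorm p (f e))%E by exact: Lnorm_ge0.
rewrite sub0r normrN ger0_norm ?fine_ge0//=.
rewrite -lee_fin fineK ?ge0_fin_numE//; apply: (le_trans nf).
apply: (@le_trans _ _ ((@basis_constant R W)%:E * d%:E)%E).
  by apply: lee_wpmul2l => //; rewrite lee_fin.
rewrite -EFinM lee_fin /d mulrA ler_pdivrMr// mulrC ler_wpM2l ?(ltW eta0)//.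
by rewrite lerDl.
Unshelve. all: by end_near. Qed.

End radial_characterization.

Theorem theorem3 (R : realType) (n : nat) (V W : innerVectType R)
    (A : 'I_n -> 'Hom(V, W)) (p : \bar R)
    (rho : R -> 'rV[R]_n -> R) (rhoh : R -> R -> R)
    (T : ('rV[R]_n -> V) -> R) (Arho : R -> ('rV[R]_n -> W) -> R) :
  (0 < n)%N ->
  (1 < p)%E ->
  (forall e, 0 < e ->
    [/\ measurable_fun [set: 'rV[R]_n] (rho e),
        (forall x, 0 <= rho e x),
        (forall x, rho e x = rhoh e (enorm x)) &
        (\int[lebesgue_rV n]_x (rho e x)%:E = 1)%E]) ->
  (forall d, 0 < d ->
    (\int[lebesgue_rV n]_(x in ~` eball d) (rho e x)%:E)%E
      @[e --> (0 : R)^'+] --> 0%E) ->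
  is_distribution T ->
  strongly_admissible A T \/
    (exists2 K : set 'rV[R]_n, compact K &
      forall e, 0 < e -> vanishes_off K (rho e)) ->
  (forall e, 0 < e -> is_radial_dist A (rho e) (rhoh e) T (Arho e)) ->
  (in_Lp p (dist_op A T) <->
    (limf_einf (fun e => dual_norm p (Arho e)) (0 : R)^'+ < +oo)%E) /\
  (in_Lp p (dist_op A T) \/
    (limf_einf (fun e => dual_norm p (Arho e)) (0 : R)^'+ < +oo)%E ->
   (p < +oo)%E ->
   exists (g : 'rV[R]_n -> W) (ge : R -> 'rV[R]_n -> W),
     [/\ Lp p g, eq_dist (dist_op A T) (fun_dist g),
         (forall e, 0 < e -> Lp p (ge e) /\ eq_dist (Arho e) (fun_dist (ge e))) &
         Lpnorm p (fun x => ge e x - g x) @[e --> (0 : R)^'+] --> 0%E]).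
Proof.
case: n A rho T Arho => [//|n] A rho T Arho _ p1 hrho htail hT hadm hS.
have iff : in_Lp p (dist_op A T) <->
    (limf_einf (fun e => dual_norm p (Arho e)) (0 : R)^'+ < +oo)%E.
  split; first exact: (limf_einf_of_in_Lp p1 hrho hT hS).
  exact: (in_Lp_of_limf_einf p1 hrho htail hT hadm hS).
split => // h py.
have [g lg eg] : in_Lp p (dist_op A T) by case: h => [//|/iff].
have [ge [hge cge]] := strong_convergence p1 hrho htail hT hS py lg eg.
by exists g, ge.
Qed.
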